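(* Let $\beta\in\{1,2\}$ and let $W=XX^*$ where $X$ is an $N\times M$ random matrix, $N\le M$, with independent real ($\beta=1$) or complex ($\beta=2$) entries, and $\mathfrak d:=N/M\to d\in(0,1]$ as $M\to\infty$. Suppose there are constants $\{C_p\}_{p\ge1}$ such that all entries satisfy, for non-negative integers $\ell,p$, $$\mathbb E(\Re X_{ij})^\ell(\Im X_{ij})^p=\mathbb E(\Re Y)^\ell(\Im Y)^p\ \text{ for } \ell+p\le 2,\quad Y\overset{\mathscr L}{=}\mathcal N_\beta(0,1/M),\qquad \mathbb E|\sqrt M X_{ij}|^p\le C_p\ \text{ for all } p\in\mathbb N.$$ Then, in the sense of convergence of finite-dimensional marginals, as $M\to\infty$: (a) for any sequence of unit vectors $\vec b=\vec b_N$ of length $N$, for the CGA on $W\vec x=\vec b$ (with $\vec x_0=0$), $(\|\vec e_k(W,\vec b)\|_W^2)_{k\ge0}\to(\frac{d^k}{1-d})_{k\ge0}$ in distribution when $d\neq1$, and $(\|\vec r_k(W,\vec b)\|_2^2)_{k\ge1}\to(d^k)_{k\ge1}$ in distribution; (b) for any sequence of unit vectors $\vec b=\vec b_N$ of length $N$, for the MINRES algorithm on $W\vec x=\vec b$, $(\|\vec r_k(W,\vec b)\|_2^2)_{k\ge1}\to\big(d^k\frac{1-d}{1-d^{k+1}}\big)_{k\ge1}$ in distribution (for $d=1$ the limit is understood by continuity, i.e. $\frac1{k+1}$); (c) for any sequence of unit vectors $\vec b=\vec b_N$ of length $M$, for the CGA applied to the normal equations $W\vec x=\frac{X}{\sqrt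 M}\vec b$ (with $\vec x_0=0$), $\big(\|\vec e_k(W,\frac{X}{\sqrt M}\vec b)\|_W^2\big)_{k\ge0}\to\big(d^{k+1}\frac{1-d}{1-d^{k+1}}\big)_{k\ge0}$ in distribution (again by continuity at $d=1$).
   Context: $\mathcal N_\beta(0,1/M)$ is a real ($\beta=1$) or complex ($\beta=2$) centered normal variable with variance $1/M$ (for $\beta=1$, $\Im Y=0$). $\|\vec y\|_W^2=\vec y^*W\vec y$. For a right-hand side $\vec c$, $\mathcal K_k=\mathrm{span}\{\vec c,W\vec c,\dots,W^{k-1}\vec c\}$ and $\vec x=W^{-1}\vec c$; the CGA iterate is $\vec x_k=\mathrm{argmin}_{\vec y\in\mathcal K_k}\|\vec x-\vec y\|_W$, the MINRES iterate is $\vec x_k=\mathrm{argmin}_{\vec y\in\mathcal K_k}\|\vec c-W\vec y\|_2$, and $\vec r_k=\vec c-W\vec x_k$, $\vec e_k=\vec x-\vec x_k$. Convergence of finite-dimensional marginals of a sequence of processes means convergence in distribution of $(x_j)_{j\in S}$ for every finite index set $S$.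
   Formalization: In (c) the right-hand side is X b, without the factor 1/√M: with W=XX* and entries of variance 1/M, that factor would give ‖e_0‖_W² ≤ 1/M → 0, contradicting the stated limit d. For β=1 the vectors b are taken real. *)

(* Defs.v *)
From HB Require Import structures.
From mathcomp Require Import all_boot all_order all_algebra.
From mathcomp Require Import all_classical all_reals all_analysis.
From mathcomp Require Import complex.

Set Implicit Arguments.
Unset Strict Implicit.
Unset Printing Implicit Defensive.

Import Order.TTheory GRing.Theory Num.Theory.
Import numFieldNormedType.Exports.
Local Open Scope classical_set_scope.
Local Open Scope ring_scope.

Section LinAlg.
Variable R : realType.
Local Notation C := (R[i]).

(* conjugate transpose *)
Definition adjmx (m n : nat) (A : 'M[C]_(m, n)) : 'M[C]_(n, m) :=
  (map_mx (fun z : C => z^*) A)^T.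

(* squared Euclidean norm ||y||_2^2 *)
Definition norm2sq (n : nat) (y : 'cV[C]_n) : R :=
  \sum_(i < n) (complex.Re (y i 0) ^+ 2 + complex.Im (y i 0) ^+ 2).

(* ||y||_W^2 = y^* W y (real part; it is real for Hermitian W) *)
Definition wnorm2 (n : nat) (W : 'M[C]_n) (y : 'cV[C]_n) : R :=
  complex.Re ((adjmx y *m W *m y) 0 0).

(* Krylov space K_k = span{c, Wc, ..., W^(k-1) c} *)
Definition krylov (n : nat) (W : 'M[C]_n) (c : 'cV[C]_n) (k : nat) : set 'cV[C]_n :=
  [set y | exists a : 'I_k -> C, y = \sum_(j < k) a j *: (W ^+ j *m c)].

(* exact solution x = W^{-1} c *)
Definition xsol (n : nat) (W : 'M[C]_n) (c : 'cV[C]_n) : 'cV[C]_n := invmx W *m c.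

(* CGA iterate: argmin_{y in K_k} ||x - y||_W *)
Definition cga_iter (n : nat) (W : 'M[C]_n) (c : 'cV[C]_n) (k : nat) : 'cV[C]_n :=
  xget 0 [set y | krylov W c k y /\
    forall z, krylov W c k z -> wnorm2 W (xsol W c - y) <= wnorm2 W (xsol W c - z)].

(* MINRES iterate: argmin_{y in K_k} ||c - W y||_2 *)
Definition minres_iter (n : nat) (W : 'M[C]_n) (c : 'cV[C]_n) (k : nat) : 'cV[C]_n :=
  xget 0 [set y | krylov W c k y /\
    forall z, krylov W c k z -> norm2sq (c - W *m y) <= norm2sq (c - W *m z)].

Definition cga_err n (W : 'M[C]_n) c k := xsol W c - cga_iter W c k.
Definition cga_res n (W : 'M[C]_n) c k := c - W *m cga_iter W c k.
Definition minres_res n (W : 'M[C]_n) c k := c - W *m minres_iter W c k.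

(* moments E (Re Y)^l (Im Y)^p, l + p <= 2, of Y ~ N_beta(0, 1/M):
   beta = 1: Y real N(0,1/M); beta = 2: Re Y, Im Y iid N(0, 1/(2M)). *)
Definition gauss_mom (beta M l p : nat) : R :=
  match l, p with
  | 0, 0 => 1
  | 2, 0 => ((beta * M)%:R)^-1
  | 0, 2 => if beta == 2%N then ((2 * M)%:R)^-1 else 0
  | _, _ => 0
  end.

Definition cabs (z : C) : R := Num.sqrt (complex.Re z ^+ 2 + complex.Im z ^+ 2).

End LinAlg.

Section Prob.
Variable R : realType.
Local Notation C := (R[i]).

(* mutual independence of the entries (Re X_ij, Im X_ij), i < n, j < m *)
Definition entries_indep d (T : measurableType d) (P : probability T R) (n m : nat)
  (X : T -> 'M[C]_(n, m)) : Prop :=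
  forall A : 'I_n -> 'I_m -> set (R * R)%type, (forall i j, measurable (A i j)) ->
    P (\bigcap_(ij in [set: 'I_n * 'I_m]%type)
          [set w | (complex.Re (X w ij.1 ij.2), complex.Im (X w ij.1 ij.2)) \in A ij.1 ij.2])
    = (\prod_(i < n) \prod_(j < m)
          P [set w | (complex.Re (X w i j), complex.Im (X w i j)) \in A i j])%E.

(* convergence in distribution of finite-dimensional marginals (indices in I)
   of processes Z_M : T_M -> (nat -> R) to the deterministic sequence z *)
Definition fdd_cvg d (T : nat -> measurableType d) (P : forall M, probability (T M) R)
  (Z : forall M, T M -> nat -> R) (z : nat -> R) (I : pred nat) : Prop :=
  forall S : seq nat, all I S ->
  forall f : 'rV[R]_(size S) -> R, continuous f -> (exists K : R, forall v, `|f v| <= K) ->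
    ('E_(P M)[fun w => f (\row_(j < size S) Z M w (nth 0%N S j))])%E @[M --> \oo]
      --> (f (\row_(j < size S) z (nth 0%N S j)))%:E.

End Prob.

(* Main.v *)
(* The moments b^* H^k b of the Hermitization H of X (with blocks 0, X, X^*, 0)
   converge in mean square to those of the Jacobi matrix whose off-diagonal
   entries alternate between 1 and sqrt d: this comes from removing one row of H
   at a time, the removed row being independent of the rest.  Hence the
   orthogonal polynomials of the limit, evaluated at W (or X^* X) and applied to
   b, form an almost orthonormal basis of the Krylov space in which W is almost
   tridiagonal, and the least-squares problems behind CGA and MINRES become
   explicit.  This settles the residuals.  The errors also involve b^* W^-1 b
   (when d < 1) and the part of b orthogonal to the rows of X, which are not
   continuous in the moments.  The Krylov basis bounds both from one side; the
   other side follows from a bound on expectations, obtained for the regularised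
   resolvent (W + M^-2)^-1 by the same row removal.  W is invertible with high
   probability because, in the last steps of a row-by-row exposure, a new row
   must satisfy a linear relation with many nonzero coefficients, which a
   Littlewood-Offord bound makes unlikely. *)
Require Import Defs.
From HB Require Import structures.
From mathcomp Require Import all_boot all_order all_algebra.
From mathcomp Require Import all_classical all_reals all_analysis.
From mathcomp Require Import measurable_realfun.
From mathcomp Require Import complex.
From mathcomp Require Import ring lra.
Import Order.TTheory GRing.Theory Num.Theory.
Import numFieldNormedType.Exports.
Local Open Scope classical_set_scope.
Local Open Scope ring_scope.

Set Implicit Arguments.
Unset Strict Implicit.
Unset Printing Implicit Defensive.

(** The entries are constrained by moments only, so [W] may be singular with positive probability
    and [W^-1] need not have a mean. Expectations are therefore taken of the resolvent alone. The
    way back to [W^-1] uses no bound on the smallest eigenvalue: once [W] is invertible, testing the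
    variational principle of the resolvent with [y = W^-1 x] costs the term [eta |y|^2], which
    Cauchy-Schwarz bounds by [eta] times the trace of the resolvent, relative to the form itself;
    for [d < 1] this factor tends to 0 in mean. For [d = 1] the resolvent estimates break down, but
    there the errors of the normal equations involve a quantity of limit [1 - d = 0], so that
    positivity is the missing bound. The unit vector may change arbitrarily with [M], so all
    constants are uniform in [b] and in the dimensions. This is why the coordinate [v] of [H^k b] is
    measured at the scale [|b_v| + M^-1/2], whose squares have a bounded sum, and why limits are
    stated for all laws and vectors at once, with a tolerance that depends only on the distance to
    the limiting regime. *)

Local Notation re := (@complex.Re _).
Local Notation im := (@complex.Im _).

(** * Random variables with all moments *)

Section Moments.
Context {R : realType} {d : measure_display} {Om : measurableType d}.
Variable mu : probability Om R.
Local Notation C := (R[i]).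
Implicit Types (f g : Om -> R) (Y Z : Om -> C).

Definition integ f := mu.-integrable setT (EFin \o f).

(* Square-integrable is not enough: products of arbitrarily many factors occur. *)
Definition LL f := measurable_fun setT f /\ forall p, integ (fun x => `|f x| ^+ p).

Definition E f : R := \int[mu]_x f x.

Lemma integ_le f g : measurable_fun setT f -> (forall x, `|f x| <= g x) ->
  integ g -> integ f.
Proof.
move=> mf fg ig; apply: (le_integrable measurableT _ _ ig).
- exact/measurable_EFinP.
- by move=> x _ /=; rewrite lee_fin (le_trans (fg x))// ler_norm.
Qed.

Lemma integ_cst (c : R) : integ (fun=> c).
Proof. exact: finite_measure_integrable_cst. Qed.

Lemma integD f g : integ f -> integ g -> integ (fun x => f x + g x).
Proof. by move=> If Ig; have := integrableD measurableT If Ig. Qed.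

Lemma integZ (c : R) f : integ f -> integ (fun x => c * f x).
Proof. by move=> If; have := integrableZl measurableT c If. Qed.

Lemma LL_dom f g : measurable_fun setT f -> (forall x, `|f x| <= `|g x|) -> LL g -> LL f.
Proof.
move=> mf fg [mg ig]; split=> // p; apply: integ_le (ig p).
- apply: measurable_funX; exact: measurableT_comp.
- by move=> x; rewrite ger0_norm ?exprn_ge0// lerXn2r ?nnegrE.
Qed.

Lemma LL_cst (c : R) : LL (fun=> c).
Proof. by split=> [|p]; [exact: measurable_cst|exact: integ_cst]. Qed.

Lemma powD2 (a b : R) p : 0 <= a -> 0 <= b -> (a + b) ^+ p <= 2 ^+ p * (a ^+ p + b ^+ p).
Proof.
move=> a0 b0; wlog ab : a b a0 b0 / a <= b.
  move=> H; case/orP: (le_total a b) => ?; first exact: H.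
  by rewrite addrC [a ^+ p + _]addrC; apply: H.
apply: (@le_trans _ _ ((2 * b) ^+ p)).
  by rewrite lerXn2r ?nnegrE ?addr_ge0 ?mulr_ge0//; lra.
by rewrite exprMn ler_wpM2l ?exprn_ge0// lerDr exprn_ge0.
Qed.

Lemma LLD f g : LL f -> LL g -> LL (fun x => f x + g x).
Proof.
move=> [mf If] [mg ig]; split=> [|p]; first exact: measurable_funD.
apply: integ_le (integZ (2 ^+ p) (integD (If p) (ig p))).
- apply: measurable_funX; apply: measurableT_comp => //; exact: measurable_funD.
- move=> x; rewrite ger0_norm ?exprn_ge0//.
  by apply: le_trans (powD2 _ (normr_ge0 _) (normr_ge0 _)); rewrite lerXn2r ?nnegrE ?addr_ge0 ?ler_normD.
Qed.

Lemma mul_sqr_le (a b : R) : a * b <= a ^+ 2 + b ^+ 2.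
Proof. by have := sqr_ge0 (a - b); have := sqr_ge0 a; have := sqr_ge0 b; nra. Qed.

Lemma LLM f g : LL f -> LL g -> LL (fun x => f x * g x).
Proof.
move=> [mf If] [mg ig]; split=> [|p]; first exact: measurable_funM.
apply: integ_le (integD (If (p * 2)%N) (ig (p * 2)%N)).
- apply: measurable_funX; apply: measurableT_comp => //; exact: measurable_funM.
- move=> x; rewrite ger0_norm ?exprn_ge0// normrM exprMn !exprM; exact: mul_sqr_le.
Qed.

Lemma LL_eq f g : f =1 g -> LL f -> LL g.
Proof. by move=> /funext ->. Qed.

Lemma LLZ (c : R) f : LL f -> LL (fun x => c * f x).
Proof. by apply: LLM; exact: LL_cst. Qed.

Lemma LLN f : LL f -> LL (fun x => - f x).
Proof. by move=> /(LLZ (-1)); apply: LL_eq => x; rewrite mulN1r. Qed.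

Lemma LLB f g : LL f -> LL g -> LL (fun x => f x - g x).
Proof. by move=> lf /LLN; apply: LLD. Qed.

Lemma LLX f n : LL f -> LL (fun x => f x ^+ n).
Proof.
move=> lf; elim: n => [|n IH]; first by apply: LL_eq (LL_cst 1) => x.
by apply: LL_eq (LLM lf IH) => x; rewrite exprS.
Qed.

Lemma LL_sum (I : Type) (s : seq I) (P : pred I) (F : I -> Om -> R) :
  (forall i, P i -> LL (F i)) -> LL (fun x => \sum_(i <- s | P i) F i x).
Proof.
move=> H; elim: s => [|i s IH].
  by apply: LL_eq (LL_cst 0) => x; rewrite big_nil.
case Pi: (P i).
  by apply: LL_eq (LLD (H i Pi) IH) => x; rewrite big_cons Pi.
by apply: LL_eq IH => x; rewrite big_cons Pi.
Qed.

Lemma LL_bnd (c : R) f : measurable_fun setT f -> (forall x, `|f x| <= c) -> LL f.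
Proof.
move=> mf fc; apply: LL_dom mf _ (LL_cst c) => x.
by apply: le_trans (fc x) (ler_norm _).
Qed.

Lemma LL_norm f : LL f -> LL (fun x => `|f x|).
Proof.
move=> lf; apply: LL_dom (lf) => [|x]; last by rewrite normr_id.
by case: lf => mf _; exact: measurableT_comp.
Qed.

Lemma LL_int f : LL f -> integ f.
Proof.
by move=> [mf /(_ 1%N)]; apply: integ_le => // x; rewrite expr1.
Qed.

Lemma E_cst (c : R) : E (fun=> c) = c.
Proof.
rewrite /E Rintegral_cst//; set m := fine _.
have -> : m = fine (1%E : \bar R) by congr fine; exact: probability_setT.
by rewrite mulr1.
Qed.

Lemma E_add f g : LL f -> LL g -> E (fun x => f x + g x) = E f + E g.
Proof. by move=> /LL_int ? /LL_int ?; rewrite /E RintegralD. Qed.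

Lemma E_scale (c : R) f : LL f -> E (fun x => c * f x) = c * E f.
Proof. by move=> /LL_int ?; rewrite /E RintegralZl. Qed.

Lemma E_sub f g : LL f -> LL g -> E (fun x => f x - g x) = E f - E g.
Proof. by move=> /LL_int ? /LL_int ?; rewrite /E RintegralB. Qed.

Lemma E_opp f : LL f -> E (fun x => - f x) = - E f.
Proof.
move=> lf; rewrite -mulN1r -E_scale//; congr E; apply/funext => x; by rewrite mulN1r.
Qed.

Lemma E_ext f g : f =1 g -> E f = E g.
Proof. by move=> /funext ->. Qed.

Lemma E_sum (I : Type) (s : seq I) (P : pred I) (F : I -> Om -> R) :
  (forall i, P i -> LL (F i)) ->
  E (fun x => \sum_(i <- s | P i) F i x) = \sum_(i <- s | P i) E (F i).
Proof.
move=> H; elim: s => [|i s IH].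
  by rewrite big_nil -[RHS]E_cst; apply: E_ext => x; rewrite big_nil.
rewrite big_cons; case Pi: (P i); last first.
  by rewrite -IH; apply: E_ext => x; rewrite big_cons Pi.
rewrite -IH -E_add//; last by apply: LL_sum.
  by apply: E_ext => x; rewrite big_cons Pi.
exact: H.
Qed.

Lemma E_ge0 f : (forall x, 0 <= f x) -> 0 <= E f.
Proof. by move=> H; apply: Rintegral_ge0. Qed.

Lemma E_le f g : LL f -> LL g -> (forall x, f x <= g x) -> E f <= E g.
Proof. by move=> /LL_int ? /LL_int ? H; apply: le_Rintegral. Qed.

Lemma E_norm f : LL f -> `|E f| <= E (fun x => `|f x|).
Proof. by move=> /LL_int ?; apply: le_normr_Rintegral. Qed.

Definition nq (z : C) : R := re z ^+ 2 + im z ^+ 2.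

Lemma nq_ge0 z : 0 <= nq z. Proof. by rewrite addr_ge0 ?sqr_ge0. Qed.
Hint Resolve nq_ge0 : core.

Lemma nqM z w : nq (z * w) = nq z * nq w.
Proof. by case: z w => a b [c e]; rewrite /nq /=; ring. Qed.

Lemma nqJ z : nq (z^*) = nq z.
Proof. by case: z => a b; rewrite /nq /=; ring. Qed.

Lemma nqN z : nq (- z) = nq z.
Proof. by case: z => a b; rewrite /nq /=; ring. Qed.

Lemma nq0 : nq 0 = 0. Proof. by rewrite /nq /= expr0n addr0. Qed.
Lemma nq1 : nq 1 = 1. Proof. by rewrite /nq /= expr0n expr1n addr0. Qed.

Lemma nqR (c : R) : nq (c%:C)%C = c ^+ 2.
Proof. by rewrite /nq /= expr0n addr0. Qed.

Lemma nq_eq0 z : (nq z == 0) = (z == 0).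
Proof.
case: z => a b; rewrite /nq /= paddr_eq0 ?sqr_ge0// !sqrf_eq0 eq_complex /=.
by [].
Qed.

Lemma reD (z w : C) : re (z + w) = re z + re w. Proof. by case: z w => ? ? []. Qed.
Lemma imD (z w : C) : im (z + w) = im z + im w. Proof. by case: z w => ? ? []. Qed.
Lemma reN (z : C) : re (- z) = - re z. Proof. by case: z. Qed.
Lemma imN (z : C) : im (- z) = - im z. Proof. by case: z. Qed.
Lemma reM (z w : C) : re (z * w) = re z * re w - im z * im w.
Proof. by case: z w => ? ? []. Qed.
Lemma imM (z w : C) : im (z * w) = re z * im w + im z * re w.
Proof. by case: z w => ? ? []. Qed.
Lemma reJ (z : C) : re (z^*) = re z. Proof. by case: z. Qed.
Lemma imJ (z : C) : im (z^*) = - im z. Proof. by case: z. Qed.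

Lemma re_sum (I : Type) (s : seq I) (P : pred I) (F : I -> C) :
  re (\sum_(i <- s | P i) F i) = \sum_(i <- s | P i) re (F i).
Proof. by elim/big_rec2: _ => //= i y x _ <-; rewrite reD. Qed.

Definition CLL Y := LL (fun x => re (Y x)) /\ LL (fun x => im (Y x)).

Lemma CLL_eq Y Z : Y =1 Z -> CLL Y -> CLL Z.
Proof. by move=> /funext ->. Qed.

Lemma CLL_cst (c : C) : CLL (fun=> c).
Proof. by split; exact: LL_cst. Qed.

Lemma CLLR f : LL f -> CLL (fun x => ((f x)%:C)%C).
Proof. by split=> //=; exact: LL_cst. Qed.

Lemma CLLD Y Z : CLL Y -> CLL Z -> CLL (fun x => Y x + Z x).
Proof.
move=> [a b] [c e]; split.
- by apply: LL_eq (LLD a c) => x; rewrite reD.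
- by apply: LL_eq (LLD b e) => x; rewrite imD.
Qed.

Lemma CLLN Y : CLL Y -> CLL (fun x => - Y x).
Proof.
move=> [a b]; split.
- by apply: LL_eq (LLN a) => x; rewrite reN.
- by apply: LL_eq (LLN b) => x; rewrite imN.
Qed.

Lemma CLLB Y Z : CLL Y -> CLL Z -> CLL (fun x => Y x - Z x).
Proof. by move=> lf /CLLN; apply: CLLD. Qed.

Lemma CLLM Y Z : CLL Y -> CLL Z -> CLL (fun x => Y x * Z x).
Proof.
move=> [a b] [c e]; split.
- by apply: LL_eq (LLB (LLM a c) (LLM b e)) => x; rewrite reM.
- by apply: LL_eq (LLD (LLM a e) (LLM b c)) => x; rewrite imM.
Qed.

Lemma CLLJ Y : CLL Y -> CLL (fun x => (Y x)^*).
Proof.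
move=> [a b]; split.
- by apply: LL_eq a => x; rewrite reJ.
- by apply: LL_eq (LLN b) => x; rewrite imJ.
Qed.

Lemma CLL_sum (I : Type) (s : seq I) (P : pred I) (F : I -> Om -> C) :
  (forall i, P i -> CLL (F i)) -> CLL (fun x => \sum_(i <- s | P i) F i x).
Proof.
move=> H; elim: s => [|i s IH].
  by apply: CLL_eq (CLL_cst 0) => x; rewrite big_nil.
case Pi: (P i).
  by apply: CLL_eq (CLLD (H i Pi) IH) => x; rewrite big_cons Pi.
by apply: CLL_eq IH => x; rewrite big_cons Pi.
Qed.

Lemma LL_nq Y : CLL Y -> LL (fun x => nq (Y x)).
Proof. by move=> [a b]; apply: LLD; apply: LLX. Qed.

(* [Y] is of order [c] in every L^p, with constants [K] meant to be independent of
   the dimensions. *)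
Definition Ob (K : nat -> R) (c : R) Y :=
  [/\ 0 < c, CLL Y & forall p, E (fun x => nq (Y x) ^+ p) <= K p * c ^+ (2 * p)].

Lemma Ob_eq K c Y Z : Y =1 Z -> Ob K c Y -> Ob K c Z.
Proof. by move=> /funext ->. Qed.

Lemma Ob_CLL K c Y : Ob K c Y -> CLL Y. Proof. by case. Qed.

Lemma Ob_K_ge0 K c Y p : Ob K c Y -> 0 <= K p.
Proof.
case=> c0 _ /(_ p) H; have := le_trans (E_ge0 (fun x => exprn_ge0 p (nq_ge0 (Y x)))) H.
by rewrite pmulr_lge0// exprn_gt0.
Qed.

Lemma Ob_le K c c' Y : c <= c' -> Ob K c Y -> Ob K c' Y.
Proof.
move=> cc' ob; have [c0 cY H] := ob; split=> //; first exact: lt_le_trans cc'.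
move=> p; apply: le_trans (H p) _; rewrite ler_wpM2l ?(Ob_K_ge0 p ob)//.
by rewrite lerXn2r ?nnegrE ?(ltW c0)// (le_trans (ltW c0)).
Qed.

Lemma Ob_K K K' c Y : (forall p, K p <= K' p) -> Ob K c Y -> Ob K' c Y.
Proof.
move=> KK [c0 cY H]; split=> // p; apply: le_trans (H p) _.
by rewrite ler_wpM2r ?exprn_ge0 ?(ltW c0).
Qed.

Lemma Ob_scale K a c Y : 0 < a -> Ob K (a * c) Y -> Ob (fun p => K p * a ^+ (2 * p)) c Y.
Proof.
move=> a0 [c0 cY H]; split=> //; first by rewrite pmulr_rgt0 in c0.
by move=> p; rewrite -mulrA -exprMn.
Qed.

Lemma Ob_cst (z : C) c : 0 < c -> nq z <= c ^+ 2 -> Ob (fun=> 1) c (fun=> z).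
Proof.
move=> c0 zc; split=> // [|p]; first exact: CLL_cst.
by rewrite E_cst mul1r exprM lerXn2r ?nnegrE ?sqr_ge0.
Qed.

(** The power mean inequality for weights that need not sum to [1]. What the induction step loses is
    [a b] times a product of two differences of the same sign. *)
Lemma pow_convex (a b x y : R) p : 0 <= a -> 0 <= b -> 0 <= x -> 0 <= y ->
  (a * x + b * y) ^+ p.+1 <= (a + b) ^+ p * (a * x ^+ p.+1 + b * y ^+ p.+1).
Proof.
move=> a0 b0 x0 y0; elim: p => [|p IH]; first by rewrite expr0 mul1r !expr1.
rewrite exprS; apply: le_trans (ler_wpM2l _ IH) _; first by rewrite addr_ge0 ?mulr_ge0.
rewrite [(a + b) ^+ p.+1]exprSr -mulrA mulrCA ler_wpM2l ?exprn_ge0 ?addr_ge0//.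
rewrite -subr_ge0.
have -> : (a + b) * (a * x ^+ p.+2 + b * y ^+ p.+2) - (a * x + b * y) * (a * x ^+ p.+1 + b * y ^+ p.+1)
  = a * b * ((x - y) * (x ^+ p.+1 - y ^+ p.+1)) by rewrite !(exprS _ p.+1); ring.
apply: mulr_ge0; first exact: mulr_ge0.
case/orP: (le_total x y) => xy.
  by rewrite -mulrNN !opprB mulr_ge0 ?subr_ge0 ?lerXn2r ?nnegrE.
by rewrite mulr_ge0 ?subr_ge0 ?lerXn2r ?nnegrE.
Qed.

(** Cauchy-Schwarz with free weights: the two sides differ by [a b |z/a - w/b|^2]. When [z] has size
    [a] and [w] has size [b] the bound is the sharp [(a + b)^2], which lets scales add exactly. *)
Lemma nqD_weighted (a b : R) (z w : C) : 0 < a -> 0 < b ->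
  nq (z + w) <= (a + b) * (a * (nq z / a ^+ 2) + b * (nq w / b ^+ 2)).
Proof.
move=> a0 b0; rewrite /nq reD imD.
have -> : (a + b) * (a * ((re z ^+ 2 + im z ^+ 2) / a ^+ 2) + b * ((re w ^+ 2 + im w ^+ 2) / b ^+ 2)) =
  ((re z + re w) ^+ 2 + (im z + im w) ^+ 2) +
  a * b * ((re z / a - re w / b) ^+ 2 + (im z / a - im w / b) ^+ 2).
  by field; rewrite !gt_eqF.
by rewrite lerDl mulr_ge0 ?addr_ge0 ?sqr_ge0// mulr_ge0 ?ltW.
Qed.

(** The substitute for Minkowski's inequality. Taking the scales themselves as weights keeps the
    constant [K] unchanged, so that a sum of any number of terms costs nothing but the sum of its
    scales. *)
Lemma ObD_same K a b Y Z : Ob K a Y -> Ob K b Z -> Ob K (a + b) (fun x => Y x + Z x).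
Proof.
move=> obY obZ; have [a0 cY HY] := obY; have [b0 cZ HZ] := obZ.
have ab0 : 0 < a + b by rewrite addr_gt0.
split=> [//||]; first exact: CLLD.
case=> [|p].
  rewrite !muln0 !expr0 mulr1; have := HY 0%N; rewrite muln0 expr0 mulr1.
  by rewrite (_ : (fun x => nq (Y x + Z x) ^+ 0) = (fun x => nq (Y x) ^+ 0))//; apply/funext=> x; rewrite !expr0.
have l1 : LL (fun x => nq (Y x) ^+ p.+1) by apply/LLX/LL_nq.
have l2 : LL (fun x => nq (Z x) ^+ p.+1) by apply/LLX/LL_nq.
pose u := (a + b) ^+ p.+1 * (a + b) ^+ p.
have u0 : 0 <= u by rewrite mulr_ge0// exprn_ge0 ?ltW.
pose ca := a / a ^+ 2 ^+ p.+1; pose cb := b / b ^+ 2 ^+ p.+1.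
apply: (@le_trans _ _ (E (fun x => u * (ca * nq (Y x) ^+ p.+1 + cb * nq (Z x) ^+ p.+1)))).
  apply: E_le.
  - by apply: LLX; apply: LL_nq; exact: CLLD.
  - by apply: LLZ; apply: LLD; apply: LLZ.
  - move=> x; apply: (@le_trans _ _ (((a + b) * (a * (nq (Y x) / a ^+ 2) + b * (nq (Z x) / b ^+ 2))) ^+ p.+1)).
      rewrite lerXn2r ?nnegrE ?nqD_weighted//.
      by apply: mulr_ge0; [exact: ltW|apply: addr_ge0; apply: mulr_ge0; rewrite ?divr_ge0 ?sqr_ge0 ?nq_ge0 ?ltW].
    rewrite exprMn /u -mulrA ler_wpM2l ?exprn_ge0 ?(ltW ab0)//.
    apply: le_trans (pow_convex _ _ _ _ _) _; rewrite ?divr_ge0 ?sqr_ge0 ?nq_ge0 ?(ltW a0) ?(ltW b0)//.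
    rewrite ler_wpM2l ?exprn_ge0 ?(ltW ab0)// !exprMn /ca /cb !exprVn.
    by rewrite le_eqVlt; apply/orP; left; apply/eqP; ring.
rewrite E_scale ?E_add ?E_scale//; [|exact: LLZ|exact: LLZ|by apply: LLD; apply: LLZ].
have hy : ca * E (fun x => nq (Y x) ^+ p.+1) <= K p.+1 * a.
  rewrite /ca -mulrA mulrC -[leRHS]mulrC.
  have := HY p.+1; rewrite exprM => H.
  by rewrite mulrC ler_pM2l// mulrC ler_pdivrMr ?exprn_gt0.
have hz : cb * E (fun x => nq (Z x) ^+ p.+1) <= K p.+1 * b.
  rewrite /cb -mulrA mulrC -[leRHS]mulrC.
  have := HZ p.+1; rewrite exprM => H.
  by rewrite mulrC ler_pM2l// mulrC ler_pdivrMr ?exprn_gt0.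
apply: le_trans (ler_wpM2l u0 (lerD hy hz)) _.
rewrite -mulrDr /u mul2n -addnn exprD [(a + b) ^+ p.+1 in leRHS]exprS.
by rewrite le_eqVlt; apply/orP; left; apply/eqP; rewrite !exprS; ring.
Qed.

Lemma ObD K1 K2 a b Y Z : Ob K1 a Y -> Ob K2 b Z ->
  Ob (fun p => K1 p + K2 p) (a + b) (fun x => Y x + Z x).
Proof.
move=> o1 o2; apply: ObD_same.
- by apply: Ob_K o1 => p; rewrite lerDl (Ob_K_ge0 p o2).
- by apply: Ob_K o2 => p; rewrite lerDr (Ob_K_ge0 p o1).
Qed.

Lemma ObN K a Y : Ob K a Y -> Ob K a (fun x => - Y x).
Proof.
move=> [a0 cY H]; split=> // [|p]; first exact: CLLN.
by rewrite (_ : (fun x => _) = (fun x => nq (Y x) ^+ p))//; apply/funext=> x; rewrite nqN.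
Qed.

Lemma ObJ K a Y : Ob K a Y -> Ob K a (fun x => (Y x)^*).
Proof.
move=> [a0 cY H]; split=> // [|p]; first exact: CLLJ.
by rewrite (_ : (fun x => _) = (fun x => nq (Y x) ^+ p))//; apply/funext=> x; rewrite nqJ.
Qed.

Lemma ObB K1 K2 a b Y Z : Ob K1 a Y -> Ob K2 b Z ->
  Ob (fun p => K1 p + K2 p) (a + b) (fun x => Y x - Z x).
Proof. by move=> o1 /ObN; apply: ObD. Qed.

(** Hölder's inequality is replaced by [x y <= x^2 + y^2] after balancing the factors by [b / a] and
    [a / b]; hence the moments of double order. *)
Lemma ObM K1 K2 a b Y Z : Ob K1 a Y -> Ob K2 b Z ->
  Ob (fun p => K1 (p * 2)%N + K2 (p * 2)%N) (a * b) (fun x => Y x * Z x).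
Proof.
move=> [a0 cY HY] [b0 cZ HZ]; split=> [||p]; [by rewrite mulr_gt0|exact: CLLM|].
have l1 : LL (fun x => nq (Y x) ^+ (p * 2)) by apply/LLX/LL_nq.
have l2 : LL (fun x => nq (Z x) ^+ (p * 2)) by apply/LLX/LL_nq.
pose ca := (b / a) ^+ (2 * p); pose cb := (a / b) ^+ (2 * p).
have ca0 : 0 <= ca by rewrite exprn_ge0// divr_ge0 ?ltW.
have cb0 : 0 <= cb by rewrite exprn_ge0// divr_ge0 ?ltW.
apply: (@le_trans _ _ (E (fun x => ca * nq (Y x) ^+ (p * 2) + cb * nq (Z x) ^+ (p * 2)))).
  apply: E_le.
  - by apply: LLX; apply: LL_nq; exact: CLLM.
  - by apply: LLD; apply: LLZ.
  - move=> x; rewrite nqM exprMn !exprM.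
    have -> : ca = ((b / a) ^+ p) ^+ 2 by rewrite /ca mulnC exprM.
    have -> : cb = ((a / b) ^+ p) ^+ 2 by rewrite /cb mulnC exprM.
    rewrite -!exprMn; apply: le_trans (mul_sqr_le _ _).
    rewrite -!exprMn (_ : nq (Y x) * nq (Z x) = b / a * nq (Y x) * (a / b * nq (Z x)))//.
    by field; rewrite !gt_eqF.
rewrite E_add ?E_scale//; [|exact: LLZ|exact: LLZ].
rewrite mulrDl; apply: lerD.
  apply: le_trans (ler_wpM2l ca0 (HY _)) _.
  rewrite /ca exprMn exprVn exprMn mulnC exprM -!exprM mulnA.
  rewrite [in X in a ^+ X](_ : (2 * p * 2 = 2 * p + 2 * p)%N); last by rewrite muln2 addnn.
  rewrite exprD [(p * 2)%N]mulnC le_eqVlt; apply/orP; left; apply/eqP; field.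
  by rewrite expf_neq0// gt_eqF.
apply: le_trans (ler_wpM2l cb0 (HZ _)) _.
rewrite /cb exprMn exprVn exprMn mulnC exprM -!exprM mulnA.
rewrite [in X in b ^+ X](_ : (2 * p * 2 = 2 * p + 2 * p)%N); last by rewrite muln2 addnn.
rewrite exprD [(p * 2)%N]mulnC le_eqVlt; apply/orP; left; apply/eqP; field.
by rewrite expf_neq0// gt_eqF.
Qed.

Lemma Ob_sum (I : Type) (s : seq I) K (c : I -> R) (F : I -> Om -> C) :
  s <> [::] -> (forall i, Ob K (c i) (F i)) ->
  Ob K (\sum_(i <- s) c i) (fun x => \sum_(i <- s) F i x).
Proof.
move=> s0 H; elim: s s0 => // i [|j s] IH _.
  by rewrite big_seq1; apply: Ob_eq (H i) => x; rewrite big_seq1.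
rewrite big_cons; apply: Ob_eq (ObD_same (H i) (IH _)) => // x.
by rewrite [in RHS]big_cons.
Qed.

(** The summand [1] in the constant covers an empty index type, for which the sum of scales is [0]
    although a scale must be positive. *)
Lemma Ob_sum_le (I : finType) K (c : I -> R) (F : I -> Om -> C) c' :
  0 < c' -> \sum_i c i <= c' -> (forall p, 0 <= K p) -> (forall i, Ob K (c i) (F i)) ->
  Ob (fun p => 1 + K p) c' (fun x => \sum_i F i x).
Proof.
move=> c'0 le K0 H; case: (pickP (@predT I)) => [i0 _|I0]; last first.
  apply: (@Ob_eq _ _ (fun=> 0)); first by move=> x; rewrite big_pred0.
  apply: (@Ob_K (fun=> 1)); first by move=> p; rewrite lerDl.
  by apply: Ob_cst => //; rewrite nq0 sqr_ge0.
apply: Ob_le le _; apply: (@Ob_K K); first by move=> p; rewrite lerDr.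
apply: Ob_sum => // e.
have : i0 \in index_enum I by rewrite mem_index_enum.
by rewrite e.
Qed.

(** By [|x| <= c + x^2 / c], which avoids square roots of expectations. *)
Lemma E_re_bound K c Y : Ob K c Y -> `|E (fun x => re (Y x))| <= (1 + K 1%N) * c.
Proof.
move=> ob; have [c0 cY H] := ob; have [lr li] := cY.
apply: le_trans (E_norm lr) _.
apply: (@le_trans _ _ (E (fun x => c + c^-1 * nq (Y x)))).
  apply: E_le; first exact: LL_norm.
    by apply: LLD; [exact: LL_cst|apply/LLZ/LL_nq].
  move=> x; rewrite -(ler_pM2l c0) mulrDr mulrA mulfV ?gt_eqF// mul1r -expr2.
  rewrite /nq -[re (Y x) ^+ 2]real_normK ?num_real//.
  have := sqr_ge0 (c - `|re (Y x)|); have := sqr_ge0 (im (Y x)).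
  have := sqr_ge0 c; have := sqr_ge0 `|re (Y x)|; nra.
rewrite E_add ?E_scale ?E_cst; last 3 first.
  exact: LL_nq. exact: LL_cst. by apply/LLZ/LL_nq.
rewrite mulrDl mul1r lerD2l mulrC ler_pdivrMr//.
by have := H 1%N; rewrite muln1 expr2 mulrA; apply: le_trans.
Qed.

End Moments.
#[global] Hint Resolve nq_ge0 : core.

Ltac nneg :=
  lazymatch goal with
  | |- is_true (0 <= _ + _)%R => apply: addr_ge0; nneg
  | |- is_true (0 <= _ * _)%R => apply: mulr_ge0; nneg
  | |- is_true (0 <= _ ^+ 2)%R => exact: sqr_ge0
  | |- is_true (0 <= _ ^+ _)%R => apply: exprn_ge0; nneg
  | |- is_true (0 <= _ ^-1)%R => rewrite invr_ge0; nneg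
  | |- is_true (0 <= nq _)%R => exact: nq_ge0
  | |- is_true (0 <= _%:R)%R => exact: ler0n
  | |- is_true (0 <= \sum_(_ <- _ | _) _)%R => apply: sumr_ge0 => ? ?; nneg
  | |- _ => solve [assumption | exact: ltW | done | auto]
  end.

(** * A Rosenthal inequality *)

Section PowerInequalities.
Context {R : realFieldType}.
Implicit Types a b g t : R.

Lemma pow_mono a b n : 0 <= a -> a <= b -> a ^+ n <= b ^+ n.
Proof. by move=> a0 ab; rewrite lerXn2r ?nnegrE// (le_trans a0). Qed.

(** Mixed monomials lie below the two that survive in [taylor_up]: compare [a] with [g]. *)
Lemma mixed_pow1 a g p : 0 <= a -> 0 <= g -> a ^+ p * g ^+ 2 <= a ^+ p.+1 * g + g ^+ p.+2.
Proof.
move=> a0 g0; case/orP: (le_total a g) => ag.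
  apply: (@le_trans _ _ (g ^+ p.+2)); last by rewrite lerDr mulr_ge0 ?exprn_ge0.
  by rewrite -[p.+2]addn2 [leRHS]exprD; apply: ler_wpM2r; [nneg|rewrite lerXn2r ?nnegrE].
apply: (@le_trans _ _ (a ^+ p.+1 * g)); last by rewrite lerDl exprn_ge0.
by rewrite expr2 mulrA ler_wpM2r// exprSr ler_wpM2l ?exprn_ge0.
Qed.

Lemma mixed_pow2 a g p : 0 <= a -> 0 <= g -> a * g ^+ p.+1 <= a ^+ p.+1 * g + g ^+ p.+2.
Proof.
move=> a0 g0; case/orP: (le_total a g) => ag.
  apply: (@le_trans _ _ (g ^+ p.+2)); last by rewrite lerDr mulr_ge0 ?exprn_ge0.
  by rewrite [leRHS]exprS ler_wpM2r ?exprn_ge0.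
apply: (@le_trans _ _ (a ^+ p.+1 * g)); last by rewrite lerDl exprn_ge0.
by rewrite exprSr mulrA ler_wpM2r// exprS ler_wpM2l// lerXn2r ?nnegrE.
Qed.

(** In the induction of [taylor_up], [7 = 4 + 2 + 1] counts the terms produced by [b^2] and [b g],
    and [6] comes from multiplying the previous error by [a + b + g <= 2 (a + g)]. *)
Fixpoint taylor_const p : R :=
  if p is p'.+1 then 1 + 7 * p'.+1%:R + 6 * taylor_const p' else 1.

Lemma taylor_const_ge0 p : 0 <= taylor_const p.
Proof. by elim: p => //= p IH; rewrite !addr_ge0 ?mulr_ge0. Qed.

(** Meant for [a = |S|^2], [g = |Y|^2] and [b] the cross term, so that [a + b + g = |S + Y|^2]. The
    term linear in [b] is kept exactly, since it has mean zero for a centered increment; all other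
    terms are moved to the two extreme monomials. *)
Lemma taylor_up p a b g : 0 <= a -> 0 <= g -> b ^+ 2 <= 4 * a * g -> 0 <= a + b + g ->
  (a + b + g) ^+ p.+1 <= a ^+ p.+1 + p.+1%:R * a ^+ p * b
     + taylor_const p * (a ^+ p * g + g ^+ p.+1).
Proof.
move=> a0 g0 bb s0; elim: p => [|p IH] /=; first by rewrite !expr1 !expr0; lra.
rewrite exprS; apply: le_trans (ler_wpM2l s0 IH) _.
set c := taylor_const p; have c0 : 0 <= c by exact: taylor_const_ge0.
have h1 := mixed_pow1 p a0 g0; have h2 := mixed_pow2 p a0 g0.
have e : forall x n, x ^+ n.+1 = x * x ^+ n :> R by move=> x n; rewrite exprS.
have ap0 : 0 <= a ^+ p by rewrite exprn_ge0.
have gp0 : 0 <= g ^+ p by rewrite exprn_ge0.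
rewrite -[p.+2%:R]natr1; move: h1 h2; rewrite !e.
set A := a ^+ p in ap0 *; set G := g ^+ p in gp0 *; set n : R := p.+1%:R.
have n0 : 0 <= n by rewrite /n.
move=> h1 h2.
have h3 : A * b ^+ 2 <= 4 * (a * A * g).
  by have := ler_wpM2l ap0 bb; rewrite (_ : A * (4 * a * g) = 4 * (a * A * g)) //; ring.
have h4 : A * (b * g) <= 2 * (a * A * g) + A * g ^+ 2.
  have : b * g <= 2 * (a * g) + g ^+ 2.
    by have := sqr_ge0 (b - g); have := sqr_ge0 g; nra.
  move/(ler_wpM2l ap0); rewrite mulrDr.
  by rewrite (_ : A * (2 * (a * g)) = 2 * (a * A * g)) //; ring.
have h5 : b <= a + g.
  rewrite -subr_ge0; case: (lerP b (a + g)) => [|ab]; first by rewrite subr_ge0.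
  have : (a + g) ^+ 2 < b ^+ 2 by rewrite ltrXn2r ?nnegrE ?addr_ge0// ltW// (le_lt_trans _ ab)// addr_ge0.
  by have := sqr_ge0 (a - g); nra.
have h6 : (a + b + g) * (A * g + g * G) <= 2 * (a + g) * (A * g + g * G).
  by rewrite ler_wpM2r ?addr_ge0 ?mulr_ge0//; lra.
have h7 := ler_wpM2l c0 h6.
have h8 := ler_wpM2l n0 h3; have h9 := ler_wpM2l n0 h4; have h10 := ler_wpM2l n0 h1.
have h11 := ler_wpM2l c0 h1; have h12 := ler_wpM2l c0 h2.
set P := a * A * g in h1 h2 h3 h4 h8 h9 h10 h11 h12 *.
set Q := g * (g * G) in h1 h2 h10 h11 h12 *.
have P0 : 0 <= P by rewrite /P !mulr_ge0.
have Q0 : 0 <= Q by rewrite /Q !mulr_ge0.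
have nQ : 0 <= n * Q by exact: mulr_ge0.
have -> : (a + b + g) * (a * A + n * A * b + c * (A * g + g * G)) =
  a * (a * A) + (n + 1) * (a * A) * b + (P + n * (A * b ^+ 2) + n * (A * (b * g)))
  + c * ((a + b + g) * (A * g + g * G)) by rewrite /P; ring.
have h13 : c * (2 * (a + g) * (A * g + g * G)) <= 6 * c * (P + Q).
  have -> : c * (2 * (a + g) * (A * g + g * G)) =
    2 * c * (P + Q) + 2 * (c * (A * g ^+ 2)) + 2 * (c * (a * (g * G))) by rewrite /P /Q; ring.
  by lra.
have -> : (1 + 7 * n + 6 * c) * (P + Q) = (P + Q) + 7 * (n * P) + 7 * (n * Q) + 6 * c * (P + Q) by ring.
by lra.
Qed.

(** The tangent line of a convex power. With a centered [t] it makes powers of the partial sums a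
    submartingale. *)
Lemma taylor_low p a t : 0 <= a -> 0 <= a + t ->
  a ^+ p.+1 + p.+1%:R * a ^+ p * t <= (a + t) ^+ p.+1.
Proof.
move=> a0 at0; elim: p => [|p IH]; first by rewrite !expr1 expr0; lra.
rewrite [leRHS]exprS; apply: le_trans (ler_wpM2l at0 IH).
rewrite -[p.+2%:R]natr1 !(exprS _ p) (exprS _ p.+1) !(exprS _ p).
have : 0 <= p.+1%:R * a ^+ p * t ^+ 2 by nneg.
by set A := a ^+ p; set n : R := p.+1%:R; lra.
Qed.

(** Young's inequality with the factor [1/2], so that the highest power can be absorbed into the
    left-hand side of [rosenthal]. *)
Lemma young_pow p a b c : 0 <= a -> 0 <= b -> 0 <= c ->
  c * (a ^+ p * b) <= 2^-1 * a ^+ p.+1 + (2 * c * b) ^+ p.+1.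
Proof.
move=> a0 b0 c0; case/orP: (le_total (c * b) (2^-1 * a)) => h.
  apply: (@le_trans _ _ (2^-1 * a ^+ p.+1)); last first.
    by rewrite lerDl exprn_ge0 ?mulr_ge0.
  have := ler_wpM2l (exprn_ge0 p a0) h; rewrite exprS.
  by set A := a ^+ p; lra.
apply: (@le_trans _ _ ((2 * c * b) ^+ p.+1)); last first.
  by rewrite lerDr mulr_ge0 ?exprn_ge0 ?invr_ge0.
have cb0 : 0 <= c * b by rewrite mulr_ge0.
rewrite exprS mulrCA mulrC.
have h' : a ^+ p <= (2 * c * b) ^+ p by rewrite lerXn2r ?nnegrE ?mulr_ge0//; lra.
apply: le_trans (ler_wpM2l cb0 h') _.
by rewrite ler_wpM2r ?exprn_ge0 ?mulr_ge0//; lra.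
Qed.

Lemma sum_pow_le (I : Type) (r : seq I) (F : I -> R) p : (forall i, 0 <= F i) ->
  \sum_(i <- r) F i ^+ p.+1 <= (\sum_(i <- r) F i) ^+ p.+1.
Proof.
move=> F0; elim: r => [|i r IH]; first by rewrite !big_nil expr0n.
rewrite !big_cons; apply: le_trans (lerD (lexx _) IH) _.
set x := F i; set y := \sum_(_ <- _) _.
have x0 : 0 <= x by exact: F0.
have y0 : 0 <= y by exact: sumr_ge0.
elim: p {IH} => [|p IH]; first by rewrite !expr1.
have s0 : 0 <= x + y by exact: addr_ge0.
rewrite [leRHS]exprS; apply: le_trans (ler_wpM2l s0 IH).
rewrite [x ^+ p.+2]exprS [y ^+ p.+2]exprS mulrDl !mulrDr.
have := exprn_ge0 p.+1 x0; have := exprn_ge0 p.+1 y0.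
by set X := x ^+ _; set Y := y ^+ _ => X0 Y0; have := mulr_ge0 x0 X0; have := mulr_ge0 y0 Y0; nra.
Qed.

End PowerInequalities.

Section SquaredModulus.
Context {R : realType}.
Implicit Types z w : R[i].

Lemma nqD z w : nq (z + w) = nq z + 2 * re (z^* * w) + nq w.
Proof. by case: z w => a b [c e]; rewrite /nq /=; ring. Qed.

Lemma nq_cross z w : (2 * re (z^* * w)) ^+ 2 <= 4 * nq z * nq w.
Proof.
case: z w => a b [c e]; rewrite /nq /=.
by have := sqr_ge0 (a * e - b * c); lra.
Qed.

End SquaredModulus.

Section Rosenthal.
Context {R : realType} {d : measure_display} {Om : measurableType d}.
Variable mu : probability Om R.
Local Notation C := (R[i]).
Local Notation E := (E mu).
Local Notation LL := (LL mu).
Local Notation CLL := (CLL mu).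

(* [f] does not see the coordinates along which [rel] lets points differ. *)
Definition blind {V : Type} (rel : Om -> Om -> Prop) (f : Om -> V) :=
  forall A A', rel A A' -> f A = f A'.

(* [h] is centered with scale [s], and independent of everything [rel]-blind. *)
Definition cent (rel : Om -> Om -> Prop) (h : Om -> C) (kap : nat -> R) (s : R) :=
  [/\ CLL h,
      forall f, LL f -> blind rel f ->
        E (fun x => f x * re (h x)) = 0 /\ E (fun x => f x * im (h x)) = 0 &
      forall f p, LL f -> (forall x, 0 <= f x) -> blind rel f ->
        E (fun x => f x * nq (h x) ^+ p) <= kap p * s ^+ (2 * p) * E f].

Lemma cent_cross rel h kap s Z : cent rel h kap s -> CLL Z -> blind rel Z ->
  E (fun x => re (Z x * h x)) = 0.
Proof.
move=> [ch H _] [zr zi] fz; have [hr hi] := ch.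
rewrite (_ : (fun x => _) = (fun x => re (Z x) * re (h x) - im (Z x) * im (h x))); last first.
  by apply/funext => x; rewrite reM.
rewrite E_sub; [|exact: LLM|exact: LLM].
have [-> _] := H _ zr (fun A A' r => congr1 re (fz A A' r)).
by have [_ ->] := H _ zi (fun A A' r => congr1 im (fz A A' r)); rewrite subrr.
Qed.

Variables (n : nat) (rel : nat -> Om -> Om -> Prop) (h u : nat -> Om -> C).
Variables (kap : nat -> R) (s : R).
Hypothesis s0 : 0 < s.
Hypothesis hc : forall j, (j < n)%N -> cent (rel j) (h j) kap s.
Hypothesis hf : forall i j, (i < j < n)%N -> blind (rel j) (h i).
Hypothesis uf : forall i j, (i <= j < n)%N -> blind (rel j) (u i).
Hypothesis uL : forall j, (j < n)%N -> CLL (u j).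

(** A martingale in [k]: [h j] is centered given everything blind along [rel j], which includes the
    earlier [h i] and all [u i] with [i <= j]. Blindness takes the place of a filtration. *)
Let S k x := \sum_(0 <= j < k) h j x * u j x.
Let V x := \sum_(0 <= j < n) nq (u j x).

Let hL j : (j < n)%N -> CLL (h j). Proof. by move=> /hc[]. Qed.

Let SS k x : S k.+1 x = S k x + h k x * u k x.
Proof. by rewrite /S big_nat_recr. Qed.

Let SL k : (k <= n)%N -> CLL (S k).
Proof.
elim: k => [|k IH] kn; first by apply: CLL_eq (CLL_cst mu 0) => x; rewrite /S big_geq.
by apply: CLL_eq (CLLD (IH (ltnW kn)) (CLLM (hL kn) (uL kn))) => x; rewrite SS.
Qed.

Let Sfree k j : (k <= j < n)%N -> blind (rel j) (S k).
Proof.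
move=> /andP[kj jn] A A' r; apply: eq_big_nat => i /andP[_ ik].
by rewrite (hf _ r) ?(uf _ r)// jn andbT ?(leq_trans (ltnW ik))// (leq_trans ik).
Qed.

Let step_mid k q G : (k < n)%N -> LL G -> blind (rel k) G ->
  E (fun x => G x * (nq (S k x) ^+ q * (2 * re ((S k x)^* * (h k x * u k x))))) = 0.
Proof.
move=> kn lG fG.
have := @cent_cross _ _ _ _ (fun x => ((2 * (G x * nq (S k x) ^+ q))%:C)%C * (S k x)^* * u k x) (hc kn).
rewrite (_ : (fun x => re _) =
  (fun x => G x * (nq (S k x) ^+ q * (2 * re ((S k x)^* * (h k x * u k x)))))); last first.
  by apply/funext => x; case: (S k x) (u k x) (h k x) => ? ? [? ?] [? ?] /=; ring.
apply.
- apply: CLLM (uL kn); apply: CLLM (CLLJ (SL (ltnW kn))).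
  by apply: CLLR; apply: LLZ; apply: LLM => //; apply/LLX/LL_nq/SL/ltnW.
- by move=> A A' r; rewrite (fG _ _ r) (Sfree _ r) ?leqnn// (uf _ r) ?leqnn.
Qed.

Let step_low k q G : (k < n)%N -> LL G -> (forall x, 0 <= G x) -> blind (rel k) G ->
  E (fun x => G x * nq (S k x) ^+ q) <= E (fun x => G x * nq (S k.+1 x) ^+ q).
Proof.
move=> kn lG G0 fG; case: q => [|q].
  by rewrite (_ : (fun x => _) = (fun x => G x * nq (S k.+1 x) ^+ 0))//; apply/funext => x; rewrite !expr0.
have lS k' : (k' <= n)%N -> LL (fun x => nq (S k' x)) by move=> ?; exact/LL_nq/SL.
have lm : LL (fun x => G x * (nq (S k x) ^+ q * (2 * re ((S k x)^* * (h k x * u k x))))).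
  apply: LLM => //; apply: LLM; first exact/LLX/lS/ltnW.
  by apply: LLZ; have [] := CLLM (CLLJ (SL (ltnW kn))) (CLLM (hL kn) (uL kn)).
rewrite -[leLHS]addr0 -(mulr0 q.+1%:R) -(step_mid q kn lG fG) -E_scale// -E_add//; last first.
- exact: LLZ.
- by apply: LLM => //; apply/LLX/lS/ltnW.
apply: E_le.
- by apply: LLD; [apply: LLM => //; apply/LLX/lS/ltnW|exact: LLZ].
- by apply: LLM => //; apply/LLX/lS.
move=> x; set b := 2 * re _.
have -> : G x * nq (S k x) ^+ q.+1 + q.+1%:R * (G x * (nq (S k x) ^+ q * b)) =
  G x * (nq (S k x) ^+ q.+1 + q.+1%:R * nq (S k x) ^+ q * b) by ring.
rewrite ler_wpM2l// SS nqD -/b -addrA.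
have h0 : 0 <= nq (S k x) + (b + nq (h k x * u k x)) by rewrite addrA -nqD nq_ge0.
apply: le_trans (taylor_low q (nq_ge0 _) h0); rewrite lerD2l mulrDr lerDl.
by nneg.
Qed.

(** The weight [G] will be [|u k|^2]. Replacing [S k] by the final [S n] under such a weight lets
    the one-step bounds be summed over [k] into the single factor [V]. *)
Let submart k q G : (k <= n)%N -> LL G -> (forall x, 0 <= G x) ->
  (forall j, (k <= j < n)%N -> blind (rel j) G) ->
  E (fun x => G x * nq (S k x) ^+ q) <= E (fun x => G x * nq (S n x) ^+ q).
Proof.
move=> kn lG G0; have [m mE] : exists m, (m + k = n)%N.
  by exists (n - k)%N; rewrite subnK.
elim: m k kn mE => [|m IH] k kn mE fG; first by rewrite -mE add0n.
have km : (k < n)%N by rewrite -mE addSn ltnS leq_addl.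
apply: le_trans (step_low q km lG G0 _) (IH _ km _ _).
- by apply: fG; rewrite leqnn.
- by rewrite addnS -addSn.
- by move=> j /andP[kj jn]; apply: fG; rewrite jn ltnW.
Qed.

Let step_up k p : (k < n)%N ->
  E (fun x => nq (S k.+1 x) ^+ p.+1) <= E (fun x => nq (S k x) ^+ p.+1)
   + taylor_const p * (kap 1%N * s ^+ 2 * E (fun x => nq (u k x) * nq (S k x) ^+ p)
       + kap p.+1 * s ^+ (2 * p.+1) * E (fun x => nq (u k x) ^+ p.+1)).
Proof.
move=> kn.
have lS k' : (k' <= n)%N -> LL (fun x => nq (S k' x)) by move=> ?; exact/LL_nq/SL.
have lu : LL (fun x => nq (u k x)) by exact/LL_nq/uL.
have lh : LL (fun x => nq (h k x)) by exact/LL_nq/hL.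
have lm : LL (fun x => nq (S k x) ^+ p * (2 * re ((S k x)^* * (h k x * u k x)))).
  apply: LLM; first exact/LLX/lS/ltnW.
  by apply: LLZ; have [] := CLLM (CLLJ (SL (ltnW kn))) (CLLM (hL kn) (uL kn)).
have l1 : LL (fun x => nq (u k x) * nq (S k x) ^+ p * nq (h k x) ^+ 1).
  by apply: LLM; [apply: LLM => //; exact/LLX/lS/ltnW|exact: LLX].
have l2 : LL (fun x => nq (u k x) ^+ p.+1 * nq (h k x) ^+ p.+1).
  by apply: LLM; exact: LLX.
pose T := taylor_const p : R.
have T0 : 0 <= T by exact: taylor_const_ge0.
apply: (@le_trans _ _ (E (fun x => nq (S k x) ^+ p.+1
    + (p.+1%:R * (nq (S k x) ^+ p * (2 * re ((S k x)^* * (h k x * u k x))))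
    + T * (nq (u k x) * nq (S k x) ^+ p * nq (h k x) ^+ 1
      + nq (u k x) ^+ p.+1 * nq (h k x) ^+ p.+1))))).
  apply: E_le.
  - exact/LLX/lS.
  - apply: LLD; first exact/LLX/lS/ltnW.
    by apply: LLD; [exact: LLZ|apply: LLZ; exact: LLD].
  move=> x; rewrite SS nqD.
  have hp : 0 <= nq (S k x) + 2 * re ((S k x)^* * (h k x * u k x)) + nq (h k x * u k x) by rewrite -nqD.
  apply: le_trans (taylor_up p (nq_ge0 _) (nq_ge0 _) (nq_cross _ _) hp) _.
  rewrite le_eqVlt; apply/orP; left; apply/eqP.
  by rewrite nqM exprMn -/T expr1; ring.
rewrite E_add; last 2 first.
- exact/LLX/lS/ltnW.
- by apply: LLD; [exact: LLZ|apply: LLZ; exact: LLD].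
rewrite lerD2l E_add; [|exact: LLZ|apply: LLZ; exact: LLD].
rewrite E_scale//.
have -> : E (fun x => nq (S k x) ^+ p * (2 * re ((S k x)^* * (h k x * u k x)))) = 0.
  rewrite -(@step_mid k p (fun=> 1) kn); [|exact: LL_cst|by []].
  by apply: E_ext => x; rewrite mul1r.
rewrite mulr0 add0r E_scale ?E_add//; last exact: LLD.
rewrite ler_wpM2l//; have [_ _ K] := hc kn; apply: lerD.
- apply: le_trans (K _ 1%N _ _ _) _ => //.
  + by apply: LLM => //; exact/LLX/lS/ltnW.
  + by move=> x; nneg.
  + by move=> A A' r; rewrite (Sfree _ r) ?leqnn// (uf _ r) ?leqnn.
- apply: le_trans (K _ p.+1 _ _ _) _ => //.
  + exact: LLX.
  + by move=> x; nneg.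
  + by move=> A A' r; rewrite (uf _ r) ?leqnn.
Qed.

(** Here [c] is the constant of the recursive inequality [H] in [rosenthal], [(2 c)^p] comes from
    Young's inequality, and the outer [2] from absorbing one half of the left-hand side. *)
Definition rosenthal_const p : R :=
  if p is p'.+1 then
    let c := taylor_const p' * (`|kap 1%N| + `|kap p|) in 2 * ((2 * c) ^+ p + c)
  else 1.

(** A Burkholder-Rosenthal bound with predictable coefficients. Summing [step_up] over the steps and
    passing to the final sum by [submart] bounds the moment of order [p] by the mean of
    [V |S n|^(2 (p - 1))] plus that of [V^p]; Young's inequality removes the first. *)
Lemma rosenthal p :
  E (fun x => nq (S n x) ^+ p) <= rosenthal_const p * s ^+ (2 * p) * E (fun x => V x ^+ p).
Proof.
case: p => [|p].
  rewrite mul1r muln0 expr0 mul1r le_eqVlt; apply/orP; left; apply/eqP.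
  by apply: E_ext => x; rewrite !expr0.
have lS k : (k <= n)%N -> LL (fun x => nq (S k x)) by move=> ?; exact/LL_nq/SL.
have lu k : (k < n)%N -> LL (fun x => nq (u k x)) by move=> ?; exact/LL_nq/uL.
pose c := taylor_const p * (`|kap 1%N| + `|kap p.+1|).
have T0 : 0 <= taylor_const p :> R by exact: taylor_const_ge0.
have c0 : 0 <= c by rewrite /c; nneg.
have lV : LL V.
  rewrite /V (_ : (fun x => _) = (fun x => \sum_(j < n) nq (u j x))).
    by apply: LL_sum => j _; exact: lu.
  by apply/funext => x; rewrite big_mkord.
have V0 x : 0 <= V x by rewrite /V; nneg.
have lSV : LL (fun x => V x * nq (S n x) ^+ p) by apply: LLM => //; exact/LLX/lS.
have H : E (fun x => nq (S n x) ^+ p.+1) <=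
    c * (s ^+ 2 * E (fun x => V x * nq (S n x) ^+ p) + s ^+ (2 * p.+1) * E (fun x => V x ^+ p.+1)).
  have Hk k : (k <= n)%N -> E (fun x => nq (S k x) ^+ p.+1) <= \sum_(0 <= j < k)
     c * (s ^+ 2 * E (fun x => nq (u j x) * nq (S n x) ^+ p) + s ^+ (2 * p.+1) * E (fun x => nq (u j x) ^+ p.+1)).
    elim: k => [|k IH] kn.
      rewrite big_geq// -[leRHS](E_cst mu); apply: E_le; first exact/LLX/lS.
        exact: LL_cst.
      by move=> x; rewrite /S big_geq// nq0 expr0n.
    rewrite big_nat_recr//=; apply: le_trans (step_up p kn) _.
    apply: lerD; first exact/IH/ltnW.
    have a1 : 0 <= E (fun x => nq (u k x) * nq (S k x) ^+ p) by apply: E_ge0 => x; nneg.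
    have a2 : 0 <= E (fun x => nq (u k x) ^+ p.+1) by apply: E_ge0 => x; nneg.
    have a3 : E (fun x => nq (u k x) * nq (S k x) ^+ p) <= E (fun x => nq (u k x) * nq (S n x) ^+ p).
      apply: submart; [exact: ltnW|exact: lu|by move=> x; nneg|].
      by move=> j /andP[kj jn] A A' r; rewrite (uf _ r)// kj.
    rewrite /c -[leRHS]mulrA ler_wpM2l// mulrDr; apply: lerD.
      apply: (@le_trans _ _ (`|kap 1%N| * s ^+ 2 * E (fun x => nq (u k x) * nq (S k x) ^+ p))).
        by rewrite ler_wpM2r// ler_wpM2r ?sqr_ge0// ler_norm.
      rewrite [leRHS]mulrA; apply: ler_pM => //; first by apply: mulr_ge0; [exact: normr_ge0|exact: sqr_ge0].
      by apply: ler_wpM2r; [exact: sqr_ge0|rewrite lerDl].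
    by rewrite mulrA ler_wpM2r// ler_wpM2r ?exprn_ge0 ?(ltW s0)// (le_trans (ler_norm _))// lerDr.
  apply: le_trans (Hk n (leqnn _)) _; rewrite -mulr_sumr ler_wpM2l// big_split/= -!mulr_sumr.
  apply: lerD.
    rewrite ler_wpM2l ?sqr_ge0// le_eqVlt; apply/orP; left; apply/eqP.
    rewrite big_mkord -E_sum; last by move=> i _; apply: LLM; [exact: lu|exact/LLX/lS].
    by apply: E_ext => x; rewrite -mulr_suml /V big_mkord.
  rewrite ler_wpM2l ?exprn_ge0 ?(ltW s0)// big_mkord -E_sum; last by move=> i _; apply/LLX/lu.
  apply: E_le; [by apply: LL_sum => i _; apply/LLX/lu|exact: LLX|move=> x].
  rewrite /V big_mkord.
  exact: (@sum_pow_le R _ (index_enum 'I_n) (fun i => nq (u i x)) p (fun i => nq_ge0 _)).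
have Y : c * (s ^+ 2 * E (fun x => V x * nq (S n x) ^+ p)) <=
   2^-1 * E (fun x => nq (S n x) ^+ p.+1) + (2 * c) ^+ p.+1 * s ^+ (2 * p.+1) * E (fun x => V x ^+ p.+1).
  have lP : LL (fun x => nq (S n x) ^+ p.+1) by exact/LLX/lS.
  have lW : LL (fun x => V x ^+ p.+1) by exact: LLX.
  rewrite -!E_scale// -?E_add; [|exact: LLZ|exact: LLZ|exact: LLZ].
  apply: E_le; [by do 2 apply: LLZ|by apply: LLD; apply: LLZ|].
  move=> x; have := young_pow p (nq_ge0 (S n x)) (_ : 0 <= s ^+ 2 * V x) c0.
  rewrite (_ : c * (s ^+ 2 * (V x * nq (S n x) ^+ p)) = c * (nq (S n x) ^+ p * (s ^+ 2 * V x))); last by ring.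
  move=> H1; apply: le_trans (H1 _) _; first by nneg.
  by rewrite mulrA [(2 * c * s ^+ 2 * V x) ^+ _]exprMn [(2 * c * s ^+ 2) ^+ _]exprMn -exprM.
move: H Y; rewrite /rosenthal_const -/c mulrDr.
set a := E _; set b := c * (s ^+ 2 * _); set e := E _; set f := s ^+ (2 * p.+1).
set g := (2 * c) ^+ p.+1.
by lra.
Qed.

End Rosenthal.

(** * Linear and quadratic forms *)

Lemma sum_triangle (V : zmodType) n (F : 'I_n -> 'I_n -> V) :
  \sum_i \sum_j F i j = \sum_j F j j +
    (\sum_(j < n) \sum_(i < n) (if (i < j)%N then F j i else 0) +
     \sum_(j < n) \sum_(i < n) (if (i < j)%N then F i j else 0)).
Proof.
rewrite [X in _ = _ + (_ + X)]exchange_big /= -!big_split /=.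
apply: eq_bigr => i _; rewrite -!big_split /= (bigD1 i)//=.
rewrite [in RHS](bigD1 i)//= ltnn !addr0 addrA addr0.
congr (_ + _); apply: eq_bigr => j ji.
by case: ltngtP => [||/val_inj e]; rewrite ?addr0 ?add0r//; rewrite e eqxx in ji.
Qed.

Section Forms.
Context {R : realType} {d : measure_display} {Om : measurableType d}.
Variable mu : probability Om R.
Local Notation C := (R[i]).
Local Notation E := (E mu).
Local Notation LL := (LL mu).
Local Notation CLL := (CLL mu).
Local Notation Ob := (Ob mu).
Local Notation cent := (cent mu).

(** A bound in the sense of [Ob] on a real variable only controls its even powers; the others follow
    from [V^p <= v^p + V^(2 p) / v^p]. *)
Lemma E_pow_half (V : Om -> R) (K : nat -> R) v : 0 < v -> LL V -> (forall x, 0 <= V x) ->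
  (forall p, E (fun x => V x ^+ (2 * p)) <= K p * v ^+ (2 * p)) ->
  forall p, E (fun x => V x ^+ p) <= (1 + K p) * v ^+ p.
Proof.
move=> v0 lV V0 H p.
have vp : 0 < v ^+ p by rewrite exprn_gt0.
have lp : LL (fun x => V x ^+ (2 * p)) by exact: LLX.
apply: (@le_trans _ _ (E (fun x => v ^+ p + (v ^+ p)^-1 * V x ^+ (2 * p)))).
  apply: E_le; [exact: LLX|apply: LLD; [exact: LL_cst|exact: LLZ]|move=> x].
  rewrite -(ler_pM2l vp) mulrDr mulrA mulfV ?gt_eqF// mul1r mulnC exprM.
  by have := mul_sqr_le (v ^+ p) (V x ^+ p); rewrite -expr2.
rewrite E_add ?E_scale ?E_cst//; [|exact: LL_cst|exact: LLZ].
rewrite mulrDl mul1r lerD2l mulrC ler_pdivrMr//.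
by apply: le_trans (H p) _; rewrite mul2n -addnn exprD mulrA.
Qed.

Lemma sum_nq_moment (I : finType) (K : nat -> R) (c : I -> R) (u : I -> Om -> C) v :
  0 < v -> (forall p, 0 <= K p) -> (forall i, Ob K (c i) (u i)) -> \sum_i c i ^+ 2 <= v ^+ 2 ->
  forall p, E (fun x => (\sum_i nq (u i x)) ^+ p) <=
     (2 + (K (p * 2)%N + K (p * 2)%N)) * v ^+ (2 * p).
Proof.
move=> v0 K0 ob le p.
pose K' p := K (p * 2)%N + K (p * 2)%N.
have H : Ob (fun p => 1 + K' p) (v ^+ 2) (fun x => \sum_i (u i x * (u i x)^*)).
  apply: (@Ob_sum_le _ _ _ mu _ K' (fun i => c i ^+ 2)) => //.
  - by rewrite exprn_gt0.
  - by move=> q; rewrite /K'; nneg.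
  - by move=> i; rewrite expr2; apply: ObM => //; apply: ObJ.
have eqV x : \sum_i (u i x * (u i x)^*) = ((\sum_i nq (u i x))%:C)%C.
  rewrite raddf_sum/=; apply: eq_bigr => i _; case: (u i x) => a b.
  by apply/eqP; rewrite eq_complex /= /nq /=; apply/andP; split; apply/eqP; ring.
have lV : LL (fun x => \sum_i nq (u i x)).
  by apply: LL_sum => i _; apply: LL_nq; exact: Ob_CLL (ob i).
rewrite exprM (_ : 2 + _ = 1 + (1 + K' p)); last by rewrite /K'; ring.
apply: (@E_pow_half _ (fun p => 1 + K' p)) => //; [by rewrite exprn_gt0|by move=> x; nneg|].
move=> {}p; case: H => _ _ /(_ p); apply: le_trans.
rewrite le_eqVlt; apply/orP; left; apply/eqP; apply: E_ext => x.
by rewrite eqV nqR exprM.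
Qed.

Lemma cent_conj rel h kap s : cent rel h kap s -> cent rel (fun x => (h x)^*) kap s.
Proof.
move=> [ch H1 H2]; split; first exact: CLLJ.
  move=> f lf ff; have [e1 e2] := H1 _ lf ff; split.
    by rewrite -e1; apply: E_ext => x; rewrite reJ.
  rewrite (_ : (fun x => _) = (fun x => - (f x * im (h x)))); last first.
    by apply/funext => x; rewrite imJ mulrN.
  by rewrite E_opp ?e2 ?oppr0//; apply: LLM => //; case: ch.
move=> f p lf f0 ff; apply: le_trans (H2 f p lf f0 ff).
by rewrite le_eqVlt; apply/orP; left; apply/eqP; apply: E_ext => x; rewrite nqJ.
Qed.

(** [sig] is the exact variance, [s] only a common scale: the zero blocks of the Hermitization are
    entries with [sig = 0] and the same [s]. *)
Definition entry rel (h : Om -> C) kap s sig :=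
  [/\ cent rel h kap s, 0 <= sig <= s ^+ 2 &
      forall f, LL f -> blind rel f -> E (fun x => f x * nq (h x)) = sig * E f].

(** This turns the diagonal of a centered quadratic form into a linear form in the new centered
    variables [|h|^2 - sig], to which [lin_Ob] applies again. *)
Lemma cent_diag rel h kap s sig : 0 < s -> entry rel h kap s sig ->
  cent rel (fun x => ((nq (h x) - sig)%:C)%C)
    (fun p => 2 ^+ (2 * p) * (kap (2 * p)%N + 1)) (s ^+ 2).
Proof.
move=> s0 [[ch _ H2] /andP[g0 gs] H3].
have lh : LL (fun x => nq (h x)) by exact: LL_nq.
have lD : LL (fun x => nq (h x) - sig) by apply: LLB => //; exact: LL_cst.
split; first exact: CLLR.
  move=> f lf ff; split => /=; last first.
    by rewrite -[RHS](E_cst mu); apply: E_ext => x; rewrite mulr0.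
  rewrite (_ : (fun x => _) = (fun x => f x * nq (h x) - sig * f x)); last first.
    by apply/funext => x; ring.
  by rewrite E_sub ?H3// ?E_scale ?subrr//; [exact: LLM|exact: LLZ].
move=> f p lf f0 ff.
have l1 : LL (fun x => f x * nq (h x) ^+ (2 * p)) by apply: LLM => //; exact: LLX.
have l2 : LL (fun x => sig ^+ (2 * p) * f x) by exact: LLZ.
apply: (@le_trans _ _ (E (fun x => 2 ^+ (2 * p) * (f x * nq (h x) ^+ (2 * p) + sig ^+ (2 * p) * f x)))).
  apply: E_le.
  - by apply: LLM => //; apply: LLX; apply: LL_nq; exact: CLLR.
  - by apply: LLZ; exact: LLD.
  move=> x; rewrite nqR -exprM [leRHS](_ : _ = f x * (2 ^+ (2 * p) * (nq (h x) ^+ (2 * p) + sig ^+ (2 * p)))); last by ring.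
  rewrite ler_wpM2l//; apply: le_trans (powD2 _ (nq_ge0 _) g0).
  have : (nq (h x) - sig) ^+ 2 <= (nq (h x) + sig) ^+ 2.
    by have := mulr_ge0 (nq_ge0 (h x)) g0; nra.
  by rewrite !exprM => ?; rewrite lerXn2r ?nnegrE ?sqr_ge0.
rewrite E_scale ?E_add ?E_scale//; last exact: LLD.
rewrite -!mulrA ler_wpM2l ?exprn_ge0// mulrDl; apply: lerD.
  apply: le_trans (H2 f (2 * p)%N lf f0 ff) _.
  by rewrite -!mulrA -exprM.
by rewrite !mul1r ler_wpM2r ?E_ge0// lerXn2r ?nnegrE ?sqr_ge0.
Qed.

Lemma lin_Ob n (rel : 'I_n -> Om -> Om -> Prop) (h u : 'I_n -> Om -> C) kap s KV v :
  0 < s -> 0 < v -> (forall j, cent (rel j) (h j) kap s) ->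
  (forall i j : 'I_n, (i < j)%N -> blind (rel j) (h i)) ->
  (forall i j : 'I_n, (i <= j)%N -> blind (rel j) (u i)) ->
  (forall j, CLL (u j)) ->
  (forall p, E (fun x => (\sum_j nq (u j x)) ^+ p) <= KV p * v ^+ (2 * p)) ->
  Ob (fun p => `|rosenthal_const kap p| * KV p) (s * v) (fun x => \sum_j h j x * u j x).
Proof.
move=> s0 v0 hc hf uf uL HV; split=> [||p]; first exact: mulr_gt0.
  by apply: CLL_sum => j _; apply: CLLM => //; case: (hc j).
(* [rosenthal] is indexed by natural numbers; beyond the ordinals the families are extended by zero,
   and the relation by the full one. *)
pose h' (j : nat) := if insub j is Some i then h i else fun=> 0.
pose u' (j : nat) := if insub j is Some i then u i else fun=> 0.
pose rel' (j : nat) := if insub j is Some i then rel i else fun _ _ => True.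
have h'E (i : 'I_n) : h' i = h i by rewrite /h' valK.
have u'E (i : 'I_n) : u' i = u i by rewrite /u' valK.
have r'E (i : 'I_n) : rel' i = rel i by rewrite /rel' valK.
have := @rosenthal _ _ _ mu n rel' h' u' kap s s0 _ _ _ _ p => /=.
have -> : (fun x => nq (\sum_(0 <= j < n) h' j x * u' j x) ^+ p) =
  (fun x => nq (\sum_j h j x * u j x) ^+ p).
  by apply/funext => x; rewrite big_mkord; congr (nq _ ^+ _); apply: eq_bigr => i _; rewrite h'E u'E.
have -> : (fun x => (\sum_(0 <= j < n) nq (u' j x)) ^+ p) = (fun x => (\sum_j nq (u j x)) ^+ p).
  by apply/funext => x; rewrite big_mkord; congr (_ ^+ _); apply: eq_bigr => i _; rewrite u'E.
move=> H; apply: le_trans (H _ _ _ _) _.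
- by move=> j jn; rewrite (h'E (Ordinal jn)) (r'E (Ordinal jn)).
- move=> i j /andP[ij jn].
  rewrite (h'E (Ordinal (ltn_trans ij jn))) (r'E (Ordinal jn)).
  exact: hf.
- move=> i j /andP[ij jn].
  rewrite (u'E (Ordinal (leq_ltn_trans ij jn))) (r'E (Ordinal jn)).
  exact: uf.
- by move=> j jn; rewrite (u'E (Ordinal jn)).
have c0 : 0 <= s ^+ (2 * p) by rewrite exprn_ge0// ltW.
have a0 : 0 <= E (fun x => (\sum_j nq (u j x)) ^+ p) by apply: E_ge0 => x; nneg.
apply: (@le_trans _ _ (`|rosenthal_const kap p| * s ^+ (2 * p) * E (fun x => (\sum_j nq (u j x)) ^+ p))).
  by rewrite ler_wpM2r// ler_wpM2r// ler_norm.
apply: le_trans (ler_wpM2l _ (HV p)) _; first by rewrite mulr_ge0.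
by rewrite exprMn le_eqVlt; apply/orP; left; apply/eqP; ring.
Qed.

Definition lin_const (kap KV : nat -> R) p := `|rosenthal_const kap p| * KV p.
Definition sq_const (K : nat -> R) p := 2 + (K (p * 2)%N + K (p * 2)%N).
(** The scale [6 s v] is the sum of three equal contributions [2 s v]: the diagonal and the two
    triangles. *)
Definition quad_const (kap KV : nat -> R) p :=
  let aKV p := `|KV p| in
  let K2 := lin_const kap (sq_const (lin_const kap aKV)) in
  let kd p := 2 ^+ (2 * p) * (kap (2 * p)%N + 1) in
  (lin_const kd (sq_const aKV) p + (K2 p + K2 p)) * 6 ^+ (2 * p).

(** A Hanson-Wright type bound in every [L^p]. Each strict triangle is a linear form in [h j] whose
    coefficient is itself a linear form in the [h i] with [i < j], so [lin_Ob] is applied twice; the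
    diagonal is handled by [cent_diag]. The bound [2] leaves room for the Hermitization, which has
    up to [2 m] rows. *)
Lemma quad_Ob kap KV n (rel : 'I_n -> Om -> Om -> Prop)
    (h : 'I_n -> Om -> C) s (sig : 'I_n -> R) (B : 'I_n -> 'I_n -> Om -> C) v :
  0 < s -> 0 < v -> n%:R * s ^+ 2 <= 2 ->
  (forall j, entry (rel j) (h j) kap s (sig j)) ->
  (forall i j : 'I_n, i != j -> blind (rel j) (h i)) ->
  (forall i j l, blind (rel l) (B i j)) ->
  (forall i j, CLL (B i j)) ->
  (forall j p, E (fun x => (\sum_i nq (B i j x)) ^+ p) <= KV p * v ^+ (2 * p)) ->
  (forall i p, E (fun x => (\sum_j nq (B i j x)) ^+ p) <= KV p * v ^+ (2 * p)) ->
  Ob (quad_const kap KV) (s * v) (fun x => \sum_i \sum_j (h i x)^* * B i j x * h j x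
                          - \sum_j ((sig j)%:C)%C * B j j x).
Proof.
pose K1 := lin_const kap (fun p => `|KV p|).
pose K2 := lin_const kap (sq_const K1).
pose kd p : R := 2 ^+ (2 * p) * (kap (2 * p)%N + 1).
pose K3 := lin_const kd (sq_const (fun p => `|KV p|)).
pose K4 p := (K3 p + (K2 p + K2 p)) * 6 ^+ (2 * p).
rewrite (_ : quad_const kap KV = K4)//.
move=> s0 v0 ns hc hf Bf BL Hc Hr.
have hc' j : cent (rel j) (h j) kap s by case: (hc j).
have ineqV (K : nat -> R) (c : R) (w : R) : 0 <= c -> n%:R * c ^+ 2 <= w ^+ 2 ->
    \sum_(i < n) (fun=> c) i ^+ 2 <= w ^+ 2.
  by move=> _ H; apply: le_trans H; rewrite sumr_const card_ord mulr_natl.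
pose below (g : 'I_n -> Om -> C) (A : 'I_n -> 'I_n -> Om -> C) (j : 'I_n) x :=
  \sum_(i < n) g i x * (if (i < j)%N then A i j x else 0).
have offd g A : (forall j, cent (rel j) (g j) kap s) ->
  (forall i j : 'I_n, i != j -> blind (rel j) (g i)) ->
  (forall i j l, blind (rel l) (A i j)) -> (forall i j, CLL (A i j)) ->
  (forall j p, E (fun x => (\sum_i nq (A i j x)) ^+ p) <= KV p * v ^+ (2 * p)) ->
  Ob K2 (s * (2 * v)) (fun x => \sum_j (g j x)^* * below g A j x).
  move=> gc gf Af AL HA.
  have obb j : Ob K1 (s * v) (below g A j).
    apply: (@Ob_K _ _ _ mu (fun p => `|rosenthal_const kap p| * KV p)).
      by move=> p; rewrite /K1 ler_wpM2l// ler_norm.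
    apply: (@lin_Ob n rel g (fun (i : 'I_n) x => if (i < j)%N then A i j x else 0)) => //.
    - by move=> i l il; apply: gf; rewrite neq_ltn il.
    - by move=> i l _ x y r /=; case: ifP => // _; exact: Af r.
    - by move=> i; case: (i < j)%N; [exact: AL|exact: CLL_cst].
    - move=> p; apply: le_trans (HA j p); apply: E_le.
      + by apply/LLX/LL_sum => i _; apply: LL_nq; case: (i < j)%N; [exact: AL|exact: CLL_cst].
      + by apply/LLX/LL_sum => i _; apply: LL_nq; exact: AL.
      move=> x; apply: pow_mono; first by nneg.
      by apply: ler_sum => i _; case: ifP => // _; rewrite nq0 nq_ge0.
  apply: (@lin_Ob n rel (fun j x => (g j x)^*) (below g A) kap s (sq_const K1)) => //.
  - by rewrite mulr_gt0.
  - by move=> j; exact: cent_conj.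
  - by move=> i l il x y r; congr (_^*); apply: gf r; rewrite neq_ltn il.
  - move=> i l il x y r; apply: eq_bigr => k _; case: ifP => ki; last by rewrite !mulr0.
    rewrite (gf _ _ _ _ _ r) ?(Af _ _ _ _ _ r)// neq_ltn (leq_trans ki il)//.
  - by move=> j; exact: Ob_CLL (obb j).
  - apply: (@sum_nq_moment _ K1 (fun=> s * v)) => //.
    + by rewrite mulr_gt0.
    + by move=> p; rewrite /K1 /lin_const; nneg.
    + apply: (ineqV K1); first by nneg.
      rewrite !exprMn mulrA ler_wpM2r ?sqr_ge0//.
      by apply: le_trans ns _; rewrite -natrX ler_nat.
have dg : Ob K3 (s ^+ 2 * (2 * v / s)) (fun x => \sum_j ((nq (h j x) - sig j)%:C)%C * B j j x).
  apply: (@lin_Ob n rel (fun j x => ((nq (h j x) - sig j)%:C)%C) (fun j => B j j) kd (s ^+ 2)) => //.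
  - by rewrite exprn_gt0.
  - by rewrite divr_gt0// mulr_gt0.
  - by move=> j; exact: cent_diag.
  - by move=> i l il x y r; rewrite (hf _ _ _ _ _ r)// neq_ltn il.
  - apply: (@sum_nq_moment _ (fun p => `|KV p|) (fun=> v)) => //.
    + by rewrite divr_gt0// mulr_gt0.
    + move=> j; split=> // p.
      apply: (@le_trans _ _ (KV p * v ^+ (2 * p))); last first.
        by rewrite ler_wpM2r ?exprn_ge0 ?(ltW v0)// ler_norm.
      apply: le_trans (Hc j p); apply: E_le.
      * by apply/LLX/LL_nq.
      * by apply/LLX/LL_sum => i _; apply: LL_nq; exact: BL.
      move=> x; apply: pow_mono; first by nneg.
      by rewrite (bigD1 j)//= lerDl; nneg.
    + apply: (ineqV KV); first by nneg.
      rewrite !exprMn exprVn ler_pdivlMr ?exprn_gt0// mulrAC ler_wpM2r ?sqr_ge0//.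
      by apply: le_trans ns _; rewrite -natrX ler_nat.
have o1 := offd h (fun i j => B j i) hc' hf (fun i j l => Bf j i l) (fun i j => BL j i) Hr.
have o2 := offd (fun j x => (h j x)^*) B (fun j => cent_conj (hc' j))
  (fun i j ij x y r => congr1 (fun z : C => z^*) (hf i j ij x y r)) Bf BL Hc.
have sv : s ^+ 2 * (2 * v / s) + (s * (2 * v) + s * (2 * v)) = 6 * (s * v).
  by field; rewrite gt_eqF.
have := ObD dg (ObD o1 o2); rewrite sv => o.
have {o} := Ob_scale (_ : 0 < 6) o; move=> /(_ (ltr0Sn _ _)).
apply: Ob_eq => x /=.
rewrite (sum_triangle (fun i j => (h i x)^* * B i j x * h j x)) [RHS]addrAC.
rewrite -sumrB; congr (_ + (_ + _)); apply: eq_bigr => i _.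
- rewrite rmorphB/= mulrBl; congr (_ - _).
  have -> : ((nq (h i x))%:C)%C = (h i x)^* * h i x.
    by case: (h i x) => a b; apply/eqP; rewrite eq_complex /= /nq /=; apply/andP; split; apply/eqP; ring.
  by ring.
- rewrite /below mulr_sumr; apply: eq_bigr => j _; case: ifP => _; last by rewrite !mulr0.
  by ring.
- rewrite conjCK /below mulr_sumr; apply: eq_bigr => j _; case: ifP => _; last by rewrite !mulr0.
  by ring.
Qed.

End Forms.

(** * Random matrices with independent entries *)

HB.instance Definition _ (R : realType) := isPointed.Build (R[i]%type) (Complex 0 0).

Section MatrixSpace.
Context {R : realType}.
Variables n m : nat.
Local Notation C := (R[i]).

(* The type R[i] carries no measurable structure in the library. *)
Definition pt (z : C) : R * R := (re z, im z).

Definition rect (A : 'I_n -> 'I_m -> set (R * R)) : set 'M[C]_(n, m) :=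
  [set M | forall i j, A i j (pt (M i j))].

Definition rects : set (set 'M[C]_(n, m)) :=
  [set D | exists2 A : 'I_n -> 'I_m -> set (R * R),
     (forall i j, measurable (A i j)) & D = rect A].

Definition MX := g_sigma_algebraType rects.

HB.instance Definition _ := Measurable.on MX.

Lemma measurable_rect (A : 'I_n -> 'I_m -> set (R * R)) :
  (forall i j, measurable (A i j)) -> measurable (rect A : set MX).
Proof. by move=> mA; apply: sub_gen_smallest; exists A. Qed.

Lemma measurable_pt i j (B : set (R * R)) :
  measurable B -> measurable [set M : MX | B (pt ((M : 'M[C]_(n, m)) i j))].
Proof.
move=> mB; pose A i' j' := if (i' == i) && (j' == j) then B else setT.
rewrite (_ : [set _ | _] = rect A).
  by apply: measurable_rect => i' j'; rewrite /A; case: ifP.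
apply/seteqP; split=> M /=.
  by move=> BM i' j'; rewrite /A; case: ifP => // /andP[/eqP-> /eqP->].
by move=> /(_ i j); rewrite /A !eqxx.
Qed.

Lemma measurable_coord i j : measurable_fun setT (fun M : MX => pt ((M : 'M[C]_(n, m)) i j)).
Proof. by move=> _ B mB; rewrite setTI; apply: measurable_pt. Qed.

Lemma measurable_re_coord i j : measurable_fun setT (fun M : MX => re ((M : 'M[C]_(n, m)) i j)).
Proof. exact: (measurableT_comp measurable_fst (measurable_coord i j)). Qed.

Lemma measurable_im_coord i j : measurable_fun setT (fun M : MX => im ((M : 'M[C]_(n, m)) i j)).
Proof. exact: (measurableT_comp measurable_snd (measurable_coord i j)). Qed.

Lemma measurable_to_MX d (T : measurableType d) (f : T -> MX) :
  (forall i j, measurable_fun setT (fun x => re ((f x : 'M[C]_(n, m)) i j))) ->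
  (forall i j, measurable_fun setT (fun x => im ((f x : 'M[C]_(n, m)) i j))) ->
  measurable_fun setT f.
Proof.
move=> mr mi; apply: (@measurability _ _ _ _ setT f rects) => //.
move=> _ [D [A mA ->]] <-; rewrite setTI.
rewrite (_ : f @^-1` _ = \bigcap_(ij in [set: 'I_n * 'I_m])
    ((fun x => pt ((f x : 'M[C]_(n, m)) ij.1 ij.2)) @^-1` A ij.1 ij.2)).
  apply: fin_bigcap_measurable; first exact: finite_finset.
  move=> [i j] _ /=; rewrite -[X in measurable X]setTI.
  by apply: measurable_fun_pair => //; exact: mA.
apply/seteqP; split=> x /=; first by move=> H [i j] _; exact: H.
by move=> H i j; exact: (H (i, j) I).
Qed.

Definition indep_entries (mu : set MX -> \bar R) :=
  forall A : 'I_n -> 'I_m -> set (R * R), (forall i j, measurable (A i j)) ->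
    mu (rect A) = (\prod_(i < n) \prod_(j < m)
       mu [set M : MX | A i j (pt ((M : 'M[C]_(n, m)) i j))])%E.

(* Taking the entries in [S] from an independent copy [y] preserves the law, so
   that independence turns into dependence on disjoint sets of arguments. *)
Definition mix (S : 'I_n -> 'I_m -> bool) (x y : MX) : MX :=
  \matrix_(i, j) if S i j then (y : 'M[C]_(n, m)) i j else (x : 'M[C]_(n, m)) i j.

Lemma measurable_mix S : measurable_fun setT (fun w : MX * MX => mix S w.1 w.2).
Proof.
apply: measurable_to_MX => i j.
- rewrite (_ : (fun _ => _) = (fun w : MX * MX => if S i j then re ((w.2 : 'M[C]_(n, m)) i j)
     else re ((w.1 : 'M[C]_(n, m)) i j))).
    case: (S i j).
      exact: (measurableT_comp (measurable_re_coord i j) measurable_snd).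
    exact: (measurableT_comp (measurable_re_coord i j) measurable_fst).
  by apply/funext => w; rewrite mxE; case: (S i j).
- rewrite (_ : (fun _ => _) = (fun w : MX * MX => if S i j then im ((w.2 : 'M[C]_(n, m)) i j)
     else im ((w.1 : 'M[C]_(n, m)) i j))).
    case: (S i j).
      exact: (measurableT_comp (measurable_im_coord i j) measurable_snd).
    exact: (measurableT_comp (measurable_im_coord i j) measurable_fst).
  by apply/funext => w; rewrite mxE; case: (S i j).
Qed.

Variable mu : probability MX R.
Hypothesis indep : indep_entries mu.

Let mixf S : {mfun (MX * MX)%type >-> MX} :=
  HB.pack (fun w : MX * MX => mix S w.1 w.2) (isMeasurableFun.Build _ _ _ _ _ (measurable_mix S)).

(** By independence both measures agree on rectangles, and these form a pi-system that generates the
    sigma-algebra. *)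
Lemma mix_law S (D : set MX) : measurable D ->
  mu D = (mu \x mu)%E ((fun w : MX * MX => mix S w.1 w.2) @^-1` D).
Proof.
move=> mD; rewrite -[RHS]/(distribution (mu \x mu)%E (mixf S) D).
apply: (@g_sigma_algebra_measure_unique _ R MX rects _ (fun=> setT)) => //.
- by move=> A [B mB ->]; exact: measurable_rect.
- move=> _; exists (fun _ _ => setT) => //.
  by apply/seteqP; split.
- by rewrite bigcup_const //; exists 0%N.
- move=> A B [A' mA ->] [B' mB ->]; exists (fun i j => A' i j `&` B' i j).
    by move=> i j; apply: measurableI.
  apply/seteqP; split=> M /=; first by move=> [a b] i j; split.
  by move=> H; split=> i j; have [] := H i j.
- move=> A [A' mA ->]; rewrite /distribution /pushforward /=.
  pose Ay i j := if S i j then A' i j else setT.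
  pose Ax i j := if S i j then setT else A' i j.
  have mAy i j : measurable (Ay i j) by rewrite /Ay; case: (S i j).
  have mAx i j : measurable (Ax i j) by rewrite /Ax; case: (S i j).
  rewrite (_ : _ @^-1` _ = rect Ax `*` rect Ay); last first.
    apply/seteqP; split=> -[x y] /=.
      by move=> H; split=> i j; have := H i j; rewrite /Ax /Ay mxE; case: (S i j).
    by move=> [H1 H2] i j; have := H1 i j; have := H2 i j; rewrite /Ax /Ay mxE; case: (S i j).
  rewrite product_measure1E; [|exact: measurable_rect|exact: measurable_rect].
  transitivity (mu (rect Ax) * mu (rect Ay))%E; last by [].
  rewrite !indep// -[RHS](@big_split _ 1%E mule) /=; apply: eq_bigr => i _.
  rewrite -[RHS](@big_split _ 1%E mule) /=; apply: eq_bigr => j _.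
  have eT : (mu [set M : MX | [set: R * R] (pt ((M : 'M[C]_(n, m)) i j))] = 1)%E.
    by rewrite (_ : [set M : MX | _] = setT); [exact: probability_setT|apply/seteqP; split].
  rewrite /Ax /Ay; case: (S i j).
    by rewrite eT mul1e.
  by rewrite eT mule1.
- by move=> _; apply: (@le_lt_trans _ _ 1%E); rewrite ?ltry//; exact: probability_le1.
Qed.

Lemma mix_integral S (f : MX -> \bar R) : measurable_fun setT f -> (forall x, (0 <= f x)%E) ->
  (\int[mu]_x f x = \int[mu \x mu]_w f (mix S w.1 w.2))%E.
Proof.
move=> mf f0.
transitivity (\int[distribution (mu \x mu)%E (mixf S)]_x f x)%E.
  by apply: eq_measure_integral => A mA _; have := mix_law S mA.
by rewrite ge0_integral_distribution.
Qed.

Lemma mix_integral2 S (f : MX -> \bar R) : measurable_fun setT f -> (forall x, (0 <= f x)%E) ->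
  (\int[mu]_x f x = \int[mu]_x \int[mu]_y f (mix S x y))%E.
Proof.
move=> mf f0; rewrite (mix_integral S)//.
rewrite (@fubini_tonelli1 _ _ _ _ _ mu mu (fun w => f (mix S w.1 w.2)))//.
exact: (measurableT_comp mf (measurable_mix S)).
Qed.

(** Under [mix S] the product [f x * g x] becomes [f x * g y] on the product space, where Fubini's
    theorem separates the factors. *)
Lemma E_factor S (f g : MX -> R) : LL mu f -> LL mu g ->
  (forall x y, f (mix S x y) = f x) -> (forall x y, g (mix S x y) = g y) ->
  E mu (fun x => f x * g x) = E mu f * E mu g.
Proof.
move=> lf lg fS gS.
have lfg := LLM lf lg.
pose h (w : MX * MX) := ((f w.1 * g w.2)%:E : \bar R).
have mh : measurable_fun setT h.
  apply/measurable_EFinP; apply: measurable_funM.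
    by apply: (measurableT_comp lf.1); exact: measurable_fst.
  by apply: (measurableT_comp lg.1); exact: measurable_snd.
have ih : (mu \x mu)%E.-integrable setT h.
  apply/integrableP; split=> //.
  have /integrableP[_] := LL_int lfg.
  rewrite (mix_integral S) //=; last first.
    by apply/measurable_EFinP; apply: measurableT_comp => //; exact: lfg.1.
  rewrite (_ : (fun w => _) = (fun w => `|h w|%E))//.
  by apply/funext => w /=; rewrite /h fS gS.
have e1 : (\int[mu]_x (f x * g x)%:E = \int[mu \x mu]_w h w)%E.
  transitivity (\int[distribution (mu \x mu)%E (mixf S)]_x (f x * g x)%:E)%E.
    by apply: eq_measure_integral => A mA _; have := mix_law S mA.
  have ehm : (fun x => (f x * g x)%:E) \o mixf S = h.
    by apply/funext => w; rewrite /h /= fS gS.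
  rewrite integral_distribution ?ehm//.
  by apply/measurable_EFinP; exact: lfg.1.
have e2 : (\int[mu]_x (f x * g x)%:E = \int[mu]_x (f x * E mu g)%:E)%E.
  rewrite e1 -integral12_prod_meas1//; apply: eq_integral => x _.
  rewrite /fubini_F /h /=.
  under eq_integral do rewrite EFinM.
  rewrite integralZl//; last exact: LL_int.
  rewrite EFinM; congr (_ * _)%E.
  by rewrite /E /Rintegral fineK//; apply: integrable_fin_num => //; exact: LL_int.
rewrite {1}/E /Rintegral e2 -[fine _]/(E mu (fun x => f x * E mu g)).
by rewrite -[RHS]mulrC -E_scale//; apply: E_ext => x; rewrite mulrC.
Qed.

End MatrixSpace.

(** * Leave-one-out identities *)

Section Adjoint.
Context {R : realType}.
Local Notation C := (R[i]).

Lemma adjE m n (A : 'M[C]_(m, n)) i j : adjmx A i j = (A j i)^*.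
Proof. by rewrite !mxE. Qed.

Lemma adjK m n (A : 'M[C]_(m, n)) : adjmx (adjmx A) = A.
Proof. by apply/matrixP => i j; rewrite !adjE conjCK. Qed.

Lemma adjM m n p (A : 'M[C]_(m, n)) (B : 'M[C]_(n, p)) :
  adjmx (A *m B) = adjmx B *m adjmx A.
Proof.
apply/matrixP => i j; rewrite adjE !mxE rmorph_sum /=; apply: eq_bigr => k _.
by rewrite !adjE rmorphM mulrC.
Qed.

Lemma adjD m n (A B : 'M[C]_(m, n)) : adjmx (A + B) = adjmx A + adjmx B.
Proof. by apply/matrixP => i j; rewrite !mxE rmorphD. Qed.

Lemma adjZ m n a (A : 'M[C]_(m, n)) : adjmx (a *: A) = a^* *: adjmx A.
Proof. by apply/matrixP => i j; rewrite !mxE rmorphM. Qed.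

Lemma adj1 n : adjmx (1%:M : 'M[C]_n) = 1%:M.
Proof. by apply/matrixP => i j; rewrite adjE !mxE rmorph_nat eq_sym. Qed.

Lemma adjX n (A : 'M[C]_n) k : adjmx (A ^+ k) = adjmx A ^+ k.
Proof.
elim: k => [|k IH]; first by rewrite !expr0 adj1.
by rewrite exprS exprSr -[A * _]/(A *m _) adjM IH.
Qed.

Lemma form_sum n (x y : 'cV[C]_n) (B : 'M[C]_n) :
  (adjmx x *m B *m y) 0 0 = \sum_i \sum_j (x i 0)^* * B i j * y j 0.
Proof.
rewrite mxE exchange_big /=; apply: eq_bigr => j _.
by rewrite mxE mulr_suml; apply: eq_bigr => i _; rewrite adjE.
Qed.

Lemma dot_sum n (x y : 'cV[C]_n) : (adjmx x *m y) 0 0 = \sum_i (x i 0)^* * y i 0.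
Proof. by rewrite mxE; apply: eq_bigr => i _; rewrite adjE. Qed.

End Adjoint.

Lemma mulmx_delta_at (T : pzRingType) n k (A : 'M[T]_(n, k)) i v : (A *m delta_mx v (0 : 'I_1)) i 0 = A i v.
Proof. by rewrite -colE mxE. Qed.

Lemma scaled_at (T : pzRingType) n k (a : T) (A : 'M[T]_(n, k)) i j : (a *: A) i j = a * A i j.
Proof. by rewrite mxE. Qed.

Lemma col_at (T : Type) n k (A : 'M[T]_(n, k)) i v : col v A i 0 = A i v.
Proof. by rewrite mxE. Qed.

Section LeaveOneOut.
Context {R : realType}.
Local Notation C := (R[i]).
Variables (k : nat) (H H' : 'M[C]_k) (v : 'I_k).
Let e : 'cV[C]_k := delta_mx v 0.
Let h : 'cV[C]_k := col v H.
Hypothesis HE : forall i j, H i j = if (i != v) && (j != v) then H' i j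
   else if i != v then h i 0 else (h j 0)^*.
Hypothesis H'v : forall i j, (i == v) || (j == v) -> H' i j = 0.
Hypothesis hv : h v 0 = 0.

Lemma masked_col0 t (b : 'cV[C]_k) : b v 0 = 0 -> (H' ^+ t *m b) v 0 = 0.
Proof.
case: t => [|t] bv; first by rewrite expr0 mul1mx.
rewrite exprS -[H' * _]/(H' *m _) -mulmxA mxE big1// => j _.
by rewrite H'v ?eqxx// mul0r.
Qed.

Lemma leave_step (b : 'cV[C]_k) : b v 0 = 0 ->
  H *m b = H' *m b + (adjmx h *m b) 0 0 *: e.
Proof.
move=> bv; apply/matrixP => i j; rewrite [j]ord1 !mxE eqxx andbT.
case: (eqVneq i v) => [->|iv].
  rewrite mulr1 [X in _ = X + _]big1 ?add0r; last by move=> l _; rewrite H'v ?eqxx// mul0r.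
  apply: eq_bigr => l _; rewrite HE eqxx adjE /=.
  by [].
rewrite mulr0 addr0; apply: eq_bigr => l _; rewrite HE iv /=.
by case: (eqVneq l v) => //= ->; rewrite bv !mulr0.
Qed.

(** First-passage decomposition of walks: a walk avoids [v] for [i] steps, enters it through [h],
    and is unrestricted for the remaining [t - i - 1] steps. *)
Lemma leave_one t (b : 'cV[C]_k) : b v 0 = 0 ->
  H ^+ t *m b = H' ^+ t *m b +
    \sum_(i < t) (adjmx h *m (H' ^+ i *m b)) 0 0 *: (H ^+ (t - i.+1) *m e).
Proof.
move=> bv; elim: t => [|t IH]; first by rewrite big_ord0 addr0 !expr0.
rewrite !exprS -[H * _]/(H *m _) -[H' * _]/(H' *m _) -!mulmxA {1}IH mulmxDr.
rewrite leave_step; last exact: masked_col0.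
rewrite -addrA; congr (_ + _); rewrite big_ord_recr /= subnn expr0 mul1mx addrC; congr (_ + _).
rewrite mulmx_sumr; apply: eq_bigr => i _.
rewrite -scalemxAr; congr (_ *: _).
by rewrite mulmxA subSn ?ltn_ord// [in RHS]exprS.
Qed.

Lemma leave_one_at t (b : 'cV[C]_k) : b v 0 = 0 ->
  (H ^+ t *m b) v 0 = \sum_(i < t) (adjmx h *m (H' ^+ i *m b)) 0 0 * (H ^+ (t - i.+1)) v v.
Proof.
move=> bv; rewrite leave_one// mxE masked_col0// add0r summxE.
by apply: eq_bigr => i _; rewrite scaled_at mulmx_delta_at.
Qed.

Definition puncture (b : 'cV[C]_k) : 'cV[C]_k := \col_i if i == v then 0 else b i 0.

Lemma puncture_v b : puncture b v 0 = 0. Proof. by rewrite mxE eqxx. Qed.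

Lemma puncture_split b : b = puncture b + b v 0 *: e.
Proof.
apply/matrixP => i j; rewrite [j]ord1 !mxE eqxx andbT; case: eqVneq => [->|_].
  by rewrite add0r mulr1.
by rewrite mulr0 addr0.
Qed.

Lemma leave_one_coord t (b : 'cV[C]_k) : (H ^+ t *m b) v 0 = b v 0 * (H ^+ t) v v +
  \sum_(i < t) (adjmx h *m (H' ^+ i *m puncture b)) 0 0 * (H ^+ (t - i.+1)) v v.
Proof.
rewrite {1}(puncture_split b) mulmxDr mxE leave_one_at ?puncture_v// addrC; congr (_ + _).
by rewrite -scalemxAr scaled_at mulmx_delta_at.
Qed.

(** Decomposition at the first return to [v]: an excursion of length [i + 2] leaves through [h],
    stays inside [H'] for [i] steps and comes back through [h]. *)
Lemma return_rec t : (H ^+ t.+1) v v =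
  \sum_(i < t) (adjmx h *m (H' ^+ i *m h)) 0 0 * (H ^+ (t - i.+1)) v v.
Proof.
by rewrite -leave_one_at// /h exprSr -[_ * H]/(_ *m _) !mxE; apply: eq_bigr => j _; rewrite mxE.
Qed.

End LeaveOneOut.

(** * The Hermitization and its principal parts *)

Section Model.
Context {R : realType}.
Local Notation C := (R[i]).

Definition Hmx n m (A : 'M[C]_(n, m)) : 'M[C]_(n + m) := block_mx 0 A (adjmx A) 0.

(** Rows and columns outside [U] are set to zero instead of being deleted, so that repeated removal
    stays within one matrix type. *)
Definition HU n m (U : {set 'I_(n + m)}) (A : 'M[C]_(n, m)) : 'M[C]_(n + m) :=
  \matrix_(i, j) if (i \in U) && (j \in U) then Hmx A i j else 0.

Lemma Hmx_herm n m (A : 'M[C]_(n, m)) : adjmx (Hmx A) = Hmx A.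
Proof.
apply/matrixP => i j; rewrite adjE /Hmx.
case: (split_ordP i) => i' ->; case: (split_ordP j) => j' ->.
- by rewrite !block_mxEul !mxE rmorph0.
- by rewrite block_mxEdl block_mxEur adjE conjCK.
- by rewrite block_mxEdl block_mxEur adjE.
- by rewrite !block_mxEdr !mxE rmorph0.
Qed.

Lemma Hmx_diag n m (A : 'M[C]_(n, m)) i : Hmx A i i = 0.
Proof. by rewrite /Hmx; case: (split_ordP i) => i' ->; rewrite ?block_mxEul ?block_mxEdr mxE. Qed.

Lemma HU_herm n m U (A : 'M[C]_(n, m)) : adjmx (HU U A) = HU U A.
Proof.
apply/matrixP => i j; rewrite adjE [HU U A j i]mxE [HU U A i j]mxE andbC.
by case: ifP => _; [rewrite -adjE Hmx_herm|rewrite rmorph0].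
Qed.

Lemma HUC n m U (A : 'M[C]_(n, m)) i j : HU U A i j = (HU U A j i)^*.
Proof. by rewrite -adjE HU_herm. Qed.

Lemma HU_diag n m U (A : 'M[C]_(n, m)) i : HU U A i i = 0.
Proof. by rewrite mxE Hmx_diag if_same. Qed.

Lemma HU_T n m (A : 'M[C]_(n, m)) : HU [set: _] A = Hmx A.
Proof. by apply/matrixP => i j; rewrite mxE !inE. Qed.

Lemma HU_split n m U (A : 'M[C]_(n, m)) v i j :
  HU U A i j = if (i != v) && (j != v) then HU (U :\ v) A i j
   else if i != v then (col v (HU U A)) i 0 else ((col v (HU U A)) j 0)^*.
Proof.
case: (eqVneq i v) => [->|iv] /=; first by rewrite col_at HUC.
case: (eqVneq j v) => [->|jv] /=; first by rewrite col_at.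
by rewrite !mxE !inE iv jv.
Qed.

Lemma HU_punct n m U (A : 'M[C]_(n, m)) v i j :
  (i == v) || (j == v) -> HU (U :\ v) A i j = 0.
Proof. by move=> H; rewrite mxE !inE; case/orP: H => /eqP ->; rewrite eqxx ?andbF. Qed.

Lemma HU_colv n m U (A : 'M[C]_(n, m)) v : (col v (HU U A)) v 0 = 0.
Proof. by rewrite mxE HU_diag. Qed.

Definition HU_leave n m U (A : 'M[C]_(n, m)) v :=
  leave_one (HU_split U A v) (@HU_punct _ _ U A v).
Definition HU_leave_coord n m U (A : 'M[C]_(n, m)) v :=
  leave_one_coord (HU_split U A v) (@HU_punct _ _ U A v).
Definition HU_return n m U (A : 'M[C]_(n, m)) v :=
  return_rec (HU_split U A v) (@HU_punct _ _ U A v) (HU_colv U A v).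

End Model.

(** * Laws of the entries of the Hermitization *)

Section Law.
Context {R : realType}.
Local Notation C := (R[i]).
Local Notation MX n m := (@MX R n m).

Definition coord n m i j (A : MX n m) : C := (A : 'M[C]_(n, m)) i j.

(** Common to both values of [beta]: the second-order information is the mean squared modulus, which
    is the same for real and complex entries. *)
Definition good_law n m (kap : nat -> R) (mu : probability (MX n m) R) :=
  [/\ indep_entries mu, forall p, 1 <= kap p &
      forall i j, [/\ CLL mu (coord i j), E mu (fun A => re (coord i j A)) = 0,
        E mu (fun A => im (coord i j A)) = 0, E mu (fun A => nq (coord i j A)) = m%:R^-1 &
        forall p, E mu (fun A => nq (coord i j A) ^+ p) <= kap p * m%:R^-1 ^+ p]].

Definition scl m : R := Num.sqrt m%:R^-1.

Lemma scl2 m : scl m ^+ 2 = m%:R^-1.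
Proof. by rewrite sqr_sqrtr// invr_ge0. Qed.

Lemma scl_gt0 m : (0 < m)%N -> 0 < scl m.
Proof. by move=> m0; rewrite sqrtr_gt0 invr_gt0 ltr0n. Qed.

Lemma scl_le1 m : (0 < m)%N -> scl m <= 1.
Proof.
move=> m0; rewrite -[leRHS]sqrtr1 ler_sqrt ?ler01// invf_le1 ?ltr0n//.
by rewrite ler1n.
Qed.

Lemma mscl2 m : (0 < m)%N -> m%:R * scl m ^+ 2 = 1.
Proof. by move=> m0; rewrite scl2 mulfV// pnatr_eq0 -lt0n. Qed.

Definition off n m (i : 'I_n) (j : 'I_m) (A A' : MX n m) :=
  forall i' j', (i', j') != (i, j) -> coord i' j' A = coord i' j' A'.

Lemma off_mix n m (i : 'I_n) (j : 'I_m) (x y : MX n m) :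
  off i j (mix (fun i' j' => (i', j') == (i, j)) x y) x.
Proof. by move=> i' j' /negbTE H; rewrite /coord mxE H. Qed.

Lemma entry_coord n m kap (mu : probability (MX n m) R) i j : (0 < m)%N ->
  good_law kap mu -> entry mu (off i j) (coord i j) kap (scl m) m%:R^-1.
Proof.
move=> m0 [ind k1 /(_ i j) [cc er ei en ep]].
have fac f g : LL mu f -> LL mu (fun A => g (coord i j A)) -> blind (off i j) f ->
   E mu (fun A => f A * g (coord i j A)) = E mu f * E mu (fun A => g (coord i j A)).
  move=> lf lg bf; apply: (@E_factor _ _ _ _ ind (fun i' j' => (i', j') == (i, j))) => //.
    by move=> x y; apply: bf; exact: off_mix.
  by move=> x y; rewrite /coord mxE eqxx.
split.
- split=> //.
    by move=> f lf bf; rewrite !fac ?er ?ei ?mulr0//; case: cc.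
  move=> f p lf f0 bf; rewrite (fac f (fun z => nq z ^+ p))//; last by apply/LLX/LL_nq.
  by rewrite mulrC ler_wpM2r ?E_ge0// exprM scl2.
- by rewrite scl2 lexx invr_ge0 ler0n.
- by move=> f lf bf; rewrite (fac f (fun z => nq z))//; [rewrite en mulrC|apply/LL_nq].
Qed.

Lemma entry_rel d (T : measurableType d) (mu : probability T R) (rel rel' : T -> T -> Prop) h kap s sig :
  (forall A A', rel A A' -> rel' A A') -> entry mu rel h kap s sig -> entry mu rel' h kap s sig.
Proof.
move=> rr; have bb V (f : T -> V) : blind rel' f -> blind rel f.
  by move=> bf A A' r; apply: bf; exact: rr.
move=> [[ch H1 H2] gs H3]; split=> //; last by move=> f lf bf; apply: H3 => //; exact: bb.
split=> //; first by move=> f lf bf; apply: H1 => //; exact: bb.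
by move=> f p lf f0 bf; apply: H2 => //; exact: bb.
Qed.

Lemma entry_conj d (T : measurableType d) (mu : probability T R) (rel : T -> T -> Prop) h kap s sig :
  entry mu rel h kap s sig -> entry mu rel (fun x => (h x)^*) kap s sig.
Proof.
move=> [c gs H]; split=> //; first exact: cent_conj.
by move=> f lf bf; rewrite -H//; apply: E_ext => x; rewrite nqJ.
Qed.

Lemma entry_zero d (T : measurableType d) (mu : probability T R) (rel : T -> T -> Prop) kap s :
  (forall p, 1 <= kap p) -> entry mu rel (fun=> 0) kap s 0.
Proof.
move=> k1; have e0 f : E mu (fun x : T => f x * 0) = 0.
  by rewrite -[RHS](E_cst mu); apply: E_ext => x; rewrite mulr0.
split; last by move=> f _ _; rewrite nq0 mul0r e0.
  split; [exact: CLL_cst|by move=> f _ _; split; exact: e0|].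
  move=> f p lf f0 _; rewrite nq0; case: p => [|p].
    rewrite muln0 !expr0 mulr1 -[leLHS]mul1r (_ : (fun x => f x * 1) = f).
      by rewrite ler_wpM2r ?E_ge0.
    by apply/funext => x; rewrite mulr1.
  rewrite expr0n e0 exprM; apply: mulr_ge0; last exact: E_ge0.
  by apply: mulr_ge0; [exact: le_trans ler01 _|apply: exprn_ge0; exact: sqr_ge0].
by rewrite lexx sqr_ge0.
Qed.

(** Each entry of [A] occurs twice in the Hermitization, at [(v, j)] and conjugated at [(j, v)];
    changing it must be allowed to change both places. *)
Definition hoff n m (v j : 'I_(n + m)) (A A' : MX n m) :=
  forall u w, ~~ ((u == v) && (w == j) || (u == j) && (w == v)) ->
    Hmx (A : 'M[C]_(n, m)) u w = Hmx (A' : 'M[C]_(n, m)) u w.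

(** The variance of the entry [(j, v)] of [HU U]: nonzero only for retained indices on opposite
    sides of the bipartition. *)
Definition sgU n m (U : {set 'I_(n + m)}) (v j : 'I_(n + m)) : R :=
  if [&& v \in U, j \in U & (v < n)%N != (j < n)%N] then m%:R^-1 else 0.

Lemma off_hoff n m (i : 'I_n) (j : 'I_m) (A A' : MX n m) : off i j A A' ->
  hoff (lshift m i) (rshift n j) A A' /\ hoff (rshift n j) (lshift m i) A A'.
Proof.
have key (u w : 'I_(n + m)) : ~~ ((u == lshift m i) && (w == rshift n j) || (u == rshift n j) && (w == lshift m i)) ->
    off i j A A' -> Hmx (A : 'M[C]_(n, m)) u w = Hmx (A' : 'M[C]_(n, m)) u w.
  move=> H o; rewrite /Hmx; move: H.
  case: (split_ordP u) => u' ->; case: (split_ordP w) => w' ->;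
    rewrite ?block_mxEul ?block_mxEur ?block_mxEdl ?block_mxEdr ?mxE//.
    rewrite !(inj_eq (@lshift_inj _ _)) !(inj_eq (@rshift_inj _ _)) eq_lrshift eq_rlshift orbF => H.
    exact: (o u' w' H).
  rewrite !(inj_eq (@lshift_inj _ _)) !(inj_eq (@rshift_inj _ _)) eq_lrshift eq_rlshift orFb => H.
  congr (_^*); apply: (o w' u'); apply: contra H => /eqP[-> ->].
  by rewrite !eqxx.
move=> o; split=> u w H; apply: key => //.
by move: H; rewrite orbC.
Qed.

Lemma entry_HU n m kap (mu : probability (MX n m) R) U v j : (0 < m)%N ->
  good_law kap mu ->
  entry mu (hoff v j) (fun A => HU U (A : 'M[C]_(n, m)) j v) kap (scl m) (sgU U v j).
Proof.
move=> m0 gl; have k1 : forall p, 1 <= kap p by case: gl.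
have z : (forall A : 'M[C]_(n, m), HU U A j v = 0) -> sgU U v j = 0 ->
    entry mu (hoff v j) (fun A : MX n m => HU U (A : 'M[C]_(n, m)) j v) kap (scl m) (sgU U v j).
  move=> z ->; rewrite (_ : (fun A : MX n m => _) = (fun=> 0)); first exact: entry_zero.
  by apply/funext => A; rewrite z.
case: (boolP (v \in U)) => vU; last first.
  by apply: z => [A|]; [rewrite mxE (negbTE vU) andbF|rewrite /sgU (negbTE vU)].
case: (boolP (j \in U)) => jU; last first.
  by apply: z => [A|]; [rewrite mxE (negbTE jU)|rewrite /sgU (negbTE jU) andbF].
have eH (A : MX n m) : HU U (A : 'M[C]_(n, m)) j v = Hmx (A : 'M[C]_(n, m)) j v.
  by rewrite mxE vU jU.
rewrite (_ : (fun A : MX n m => _) = (fun A : MX n m => Hmx (A : 'M[C]_(n, m)) j v)); last first.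
  exact/funext.
rewrite /sgU vU jU /= => {z vU jU eH}.
case: (split_ordP v) => v' ->; case: (split_ordP j) => j' ->.
- rewrite eqxx /=.
  rewrite (_ : (fun A : MX n m => _) = (fun=> 0)); first exact: entry_zero.
  by apply/funext => A; rewrite /Hmx block_mxEul mxE.
- rewrite /=.
  rewrite (_ : (fun A : MX n m => _) = (fun A => (coord v' j' A)^*)).
    apply: entry_conj; apply: entry_rel (entry_coord v' j' m0 gl) => A A' o.
    by have [] := off_hoff o.
  by apply/funext => A; rewrite /Hmx block_mxEdl adjE.
- rewrite /=.
  rewrite (_ : (fun A : MX n m => _) = (fun A => coord j' v' A)).
    apply: entry_rel (entry_coord j' v' m0 gl) => A A' o.
    by have [] := off_hoff o.
  by apply/funext => A; rewrite /Hmx block_mxEur.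
- rewrite eqxx /=.
  rewrite (_ : (fun A : MX n m => _) = (fun=> 0)); first exact: entry_zero.
  by apply/funext => A; rewrite /Hmx block_mxEdr mxE.
Qed.

Lemma HU_punct_blind n m U (v j : 'I_(n + m)) (A A' : MX n m) : hoff v j A A' ->
  HU (U :\ v) (A : 'M[C]_(n, m)) = HU (U :\ v) (A' : 'M[C]_(n, m)).
Proof.
move=> o; apply/matrixP => u w; rewrite mxE [RHS]mxE !inE.
case: ifP => // /andP[/andP[uv _] /andP[wv _]]; apply: o.
by rewrite negb_or !negb_and uv wv orbT.
Qed.

Lemma HU_col_blind n m U (v i j : 'I_(n + m)) (A A' : MX n m) : i != j -> hoff v j A A' ->
  HU U (A : 'M[C]_(n, m)) i v = HU U (A' : 'M[C]_(n, m)) i v.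
Proof.
move=> ij o; rewrite mxE [RHS]mxE; case: ifP => // _; apply: o.
rewrite (negbTE ij) orbF; apply: contra ij => /andP[/eqP -> /eqP ->]; exact: eqxx.
Qed.

Section MatrixCLL.
Context {d : measure_display} {T : measurableType d}.
Variable mu : probability T R.

Definition mCLL p q (F : T -> 'M[C]_(p, q)) := forall i j, CLL mu (fun x => F x i j).

Lemma mCLL_mul p q r (F : T -> 'M[C]_(p, q)) (G : T -> 'M[C]_(q, r)) :
  mCLL F -> mCLL G -> mCLL (fun x => F x *m G x).
Proof.
move=> cF cG i j; apply: (@CLL_eq _ _ _ mu (fun x => \sum_k F x i k * G x k j)).
  by move=> x; rewrite mxE.
by apply: CLL_sum => k _; exact: CLLM.
Qed.

Lemma mCLL_cst p q (A : 'M[C]_(p, q)) : mCLL (fun=> A).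
Proof. by move=> i j; exact: CLL_cst. Qed.

Lemma mCLL_adj p q (F : T -> 'M[C]_(p, q)) : mCLL F -> mCLL (fun x => adjmx (F x)).
Proof. by move=> cF i j; apply: CLL_eq (CLLJ (cF j i)) => x; rewrite adjE. Qed.

Lemma mCLL_X p (F : T -> 'M[C]_p) k : mCLL F -> mCLL (fun x => F x ^+ k).
Proof.
move=> cF; elim: k => [|k IH]; first exact: mCLL_cst.
move=> i j; apply: CLL_eq (mCLL_mul cF IH i j) => x; by rewrite exprS.
Qed.

End MatrixCLL.

Lemma mCLL_HU n m kap (mu : probability (MX n m) R) U : (0 < m)%N -> good_law kap mu ->
  mCLL mu (fun A => HU U (A : 'M[C]_(n, m))).
Proof. by move=> m0 gl j v; have [[]] := entry_HU U v j m0 gl. Qed.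

End Law.

(** * Powers of the Hermitization *)

Section PowerBounds.
Context {R : realType}.
Local Notation C := (R[i]).
Local Notation MX n m := (@MX R n m).
Local Notation scl := (@scl R).
Local Notation sgR := (@sgU R _ _).
Variable kap : nat -> R.

Definition bs n (b : 'cV[C]_n) v : R := Num.sqrt (nq (b v 0)).

Lemma bs_ge0 n (b : 'cV[C]_n) v : 0 <= bs b v. Proof. exact: sqrtr_ge0. Qed.

Lemma bs2 n (b : 'cV[C]_n) v : bs b v ^+ 2 = nq (b v 0).
Proof. by rewrite sqr_sqrtr ?nq_ge0. Qed.

Lemma norm2sqE n (b : 'cV[C]_n) : norm2sq b = \sum_i nq (b i 0).
Proof. by []. Qed.

Lemma nq_le_norm n (b : 'cV[C]_n) v : nq (b v 0) <= norm2sq b.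
Proof. by rewrite norm2sqE (bigD1 v)//= lerDl; nneg. Qed.

Lemma bs_le1 n (b : 'cV[C]_n) v : norm2sq b <= 1 -> bs b v <= 1.
Proof.
by move=> b1; rewrite -sqrtr1 ler_wsqrtr// (le_trans (nq_le_norm b v)).
Qed.

Lemma norm2sq_delta n (v : 'I_n) : norm2sq (delta_mx v 0 : 'cV[C]_n) = 1.
Proof.
rewrite norm2sqE (bigD1 v)//= mxE !eqxx nq1 big1 ?addr0// => i iv.
by rewrite mxE (negbTE iv) nq0.
Qed.

Lemma norm2sq_puncture n (v : 'I_n) (b : 'cV[C]_n) : norm2sq (puncture v b) <= norm2sq b.
Proof.
rewrite !norm2sqE; apply: ler_sum => i _; rewrite mxE; case: eqP => // _.
by rewrite nq0 nq_ge0.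
Qed.

Lemma sum_scl n m : (0 < m)%N -> (n <= m)%N -> (n + m)%:R * scl m ^+ 2 <= 2.
Proof.
move=> m0 nm; apply: (@le_trans _ _ ((m + m)%:R * scl m ^+ 2)).
  by rewrite ler_wpM2r ?sqr_ge0// ler_nat leq_add2r.
by rewrite natrD mulrDl mscl2.
Qed.

(** The sum is at most [2 + 4]; [9] is used because the square root of the bound becomes a scale. *)
Lemma sum_bs n m (b : 'cV[C]_(n + m)) : (0 < m)%N -> (n <= m)%N -> norm2sq b <= 1 ->
  \sum_i (bs b i + scl m) ^+ 2 <= 3 ^+ 2.
Proof.
move=> m0 nm b1; apply: (@le_trans _ _ (\sum_i (2 * nq (b i 0) + 2 * scl m ^+ 2))).
  by apply: ler_sum => i _; rewrite -bs2; have := sqr_ge0 (bs b i - scl m); lra.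
rewrite big_split /= -!mulr_sumr -norm2sqE sumr_const card_ord -[_ *+ (n + m)]mulr_natl.
by have := sum_scl m0 nm; lra.
Qed.

(** The initial vector contributes [|b_v|] and the spreading of mass over all coordinates
    contributes [m^-1/2]. Quantifying over [U] lets the induction apply the bound to the matrix with
    a row removed. *)
Definition pbound (K : nat -> R) k := forall t, (t < k)%N ->
  forall n m (mu : probability (MX n m) R) U b v, (0 < m)%N -> (n <= m)%N ->
  good_law kap mu -> norm2sq b <= 1 ->
  Ob mu K (bs b v + scl m) (fun A => (HU U (A : 'M[C]_(n, m)) ^+ t *m b) v 0).

Section Step.
Variables (K : nat -> R) (k : nat).
Hypothesis K0 : forall p, 0 <= K p.
Hypothesis IH : pbound K k.
Variables (n m : nat) (mu : probability (MX n m) R).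
Hypothesis m0 : (0 < m)%N.
Hypothesis nm : (n <= m)%N.
Hypothesis gl : good_law kap mu.

Let k1 : forall p, 1 <= kap p. Proof. by case: gl. Qed.
Let s0 : 0 < scl m := scl_gt0 m0.

Definition linf (U : {set 'I_(n + m)}) v t (b : 'cV[C]_(n + m)) (A : MX n m) : C :=
  (adjmx (col v (HU U (A : 'M[C]_(n, m)))) *m (HU (U :\ v) (A : 'M[C]_(n, m)) ^+ t *m b)) 0 0.

Definition quadf (U : {set 'I_(n + m)}) v t (A : MX n m) : C :=
  linf U v t (col v (HU U (A : 'M[C]_(n, m)))) A.

Lemma lin_bound U v t b : (t < k)%N -> norm2sq b <= 1 ->
  Ob mu (lin_const kap (sq_const K)) (scl m * 3) (linf U v t b).
Proof.
move=> tk b1.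
pose h (j : 'I_(n + m)) (A : MX n m) := (HU U (A : 'M[C]_(n, m)) j v)^*.
pose u (j : 'I_(n + m)) (A : MX n m) := (HU (U :\ v) (A : 'M[C]_(n, m)) ^+ t *m b) j 0.
apply: (@Ob_eq _ _ _ _ _ _ (fun A : MX n m => \sum_j h j A * u j A)).
  by move=> A; rewrite /linf dot_sum; apply: eq_bigr => j _; rewrite col_at.
apply: (@lin_Ob _ _ _ mu _ (hoff v) h u kap (scl m) _ 3 s0 (ltr0Sn _ _)).
- by move=> j; have [] := entry_conj (entry_HU U v j m0 gl).
- by move=> i j ij A A' o; rewrite /h (HU_col_blind U _ o)// neq_ltn ij.
- by move=> i j ij A A' o; rewrite /u (HU_punct_blind U o).
- by move=> j; exact: Ob_CLL (IH tk (U :\ v) j m0 nm gl b1).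
- move=> p; apply: (@sum_nq_moment _ _ _ mu _ K (fun j => bs b j + scl m)) => //.
  + by move=> j; exact: IH.
  + exact: sum_bs.
Qed.

Lemma entry_power_bound U t i j : (t < k)%N ->
  Ob mu K ((i == j)%:R + scl m) (fun A => (HU U (A : 'M[C]_(n, m)) ^+ t) i j).
Proof.
move=> tk; have := IH tk U i m0 nm gl (_ : norm2sq (delta_mx j 0) <= 1).
rewrite norm2sq_delta => /(_ (lexx _)); rewrite /bs mxE eqxx andbT.
rewrite (_ : Num.sqrt _ = (i == j)%:R); last by case: eqP; rewrite ?nq1 ?nq0 ?sqrtr0 ?sqrtr1.
by apply: Ob_eq => A; rewrite mulmx_delta_at.
Qed.

Let sum_delta (j : 'I_(n + m)) : \sum_i ((i == j)%:R + scl m) ^+ 2 <= 3 ^+ 2 :> R.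
Proof.
have := @sum_bs _ _ (delta_mx j 0) m0 nm; rewrite norm2sq_delta => /(_ (lexx _)).
apply: le_trans; apply: ler_sum => i _; rewrite /bs mxE eqxx andbT.
by case: eqP; rewrite ?nq1 ?nq0 ?sqrtr0 ?sqrtr1.
Qed.

(** The conditional mean of [quadf] given the matrix without row [v]. *)
Definition trf (U : {set 'I_(n + m)}) v t (A : MX n m) : C :=
  \sum_j ((sgR U v j)%:C)%C * (HU (U :\ v) (A : 'M[C]_(n, m)) ^+ t) j j.

Lemma quad_bound U v t : (t < k)%N ->
  Ob mu (quad_const kap (sq_const K)) (scl m * 3) (fun A => quadf U v t A - trf U v t A).
Proof.
move=> tk.
pose h (j : 'I_(n + m)) (A : MX n m) := HU U (A : 'M[C]_(n, m)) j v.
pose B (i j : 'I_(n + m)) (A : MX n m) := (HU (U :\ v) (A : 'M[C]_(n, m)) ^+ t) i j.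
apply: (@Ob_eq _ _ _ _ _ _ (fun A : MX n m => \sum_i \sum_j (h i A)^* * B i j A * h j A
   - \sum_j ((sgR U v j)%:C)%C * B j j A)).
  move=> A; congr (_ - _); rewrite /quadf /linf mulmxA form_sum.
  by apply: eq_bigr => i _; apply: eq_bigr => j _; rewrite !col_at.
apply: (@quad_Ob _ _ _ mu kap (sq_const K) _ (hoff v) h (scl m) (fun j => sgR U v j) B 3 s0 (ltr0Sn _ _) (sum_scl m0 nm)).
- by move=> j; exact: entry_HU.
- by move=> i j ij A A' o; exact: HU_col_blind o.
- by move=> i j l A A' o; rewrite /B (HU_punct_blind U o).
- by move=> i j; exact: Ob_CLL (entry_power_bound (U :\ v) i j tk).
- move=> j p; apply: (@sum_nq_moment _ _ _ mu _ K (fun i => (i == j)%:R + scl m)) => //.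
  by move=> i; exact: entry_power_bound.
- move=> i p; apply: (@sum_nq_moment _ _ _ mu _ K (fun j => (i == j)%:R + scl m)) => //.
    by move=> j; exact: entry_power_bound.
  by under eq_bigr => j _ do rewrite eq_sym.
Qed.

Definition tr_const p := 1 + (1 + K (p * 2)%N).

Lemma sgU_ge0 U (v j : 'I_(n + m)) : 0 <= sgR U v j <= m%:R^-1.
Proof. by rewrite /sgU; case: ifP => _; rewrite ?lexx invr_ge0 ler0n. Qed.

Lemma tr_bound U v t : (t < k)%N -> Ob mu tr_const 4 (trf U v t).
Proof.
move=> tk; apply: (@Ob_sum_le _ _ _ mu _ (fun p => 1 + K (p * 2)%N) (fun=> m%:R^-1 * 2)) => //.
- rewrite sumr_const card_ord -[_ *+ (n + m)]mulr_natl mulrA.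
  by have := sum_scl m0 nm; rewrite scl2; lra.
- by move=> p; nneg.
- move=> j; apply: (@ObM _ _ _ mu (fun=> 1) K).
    have /andP[g0 gm] := sgU_ge0 U v j.
    apply: Ob_cst; first by rewrite invr_gt0 ltr0n.
    by rewrite nqR lerXn2r ?nnegrE// invr_ge0.
  apply: Ob_le (entry_power_bound (U :\ v) j j tk).
  by rewrite eqxx -[true%:R]/(1 : R); have := @scl_le1 R _ m0; lra.
Qed.

Definition ret_const p := quad_const kap (sq_const K) p + tr_const p.

Lemma quad_bound1 U v t : (t < k)%N -> Ob mu ret_const 7 (quadf U v t).
Proof.
move=> tk; have := ObD (quad_bound U v tk) (tr_bound U v tk) => H.
apply: (@Ob_le _ _ _ mu _ (scl m * 3 + 4)); first by have := @scl_le1 R _ m0; lra.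
by apply: Ob_eq H => A; rewrite subrK.
Qed.

Definition diag_const p := 1 + `|ret_const (p * 2)%N + K (p * 2)%N|.

Let ObA (K1 : nat -> R) c Y : Ob mu K1 c Y -> Ob mu (fun p => `|K1 p|) c Y.
Proof. by apply: Ob_K => p; exact: ler_norm. Qed.

Let pw1 U t v : (t < k)%N -> Ob mu K 2 (fun A => (HU U (A : 'M[C]_(n, m)) ^+ t) v v).
Proof.
move=> tk; apply: Ob_le (entry_power_bound U v v tk).
by rewrite eqxx -[true%:R]/(1 : R); have := @scl_le1 R _ m0; lra.
Qed.

Lemma diag_bound U v t : (t <= k)%N ->
  Ob mu diag_const (14 * k.+1%:R) (fun A => (HU U (A : 'M[C]_(n, m)) ^+ t) v v).
Proof.
have k1R : 1 <= k.+1%:R :> R by rewrite ler1n.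
case: t => [|t] tk.
  apply: (@Ob_eq _ _ _ _ _ _ (fun=> 1)).
    by move=> A; rewrite expr0 mxE eqxx.
  apply: (@Ob_K _ _ _ mu (fun=> 1)); first by move=> p; rewrite /diag_const lerDl normr_ge0.
  apply: Ob_cst; first by rewrite mulr_gt0.
  by rewrite nq1 -[leLHS](expr1n _ 2); apply: pow_mono => //; lra.
apply: (@Ob_eq _ _ _ _ _ _ (fun A : MX n m => \sum_(i < t) quadf U v i A * (HU U (A : 'M[C]_(n, m)) ^+ (t - i.+1)) v v)).
  by move=> A; rewrite HU_return.
apply: (@Ob_sum_le _ _ _ mu _ (fun p => `|ret_const (p * 2)%N + K (p * 2)%N|) (fun=> 7 * 2)) => //.
- rewrite sumr_const card_ord -[_ *+ t]mulr_natl.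
  have : t%:R <= k.+1%:R :> R by rewrite ler_nat ltnW// ltnW.
  by lra.
- move=> i; apply: ObA; apply: ObM.
    by apply: quad_bound1; exact: ltn_trans (ltn_ord i) tk.
  by apply: pw1; apply: leq_trans tk; rewrite ltnS leq_subr.
Qed.

Definition step_const p :=
  (1 + diag_const (p * 2)%N + (1 + `|lin_const kap (sq_const K) (p * 2)%N + K (p * 2)%N|)) *
  (20 * k.+1%:R) ^+ (2 * p).

Lemma step_bound U b v : norm2sq b <= 1 ->
  Ob mu step_const (bs b v + scl m) (fun A => (HU U (A : 'M[C]_(n, m)) ^+ k *m b) v 0).
Proof.
move=> b1; have c0 : 0 < bs b v + scl m by rewrite ltr_wpDl ?bs_ge0.
have k1R : 0 < k.+1%:R :> R by rewrite ltr0n.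
apply: (@Ob_eq _ _ _ _ _ _ (fun A : MX n m => b v 0 * (HU U (A : 'M[C]_(n, m)) ^+ k) v v +
   \sum_(i < k) linf U v i (puncture v b) A * (HU U (A : 'M[C]_(n, m)) ^+ (k - i.+1)) v v)).
  by move=> A; rewrite HU_leave_coord.
apply: Ob_scale; first by rewrite mulr_gt0.
(* [20 = 14 + 6]: [14 (k + 1)] is the scale of the diagonal entry in [diag_bound], and each of the
   [k] products below has scale [3 * 2] times [scl m]. *)
have -> : 20 * k.+1%:R * (bs b v + scl m) =
  (bs b v + scl m) * (14 * k.+1%:R) + 6 * k.+1%:R * (bs b v + scl m) by ring.
apply: ObD.
  apply: (@ObM _ _ _ mu (fun=> 1)); last exact: diag_bound.
  apply: Ob_cst => //; rewrite -bs2; apply: pow_mono; first exact: bs_ge0.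
  by rewrite lerDl ltW.
apply: (@Ob_sum_le _ _ _ mu _ (fun p => `|lin_const kap (sq_const K) (p * 2)%N + K (p * 2)%N|)
  (fun=> scl m * 3 * 2)) => //.
- by rewrite !mulr_gt0.
- rewrite sumr_const card_ord -[_ *+ k]mulr_natl.
  have h1 : k%:R <= k.+1%:R :> R by rewrite ler_nat.
  have h2 := ler_wpM2r (ltW s0) h1; have h3 := mulr_ge0 (ltW k1R) (bs_ge0 b v).
  by rewrite mulrDr; lra.
- move=> i; have ik := ltn_ord i; apply: ObA; apply: ObM.
    by apply: lin_bound => //; exact: le_trans (norm2sq_puncture v b) b1.
  by apply: pw1; rewrite ltn_subrL (leq_ltn_trans _ ik).
Qed.

End Step.

Lemma power_bound k : exists K, (forall p, 0 <= K p) /\ pbound K k.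
Proof.
elim: k => [|k [K [K0 IH]]]; first by exists (fun=> 0); split.
exists (fun p => K p + `|step_const K k p|); split; first by move=> p; nneg.
move=> t; rewrite ltnS leq_eqVlt => /orP[/eqP ->|tk] n m mu U b v m0 nm gl b1.
  apply: Ob_K (step_bound K0 IH m0 nm gl U v b1) => p.
  by rewrite (le_trans (ler_norm _))// lerDr.
by apply: Ob_K (IH t tk n m mu U b v m0 nm gl b1) => p; rewrite lerDl.
Qed.

End PowerBounds.

(** * Limit moments *)

Section Path.
Context {R : realType}.
Implicit Types (w f : nat -> R).

Definition pathop w f : nat -> R := fun i =>
  (if i is j.+1 then w j * f j else 0) + w i * f i.+1.

Definition pdelta j : nat -> R := fun i => (i == j)%:R.

Definition pmom w k : R := iter k (pathop w) (pdelta 0) 0.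

Definition pshift w : nat -> R := fun i => w i.+1.

(** Decomposition at the last visit to [0]: from there a path steps to [1] with weight [w 0] and
    stays [j] steps in the half-line shifted by one. *)
Lemma pathop_exit w k i : iter k (pathop w) (pdelta 0) i.+1 =
  \sum_(j < k) pmom w (k - j.+1) * (w 0%N * iter j (pathop (pshift w)) (pdelta 0) i).
Proof.
elim: k i => [|k IH] i; first by rewrite big_ord0.
rewrite iterS {1}/pathop big_ord_recl /= subn1 /=.
have -> : w i.+1 * iter k (pathop w) (pdelta 0) i.+2 =
   \sum_(j < k) pmom w (k - j.+1) * (w 0%N * (pshift w i * iter j (pathop (pshift w)) (pdelta 0) i.+1)).
  by rewrite IH mulr_sumr; apply: eq_bigr => j _; rewrite /pshift; ring.
case: i => [|i].
  rewrite /pdelta eqxx mulr1; congr (_ + _); first by rewrite /pmom mulrC.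
  by apply: eq_bigr => j _; rewrite {2}/pathop add0r subSS.
rewrite /pdelta /= mulr0 mulr0 add0r IH mulr_sumr -big_split /=.
apply: eq_bigr => j _; rewrite subSS {3}/pathop /pshift /pdelta.
by ring.
Qed.

(** The recursion of [return_rec] with the excursion replaced by its limit: [w 0 ^ 2] is the total
    variance of the removed row, and the shifted path stands for the matrix seen from the other
    side. Comparing the two recursions identifies the limit. *)
Lemma pmom_rec w k : pmom w k.+1 =
  w 0%N ^+ 2 * \sum_(i < k) pmom (pshift w) i * pmom w (k - i.+1).
Proof.
rewrite {1}/pmom iterS {1}/pathop add0r pathop_exit mulr_sumr mulr_sumr.
by apply: eq_bigr => i _; rewrite {2}/pmom; ring.
Qed.

(* Alternating weights: the side [true] starts with weight 1. *)
Definition pwt (d : R) (s : bool) : nat -> R := fun i => if s (+) odd i then 1 else Num.sqrt d.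

Lemma pwt_shift d s : pshift (pwt d s) = pwt d (~~ s).
Proof. by apply/funext => i; rewrite /pshift /pwt /= addbN addNb. Qed.

Definition Lim d s k := pmom (pwt d s) k.

Lemma Lim_rec d s k : 0 <= d -> Lim d s k.+1 =
  (if s then 1 else d) * \sum_(i < k) Lim d (~~ s) i * Lim d s (k - i.+1).
Proof.
move=> d0; rewrite /Lim pmom_rec pwt_shift; congr (_ * _).
by rewrite /pwt addbF; case: s; rewrite ?expr1n ?sqr_sqrtr.
Qed.

Lemma Lim0 d s : Lim d s 0 = 1. Proof. by []. Qed.

End Path.

(** * Concentration of the moments *)

Section Limits.
Context {R : realType}.
Local Notation C := (R[i]).
Local Notation MX n m := (@MX R n m).
Local Notation scl := (@scl R).
Local Notation sgR := (@sgU R _ _).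
Variables (kap : nat -> R) (d : R).
Hypothesis d01 : 0 <= d <= 1.

Let d0 : 0 <= d. Proof. by case/andP: d01. Qed.

Definition eps n m : R := scl m + `|n%:R / m%:R - d|.

Lemma scl_eps n m : scl m <= eps n m. Proof. by rewrite lerDl. Qed.

Lemma eps_gt0 n m : (0 < m)%N -> 0 < eps n m.
Proof. by move=> m0; rewrite ltr_wpDr ?scl_gt0. Qed.

Definition cside (s : bool) : R := if s then 1 else d.

Lemma cside_le1 s : 0 <= cside s <= 1.
Proof. by rewrite /cside; case: s; rewrite ?ler01 ?lexx. Qed.

Lemma sum_sg n m (U : {set 'I_(n + m)}) r v : (0 < m)%N -> (#|~: U| <= r)%N -> v \in U ->
  `|\sum_j sgR U v j - cside (v < n)%N| <= r.+1%:R * eps n m.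
Proof.
move=> m0 Ur vU.
have mR : 0 < m%:R :> R by rewrite ltr0n.
have sm : m%:R^-1 <= scl m :> R.
  rewrite -scl2 expr2 -[leRHS]mul1r ler_wpM2r ?scl_le1//.
  by rewrite ltW// scl_gt0.
pose opp (j : 'I_(n + m)) := (v < n)%N != (j < n)%N.
pose x : R := \sum_(j | opp j) m%:R^-1.
pose y : R := \sum_(j | opp j && (j \notin U)) m%:R^-1.
have e1 : \sum_j sgR U v j = x - y.
  rewrite /x /y (bigID (fun j => j \in U) opp) /= addrK [RHS]big_mkcond /=.
  by apply: eq_bigr => j _; rewrite /sgU vU /= /opp andbC.
have y0 : 0 <= y by rewrite /y; apply: sumr_ge0 => j _; rewrite invr_ge0 ler0n.
have yr : y <= r%:R * scl m.
  apply: (@le_trans _ _ (\sum_(j in ~: U) m%:R^-1)).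
    rewrite /y big_mkcond [leRHS]big_mkcond /=; apply: ler_sum => j _; rewrite inE.
    by case: (opp j); case: (j \in U); rewrite //= invr_ge0 ler0n.
  rewrite sumr_const -[m%:R^-1 *+ _]mulr_natl; apply: ler_pM; rewrite ?ler0n ?invr_ge0 ?ler0n//.
  by rewrite ler_nat.
have ex : x = if (v < n)%N then 1 else n%:R / m%:R.
  rewrite /x big_mkcond big_split_ord /= /opp.
  case: (boolP (v < n)%N) => vn.
    rewrite big1 ?add0r => [|j _]; last by rewrite /= ltn_ord eqxx.
    rewrite (eq_bigr (fun=> m%:R^-1)) => [|j _]; last first.
      by rewrite /= -ltn_subRL subnn ltn0.
    by rewrite sumr_const card_ord -[_ *+ m]mulr_natl mulfV// gt_eqF.
  rewrite [X in _ + X]big1 ?addr0 => [|j _]; last by rewrite /= -ltn_subRL subnn ltn0.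
  rewrite (eq_bigr (fun=> m%:R^-1)) => [|j _]; last by rewrite /= ltn_ord.
  by rewrite sumr_const card_ord -[m%:R^-1 *+ _]mulr_natl.
have xc : `|x - cside (v < n)%N| <= `|n%:R / m%:R - d|.
  by rewrite ex /cside; case: ifP => _ //; rewrite subrr normr0.
rewrite e1 addrAC; apply: le_trans (ler_normD _ _) _.
rewrite normrN (ger0_norm y0) -natr1 mulrDl mul1r [leRHS]addrC; apply: lerD.
  by apply: le_trans xc _; rewrite lerDr ltW// scl_gt0.
apply: le_trans yr _; rewrite ler_wpM2l ?ler0n//; exact: scl_eps.
Qed.

Let ObA n m (mu : probability (MX n m) R) (K1 : nat -> R) c Y :
  Ob mu K1 c Y -> Ob mu (fun p => `|K1 p|) c Y.
Proof. by apply: Ob_K => p; exact: ler_norm. Qed.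

Let Ob_real n m (mu : probability (MX n m) R) (x c : R) : 0 < c -> `|x| <= c ->
  Ob mu (fun=> 1) c (fun=> (x%:C)%C).
Proof. by move=> c0 xc; apply: Ob_cst => //; rewrite nqR -real_normK ?num_real//; apply: pow_mono. Qed.

(** [r] bounds the number of removed indices. Passing from power [k] to [k + 1] uses the bound for
    one more removed index, so the induction on [k] runs for all [r] at once. *)
Definition limbound (K : nat -> R) k r := forall t, (t < k)%N ->
  forall n m (mu : probability (MX n m) R) U v, (0 < m)%N -> (n <= m)%N ->
  good_law kap mu -> (#|~: U| <= r)%N -> v \in U ->
  Ob mu K (eps n m) (fun A => (HU U (A : 'M[C]_(n, m)) ^+ t) v v - ((Lim d (v < n)%N t)%:C)%C).

Lemma Ob_const_sum n m (mu : probability (MX n m) R) (I : finType) K c c' (F : I -> MX n m -> C) :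
  0 < c' -> #|I|%:R * c <= c' -> (forall i, Ob mu K c (F i)) ->
  Ob mu (fun p => 1 + `|K p|) c' (fun x => \sum_i F i x).
Proof.
move=> c0 le H; apply: (@Ob_sum_le _ _ _ mu _ (fun p => `|K p|) (fun=> c)) => //.
- by rewrite sumr_const -[c *+ _]mulr_natl.
- by move=> i; exact: ObA.
Qed.

Lemma quad_limit K KL k t r : (forall p, 0 <= K p) -> pbound kap K k -> limbound KL k r.+1 ->
  (t < k)%N -> exists K', forall n m (mu : probability (MX n m) R) U v, (0 < m)%N -> (n <= m)%N ->
  good_law kap mu -> (#|~: U| <= r)%N -> v \in U ->
  Ob mu K' (eps n m) (fun A => quadf U v t A - ((cside (v < n)%N * Lim d (~~ (v < n)%N) t)%:C)%C).
Proof.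
move=> K0 HK HL tk; pose L s := Lim d s t; pose l := 1 + (`|L true| + `|L false|).
have lL s : `|L s| <= l by have a1 := normr_ge0 (L true); have a2 := normr_ge0 (L false); rewrite /l; case: s; lra.
have l0 : 0 < l by rewrite /l ltr_pwDl// addr_ge0.
pose c := 3 + 2 + r.+1%:R * l.
have c0 : 0 < c by rewrite /c; have := mulr_ge0 (ler0n R r.+1) (ltW l0); lra.
exists (fun p => (quad_const kap (sq_const K) p + ((1 + `|1 + KL (p * 2)%N|) + 1)) * c ^+ (2 * p)).
move=> n m mu U v m0 nm gl Ur vU.
have mR : 0 < m%:R :> R by rewrite ltr0n.
have e0 : 0 < eps n m by exact: eps_gt0.
have s0 : 0 < scl m by exact: scl_gt0.
apply: Ob_scale => //.
set lim := Lim d (~~ (v < n)%N) t.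
pose y : R := \sum_j sgR U v j - cside (v < n)%N.
(* Three sources of error: the fluctuation of the quadratic form around its conditional mean, the
   diagonal entries of the punctured power around their limit, and the total variance around [1] or
   [d]. *)
apply: (@Ob_eq _ _ _ _ _ _ (fun A : MX n m => (quadf U v t A - trf U v t A) +
   (\sum_j ((sgR U v j)%:C)%C * ((HU (U :\ v) (A : 'M[C]_(n, m)) ^+ t) j j - (lim%:C)%C)
     + ((y * lim)%:C)%C))).
  move=> A; rewrite /trf /y.
  under [X in _ + (X + _)]eq_bigr => j _ do rewrite mulrBr.
  rewrite sumrB -mulr_suml -rmorph_sum /= mulrBl rmorphB /= !rmorphM /=.
  by ring.
have -> : c * eps n m = 3 * eps n m + (2 * eps n m + r.+1%:R * l * eps n m) by rewrite /c; ring.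
apply: ObD.
  apply: (@Ob_le _ _ _ mu _ (scl m * 3)); first by have := scl_eps n m; lra.
  exact: (quad_bound K0 HK m0 nm gl U v tk).
apply: ObD.
  apply: (@Ob_const_sum _ _ mu _ (fun p => 1 + KL (p * 2)%N) (m%:R^-1 * eps n m)).
  - by rewrite mulr_gt0.
  - rewrite card_ord mulrA; apply: ler_wpM2r; first exact: ltW.
    by have := @sum_scl R _ _ m0 nm; rewrite scl2.
  move=> j; rewrite /sgU vU /=; case: ifP => [/andP[jU vj]|_]; last first.
    apply: (@Ob_eq _ _ _ _ _ _ (fun=> 0)); first by move=> A; rewrite rmorph0 mul0r.
    apply: (@Ob_K _ _ _ mu (fun=> 1)).
      move=> p; rewrite lerDl.
      have ov : Ob mu KL (eps n m) (fun A => (HU U (A : 'M[C]_(n, m)) ^+ t) v v - ((Lim d (v < n)%N t)%:C)%C).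
        by apply: HL => //; exact: leq_trans Ur (leqnSn _).
      exact: (Ob_K_ge0 _ ov).
    by apply: Ob_cst; [rewrite mulr_gt0 ?invr_gt0|rewrite nq0 sqr_ge0].
  apply: (@ObM _ _ _ mu (fun=> 1) KL).
    by apply: Ob_real; rewrite ?invr_gt0// ger0_norm// invr_ge0 ltW.
  have jv : j != v by apply: contra vj => /eqP ->.
  rewrite /lim (_ : ~~ (v < n)%N = (j < n)%N); last first.
    by move: vj; case: (v < n)%N; case: (j < n)%N.
  apply: HL => //; last by rewrite !inE jv.
  rewrite (_ : ~: (U :\ v) = v |: ~: U)%SET; last first.
    by apply/finset.setP => x; rewrite !inE negb_and negbK.
  by rewrite cardsU1 !inE vU.
apply: Ob_real; first by rewrite !mulr_gt0// ltr0n.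
by rewrite normrM [leRHS]mulrAC; apply: ler_pM; [exact: normr_ge0|exact: normr_ge0|exact: sum_sg|exact: lL].
Qed.

Lemma diag_limit k : forall r, exists K, (forall p, 0 <= K p) /\ limbound K k r.
Proof.
elim: k => [|k IH] r; first by exists (fun=> 0); split.
have [KL [KL0 HL]] := IH r.+1.
have [K [K0 HK]] := power_bound kap k.
have HL' : limbound KL k r.
  by move=> t tk n m mu U v m0 nm gl Ur vU; apply: HL => //; exact: leq_trans (leqnSn _).
suff [K1 H1] : exists K1, forall n m (mu : probability (MX n m) R) U v, (0 < m)%N -> (n <= m)%N ->
    good_law kap mu -> (#|~: U| <= r)%N -> v \in U ->
    Ob mu K1 (eps n m) (fun A => (HU U (A : 'M[C]_(n, m)) ^+ k) v v - ((Lim d (v < n)%N k)%:C)%C).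
  exists (fun p => KL p + `|K1 p|); split; first by move=> p; rewrite addr_ge0.
  move=> t; rewrite ltnS leq_eqVlt => /orP[/eqP ->|tk] n m mu U v m0 nm gl Ur vU.
    apply: Ob_K (H1 n m mu U v m0 nm gl Ur vU) => p.
    by rewrite (le_trans (ler_norm _))// lerDr.
  by apply: Ob_K (HL' t tk n m mu U v m0 nm gl Ur vU) => p; rewrite lerDl normr_ge0.
case: k IH HL HK HL' => [|k] IH HL HK HL'.
  exists (fun=> 1) => n m mu U v m0 nm gl Ur vU.
  apply: (@Ob_eq _ _ _ _ _ _ (fun=> 0)).
    by move=> A; rewrite expr0 mxE eqxx Lim0 subrr.
  by apply: Ob_cst; [exact: eps_gt0|rewrite nq0 sqr_ge0].
have HQ i : exists K', (i < k.+1)%N -> forall n m (mu : probability (MX n m) R) U v, (0 < m)%N -> (n <= m)%N ->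
  good_law kap mu -> (#|~: U| <= r)%N -> v \in U ->
  Ob mu K' (eps n m) (fun A => quadf U v i A - ((cside (v < n)%N * Lim d (~~ (v < n)%N) i)%:C)%C).
  case: (ltnP i k.+1) => ik; last by exists (fun=> 0).
  by have [K' H'] := quad_limit K0 HK HL ik; exists K' => _.
have [KQ {}HQ] := choice HQ.
have [KQ' HQ'] : exists KQ' : nat -> R, forall (i : 'I_k), forall n m (mu : probability (MX n m) R) U v,
    (0 < m)%N -> (n <= m)%N -> good_law kap mu -> (#|~: U| <= r)%N -> v \in U ->
    Ob mu (fun p => `|KQ' p|) (eps n m)
      (fun A => quadf U v i A - ((cside (v < n)%N * Lim d (~~ (v < n)%N) i)%:C)%C).
  exists (fun p => \sum_(i < k) `|KQ i p|) => i n m mu U v m0 nm gl Ur vU.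
  apply: Ob_K (HQ i (ltnW (ltn_ord i)) n m mu U v m0 nm gl Ur vU) => p.
  rewrite ger0_norm ?sumr_ge0// (bigD1 i)//= (le_trans (ler_norm _))// lerDl.
  by rewrite sumr_ge0.
pose T (s : bool) : R := \sum_(i < k) `|Lim d s i|.
have TT s (i : nat) : (i < k)%N -> `|Lim d s i| <= T true + T false.
  move=> ik; have h s' : 0 <= T s' by apply: sumr_ge0.
  have : `|Lim d s i| <= T s by rewrite /T (bigD1 (Ordinal ik))//= lerDl sumr_ge0.
  by have := h true; have := h false; case: s; lra.
pose l := 1 + (T true + T false).
have T0 : 0 <= T true + T false by rewrite addr_ge0// sumr_ge0.
have l0 : 0 < l by rewrite /l; lra.
pose K1 p := `|KQ' (p * 2)%N| + K (p * 2)%N.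
pose K2 p := 1 + KL (p * 2)%N.
eexists => n m mu U v m0 nm gl Ur vU.
have mR : 0 < m%:R :> R by rewrite ltr0n.
have e0 : 0 < eps n m by exact: eps_gt0.
apply: (@Ob_scale _ _ _ mu _ (k.+1%:R * (2 + l)) (eps n m)).
  by rewrite mulr_gt0 ?ltr0n//; lra.
apply: (@Ob_eq _ _ _ _ _ _ (fun A : MX n m => \sum_(i < k)
   ((quadf U v i A - ((cside (v < n)%N * Lim d (~~ (v < n)%N) i)%:C)%C) *
      (HU U (A : 'M[C]_(n, m)) ^+ (k - i.+1)) v v +
    ((cside (v < n)%N * Lim d (~~ (v < n)%N) i)%:C)%C *
     ((HU U (A : 'M[C]_(n, m)) ^+ (k - i.+1)) v v - ((Lim d (v < n)%N (k - i.+1))%:C)%C)))).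
  move=> A; rewrite HU_return Lim_rec// mulr_sumr rmorph_sum /= -sumrB.
  by apply: eq_bigr => i _; rewrite /quadf /linf !rmorphM /=; ring.
have c1 : 0 < (2 + l) * eps n m by rewrite mulr_gt0//; lra.
apply: (@Ob_const_sum _ _ mu _ (fun p => K1 p + K2 p) ((2 + l) * eps n m)).
- by rewrite -mulrA mulr_gt0// ltr0n.
- by rewrite card_ord -mulrA ler_wpM2r ?(ltW c1)// ler_nat.
move=> i; have ik := ltn_ord i.
have ki : (k - i.+1 < k)%N by rewrite ltn_subrL (leq_ltn_trans _ ik).
rewrite mulrDl; apply: ObD.
  rewrite [2 * _]mulrC; apply: (@ObM _ _ _ mu (fun p => `|KQ' p|) K); first exact: HQ'.
  apply: Ob_le (entry_power_bound HK m0 nm gl U v v (ltnW ki)).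
  by rewrite eqxx -[true%:R]/(1 : R); have := @scl_le1 R _ m0; lra.
apply: (@ObM _ _ _ mu (fun=> 1) KL); last exact: HL' (ltnW ki) _ _ _ _ _ _ _ _ _ _.
apply: Ob_real => //; rewrite normrM.
have /andP[a1 a2] := cside_le1 (v < n)%N.
have := TT (~~ (v < n)%N) i ik; rewrite (ger0_norm a1).
have := normr_ge0 (Lim d (~~ (v < n)%N) i); rewrite /l.
by nra.
Qed.

End Limits.

Lemma dot_delta (R : realType) n v (y : 'cV[R[i]]_n) : (adjmx (delta_mx v (0 : 'I_1)) *m y) 0 0 = y v 0.
Proof.
rewrite dot_sum (bigD1 v)//= mxE !eqxx rmorph1 mul1r big1 ?addr0// => j jv.
by rewrite mxE (negbTE jv) rmorph0 mul0r.
Qed.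

(** * Mean square deviation of the moments *)

Section Forms.
Context {R : realType}.
Local Notation C := (R[i]).
Local Notation MX n m := (@MX R n m).
Local Notation scl := (@scl R).
Variables (kap : nat -> R) (d : R).
Hypothesis d01 : 0 <= d <= 1.

Variables (k : nat) (K KL : nat -> R).
Hypothesis K0 : forall p, 0 <= K p.
Hypothesis KL0 : forall p, 0 <= KL p.
Hypothesis HK : pbound kap K k.+1.
Hypothesis HL : limbound kap d KL k.+1 0.

Definition bform n m (b : 'cV[C]_(n + m)) j (A : MX n m) : C :=
  (adjmx b *m (Hmx (A : 'M[C]_(n, m)) ^+ j *m b)) 0 0.

Section Fixed.
Variables (n m : nat) (mu : probability (MX n m) R) (b : 'cV[C]_(n + m)).
Hypothesis m0 : (0 < m)%N.
Hypothesis nm : (n <= m)%N.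
Hypothesis gl : good_law kap mu.
Hypothesis b1 : norm2sq b = 1.

Local Notation UT := ([set: 'I_(n + m)]%SET).
Let s0 : 0 < scl m. Proof. exact: scl_gt0. Qed.
Let s1 : scl m <= 1. Proof. exact: scl_le1. Qed.
Let bb1 : norm2sq b <= 1. Proof. by rewrite b1. Qed.
Let H (A : MX n m) : 'M[C]_(n + m) := Hmx (A : 'M[C]_(n, m)).

Let bsl v : bs b v <= 1. Proof. exact: bs_le1. Qed.
Let bs0 v : 0 <= bs b v. Proof. exact: bs_ge0. Qed.

Definition sz v : R := bs b v + scl m.

Lemma sz_gt0 v : 0 < sz v. Proof. by rewrite ltr_wpDl. Qed.
Lemma sz_le2 v : sz v <= 2. Proof. exact: lerD (bsl v) s1. Qed.
Lemma scl_sz v : scl m <= sz v. Proof. by rewrite lerDr. Qed.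

Let ObA (K1 : nat -> R) c Y : Ob mu K1 c Y -> Ob mu (fun p => `|K1 p|) c Y.
Proof. by apply: Ob_K => p; exact: ler_norm. Qed.

Lemma Ob_bv v : Ob mu (fun=> 1) (sz v) (fun=> b v 0).
Proof. by apply: Ob_cst; [exact: sz_gt0|rewrite -bs2; apply: pow_mono => //; rewrite lerDl ltW]. Qed.

Lemma Ob_Fv v : Ob mu K (sz v) (fun A => (H A ^+ k *m b) v 0).
Proof. by have := HK (ltnSn k) UT v m0 nm gl bb1; apply: Ob_eq => A; rewrite HU_T. Qed.

Lemma bform_sum A : bform b k A = \sum_v (b v 0)^* * (H A ^+ k *m b) v 0.
Proof. by rewrite /bform dot_sum. Qed.

Definition K_F p := 1 + (1 + K (p * 2)%N).

Lemma Ob_bform : Ob mu K_F 9 (bform b k).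
Proof.
apply: (@Ob_eq _ _ _ _ _ _ (fun A : MX n m => \sum_v (b v 0)^* * (H A ^+ k *m b) v 0)).
  by move=> A; rewrite bform_sum.
apply: (@Ob_sum_le _ _ _ mu _ (fun p => 1 + K (p * 2)%N) (fun v => sz v * sz v)) => //.
- apply: le_trans (_ : 3 ^+ 2 <= _); last by rewrite -natrX ler_nat.
  by apply: le_trans (sum_bs m0 nm bb1); apply: ler_sum => v _; rewrite expr2.
- by move=> p; rewrite addr_ge0.
- by move=> v; apply: (@ObM _ _ _ mu (fun=> 1) K); [exact: ObJ (Ob_bv v)|exact: Ob_Fv].
Qed.

Lemma linf_bound v i : (i < k)%N ->
  Ob mu (lin_const kap (sq_const K)) (scl m * 3) (linf UT v i (puncture v b)).
Proof.
move=> ik; apply: (lin_bound K0 HK m0 nm gl); first exact: leq_trans ik _.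
exact: le_trans (norm2sq_puncture v b) bb1.
Qed.

Lemma linf_centered v i (Z : MX n m -> C) : (i < k)%N -> CLL mu Z ->
  (forall j, blind (hoff v j) Z) ->
  E mu (fun A => re (Z A * linf UT v i (puncture v b) A)) = 0.
Proof.
move=> ik cZ bZ; pose P A := HU (UT :\ v) (A : 'M[C]_(n, m)) ^+ i *m puncture v b.
have cP j : CLL mu (fun A : MX n m => P A j 0).
  have := HK (ltn_trans ik (ltnSn k)) (UT :\ v) j m0 nm gl (le_trans (norm2sq_puncture v b) bb1).
  by move/Ob_CLL.
have eY j : entry mu (hoff v j) (fun A : MX n m => (HU UT (A : 'M[C]_(n, m)) j v)^*) kap (scl m) (sgU UT v j).
  exact/entry_conj/entry_HU.
rewrite (_ : (fun A => _) = (fun A : MX n m => \sum_j re (Z A * P A j 0 * (HU UT (A : 'M[C]_(n, m)) j v)^*))).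
  rewrite E_sum => [|j _].
    rewrite big1// => j _; have [c _ _] := eY j.
    apply: (cent_cross c); first by apply: CLLM.
    by move=> A A' o; rewrite (bZ j _ _ o) /P (HU_punct_blind UT o).
  have [[cc _ _] _ _] := eY j.
  by have [] := CLLM (CLLM cZ (cP j)) cc.
apply/funext => A; rewrite /linf dot_sum mulr_sumr re_sum; apply: eq_bigr => j _.
by congr re; rewrite col_at /P; ring.
Qed.

Definition bform_at v (A : MX n m) : C :=
  (adjmx (puncture v b) *m (HU (UT :\ v) (A : 'M[C]_(n, m)) ^+ k *m puncture v b)) 0 0.

Definition K_D p := (1 + K (p * 2)%N) + ((1 + K (p * 2)%N) +
  (1 + `|lin_const kap (sq_const K) (p * 2)%N + K (p * 2)%N|)).

(** Symmetry of [H] is used on both sides of the form: the coordinate [v] of [b] and the visits to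
    [v] both cost a factor of order [sz v]. *)
Lemma bform_diff v : Ob mu (fun p => K_D p * (3 * k.+2%:R) ^+ (2 * p)) (sz v)
  (fun A => bform b k A - bform_at v A).
Proof.
have z0 := sz_gt0 v; have z2 := sz_le2 v; have sz' := scl_sz v.
pose b' := puncture v b; have b'1 : norm2sq b' <= 1 := le_trans (norm2sq_puncture v b) bb1.
have obb' t : (t <= k)%N -> Ob mu K (scl m) (fun A => (H A ^+ t *m b') v 0).
  move=> tk; have := HK (tk : (t < k.+1)%N) UT v m0 nm gl b'1.
  by rewrite /bs puncture_v nq0 sqrtr0 add0r; apply: Ob_eq => A; rewrite HU_T.
apply: (@Ob_eq _ _ _ _ _ _ (fun A : MX n m => b v 0 * ((H A ^+ k *m b) v 0)^* +
   ((b v 0)^* * (H A ^+ k *m b') v 0 +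
    \sum_(i < k) linf UT v i b' A * ((H A ^+ (k - i.+1) *m b') v 0)^*))).
  move=> A; rewrite /bform -/(H A).
  have e1 (x : 'cV[C]_(n + m)) (y : 'cV[C]_(n + m)) :
     (adjmx x *m y) 0 0 = (adjmx (puncture v x) *m y) 0 0 + (x v 0)^* * y v 0.
    rewrite !dot_sum (bigD1 v)//= [in RHS](bigD1 v)//= puncture_v rmorph0 mul0r add0r addrC.
    by congr (_ + _); apply: eq_bigr => j jv; rewrite mxE (negbTE jv).
  have herm t (x y : 'cV[C]_(n + m)) : (adjmx x *m (H A ^+ t *m y)) 0 0 = ((adjmx y *m (H A ^+ t *m x)) 0 0)^*.
    by rewrite -adjE !adjM adjK adjX Hmx_herm mulmxA.
  have e2 : (adjmx b *m (H A ^+ k *m b)) 0 0 =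
     (adjmx b' *m (H A ^+ k *m b')) 0 0 + (b v 0)^* * (H A ^+ k *m b') v 0 + b v 0 * ((H A ^+ k *m b) v 0)^*.
    have f1 := e1 b (H A ^+ k *m b'); have f2 := e1 b (H A ^+ k *m b).
    have f3 := herm k b b'; have f4 := herm k b b.
    rewrite f4 f2 -/b' rmorphD rmorphM /= conjCK.
    by rewrite (herm k b' b) conjCK f1 -/b'.
  have e3 : (adjmx b' *m (H A ^+ k *m b')) 0 0 = bform_at v A +
      \sum_(i < k) linf UT v i b' A * ((H A ^+ (k - i.+1) *m b') v 0)^*.
    rewrite /H -HU_T (@HU_leave _ _ _ _ _ v)// ?puncture_v// mulmxDr mxE; congr (_ + _).
    rewrite mulmx_sumr summxE; apply: eq_bigr => i _.
    rewrite -scalemxAr scaled_at; congr (_ * _).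
    by rewrite HU_T herm dot_delta.
  by rewrite e2 e3; set S := \sum_(i < k) _; ring.
apply: Ob_scale; first by rewrite mulr_gt0 ?ltr0n.
apply: (@Ob_le _ _ _ mu _ (sz v * sz v + (sz v * scl m + sz v * (3 * k%:R + 1)))).
  have kk : k.+2%:R = k%:R + 2 :> R by rewrite -addn2 natrD.
  have := ler_wpM2l (ltW z0) z2; have := ler_wpM2l (ltW z0) s1.
  rewrite kk; set x := sz v; set y := k%:R : R => h1 h2.
  have : 0 <= x * y by rewrite mulr_ge0 ?ler0n ?ltW.
  by have := ltW z0; rewrite -/x; lra.
apply: ObD; first by apply: (@ObM _ _ _ mu (fun=> 1) K); [exact: Ob_bv|exact/ObJ/Ob_Fv].
apply: ObD; first by apply: (@ObM _ _ _ mu (fun=> 1) K); [exact/ObJ/Ob_bv|exact: obb'].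
apply: (@Ob_sum_le _ _ _ mu _ (fun p => `|lin_const kap (sq_const K) (p * 2)%N + K (p * 2)%N|)
  (fun=> scl m * 3 * scl m)) => //.
- by rewrite mulr_gt0// ltr_wpDl ?mulr_ge0 ?ler0n.
- rewrite sumr_const card_ord -[_ *+ k]mulr_natl.
  have h1 : scl m * scl m <= sz v by have := ler_wpM2l (ltW s0) s1; lra.
  have h2 := ler_wpM2l (ler0n R k) h1; have := ltW z0.
  by set x := sz v in h2 *; set y := k%:R : R in h2 *; lra.
- move=> i; have ik := ltn_ord i; apply: ObA; apply: ObM; first exact: linf_bound.
  by apply: ObJ; apply: obb'; rewrite leq_subr.
Qed.

Lemma bform_at_blind v j : blind (hoff v j) (bform_at v).
Proof. by move=> A A' o; rewrite /bform_at (HU_punct_blind UT o). Qed.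

Lemma CLL_bform_at v : CLL mu (bform_at v).
Proof.
have cH := mCLL_HU (UT :\ v) m0 gl.
exact: (mCLL_mul (mCLL_cst mu _) (mCLL_mul (mCLL_X k cH) (mCLL_cst mu _))).
Qed.

Variable s : bool.
Hypothesis bside : forall v : 'I_(n + m), (v < n)%N != s -> b v 0 = 0.

Let L j := Lim d s j.
Let lm := 1 + \sum_(j < k.+1) `|L j|.

Let lm1 : 1 <= lm. Proof. by rewrite lerDl sumr_ge0. Qed.

Let lm_gt0 : 0 < lm. Proof. exact: lt_le_trans ltr01 lm1. Qed.
Let lm9 : 0 < 9 + lm. Proof. by rewrite addr_gt0 ?ltr0n. Qed.

Let Llm (j : nat) : (j <= k)%N -> `|L j| <= lm.
Proof.
move=> jk; rewrite /lm (bigD1 (Ordinal (jk : (j < k.+1)%N)))//= addrCA lerDl addr_ge0// sumr_ge0//.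
Qed.

Definition bdev (A : MX n m) : C := bform b k A - ((L k)%:C)%C.

Definition K_dev p := K_F p + 1.

Lemma Ob_bdev : Ob mu K_dev (9 + lm) bdev.
Proof.
apply: (@ObB _ _ _ mu K_F (fun=> 1)); first exact: Ob_bform.
apply: Ob_cst; first exact: lt_le_trans ltr01 lm1.
by rewrite nqR -real_normK ?num_real//; apply: pow_mono => //; exact: Llm.
Qed.

Lemma bdev_sum A : bdev A = \sum_v (b v 0)^* * ((H A ^+ k *m b) v 0 - b v 0 * ((L k)%:C)%C).
Proof.
rewrite /bdev bform_sum.
have {1}-> : ((L k)%:C)%C = \sum_v (b v 0)^* * (b v 0 * ((L k)%:C)%C).
  rewrite -[LHS]mul1r.
  have -> : (1 : C) = \sum_v (b v 0)^* * b v 0.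
    have -> : (1 : C) = ((norm2sq b)%:C)%C by rewrite b1.
    rewrite norm2sqE rmorph_sum /=; apply: eq_bigr => v _.
    case: (b v 0) => x y; apply/eqP; rewrite eq_complex /= /nq /=.
    by apply/andP; split; apply/eqP; ring.
  by rewrite mulr_suml; apply: eq_bigr => v _; rewrite mulrA.
by rewrite -sumrB; apply: eq_bigr => v _; rewrite mulrBr.
Qed.

Let Z (v : 'I_(n + m)) A := (bdev A)^* * (b v 0)^*.

Definition K_Z p := K_dev (p * 2)%N + 1.

Let Ob_Z v : Ob mu K_Z ((9 + lm) * sz v) (Z v).
Proof. by apply: (@ObM _ _ _ mu K_dev (fun=> 1)); apply: ObJ; [exact: Ob_bdev|exact: Ob_bv]. Qed.

Let diagf (v : 'I_(n + m)) j (A : MX n m) : C := (HU UT (A : 'M[C]_(n, m)) ^+ j) v v - ((L j)%:C)%C.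

Let Ob_diagf (v : 'I_(n + m)) j : (v < n)%N = s -> (j <= k)%N -> Ob mu KL (eps d n m) (diagf v j).
Proof.
move=> vs jk; rewrite /diagf /L -vs; apply: HL => //.
by rewrite finset.setCT cards0.
Qed.

Let lf (v : 'I_(n + m)) i := linf UT v i (puncture v b).

Definition K_t1 p := K_Z (p * 2)%N + (1 + KL (p * 2 * 2)%N).
Definition K_t2 p := 1 + `|(K_Z (p * 2 * 2)%N + lin_const kap (sq_const K) (p * 2 * 2)%N) + KL (p * 2)%N|.
Let K_D' p := K_D p * (3 * k.+2%:R) ^+ (2 * p).
Definition K_t3 p := 1 + `|1 + ((K_D' (p * 2 * 2 * 2)%N + 1) + lin_const kap (sq_const K) (p * 2 * 2)%N)|.

(** The mean of [|bdev|^2] splits over [v], with one copy of [bdev] kept whole. Expand the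
    coordinate [v] of [H^k b] by first passage and replace the diagonal entries by their limits at
    cost [eps]. What remains is linear in row [v], hence uncorrelated with [bform_at v], so [bdev]
    may be replaced by its change under removal of [v]. Every error has size [sz v ^ 2 * eps], which
    is summable over [v]. *)
Lemma term_bound (v : 'I_(n + m)) : (v < n)%N = s ->
  `|E mu (fun A => re (Z v A * ((H A ^+ k *m b) v 0 - b v 0 * ((L k)%:C)%C)))| <=
   (1 + (K_t1 1%N + (K_t2 1%N + K_t3 1%N))) * (((9 + lm) * (1 + 3 * k.+1%:R) + 3 * lm * k.+1%:R) * (sz v ^+ 2 * eps d n m)).
Proof.
move=> vs; have z0 := sz_gt0 v; have z2 := sz_le2 v; have sz' := scl_sz v.
have e0 : 0 < eps d n m by exact: eps_gt0.
have se : scl m <= eps d n m by exact: scl_eps.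
pose Y A := Z v A * (b v 0 * diagf v k A) +
   (\sum_(i < k) Z v A * lf v i A * diagf v (k - i.+1) A +
    \sum_(i < k) ((L (k - i.+1))%:C)%C * ((bform b k A - bform_at v A)^* * (b v 0)^* * lf v i A)).
(* The only part that is not small pointwise. Its factor [bform_at v] is blind to row [v], in which
   [lf v i] is centered, so its mean vanishes. *)
pose Y0 A := \sum_(i < k) ((L (k - i.+1))%:C)%C * ((bform_at v A - ((L k)%:C)%C)^* * (b v 0)^*) * lf v i A.
have clf i : (i < k)%N -> CLL mu (lf v i) by move=> ik; exact: Ob_CLL (linf_bound v ik).
have cY0 : CLL mu Y0.
  apply: CLL_sum => i _; apply: CLLM; last exact: clf.
  apply: CLLM; first exact: CLL_cst.
  apply: CLLM; last exact: CLL_cst.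
  by apply: CLLJ; apply: CLLB; [exact: CLL_bform_at|exact: CLL_cst].
have EY0 : E mu (fun A => re (Y0 A)) = 0.
  rewrite (_ : (fun A => _) = (fun A => \sum_(i < k)
     re (((L (k - i.+1))%:C)%C * ((bform_at v A - ((L k)%:C)%C)^* * (b v 0)^*) * lf v i A))); last first.
    by apply/funext => A; rewrite re_sum.
  have cZ i : CLL mu (fun A => ((L (k - i.+1))%:C)%C * ((bform_at v A - ((L k)%:C)%C)^* * (b v 0)^*)).
    apply: CLLM; first exact: CLL_cst.
    apply: CLLM; last exact: CLL_cst.
    by apply: CLLJ; apply: CLLB; [exact: CLL_bform_at|exact: CLL_cst].
  rewrite E_sum => [|i _]; last by have [] := CLLM (cZ i) (clf i (ltn_ord i)).
  rewrite big1// => i _; apply: (linf_centered (ltn_ord i) (cZ i)).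
  by move=> j A A' o; rewrite (bform_at_blind o).
have ObY : Ob mu (fun p => K_t1 p + (K_t2 p + K_t3 p))
   (((9 + lm) * (1 + 3 * k.+1%:R) + 3 * lm * k.+1%:R) * (sz v ^+ 2 * eps d n m)) Y.
  have q0 : 0 < sz v ^+ 2 * eps d n m by rewrite mulr_gt0 ?exprn_gt0.
  have l9 := lm9.
  have kk : k%:R <= k.+1%:R :> R by rewrite ler_nat.
  have k0 : 0 < k.+1%:R :> R by rewrite ltr0n.
  have zse : sz v * scl m * eps d n m <= sz v ^+ 2 * eps d n m.
    by rewrite ler_wpM2r ?(ltW e0)// expr2 ler_wpM2l ?(ltW z0).
  have zse2 : sz v * sz v * scl m <= sz v ^+ 2 * eps d n m.
    by rewrite expr2 ler_wpM2l ?mulr_ge0 ?(ltW z0).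
  rewrite (_ : _ * (sz v ^+ 2 * eps d n m) = (9 + lm) * sz v * (sz v * eps d n m) +
     ((9 + lm) * 3 * k.+1%:R * (sz v ^+ 2 * eps d n m) + 3 * lm * k.+1%:R * (sz v ^+ 2 * eps d n m))); last by ring.
  apply: ObD.
    apply: (@ObM _ _ _ mu K_Z (fun p => 1 + KL (p * 2)%N)); first exact: Ob_Z.
    by apply: (@ObM _ _ _ mu (fun=> 1) KL); [exact: Ob_bv|exact: Ob_diagf].
  apply: ObD.
    apply: (@Ob_sum_le _ _ _ mu _ (fun p => `|(K_Z (p * 2 * 2)%N + lin_const kap (sq_const K) (p * 2 * 2)%N) + KL (p * 2)%N|)
      (fun=> (9 + lm) * sz v * (scl m * 3) * eps d n m)) => //.
    - by rewrite !mulr_gt0 ?exprn_gt0.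
    - rewrite sumr_const card_ord -[_ *+ k]mulr_natl.
      rewrite [leLHS](_ : _ = (9 + lm) * 3 * k%:R * (sz v * scl m * eps d n m)); last by ring.
      apply: ler_pM => //; [by rewrite !mulr_ge0 ?ler0n ?ltW|by rewrite !mulr_ge0 ?ltW|].
      by rewrite ler_wpM2l// mulr_ge0 ?ltW.
    - move=> i; have ik := ltn_ord i; apply: ObA.
      apply: (@ObM _ _ _ mu (fun p => K_Z (p * 2)%N + lin_const kap (sq_const K) (p * 2)%N) KL).
        by apply: (@ObM _ _ _ mu K_Z (lin_const kap (sq_const K))); [exact: Ob_Z|exact: linf_bound].
      by apply: Ob_diagf; rewrite ?leq_subr.
  apply: (@Ob_sum_le _ _ _ mu _ (fun p => `|1 + ((K_D' (p * 2 * 2 * 2)%N + 1) + lin_const kap (sq_const K) (p * 2 * 2)%N)|)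
      (fun=> lm * (sz v * sz v * (scl m * 3)))) => //.
  - by rewrite !mulr_gt0 ?exprn_gt0.
  - rewrite sumr_const card_ord -[_ *+ k]mulr_natl.
    rewrite [leLHS](_ : _ = 3 * lm * k%:R * (sz v * sz v * scl m)); last by ring.
    have lm0 := ltW lm_gt0.
    apply: ler_pM => //; [by rewrite !mulr_ge0 ?ler0n|by rewrite !mulr_ge0 ?ltW|].
    by rewrite ler_wpM2l// mulr_ge0.
  - move=> i; have ik := ltn_ord i; apply: ObA.
    apply: (@ObM _ _ _ mu (fun=> 1) (fun p => (K_D' (p * 2 * 2)%N + 1) + lin_const kap (sq_const K) (p * 2)%N)).
      apply: Ob_cst; first exact: lm_gt0.
      by rewrite nqR -real_normK ?num_real//; apply: pow_mono => //; apply: Llm; rewrite leq_subr.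
    apply: (@ObM _ _ _ mu (fun p => K_D' (p * 2)%N + 1) (lin_const kap (sq_const K))); last exact: linf_bound.
    by apply: (@ObM _ _ _ mu K_D' (fun=> 1)); apply: ObJ; [exact: bform_diff|exact: Ob_bv].
rewrite (_ : (fun A => _) = (fun A => re (Y A) + re (Y0 A))); last first.
  apply/funext => A; rewrite -reD; congr re.
  rewrite [RHS](_ : _ = Z v A * (b v 0 * diagf v k A) + \sum_(i < k)
     (Z v A * lf v i A * diagf v (k - i.+1) A +
      ((L (k - i.+1))%:C)%C * ((bform b k A - bform_at v A)^* * (b v 0)^* * lf v i A) +
      ((L (k - i.+1))%:C)%C * ((bform_at v A - ((L k)%:C)%C)^* * (b v 0)^*) * lf v i A)); last first.
    by rewrite /Y /Y0 !big_split /= !addrA.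
  rewrite /H -HU_T (HU_leave_coord _ _ v).
  have -> : \sum_(i < k) (Z v A * lf v i A * diagf v (k - i.+1) A +
      ((L (k - i.+1))%:C)%C * ((bform b k A - bform_at v A)^* * (b v 0)^* * lf v i A) +
      ((L (k - i.+1))%:C)%C * ((bform_at v A - ((L k)%:C)%C)^* * (b v 0)^*) * lf v i A) =
      Z v A * \sum_(i < k) lf v i A * (HU UT (A : 'M[C]_(n, m)) ^+ (k - i.+1)) v v.
    rewrite mulr_sumr; apply: eq_bigr => i _.
    by rewrite /Z /bdev /diagf !rmorphB /=; ring.
  by rewrite /diagf /lf /linf; ring.
have [rY _] := Ob_CLL ObY.
rewrite E_add ?EY0 ?addr0//; last by case: cY0.
exact: (E_re_bound ObY).
Qed.

Lemma bdev_bound : E mu (fun A => nq (bdev A)) <=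
  (1 + (K_t1 1%N + (K_t2 1%N + K_t3 1%N))) * (((9 + lm) * (1 + 3 * k.+1%:R) + 3 * lm * k.+1%:R) * (9 * eps d n m)).
Proof.
set KK := 1 + _; set c := (9 + lm) * _ + _.
have [cdr cdi] := Ob_CLL Ob_bdev.
have cF v : CLL mu (fun A => Z v A * ((H A ^+ k *m b) v 0 - b v 0 * ((L k)%:C)%C)).
  apply: CLLM; first exact: Ob_CLL (Ob_Z v).
  by apply: CLLB; [exact: Ob_CLL (Ob_Fv v)|exact: CLL_cst].
rewrite (_ : (fun A => _) = (fun A => \sum_v re (Z v A * ((H A ^+ k *m b) v 0 - b v 0 * ((L k)%:C)%C)))); last first.
  apply/funext => A; rewrite -re_sum.
  rewrite (eq_bigr (fun v => (bdev A)^* * ((b v 0)^* * ((H A ^+ k *m b) v 0 - b v 0 * ((L k)%:C)%C)))).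
    rewrite -mulr_sumr -bdev_sum; case: (bdev A) => x y; rewrite /nq /=; ring.
  by move=> v _; rewrite /Z mulrA.
rewrite E_sum => [|v _]; last by case: (cF v).
have e0 : 0 < eps d n m by exact: eps_gt0.
have KK0 : 0 <= KK.
  have h3 : 0 <= K_t3 1%N by rewrite addr_ge0.
  have h2 : 0 <= K_t2 1%N by rewrite addr_ge0.
  have h1 : 0 <= K_t1 1%N by rewrite /K_t1 /K_Z /K_dev /K_F !addr_ge0.
  by rewrite /KK !addr_ge0.
have c0 : 0 <= c.
  have k0 : 0 <= k.+1%:R :> R by rewrite ler0n.
  have l9 := ltW lm9.
  have lm0 := ltW lm_gt0.
  by rewrite /c; nneg.
apply: (@le_trans _ _ (\sum_v KK * (c * (sz v ^+ 2 * eps d n m)))).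
  apply: ler_sum => v _; case: (eqVneq (v < n)%N s) => vs.
    by apply: le_trans (ler_norm _) _; exact: term_bound.
  rewrite (_ : (fun A => _) = (fun=> 0)); last first.
    by apply/funext => A; rewrite /Z bside// rmorph0 mulr0 mul0r.
  by rewrite E_cst; nneg.
rewrite -mulr_sumr ler_wpM2l// -mulr_sumr ler_wpM2l// -mulr_suml ler_wpM2r ?(ltW e0)//.
by apply: le_trans (sum_bs m0 nm bb1) _; rewrite -natrX.
Qed.

End Fixed.
End Forms.

Lemma form_limit (R : realType) (kap : nat -> R) (d : R) k : 0 <= d <= 1 ->
  exists Cst : R, forall n m (mu : probability (@MX R n m) R) (s : bool) (b : 'cV[R[i]]_(n + m)),
  (0 < m)%N -> (n <= m)%N -> good_law kap mu -> norm2sq b = 1 ->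
  (forall v : 'I_(n + m), (v < n)%N != s -> b v 0 = 0) ->
  E mu (fun A => nq (bform b k A - ((Lim d s k)%:C)%C)) <= Cst * eps d n m.
Proof.
move=> d01.
have [K [K0 HK]] := power_bound kap k.+1.
have [KL [KL0 HL]] := diag_limit kap d01 k.+1 0.
have Hs (s : bool) : exists Cs : R, forall n m (mu : probability (@MX R n m) R) (b : 'cV[R[i]]_(n + m)),
  (0 < m)%N -> (n <= m)%N -> good_law kap mu -> norm2sq b = 1 ->
  (forall v : 'I_(n + m), (v < n)%N != s -> b v 0 = 0) ->
  E mu (fun A => nq (bform b k A - ((Lim d s k)%:C)%C)) <= Cs * eps d n m.
  eexists => n m mu b m0 nm gl b1 bs.
  have := bdev_bound K0 KL0 HK HL m0 nm gl b1 bs.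
  by rewrite /bdev !mulrA => h; exact: h.
have [Ct Ht] := Hs true; have [Cf Hf] := Hs false.
exists (`|Ct| + `|Cf|) => n m mu [] b m0 nm gl b1 bs.
  apply: le_trans (Ht n m mu b m0 nm gl b1 bs) _; apply: ler_wpM2r; first by rewrite ltW// eps_gt0.
  by rewrite (le_trans (ler_norm _))// lerDl.
apply: le_trans (Hf n m mu b m0 nm gl b1 bs) _; apply: ler_wpM2r; first by rewrite ltW// eps_gt0.
by rewrite (le_trans (ler_norm _))// lerDr.
Qed.

(** * Orthogonal polynomials of the limit *)

Section Jacobi.
Variable F : fieldType.
Variables (al be0 be : F).
Hypothesis al0 : al != 0.

Definition jac (f : nat -> F) : nat -> F := fun i =>
  (if i is j.+1 then al * f j else 0) + (if i is _.+1 then be else be0) * f i + al * f i.+1.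

Fixpoint orth2 i : {poly F} * {poly F} :=
  if i is j.+1 then let: (p, q) := orth2 j in (q, al^-1 *: (('X - be%:P) * q - al *: p))
  else (1, al^-1 *: ('X - be0%:P)).

Definition orth := locked (fun i => (orth2 i).1).

Lemma orth0 : orth 0 = 1. Proof. by rewrite /orth -lock. Qed.
Lemma orth1 : al *: orth 1 = 'X - be0%:P.
Proof. by rewrite /orth -lock /= scalerA mulfV// scale1r. Qed.
Lemma orthS i : al *: orth i.+2 = ('X - be%:P) * orth i.+1 - al *: orth i.
Proof.
by rewrite /orth -lock /=; case: (orth2 i) => p q /=; rewrite scalerA mulfV// scale1r.
Qed.

Lemma orth1E : al *: orth 1 = 'X * orth 0 - be0 *: orth 0.
Proof. by rewrite orth1 orth0 mulr1 -mul_polyC mulr1. Qed.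

Lemma orthSE i : al *: orth i.+2 = 'X * orth i.+1 - be *: orth i.+1 - al *: orth i.
Proof. by rewrite orthS mulrBl mul_polyC. Qed.

(** Linear in [P] and sending [X^l] to [u l]. It is the moment functional when [u] is a sequence of
    moments, and [P(A) b] when [u l = A^l b]. *)
Definition lev (E : lmodType F) (u : nat -> E) (P : {poly F}) : E :=
  \sum_(l < size P) P`_l *: u l.

Lemma lev_widen (E : lmodType F) (u : nat -> E) (P : {poly F}) k : (size P <= k)%N ->
  lev u P = \sum_(l < k) P`_l *: u l.
Proof.
move=> sk; rewrite /lev (big_ord_widen k (fun l => P`_l *: u l))// big_mkcond /=.
by apply: eq_bigr => l _; case: ltnP => // h; rewrite nth_default// scale0r.
Qed.

Lemma levD (E : lmodType F) (u : nat -> E) P Q : lev u (P + Q) = lev u P + lev u Q.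
Proof.
rewrite (lev_widen u (size_polyD P Q)) (lev_widen u (leq_maxl (size P) (size Q))).
rewrite (lev_widen u (leq_maxr (size P) (size Q))) -big_split /=.
by apply: eq_bigr => l _; rewrite coefD scalerDl.
Qed.

Lemma levZ (E : lmodType F) (u : nat -> E) a P : lev u (a *: P) = a *: lev u P.
Proof.
rewrite (lev_widen u (size_scale_leq a P)) /lev scaler_sumr.
by apply: eq_bigr => l _; rewrite coefZ scalerA.
Qed.

Lemma levB (E : lmodType F) (u : nat -> E) P Q : lev u (P - Q) = lev u P - lev u Q.
Proof. by rewrite levD -(scaleN1r Q) levZ scaleN1r. Qed.

Lemma levX (E : lmodType F) (u : nat -> E) P : lev u ('X * P) = lev (fun l => u l.+1) P.
Proof.
rewrite (@lev_widen _ _ _ (size P).+1); last by rewrite mulrC; apply: leq_trans (size_polyMleq _ _) _; rewrite size_polyX addn2.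
rewrite big_ord_recl /= mulrC coefMX /= scale0r add0r.
by apply: eq_bigr => l _; rewrite coefMX.
Qed.

Lemma lev1 (E : lmodType F) (u : nat -> E) : lev u 1 = u 0%N.
Proof. by rewrite /lev size_poly1 big_ord_recl big_ord0 coefC /= scale1r addr0. Qed.

(** A family satisfying the three-term recursion, with multiplication by ['X] inside its argument,
    is determined by its initial member. This serves both for the coordinates of the limit and for
    the inner products of the Krylov vectors. *)
Lemma lev_orth (E : lmodType F) (u : nat -> E) (G : nat -> {poly F} -> E) :
  (forall Q, G 0%N Q = lev u Q) ->
  (forall Q, al *: G 1%N Q = G 0%N ('X * Q) - be0 *: G 0%N Q) ->
  (forall i Q, al *: G i.+2 Q = G i.+1 ('X * Q) - be *: G i.+1 Q - al *: G i Q) ->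
  forall i Q, G i Q = lev u (orth i * Q).
Proof.
move=> G0 G1 GS i; suff [] : (forall Q, G i Q = lev u (orth i * Q)) /\ (forall Q, G i.+1 Q = lev u (orth i.+1 * Q)) by [].
elim: i => [|i [IH0 IH1]].
  split=> Q; first by rewrite orth0 mul1r G0.
  apply: (scalerI al0); rewrite G1 !G0 -levZ -levZ -levB; congr lev.
  by rewrite [RHS]scalerAl orth1 mulrBl mul_polyC.
split=> // Q; apply: (scalerI al0); rewrite GS !IH0 !IH1 -!levZ -!levB; congr lev.
by rewrite [RHS]scalerAl orthS !mulrBl mul_polyC -!scalerAl -['X * _ * Q]mulrA mulrCA.
Qed.

Let T2 l := iter l jac (fun i => (i == 0)%:R).

Definition jmom l : F^o := T2 l 0%N.

Lemma orth_functional j Q : lev (fun l => T2 l j : F^o) Q = lev jmom (orth j * Q).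
Proof.
apply: (lev_orth (G := fun j Q => lev (fun l => T2 l j : F^o) Q)) => {j Q} [//|Q|i Q].
  rewrite levX /= [X in X - _](_ : _ = be0 *: lev (fun l => T2 l 0%N : F^o) Q + al *: lev (fun l => T2 l 1%N : F^o) Q).
    by rewrite addrAC subrr add0r.
  rewrite /lev !scaler_sumr -big_split /=; apply: eq_bigr => l _.
  by rewrite /jac /GRing.scale /=; ring.
rewrite levX /= [X in X - _ - _](_ : _ = be *: lev (fun l => T2 l i.+1 : F^o) Q + al *: lev (fun l => T2 l i : F^o) Q
   + al *: lev (fun l => T2 l i.+2 : F^o) Q).
  apply/esym/eqP; rewrite !subr_eq; apply/eqP; rewrite addrC -[RHS]addrA; congr (_ + _).
  by rewrite addrC.
rewrite /lev !scaler_sumr -!big_split /=; apply: eq_bigr => l _.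
by rewrite /jac /GRing.scale /=; ring.
Qed.

(** In other words, [orth i] evaluated at the Jacobi matrix maps the first basis vector to the
    [i]-th; [T2 l j] is the coordinate [j] of the [l]-th power applied to the first basis vector. *)
Lemma orth_shift j i : lev (fun l => T2 l j : F^o) (orth i) = (i == j)%:R.
Proof.
suff [] : (forall j, lev (fun l => T2 l j : F^o) (orth i) = (i == j)%:R) /\
   (forall j, lev (fun l => T2 l j : F^o) (orth i.+1) = (i.+1 == j)%:R) by [].
have lX P k : lev (fun l => T2 l k : F^o) ('X * P) =
    (if k is k'.+1 then al * lev (fun l => T2 l k' : F^o) P else 0) +
    (if k is _.+1 then be else be0) * lev (fun l => T2 l k : F^o) P + al * lev (fun l => T2 l k.+1 : F^o) P.
  rewrite levX; case: k => [|k]; rewrite /lev /= ?add0r !mulr_sumr -!big_split /=; apply: eq_bigr => l _.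
    by rewrite /jac /GRing.scale /=; ring.
  by rewrite /jac /GRing.scale /=; ring.
elim: i {j} => [|i [IH0 IH1]].
  have h0 k : lev (fun l => T2 l k : F^o) (orth 0) = (0 == k)%:R by rewrite orth0 lev1 eq_sym.
  split=> // k; apply: (mulfI al0).
  have := congr1 (lev (fun l => T2 l k : F^o)) orth1E; rewrite levZ levB lX levZ.
  by case: k => [|[|k]]; rewrite !h0 /GRing.scale /= => ->; ring.
split=> // k; apply: (mulfI al0).
have := congr1 (lev (fun l => T2 l k : F^o)) (orthSE i); rewrite levZ !levB lX !levZ.
by case: k => [|k]; rewrite ?IH0 !IH1 ?IH0 /GRing.scale /= => ->; rewrite ?eqSS; ring.
Qed.

Lemma orth_jmom i j : lev jmom (orth i * orth j) = (i == j)%:R.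
Proof. by rewrite -orth_functional orth_shift eq_sym. Qed.

End Jacobi.

(** * Krylov vectors built from the limit polynomials *)

Section OrthVectors.
Context {R : realType}.
Local Notation C := (R[i]).
Variables (al be0 be : R).
Hypothesis al0 : al != 0.

Local Notation orthc := (orth (al%:C)%C (be0%:C)%C (be%:C)%C).

Lemma al0C : (al%:C)%C != 0 :> C.
Proof. by rewrite -(rmorph0 (real_complex R)) (inj_eq (@complexI R)). Qed.

Section Vec.
Variables (n : nat) (A : 'M[C]_n) (b : 'cV[C]_n).
Hypothesis Aherm : adjmx A = A.

Definition kvec l : 'cV[C]_n := A ^+ l *m b.
Definition ovec i : 'cV[C]_n := lev kvec (orthc i).
Definition kmom l : C^o := (adjmx b *m kvec l) 0 0.

Lemma lev_kvecS P : lev (fun l => kvec l.+1) P = A *m lev kvec P.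
Proof.
rewrite /lev mulmx_sumr; apply: eq_bigr => l _.
by rewrite -scalemxAr /kvec exprS -mulmxA.
Qed.

Lemma ovec0 : ovec 0 = b.
Proof. by rewrite /ovec orth0 lev1 /kvec expr0 mul1mx. Qed.

Lemma ovec1 : A *m ovec 0 = (be0%:C)%C *: ovec 0 + (al%:C)%C *: ovec 1.
Proof.
rewrite /ovec -[X in _ + X]levZ (orth1E _ _ al0C) levB levX lev_kvecS levZ.
by rewrite addrC subrK.
Qed.

Lemma ovecS i : A *m ovec i.+1 = (al%:C)%C *: ovec i + (be%:C)%C *: ovec i.+1 + (al%:C)%C *: ovec i.+2.
Proof.
rewrite /ovec -[X in _ + X]levZ (orthSE _ _ al0C) !levB levX lev_kvecS !levZ.
by apply/esym; rewrite addrC -[X in X + _]addrA -opprD [X in _ - X]addrC subrK.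
Qed.

Lemma ip_ovec i Q : (adjmx (ovec i) *m lev kvec Q) 0 0 = lev kmom (orthc i * Q).
Proof.
have cR (x : R) : ((x%:C)%C : C)^* = (x%:C)%C by exact: conjc_real.
have h x P : (adjmx x *m lev kvec ('X * P)) 0 0 = (adjmx (A *m x) *m lev kvec P) 0 0.
  by rewrite levX lev_kvecS adjM Aherm -!mulmxA.
apply: (lev_orth al0C (G := fun i Q => (adjmx (ovec i) *m lev kvec Q) 0 0 : C^o)) => {i Q} [Q|Q|i Q].
- rewrite ovec0 /lev mulmx_sumr summxE; apply: eq_bigr => l _.
  by rewrite -scalemxAr scaled_at.
- rewrite h ovec1 adjD !adjZ !cR mulmxDl -!scalemxAl !mxE.
  by rewrite addrAC subrr add0r.
- rewrite h ovecS !adjD !adjZ !cR !mulmxDl -!scalemxAl.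
  set x := _ *m _; set y := _ *m _; set z := _ *m _.
  rewrite !mxE /GRing.scale /=; ring.
Qed.

Lemma gram_kmom i j : (adjmx (ovec i) *m ovec j) 0 0 = lev kmom (orthc i * orthc j).
Proof. exact: ip_ovec. Qed.

(** The coefficients do not depend on the matrix, so convergence of finitely many moments gives
    almost orthonormality. *)
Lemma gram_diff i j : (adjmx (ovec i) *m ovec j) 0 0 - (i == j)%:R =
  \sum_(l < size (orthc i * orthc j)) (orthc i * orthc j)`_l *
     (kmom l - jmom (al%:C)%C (be0%:C)%C (be%:C)%C l).
Proof.
rewrite gram_kmom -(orth_jmom (be0%:C)%C (be%:C)%C al0C) /lev -sumrB; apply: eq_bigr => l _.
by rewrite mulrBr.
Qed.

End Vec.
End OrthVectors.

Section LimitMoments.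
Context {R : realType}.
Local Notation C := (R[i]).
Local Notation MX n m := (@MX R n m).
Variables (kap : nat -> R) (d : R).
Hypothesis d01 : 0 < d <= 1.

Let d0 : 0 < d. Proof. by case/andP: d01. Qed.
Let d01' : 0 <= d <= 1. Proof. by case/andP: d01 => /ltW -> ->. Qed.

Lemma pathop_even (w f : nat -> R) i : pathop w (pathop w f) i.*2 =
  (if i is j.+1 then w j.*2.+1 * w j.*2 * f j.*2 else 0) +
  ((if i is j.+1 then w j.*2.+1 ^+ 2 else 0) + w i.*2 ^+ 2) * f i.*2 + w i.*2 * w i.*2.+1 * f i.+1.*2.
Proof. by case: i => [|i]; rewrite /pathop /=; ring. Qed.

(** The square of the path operator preserves the even sites and acts there as a Jacobi matrix: two
    consecutive squared weights add up to [1 + d], only the first squared weight is present at site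
    [0], and every off-diagonal entry is [sqrt d]. Even powers of the Hermitization are powers of
    [W] or of its counterpart on the other side. *)
Lemma jmom_Lim s l : jmom ((Num.sqrt d)%:C)%C ((cside d s)%:C)%C ((1 + d)%:C)%C l = ((Lim d s l.*2)%:C)%C.
Proof.
suff H : forall i, iter l (jac ((Num.sqrt d)%:C)%C ((cside d s)%:C)%C ((1 + d)%:C)%C) (fun i => (i == 0)%:R) i =
   ((iter l.*2 (pathop (pwt d s)) (@pdelta R 0) i.*2)%:C)%C by exact: (H 0%N).
elim: l => [|l IH] j.
  by rewrite /= /pdelta double_eq0; case: (j == 0%N).
have p2 k : pwt d s k.*2 = (if s then 1 else Num.sqrt d) by rewrite /pwt odd_double addbF.
have p3 k : pwt d s k.*2.+1 = (if s then Num.sqrt d else 1) by rewrite /pwt /= odd_double addbT; case: (s).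
rewrite iterS doubleS 2!iterS pathop_even; move: (iter l _ _) (iter l.*2 _ _) IH => g f IH.
have sd : Num.sqrt d ^+ 2 = d by rewrite sqr_sqrtr// ltW.
case: j => [|j]; rewrite /jac !IH.
  rewrite -(rmorph0 (real_complex R)) -!rmorphM -!rmorphD; congr (_%:C)%C.
  rewrite (p2 0%N) (p3 0%N) /cside; case: (s); rewrite ?sd; ring.
rewrite -!rmorphM -!rmorphD; congr (_%:C)%C.
by rewrite !p2 !p3; case: (s); rewrite ?sd; ring.
Qed.

Lemma nq_sum_le k (z : 'I_k -> C) : nq (\sum_i z i) <= k%:R * \sum_i nq (z i).
Proof.
elim: k z => [|k IH] z; first by rewrite !big_ord0 nq0 mulr0.
rewrite !big_ord_recr /=; set x := \sum_(i < k) _.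
case: k IH z @x => [|k] IH z x.
  by rewrite /x !big_ord0 !add0r mul1r.
have k0 : 0 < k.+1%:R :> R by rewrite ltr0n.
apply: le_trans (nqD_weighted x (z ord_max) k0 ltr01) _.
rewrite natr1 ler_wpM2l ?ler0n// expr1n divr1 mul1r lerD2r.
rewrite [leLHS](_ : _ = k.+1%:R^-1 * nq x); last by field; rewrite gt_eqF.
rewrite ler_pdivrMl//.
exact: (IH (fun i => z (widen_ord (leqnSn _) i))).
Qed.

Lemma Hmx_even_left n m (X : 'M[C]_(n, m)) (b : 'cV[C]_n) l :
  Hmx X ^+ l.*2 *m col_mx b 0 = col_mx ((X *m adjmx X) ^+ l *m b) (0 : 'cV_m).
Proof.
elim: l => [|l IH]; first by rewrite !expr0 !mul1mx.
rewrite doubleS exprS -mulmxA exprS -mulmxA IH exprS -mulmxA.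
rewrite /Hmx !mul_block_col !mul0mx !mulmx0 !add0r ?addr0 ?mul0mx ?mulmx0 ?addr0 ?add0r. by rewrite !mulmxA.
Qed.

Lemma Hmx_even_right n m (X : 'M[C]_(n, m)) (b : 'cV[C]_m) l :
  Hmx X ^+ l.*2 *m col_mx 0 b = col_mx (0 : 'cV_n) ((adjmx X *m X) ^+ l *m b).
Proof.
elim: l => [|l IH]; first by rewrite !expr0 !mul1mx.
rewrite doubleS exprS -mulmxA exprS -mulmxA IH exprS -mulmxA.
rewrite /Hmx !mul_block_col !mul0mx !mulmx0 !add0r ?addr0 ?mul0mx ?mulmx0 ?addr0 ?add0r. by rewrite !mulmxA.
Qed.

Lemma adj_col_mx n m p (x : 'M[C]_(n, p)) (y : 'M[C]_(m, p)) : adjmx (col_mx x y) = row_mx (adjmx x) (adjmx y).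
Proof. by rewrite /adjmx map_col_mx tr_col_mx. Qed.

Lemma norm2sq_col_mx n m (x : 'cV[C]_n) (y : 'cV[C]_m) : norm2sq (col_mx x y) = norm2sq x + norm2sq y.
Proof.
rewrite !norm2sqE big_split_ord /=; congr (_ + _); apply: eq_bigr => i _.
  by rewrite col_mxEu.
by rewrite col_mxEd.
Qed.

Lemma norm2sq0 n : norm2sq (0 : 'cV[C]_n) = 0.
Proof. by rewrite norm2sqE big1// => i _; rewrite mxE nq0. Qed.

Definition lbasis (n m : nat) (b : 'cV[C]_n) i (X : MX n m) : 'cV[C]_n :=
  ovec (Num.sqrt d) (cside d true) (1 + d) ((X : 'M[C]_(n, m)) *m adjmx (X : 'M[C]_(n, m))) b i.

Definition rbasis (n m : nat) (b : 'cV[C]_m) i (X : MX n m) : 'cV[C]_m :=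
  ovec (Num.sqrt d) (cside d false) (1 + d) (adjmx (X : 'M[C]_(n, m)) *m (X : 'M[C]_(n, m))) b i.

Let al0 : Num.sqrt d != 0. Proof. by rewrite gt_eqF// sqrtr_gt0. Qed.

Lemma CLL_bform n m (mu : probability (MX n m) R) (b : 'cV[C]_(n + m)) j :
  (0 < m)%N -> good_law kap mu -> CLL mu (bform b j).
Proof.
move=> m0 gl; have := mCLL_HU [set: 'I_(n + m)]%SET m0 gl => cH.
have := mCLL_mul (mCLL_cst mu (adjmx b)) (mCLL_mul (mCLL_X j cH) (mCLL_cst mu b)) => /(_ 0 0).
by apply: CLL_eq => A; rewrite /bform HU_T.
Qed.

Let gram_bound s i j : exists Cst : R, forall n m (mu : probability (MX n m) R) (b : 'cV[C]_(n + m))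
  (G : MX n m -> C) , (0 < m)%N -> (n <= m)%N -> good_law kap mu -> norm2sq b = 1 ->
  (forall v : 'I_(n + m), (v < n)%N != s -> b v 0 = 0) ->
  (forall X, G X - (i == j)%:R = let Q := orth ((Num.sqrt d)%:C)%C ((cside d s)%:C)%C ((1 + d)%:C)%C i *
     orth ((Num.sqrt d)%:C)%C ((cside d s)%:C)%C ((1 + d)%:C)%C j in
     \sum_(l < size Q) Q`_l * (bform b l.*2 X - ((Lim d s l.*2)%:C)%C)) ->
  LL mu (fun X => nq (G X - (i == j)%:R)) /\
  E mu (fun X => nq (G X - (i == j)%:R)) <= Cst * eps d n m.
Proof.
set Q := _ * _.
have [Cf HC] := choice (fun k => form_limit kap k d01').
exists ((size Q)%:R * \sum_(l < size Q) nq Q`_l * Cf l.*2) => n m mu b G m0 nm gl b1 bs HG.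
have cl l : CLL mu (fun X => bform b l X - ((Lim d s l)%:C)%C).
  by apply: CLLB; [exact: CLL_bform|exact: CLL_cst].
have cG : CLL mu (fun X => G X - (i == j)%:R).
  apply: (@CLL_eq _ _ _ _ (fun X => \sum_(l < size Q) Q`_l * (bform b l.*2 X - ((Lim d s l.*2)%:C)%C))).
    by move=> X; rewrite HG.
  by apply: CLL_sum => l _; apply: CLLM; [exact: CLL_cst|exact: cl].
have lG : LL mu (fun X => nq (G X - (i == j)%:R)) by exact: LL_nq.
split=> //.
have le1 l : LL mu (fun X => nq Q`_l * nq (bform b l.*2 X - ((Lim d s l.*2)%:C)%C)).
  by apply: LLZ; exact: LL_nq.
apply: (@le_trans _ _ (E mu (fun X => (size Q)%:R * \sum_(l < size Q) nq Q`_l * nq (bform b l.*2 X - ((Lim d s l.*2)%:C)%C)))).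
  apply: E_le => //; first by apply: LLZ; apply: LL_sum => l _; exact: le1.
  move=> X; rewrite HG; apply: le_trans (nq_sum_le _) _; rewrite ler_wpM2l ?ler0n//.
  by apply: ler_sum => l _; rewrite nqM.
rewrite E_scale; last by apply: LL_sum => l _; exact: le1.
rewrite E_sum => [|l _]; last exact: le1.
rewrite -mulrA ler_wpM2l ?ler0n// mulr_suml; apply: ler_sum => l _.
rewrite E_scale; last exact: LL_nq.
rewrite -[leRHS]mulrA; apply: ler_wpM2l; first exact: nq_ge0.
exact: (HC l.*2 n m mu s b m0 nm gl b1 bs).
Qed.

Lemma lgram_limit i j : exists Cst : R, forall n m (mu : probability (MX n m) R) (b : 'cV[C]_n),
  (0 < m)%N -> (n <= m)%N -> good_law kap mu -> norm2sq b = 1 ->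
  LL mu (fun X => nq ((adjmx (lbasis b i X) *m lbasis b j X) 0 0 - (i == j)%:R)) /\
  E mu (fun X => nq ((adjmx (lbasis b i X) *m lbasis b j X) 0 0 - (i == j)%:R)) <= Cst * eps d n m.
Proof.
have [Cst H] := gram_bound true i j; exists Cst => n m mu b m0 nm gl b1.
apply: (H n m mu (col_mx b 0)) => //.
- by rewrite norm2sq_col_mx norm2sq0 addr0.
- move=> v; case: (split_ordP v) => v' ->; first by [].
  by rewrite col_mxEd mxE.
move=> X /=; rewrite gram_diff// ?adjM ?adjK//; apply: eq_bigr => l _.
congr (_ * (_ - _)); last exact: jmom_Lim.
by rewrite /kmom /kvec /bform Hmx_even_left adj_col_mx mul_row_col mulmx0 addr0.
Qed.

Lemma rgram_limit i j : exists Cst : R, forall n m (mu : probability (MX n m) R) (b : 'cV[C]_m),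
  (0 < m)%N -> (n <= m)%N -> good_law kap mu -> norm2sq b = 1 ->
  LL mu (fun X => nq ((adjmx (rbasis b i X) *m rbasis b j X) 0 0 - (i == j)%:R)) /\
  E mu (fun X => nq ((adjmx (rbasis b i X) *m rbasis b j X) 0 0 - (i == j)%:R)) <= Cst * eps d n m.
Proof.
have [Cst H] := gram_bound false i j; exists Cst => n m mu b m0 nm gl b1.
apply: (H n m mu (col_mx 0 b)) => //.
- by rewrite norm2sq_col_mx norm2sq0 add0r.
- move=> v; case: (split_ordP v) => v' ->; first by rewrite col_mxEu mxE.
  by [].
move=> X /=; rewrite gram_diff// ?adjM ?adjK//; apply: eq_bigr => l _.
congr (_ * (_ - _)); last exact: jmom_Lim.
by rewrite /kmom /kvec /bform Hmx_even_right adj_col_mx mul_row_col mulmx0 add0r.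
Qed.

End LimitMoments.

(** * Least squares over nearly orthonormal Krylov bases *)

Section InnerProduct.
Context {R : realType}.
Local Notation C := (R[i]).

Definition ip n (x y : 'cV[C]_n) : C := (adjmx x *m y) 0 0.

Lemma ipDl n (x y z : 'cV[C]_n) : ip (x + y) z = ip x z + ip y z.
Proof. by rewrite /ip adjD mulmxDl mxE. Qed.
Lemma ipDr n (x y z : 'cV[C]_n) : ip x (y + z) = ip x y + ip x z.
Proof. by rewrite /ip mulmxDr mxE. Qed.
Lemma ipNr n (x y : 'cV[C]_n) : ip x (- y) = - ip x y.
Proof. by rewrite /ip mulmxN mxE. Qed.
Lemma ipZr n a (x y : 'cV[C]_n) : ip x (a *: y) = a * ip x y.
Proof. by rewrite /ip -scalemxAr mxE. Qed.
Lemma ipZl n a (x y : 'cV[C]_n) : ip (a *: x) y = a^* * ip x y.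
Proof. by rewrite /ip adjZ -scalemxAl mxE. Qed.
Lemma ipJ n (x y : 'cV[C]_n) : ip x y = (ip y x)^*.
Proof. by rewrite /ip -adjE adjM adjK. Qed.
Lemma ipM n m (A : 'M[C]_(n, m)) x y : ip x (A *m y) = ip (adjmx A *m x) y.
Proof. by rewrite /ip adjM adjK mulmxA. Qed.
Lemma ip_sumr n (I : Type) (s : seq I) (P : pred I) (x : 'cV[C]_n) F :
  ip x (\sum_(i <- s | P i) F i) = \sum_(i <- s | P i) ip x (F i).
Proof. by rewrite /ip mulmx_sumr summxE. Qed.
Lemma ip_suml n (I : Type) (s : seq I) (P : pred I) (x : 'cV[C]_n) F :
  ip (\sum_(i <- s | P i) F i) x = \sum_(i <- s | P i) ip (F i) x.
Proof. by rewrite ipJ ip_sumr rmorph_sum; apply: eq_bigr => i _; rewrite [RHS]ipJ. Qed.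

Lemma norm2sq_ip n (y : 'cV[C]_n) : norm2sq y = re (ip y y).
Proof.
rewrite norm2sqE /ip dot_sum re_sum; apply: eq_bigr => i _.
by case: (y i 0) => a b; rewrite /nq /=; ring.
Qed.

Lemma ip_norm2sq n (y : 'cV[C]_n) : ip y y = ((norm2sq y)%:C)%C.
Proof.
rewrite norm2sqE /ip dot_sum rmorph_sum /=; apply: eq_bigr => i _.
by case: (y i 0) => a b; apply/eqP; rewrite eq_complex /nq /=; apply/andP; split; apply/eqP; ring.
Qed.

Lemma norm2sq_ge0 n (y : 'cV[C]_n) : 0 <= norm2sq y.
Proof. by rewrite norm2sqE; nneg. Qed.

Lemma norm2sq_eq0 n (y : 'cV[C]_n) : norm2sq y = 0 -> y = 0.
Proof.
rewrite norm2sqE => /eqP; rewrite psumr_eq0 => [/allP h|i _]; last by nneg.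
apply/matrixP => i j; rewrite ord1 mxE; apply/eqP; rewrite -nq_eq0.
by apply: h; rewrite mem_index_enum.
Qed.

Lemma norm2sqD n (x y : 'cV[C]_n) : norm2sq (x + y) = norm2sq x + 2 * re (ip x y) + norm2sq y.
Proof.
rewrite !norm2sq_ip ipDl !ipDr !reD [ip y x]ipJ reJ; ring.
Qed.

Lemma norm2sqB n (x y : 'cV[C]_n) : norm2sq (x - y) = norm2sq x - 2 * re (ip x y) + norm2sq y.
Proof.
have -> : norm2sq y = norm2sq (- y) by rewrite !norm2sqE; apply: eq_bigr => i _; rewrite mxE nqN.
by rewrite norm2sqD ipNr; case: (ip x y) => a e /=; ring.
Qed.

(* [G] and [G^* G] have the same row space because [G^* G c = 0] forces [G c = 0]. *)
Lemma proj_exists n k (G : 'M[C]_(n, k)) (v : 'cV[C]_n) :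
  exists a : 'cV[C]_k, adjmx G *m (v - G *m a) = 0.
Proof.
set S := adjmx G *m G.
have GS : (G <= S)%MS.
  rewrite submxE; apply/eqP; set Q := cokermx S.
  have SQ : adjmx (G *m Q) *m (G *m Q) = 0 by rewrite adjM -mulmxA [adjmx G *m _]mulmxA -/S mulmx_coker mulmx0.
  apply/matrixP => i j; rewrite [RHS]mxE.
  have : norm2sq (col j (G *m Q)) = 0.
    rewrite norm2sq_ip /ip (_ : (adjmx (col j (G *m Q)) *m col j (G *m Q)) 0 0 = (adjmx (G *m Q) *m (G *m Q)) j j).
      by rewrite SQ mxE.
    by rewrite !mxE; apply: eq_bigr => l _; rewrite !mxE.
  by move/norm2sq_eq0/matrixP/(_ i 0); rewrite !mxE.
have /submxP [D HD] : (adjmx v *m G <= S)%MS by apply: submx_trans GS; rewrite submxMl.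
exists (adjmx D).
rewrite mulmxBr mulmxA -/S; apply/eqP; rewrite subr_eq0; apply/eqP.
have -> : S = adjmx S by rewrite /S adjM adjK.
by rewrite -adjM -HD adjM adjK.
Qed.

Lemma abs_re_le (z : C) (c : R) : 0 <= c -> nq z <= c ^+ 2 -> `|re z| <= c.
Proof.
move=> c0 h; rewrite -ler_sqr ?nnegrE// real_normK ?num_real//.
by apply: le_trans h; rewrite /nq lerDl sqr_ge0.
Qed.

Definition comb n (p : nat -> 'cV[C]_n) k (r : nat -> C) := \sum_(i < k) r i *: p i.

Definition spn n (p : nat -> 'cV[C]_n) k y := exists r, y = comb p k r.

Lemma combD n (p : nat -> 'cV[C]_n) k r r' : comb p k r + comb p k r' = comb p k (fun i => r i + r' i).
Proof. by rewrite /comb -big_split; apply: eq_bigr => i _; rewrite scalerDl. Qed.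

Lemma combZ n (p : nat -> 'cV[C]_n) k a r : a *: comb p k r = comb p k (fun i => a * r i).
Proof. by rewrite /comb scaler_sumr; apply: eq_bigr => i _; rewrite scalerA. Qed.

Lemma combB n (p : nat -> 'cV[C]_n) k r r' : comb p k r - comb p k r' = comb p k (fun i => r i - r' i).
Proof. by rewrite /comb -sumrB; apply: eq_bigr => i _; rewrite scalerBl. Qed.

Lemma combS n (p : nat -> 'cV[C]_n) k r : comb p k.+1 r = comb p k r + r k *: p k.
Proof. exact: big_ord_recr. Qed.

Lemma comb_eq n (p : nat -> 'cV[C]_n) k r r' : (forall i, (i < k)%N -> r i = r' i) -> comb p k r = comb p k r'.
Proof. by move=> h; apply: eq_bigr => i _; rewrite h. Qed.

Lemma comb_mul n m (B : 'M[C]_(m, n)) (p : nat -> 'cV[C]_n) k r :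
  B *m comb p k r = comb (fun i => B *m p i) k r.
Proof. by rewrite mulmx_sumr; apply: eq_bigr => i _; rewrite scalemxAr. Qed.

Lemma spnD n (p : nat -> 'cV[C]_n) k x y : spn p k x -> spn p k y -> spn p k (x + y).
Proof. by move=> [r ->] [r' ->]; eexists; exact: combD. Qed.

Lemma spnZ n (p : nat -> 'cV[C]_n) k a x : spn p k x -> spn p k (a *: x).
Proof. by move=> [r ->]; eexists; exact: combZ. Qed.

Lemma spn0 n (p : nat -> 'cV[C]_n) k : spn p k 0.
Proof. by exists (fun=> 0); rewrite /comb big1// => i _; rewrite scale0r. Qed.

Lemma spn_sum n (p : nat -> 'cV[C]_n) k (I : Type) (s : seq I) F : (forall i, spn p k (F i)) -> spn p k (\sum_(i <- s) F i).
Proof.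
by move=> h; elim: s => [|i s IH]; [rewrite big_nil; exact: spn0|rewrite big_cons; exact: spnD].
Qed.

Lemma spn_at n (p : nat -> 'cV[C]_n) k i : (i < k)%N -> spn p k (p i).
Proof.
move=> ik; exists (fun j => (j == i)%:R); rewrite /comb (bigD1 (Ordinal ik))//= eqxx scale1r big1 ?addr0// => j ji.
by rewrite (_ : (j == i :> nat) = false) ?scale0r//; apply: negbTE.
Qed.

Lemma spn_trans n (p q : nat -> 'cV[C]_n) k l x : (forall i, (i < k)%N -> spn q l (p i)) -> spn p k x -> spn q l x.
Proof. by move=> h [r ->]; apply: spn_sum => i; apply: spnZ; exact: h. Qed.

Lemma spn_widen n (p : nat -> 'cV[C]_n) k l x : (k <= l)%N -> spn p k x -> spn p l x.
Proof. by move=> kl; apply: spn_trans => i ik; apply: spn_at; exact: leq_trans kl. Qed.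

Section Frame.
Variables (n k : nat) (p : nat -> 'cV[C]_n) (del : R).
Hypothesis del0 : 0 <= del.
Hypothesis Hp : forall i j, (i < k)%N -> (j < k)%N -> nq (ip (p i) (p j) - (i == j)%:R) <= del ^+ 2.

Lemma frame_ip (r s : nat -> C) :
  ip (comb p k r) (comb p k s) = \sum_(i < k) (r i)^* * s i +
    \sum_(i < k) \sum_(j < k) (r i)^* * s j * (ip (p i) (p j) - (i == j :> nat)%:R).
Proof.
rewrite /comb ip_suml -big_split /=; apply: eq_bigr => i _.
rewrite ipZl ip_sumr mulr_sumr.
rewrite (eq_bigr (fun j : 'I_k => (r i)^* * s j * (i == j :> nat)%:R + (r i)^* * s j * (ip (p i) (p j) - (i == j :> nat)%:R))); last first.
  by move=> j _; rewrite ipZr; ring.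
rewrite big_split /=; congr (_ + _).
rewrite (bigD1 i)//= eqxx mulr1 big1 ?addr0// => j ji.
by rewrite (_ : (i == j :> nat) = false) ?mulr0//; apply: negbTE; rewrite eq_sym.
Qed.

(** Entrywise errors of the Gram matrix are summed with [|r_i| |r_j| <= (|r_i|^2 + |r_j|^2) / 2], so
    each coefficient is charged [k] times. *)
Lemma frame (r : nat -> C) : (1 - k%:R * del) * \sum_(i < k) nq (r i) <=
  norm2sq (comb p k r) <= (1 + k%:R * del) * \sum_(i < k) nq (r i).
Proof.
set S := \sum_(i < k) nq (r i); rewrite norm2sq_ip frame_ip reD.
have -> : re (\sum_(i < k) (r i)^* * r i) = S.
  by rewrite re_sum; apply: eq_bigr => i _; case: (r i) => a b; rewrite /nq /=; ring.
set x := re _; suff : `|x| <= k%:R * del * S.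
  by rewrite ler_norml => /andP[]; lra.
have S2 : k%:R * del * S = \sum_(i < k) \sum_(j < k) del * ((nq (r i) + nq (r j)) / 2).
  transitivity (\sum_(i < k) (del / 2) * (k%:R * nq (r i) + S)).
    by rewrite -mulr_sumr big_split /= sumr_const card_ord -mulr_sumr -/S -[S *+ k]mulr_natl; field.
  apply: eq_bigr => i _; rewrite -mulr_sumr -mulr_suml big_split /= sumr_const card_ord -/S -[_ *+ k]mulr_natl; ring.
rewrite S2 /x re_sum; apply: le_trans (ler_norm_sum _ _ _) _; apply: ler_sum => i _.
rewrite re_sum; apply: le_trans (ler_norm_sum _ _ _) _; apply: ler_sum => j _.
have a0 := nq_ge0 (r i); have b0 := nq_ge0 (r j).
apply: abs_re_le; first by rewrite mulr_ge0// divr_ge0// addr_ge0.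
rewrite !nqM nqJ exprMn [leLHS]mulrC; apply: ler_pM; [by nneg|by nneg|exact: (Hp (ltn_ord i) (ltn_ord j))|].
by have := sqr_ge0 (nq (r i) - nq (r j)); lra.
Qed.

End Frame.

Section Krylov.
Variables (al be0 be : R).
Hypothesis al0 : al != 0.
Variables (n : nat) (A : 'M[C]_n) (b : 'cV[C]_n).
Hypothesis Aherm : adjmx A = A.

Local Notation p := (ovec al be0 be A b).

Definition jdiag i : R := if i is _.+1 then be else be0.

Lemma ovec_step i : A *m p i =
  (if i is j.+1 then (al%:C)%C *: p j else 0) + ((jdiag i)%:C)%C *: p i + (al%:C)%C *: p i.+1.
Proof. by case: i => [|i]; [rewrite add0r; exact: ovec1|exact: ovecS]. Qed.

Lemma spn_mulA k y : spn p k y -> spn p k.+1 (A *m y).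
Proof.
move=> [r ->]; rewrite /comb mulmx_sumr; apply: spn_sum => i.
rewrite -scalemxAr; apply: spnZ; rewrite ovec_step.
have ik := ltn_ord i.
apply: spnD; last by apply/spnZ/spn_at.
apply: spnD; last by apply/spnZ/spn_at; exact: leqW.
case: (i : nat) ik => [|j] ik; first exact: spn0.
by apply/spnZ/spn_at; rewrite ltnS ltnW// ltnW.
Qed.

Lemma size_orth i : (size (orth (al%:C)%C (be0%:C)%C (be%:C)%C i) <= i.+1)%N.
Proof.
have h0 := al0C al0.
suff [] : (size (orth (al%:C)%C (be0%:C)%C (be%:C)%C i) <= i.+1)%N /\
   (size (orth (al%:C)%C (be0%:C)%C (be%:C)%C i.+1) <= i.+2)%N by [].
elim: i => [|i [IH0 IH1]].
  rewrite orth0 size_poly1; split=> //.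
  rewrite -(size_scale _ h0) (orth1 _ _ h0) -polyCN -[X in X%:P]opprK.
  by rewrite polyCN size_XsubC.
split=> //; rewrite -(size_scale _ h0) (orthS _ _ h0).
apply: leq_trans (size_polyD _ _) _; rewrite geq_max; apply/andP; split.
  apply: leq_trans (size_polyMleq _ _) _; rewrite size_XsubC addSn /= add1n ltnS.
  exact: IH1.
by rewrite size_polyN; apply: leq_trans (size_scale_leq _ _) _; apply: leq_trans IH0 _; rewrite leqW.
Qed.

Lemma krylov_spn k y : krylov A b k y <-> spn p k y.
Proof.
have kv j : spn p j.+1 (kvec A b j).
  elim: j => [|j IH].
    by rewrite /kvec expr0 mul1mx -{2}[b](ovec0 al be0 be A); exact: spn_at.
  by rewrite /kvec exprS -mulmxA; exact: spn_mulA.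
split=> [[a ->]|].
  by apply: spn_sum => i; apply/spnZ/(spn_widen (ltn_ord i)); exact: kv.
move=> [r ->]; exists (fun j => \sum_(i < k) r i * (orth (al%:C)%C (be0%:C)%C (be%:C)%C i)`_j).
under eq_bigr => j _ do rewrite scaler_suml.
rewrite exchange_big /=; apply: eq_bigr => i _.
rewrite /ovec (lev_widen _ (leq_trans (size_orth i) (ltn_ord i))) scaler_sumr.
by apply: eq_bigr => j _; rewrite scalerA.
Qed.

(** The values [orth i] at [0], given by their three-term recursion. Residual polynomials take the
    value [1] at [0]; in the basis [p] this is the linear constraint that [\sum_i z i * r i = 1]. *)
Variable z : nat -> R.
Hypothesis z0 : z 0%N = 1.
Hypothesis z1 : be0 * z 0%N + al * z 1%N = 0.
Hypothesis zS : forall i, al * z i + be * z i.+1 + al * z i.+2 = 0.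

Let Z k := \sum_(i < k.+1) z i ^+ 2.

Let zstep i : (if i is j.+1 then al * z j else 0) + jdiag i * z i + al * z i.+1 = 0.
Proof. by case: i => [|i]; [rewrite add0r z1|rewrite zS]. Qed.

Local Notation zc i := ((z i)%:C)%C.

Let zstepC i : (if i is j.+1 then (al%:C)%C * zc j else 0) + ((jdiag i)%:C)%C * zc i + (al%:C)%C * zc i.+1 = 0.
Proof.
have := congr1 (real_complex R) (zstep i).
by case: i => [|i]; rewrite /= ?rmorphD ?rmorphM ?rmorph0 /=.
Qed.

(* The coefficients of [A c_k p_k] truncated at index [k], i.e. without its top term. *)
Let low k i : C := if i == k then ((jdiag k)%:C)%C else if i.+1 == k then (al%:C)%C else 0.

Let low_sum (E : lmodType C) (q : nat -> E) k :
  \sum_(i < k.+1) low k i *: q i = (if k is j.+1 then (al%:C)%C *: q j else 0) + ((jdiag k)%:C)%C *: q k.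
Proof.
rewrite big_ord_recr /= /low eqxx; congr (_ + _); case: k => [|k]; first by rewrite big_ord0.
rewrite big_ord_recr /= (ltn_eqF (ltnSn k)) eqxx big1 ?add0r// => i _.
have ik := ltn_ord i; rewrite (ltn_eqF (ltnW (ik : (i.+1 < k.+1)%N))) (ltn_eqF (ik : (i.+1 < k.+1)%N)).
by rewrite scale0r.
Qed.

Lemma mulA_comb k y : spn p k y -> exists2 r, A *m y = comb p k.+1 r & \sum_(i < k.+1) zc i * r i = 0.
Proof.
move=> [c ->]; elim: k => [|k [r Hr Zr]].
  exists (fun=> 0); rewrite /comb ?big_ord0 ?mulmx0 big1// => i _; rewrite ?scale0r ?mulr0//.
exists (fun i => (if (i < k.+1)%N then r i + c k * low k i else c k * (al%:C)%C)).
  rewrite combS mulmxDr Hr [RHS]combS ltnn.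
  rewrite (@comb_eq _ _ _ (fun i => if (i < k.+1)%N then _ else _) (fun i => r i + c k * low k i)); last by move=> i ik; rewrite /= ik.
  rewrite -combD -addrA; congr (_ + _); rewrite -scalemxAr ovec_step.
  by rewrite -(low_sum p) scalerDr -combZ scalerA.
rewrite big_ord_recr /= ltnn.
rewrite (eq_bigr (fun i : 'I_k.+1 => zc i * r i + c k * (low k i * zc i))); last first.
  by move=> i _; rewrite ltn_ord; ring.
rewrite big_split /= Zr add0r -mulr_sumr mulrCA -mulrDr.
have := low_sum (fun i => zc i : C^o) k; rewrite /GRing.scale /= => ->.
by rewrite [_ * (al%:C)%C]mulrC; have := zstepC k; rewrite /GRing.scale /=; case: (k) => [|k'] ->; rewrite mulr0.
Qed.

(** The polynomials divisible by ['X] are exactly those vanishing at [0]. The preimage is built by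
    eliminating the top coefficient with a multiple of [p k]. *)
Lemma mulA_combV k (r : nat -> C) : \sum_(i < k.+1) zc i * r i = 0 ->
  exists2 y, spn p k y & A *m y = comb p k.+1 r.
Proof.
elim: k r => [|k IH] r.
  rewrite big_ord_recl big_ord0 z0 mul1r addr0 => r0.
  by exists 0; [exact: spn0|rewrite mulmx0 /comb big_ord_recl big_ord0 r0 scale0r addr0].
rewrite big_ord_recr /= => Hr.
have h0 := al0C al0; pose c := r k.+1 / (al%:C)%C.
have rk : r k.+1 = c * (al%:C)%C by rewrite divfK.
have [|y sy Ay] := IH (fun i => r i - c * low k i).
  rewrite (eq_bigr (fun i : 'I_k.+1 => zc i * r i - c * (low k i * zc i))); last by move=> i _; ring.
  rewrite sumrB -mulr_sumr.
  have := low_sum (fun i => zc i : C^o) k; rewrite /GRing.scale /= => ->.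
  have -> : \sum_(i < k.+1) zc i * r i = - (zc k.+1 * (c * (al%:C)%C)).
    by apply/eqP; rewrite -addr_eq0 -rk Hr.
  have := zstepC k; rewrite /GRing.scale /=.
  by case: (k) => [|k'] e; rewrite -[RHS](mulr0 (- c)) -[X in _ = _ * X]e; ring.
exists (y + c *: p k).
  by apply: spnD; [exact: spn_widen sy|apply/spnZ/spn_at].
rewrite mulmxDr Ay -scalemxAr ovec_step -(low_sum p) -combB [RHS]combS rk.
have -> : comb p k.+1 (fun i => c * low k i) = c *: \sum_(i < k.+1) low k i *: p i by rewrite -combZ.
by rewrite scalerDr scalerA addrA subrK.
Qed.

Lemma residual_comb k y : spn p k y ->
  exists2 r, b - A *m y = comb p k.+1 r & \sum_(i < k.+1) zc i * r i = 1.
Proof.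
move=> /mulA_comb[r -> Zr]; exists (fun i => (i == 0%N)%:R - r i).
  rewrite -combB; congr (_ - _); rewrite /comb big_ord_recl /= ovec0 scale1r big1 ?addr0// => i _.
  by rewrite scale0r.
rewrite (eq_bigr (fun i : 'I_k.+1 => zc i * (i == 0%N :> nat)%:R - zc i * r i)); last by move=> i _; rewrite mulrBr.
rewrite sumrB Zr subr0 big_ord_recl /= z0 mulr1 big1 ?addr0// => i _.
by rewrite mulr0.
Qed.

Lemma comb_residual k (r : nat -> C) : \sum_(i < k.+1) zc i * r i = 1 ->
  exists2 y, spn p k y & b - A *m y = comb p k.+1 r.
Proof.
move=> Zr; have [|y sy Ay] := @mulA_combV k (fun i => (i == 0%N)%:R - r i).
  rewrite (eq_bigr (fun i : 'I_k.+1 => zc i * (i == 0%N :> nat)%:R - zc i * r i)); last by move=> i _; rewrite mulrBr.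
  rewrite sumrB Zr big_ord_recl /= z0 mulr1 big1 ?addr0 ?subrr// => i _.
  by rewrite mulr0.
exists y => //; rewrite Ay -combB opprB addrCA (_ : b - _ = 0) ?addr0//.
apply/eqP; rewrite subr_eq0; apply/eqP.
rewrite /comb big_ord_recl /= ovec0 scale1r big1 ?addr0// => i _.
by rewrite scale0r.
Qed.

Variables (k : nat) (del : R).
Hypothesis del0 : 0 <= del.
Hypothesis Hp : forall i j, (i < k.+1)%N -> (j < k.+1)%N -> nq (ip (p i) (p j) - (i == j)%:R) <= del ^+ 2.

Let Zgt0 : 0 < Z k.
Proof. by rewrite /Z big_ord_recl z0 expr1n ltr_pwDl// sumr_ge0// => i _; rewrite sqr_ge0. Qed.

(** For an orthonormal basis the problem is to minimise [\sum_i |r_i|^2] under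
    [\sum_i z i * r i = 1]; the minimum [1 / Z k] is attained at [r = z / Z k]. The frame bound
    accounts for the defect of orthonormality. *)
Lemma minres_lower y : k.+1%:R * del <= 1 -> spn p k y ->
  (1 - k.+1%:R * del) / Z k <= norm2sq (b - A *m y).
Proof.
move=> kd /residual_comb[r -> Zr].
have /andP[h _] := frame del0 Hp r; apply: le_trans h; apply: ler_wpM2l; first by rewrite subr_ge0.
have : 0 <= \sum_(i < k.+1) nq (r i - ((z i / Z k)%:C)%C) by nneg.
have -> : \sum_(i < k.+1) nq (r i - ((z i / Z k)%:C)%C) =
   \sum_(i < k.+1) nq (r i) - 2 / Z k * re (\sum_(i < k.+1) zc i * r i) + (Z k)^-1 ^+ 2 * Z k.
  rewrite re_sum [X in _ = _ + _ * X]/Z !mulr_sumr -sumrB -big_split /=; apply: eq_bigr => i _.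
  by case: (r i) => x y'; rewrite /nq /=; field; rewrite gt_eqF.
rewrite Zr /= [X in _ + X](_ : _ = (Z k)^-1); last by field; rewrite gt_eqF.
by set u := (Z k)^-1; lra.
Qed.

Lemma minres_upper : exists2 y, spn p k y & norm2sq (b - A *m y) <= (1 + k.+1%:R * del) / Z k.
Proof.
have [|y sy Ay] := @comb_residual k (fun i => ((z i / Z k)%:C)%C).
  rewrite (eq_bigr (fun i : 'I_k.+1 => ((z i ^+ 2 / Z k)%:C)%C)).
    by rewrite -rmorph_sum -mulr_suml mulfV ?rmorph1 ?gt_eqF.
  by move=> i _; rewrite -rmorphM mulrA.
exists y => //; rewrite Ay; have /andP[_ h] := frame del0 Hp (fun i => ((z i / Z k)%:C)%C).
apply: le_trans h _; rewrite (_ : \sum_(i < k.+1) _ = (Z k)^-1)//.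
rewrite (eq_bigr (fun i : 'I_k.+1 => (Z k)^-1 ^+ 2 * z i ^+ 2)).
  by rewrite -mulr_sumr expr2 -mulrA mulVf ?gt_eqF// mulr1.
by move=> i _; rewrite nqR exprMn mulrC.
Qed.

(** A residual orthogonal to [p 0, ..., p (k - 1)] has small coordinates there, up to the defect of
    the Gram matrix. The constraint then forces [z k * r k] to be close to [1], so the squared norm
    is close to [1 / z k ^ 2]. *)
Lemma galerkin_res y (th : R) : 0 < th <= 10^-1 -> spn p k y ->
  (forall i, (i < k)%N -> ip (p i) (b - A *m y) = 0) ->
  k.+1%:R * del <= th -> (k.+1%:R * del) ^+ 2 <= th ^+ 2 ->
  k.+1%:R * Z k * (k.+1%:R * del) ^+ 2 <= th ^+ 2 * z k ^+ 2 -> 0 < z k ^+ 2 ->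
  `|z k ^+ 2 * norm2sq (b - A *m y) - 1| <= 10 * th.
Proof.
move=> /andP[t0 t1] /residual_comb[r -> Zr] G kd kd2 kz zk.
set S := \sum_(i < k.+1) nq (r i).
have S0 : 0 <= S by rewrite /S; nneg.
have /andP[f1 f2] := frame del0 Hp r; rewrite -/S in f1 f2.
have k0 : 0 < k.+1%:R :> R by rewrite ltr0n.
have small i : (i < k)%N -> nq (r i) <= k.+1%:R * del ^+ 2 * S.
  move=> ik; have ik' := ltnW ik : (i < k.+1)%N.
  have e : r i = - \sum_(j < k.+1) r j * (ip (p i) (p j) - (i == j :> nat)%:R).
    apply/eqP; rewrite -addr_eq0; apply/eqP; rewrite -[RHS](G i ik) /comb ip_sumr.
    rewrite [RHS](eq_bigr (fun j : 'I_k.+1 => r j * (i == j :> nat)%:R + r j * (ip (p i) (p j) - (i == j :> nat)%:R))).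
      rewrite big_split /=; congr (_ + _); rewrite (bigD1 (Ordinal ik'))//= eqxx mulr1 big1 ?addr0// => j ji.
      by rewrite (_ : (i == j :> nat) = false) ?mulr0//; apply: negbTE; rewrite eq_sym.
    by move=> j _; rewrite ipZr; ring.
  rewrite e nqN; apply: le_trans (nq_sum_le _) _; rewrite -mulrA ler_wpM2l ?(ltW k0)//.
  rewrite mulr_sumr; apply: ler_sum => j _; rewrite nqM mulrC; apply: ler_wpM2r; first by nneg.
  exact: (Hp ik' (ltn_ord j)).
set w := zc k * r k.
have nw : nq w = z k ^+ 2 * nq (r k) by rewrite nqM nqR.
have Ss : S - nq (r k) <= th ^+ 2 * S.
  have {1}-> : S = \sum_(i < k) nq (r i) + nq (r k) by rewrite /S big_ord_recr.
  rewrite addrK; apply: le_trans (_ : \sum_(i < k) k.+1%:R * del ^+ 2 * S <= _).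
    by apply: ler_sum => i _; apply: small.
  rewrite sumr_const card_ord -[_ *+ k]mulr_natl mulrA; apply: ler_wpM2r => //.
  apply: le_trans kd2; rewrite exprMn mulrA ler_wpM2r ?sqr_ge0// expr2 ler_wpM2r ?(ltW k0)//.
  by rewrite ler_nat.
have Sk : nq (r k) <= S by rewrite /S big_ord_recr /= lerDr; nneg.
have nw1 : nq (1 - w) <= th ^+ 2 * (z k ^+ 2 * S).
  have -> : 1 - w = \sum_(i < k) zc i * r i by rewrite -Zr big_ord_recr /= addrK.
  apply: le_trans (nq_sum_le _) _.
  apply: (@le_trans _ _ (k.+1%:R * \sum_(i < k) (z i ^+ 2 * (k.+1%:R * del ^+ 2 * S)))).
    apply: ler_pM; rewrite ?ler0n ?ler_nat//; first by nneg.
    by apply: ler_sum => i _; rewrite nqM nqR ler_wpM2l ?sqr_ge0// small.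
  rewrite -mulr_suml [leRHS]mulrA.
  apply: le_trans (_ : (k.+1%:R * Z k * (k.+1%:R * del) ^+ 2) * S <= _); last by rewrite ler_wpM2r.
  rewrite [leRHS](_ : _ = k.+1%:R * (Z k * (k.+1%:R ^+ 2 * del ^+ 2 * S))); last by ring.
  apply: ler_wpM2l; first exact: ltW.
  apply: ler_pM; [by nneg|by nneg| |].
    by rewrite /Z big_ord_recr /= lerDl sqr_ge0.
  do 2 (apply: ler_wpM2r; first by nneg).
  by rewrite expr2 ler_peMr ?(ltW k0)// ler1n.
(* [c1] and [c2] compare [1] and [w] in both directions by Cauchy-Schwarz with weights [th] and [1]:
   the factor [1 + th^-1] is harmless since [|1 - w|^2] is of order [th^2]. *)
have c1 : 1 <= (1 + th) * nq w + (1 + th^-1) * nq (1 - w).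
  rewrite -[leLHS]nq1 -{1}[1](subrK w) addrC.
  have := @nqD_weighted R th 1 (1 - w) w t0 ltr01; rewrite addrC.
  have -> : (th + 1) * (th * (nq (1 - w) / th ^+ 2) + 1 * (nq w / 1 ^+ 2)) = (1 + th) * nq w + (1 + th^-1) * nq (1 - w).
    by field; rewrite gt_eqF.
  by [].
have c2 : nq w <= (1 + th) + (1 + th^-1) * nq (1 - w).
  have := @nqD_weighted R th 1 (- (1 - w)) 1 t0 ltr01.
  rewrite opprB subrK nq1 -opprB nqN.
  have -> : (th + 1) * (th * (nq (1 - w) / th ^+ 2) + 1 * (1 / 1 ^+ 2)) = (1 + th) + (1 + th^-1) * nq (1 - w).
    by field; rewrite gt_eqF.
  by [].
set N := z k ^+ 2 * S in nw1.
have N0 : 0 <= N by rewrite mulr_ge0// ltW.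
have tn : (1 + th^-1) * nq (1 - w) <= (th ^+ 2 + th) * N.
  apply: le_trans (_ : (1 + th^-1) * (th ^+ 2 * N) <= _).
    by rewrite ler_wpM2l// addr_ge0// invr_ge0 ltW.
  by rewrite le_eqVlt; apply/orP; left; apply/eqP; field; rewrite gt_eqF.
have wN : nq w <= N by rewrite nw ler_wpM2l// ltW.
have wN' : (1 - th ^+ 2) * N <= nq w.
  rewrite nw /N mulrCA ler_wpM2l ?(ltW zk)//; lra.
have h1 : z k ^+ 2 * norm2sq (comb p k.+1 r) <= (1 + th) * N.
  rewrite /N mulrCA ler_wpM2l ?(ltW zk)//; apply: le_trans f2 _; rewrite ler_wpM2r//; lra.
have h2 : (1 - th) * N <= z k ^+ 2 * norm2sq (comb p k.+1 r).
  rewrite /N mulrCA ler_wpM2l ?(ltW zk)//; apply: le_trans f1; rewrite ler_wpM2r//; lra.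
have t2 : th ^+ 2 <= th * 10^-1 by rewrite expr2 ler_wpM2l ?(ltW t0).
move: (z k ^+ 2 * norm2sq _) h1 h2 => q h1 h2.
have a1 : 1 <= (1 + 3 * th) * N.
  have := ler_wpM2r N0 t2; nra.
have a2 : (1 - 2 * th) * N <= 1 + th by have := ler_wpM2r N0 t2; nra.
have N2 : N <= 2 by nra.
have tN := ler_wpM2l (ltW t0) N2.
rewrite ler_norml; apply/andP; split; lra.
Qed.

End Krylov.

(** * A dual basis for the energy norm *)

Section Dual.
Variables (d : R) (n m : nat) (X : 'M[C]_(n, m)) (b : 'cV[C]_n).
Hypothesis d01 : 0 < d <= 1.

Let sq := Num.sqrt d.
Let sq2 : sq ^+ 2 = d. Proof. by rewrite sqr_sqrtr//; case/andP: d01 => /ltW. Qed.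
Let sq0 : sq != 0. Proof. by rewrite gt_eqF// sqrtr_gt0; case/andP: d01. Qed.
Let d0 : 0 <= d. Proof. by case/andP: d01 => /ltW. Qed.
Let d1 : d <= 1. Proof. by case/andP: d01. Qed.

Local Notation A := (X *m adjmx X).
Local Notation p := (ovec sq 1 (1 + d) A b).

(** A bidiagonalisation. The limiting Jacobi matrix is [L L^T], where [L] is lower bidiagonal with
    [1] on the diagonal and [sqrt d] below it; accordingly [X u_i = p_i + sqrt d p_(i+1)]. The [u_i]
    are almost orthonormal and span the image of the Krylov space under [adjmx X], whose Euclidean
    norm is the energy norm. *)
Fixpoint uvec i : 'cV[C]_m :=
  if i is j.+1 then adjmx X *m p i - (sq%:C)%C *: uvec j else adjmx X *m p 0%N.

Lemma mul_uvec i : X *m uvec i = p i + (sq%:C)%C *: p i.+1.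
Proof.
elim: i => [|i IH]; first by rewrite /= mulmxA ovec_step// add0r /= rmorph1 scale1r.
rewrite /= mulmxBr mulmxA ovec_step// -scalemxAr IH /= scalerDr scalerA -rmorphM -expr2 sq2.
rewrite rmorphD rmorph1 scalerDl scale1r.
have e (V : zmodType) (x q y z : V) : x + (q + y) + z - (x + y) = q + z.
  by apply/eqP; rewrite subr_eq; apply/eqP; rewrite (addrC q y) (addrA x y q) -(addrA (x + y) q z) (addrC (x + y)).
exact: e.
Qed.

(** The factor [3] comes from [|x + y + z|^2 <= 3 (|x|^2 + |y|^2 + |z|^2)], the [2] from the two
    Gram errors of the [p i] entering each step. *)
Fixpoint uconst i : R := if i is j.+1 then 3 * (2 + uconst j) else 6.

Lemma uconst_ge1 i : 1 <= uconst i.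
Proof. by elim: i => [|i IH] /=; lra. Qed.

Lemma uconst_le i j : (i <= j)%N -> uconst i <= uconst j.
Proof.
move=> /subnK <-; elim: (j - i)%N => [//|k IH]; rewrite addSn /=.
by apply: le_trans IH _; have := uconst_ge1 (k + i); lra.
Qed.

Let nq3 (x y z : C) : nq (x + y + z) <= 3 * (nq x + nq y + nq z).
Proof.
have := nq_sum_le (fun i : 'I_3 => nth 0 [:: x; y; z] i).
by rewrite !big_ord_recr !big_ord0 /= !add0r.
Qed.

Let nqsq (x : C) : nq ((sq%:C)%C * x) <= nq x.
Proof. by rewrite nqM nqR sq2 ler_piMl//; nneg. Qed.

Variables (k : nat) (del : R).
Hypothesis Hp : forall i j, (i < k.+1)%N -> (j < k.+1)%N -> nq (ip (p i) (p j) - (i == j)%:R) <= del ^+ 2.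

Let sqNJ : (- (sq%:C)%C : C)^* = - (sq%:C)%C.
Proof. by rewrite -rmorphN; exact: conjc_real. Qed.

Lemma gram_uvec i j : (i < k)%N -> (j < k)%N ->
  nq (ip (uvec i) (uvec j) - (i == j)%:R) <= uconst i * del ^+ 2.
Proof.
have dd := sqr_ge0 del.
elim: i => [|i IH] ik jk.
  rewrite /= -[X in adjmx X]/X -ipM mul_uvec ipDr ipZr.
  have h1 := Hp (ltn0Sn k) (ltnW jk : (j < k.+1)%N).
  have h2 := Hp (ltn0Sn k) (jk : (j.+1 < k.+1)%N).
  rewrite subr0 in h2.
  have := nq3 (ip (p 0%N) (p j) - (0 == j)%:R) ((sq%:C)%C * ip (p 0%N) (p j.+1)) 0.
  rewrite addr0 nq0 addrAC; have := nqsq (ip (p 0%N) (p j.+1)); lra.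
have -> : ip (uvec i.+1) (uvec j) - (i.+1 == j)%:R =
    (ip (p i.+1) (p j) - (i.+1 == j)%:R) + (sq%:C)%C * (ip (p i.+1) (p j.+1) - (i.+1 == j.+1)%:R) +
    (- ((sq%:C)%C * (ip (uvec i) (uvec j) - (i == j)%:R))).
  rewrite -[uvec i.+1]/(adjmx X *m p i.+1 - (sq%:C)%C *: uvec i) -scaleNr ipDl ipZl sqNJ -ipM mul_uvec ipDr ipZr.
  by rewrite eqSS; ring.
apply: le_trans (nq3 _ _ _) _; rewrite nqN.
have h1 := Hp (ltnW ik : (i.+1 < k.+1)%N) (ltnW jk : (j < k.+1)%N).
have h2 := Hp (ltnW ik : (i.+1 < k.+1)%N) (jk : (j.+1 < k.+1)%N).
have h3 := IH (ltnW ik) jk.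
have := nqsq (ip (uvec i) (uvec j) - (i == j)%:R); have := nqsq (ip (p i.+1) (p j.+1) - (i.+1 == j.+1)%:R).
by rewrite /=; lra.
Qed.

Let tau i : R := (- sq) ^+ i.

(** Only [X u = b] enters, through [<u_(i+1), u> = <p_(i+1), b> - sqrt d <u_i, u>] and [b = p 0].
    The projections of [u] are thus determined by the moments, although the norm of [u] is not. *)
Lemma proj_uvec (u : 'cV[C]_m) i : X *m u = b -> (i < k)%N ->
  nq (ip (uvec i) u - ((tau i)%:C)%C) <= uconst i * del ^+ 2.
Proof.
move=> Xu; have dd := sqr_ge0 del.
have pb j : (j < k.+1)%N -> nq (ip (p j) b - (j == 0)%:R) <= del ^+ 2.
  by move=> jk; have := Hp jk (ltn0Sn k); rewrite ovec0.
elim: i => [|i IH] ik.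
  rewrite /= -ipM Xu /tau expr0 rmorph1; have := pb 0%N (ltn0Sn k); rewrite eqxx /=; lra.
have -> : ip (uvec i.+1) u - ((tau i.+1)%:C)%C = (ip (p i.+1) b - (i.+1 == 0)%:R) +
   (- ((sq%:C)%C * (ip (uvec i) u - ((tau i)%:C)%C))) + 0.
  rewrite -[uvec i.+1]/(adjmx X *m p i.+1 - (sq%:C)%C *: uvec i) -scaleNr ipDl ipZl sqNJ -ipM Xu.
  by rewrite /tau exprS rmorphM rmorphN /=; ring.
apply: le_trans (nq3 _ _ _) _; rewrite nqN nq0.
have h1 := pb i.+1 (ltnW ik); have h3 := IH (ltnW ik).
have := nqsq (ip (uvec i) u - ((tau i)%:C)%C).
by rewrite /=; lra.
Qed.

Lemma spn_uvec y l : spn p l y -> spn uvec l (adjmx X *m y).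
Proof.
move=> [r ->]; rewrite comb_mul; apply: spn_sum => i; apply: spnZ.
have il := ltn_ord i; case: (i : nat) il => [|j] il; first exact: (spn_at uvec il).
rewrite (_ : adjmx X *m p j.+1 = uvec j.+1 + (sq%:C)%C *: uvec j); last by rewrite /= subrK.
by apply: spnD; [exact: spn_at|apply/spnZ/spn_at; exact: ltnW].
Qed.

Lemma uvec_spn v l : spn uvec l v -> exists2 y, spn p l y & adjmx X *m y = v.
Proof.
have h j : exists2 y, spn p j.+1 y & adjmx X *m y = uvec j.
  elim: j => [|j [y sy Xy]]; first by exists (p 0%N) => //; exact: spn_at.
  exists (p j.+1 + (- (sq%:C)%C) *: y); last by rewrite mulmxDr -scalemxAr Xy /= scaleNr.
  by apply: spnD; [exact: spn_at|apply: spnZ; exact: spn_widen sy].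
move=> [r ->]; rewrite /comb; elim: l => [|l [y sy Xy]].
  by exists 0; [exact: spn0|rewrite mulmx0 big_ord0].
have [z sz Xz] := h l; exists (y + r l *: z).
  by apply: spnD; [exact: spn_widen sy|exact: spnZ].
by rewrite mulmxDr Xy -scalemxAr Xz big_ord_recr.
Qed.

Variable th : R.
Hypothesis t01 : 0 < th <= 10^-1.
Hypothesis dth : uconst k * del ^+ 2 <= (th / k.+1%:R) ^+ 2.

Let t0 : 0 < th. Proof. by case/andP: t01. Qed.
Let t1 : th <= 10^-1. Proof. by case/andP: t01. Qed.
Let k0 : 0 < k.+1%:R :> R. Proof. by rewrite ltr0n. Qed.
Let tk0 : 0 <= th / k.+1%:R. Proof. by rewrite divr_ge0 ?ltW. Qed.

Let frameU (c : nat -> C) : (1 - th) * \sum_(i < k) nq (c i) <=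
  norm2sq (comb uvec k c) <= (1 + th) * \sum_(i < k) nq (c i).
Proof.
have S0 : 0 <= \sum_(i < k) nq (c i) by nneg.
have hU i j : (i < k)%N -> (j < k)%N -> nq (ip (uvec i) (uvec j) - (i == j)%:R) <= (th / k.+1%:R) ^+ 2.
  move=> ik jk; apply: le_trans (gram_uvec ik jk) _; apply: le_trans dth.
  by rewrite ler_wpM2r ?sqr_ge0// uconst_le// ltnW.
have /andP[h1 h2] := frame tk0 hU c.
have kt : k%:R * (th / k.+1%:R) <= th.
  by rewrite mulrCA ler_piMr ?(ltW t0)// ler_pdivrMr// mul1r ler_nat.
move: (k%:R * (th / k.+1%:R)) kt h1 h2 => q kt h1 h2.
apply/andP; split; [apply: le_trans h1|apply: le_trans h2 _]; rewrite ler_wpM2r//; lra.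
Qed.

Variable u : 'cV[C]_m.
Hypothesis Xu : X *m u = b.

Let projU i : (i < k)%N -> nq (ip (uvec i) u - ((tau i)%:C)%C) <= th ^+ 2.
Proof.
move=> ik; apply: le_trans (proj_uvec Xu ik) _; apply: le_trans (_ : uconst k * del ^+ 2 <= _).
  by rewrite ler_wpM2r ?sqr_ge0// uconst_le// ltnW.
apply: le_trans dth _; rewrite ler_sqr ?nnegrE ?(ltW t0)// ler_pdivrMr// ler_peMr ?(ltW t0)//.
by rewrite ler1n.
Qed.

Let tau2 i : tau i ^+ 2 = d ^+ i.
Proof. by rewrite /tau exprAC sqrrN sq2. Qed.

Let tau1 i : d ^+ i <= 1. Proof. exact: exprn_ile1. Qed.

Let expand (c : nat -> C) : norm2sq (u - comb uvec k c) =
  norm2sq u + (norm2sq (comb uvec k c) - \sum_(i < k) 2 * re ((c i)^* * ip (uvec i) u)).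
Proof.
rewrite norm2sqB ipJ reJ {1}/comb ip_suml re_sum -mulr_sumr addrAC addrA; congr (_ - 2 * _).
by apply: eq_bigr => i _; rewrite ipZl.
Qed.

(** The energy norm of the error is the distance from [u] to the span of the [u_i]. The squared
    length of the projection is [\sum_(i < k) d ^+ i] up to the tolerance; the norm of [u] is left
    to be found separately. *)
Lemma cga_lower y : spn p k y ->
  norm2sq u - \sum_(i < k) (d ^+ i + 5 * th) <= norm2sq (u - adjmx X *m y).
Proof.
move=> /spn_uvec[c ->]; rewrite expand lerD2l lerNl opprB lerBlDr.
have /andP[h _] := frameU c; apply: le_trans (lerD (lexx _) h).
rewrite mulr_sumr -big_split /=; apply: ler_sum => i _.
set s := ip _ _; have := projU (ltn_ord i); rewrite -/s => he.
have td := tau2 i; have t1' := tau1 i.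
have : nq s <= d ^+ i + 3 * th.
  have := @nqD_weighted R th 1 (s - ((tau i)%:C)%C) ((tau i)%:C)%C t0 ltr01.
  rewrite subrK nqR td => h'; apply: le_trans h' _.
  rewrite [leLHS](_ : _ = (1 + th^-1) * nq (s - ((tau i)%:C)%C) + (1 + th) * d ^+ i); last by field; rewrite gt_eqF.
  have : (1 + th^-1) * nq (s - ((tau i)%:C)%C) <= (1 + th^-1) * th ^+ 2.
    by rewrite ler_wpM2l// addr_ge0// invr_ge0 ltW.
  rewrite [leRHS](_ : _ = th ^+ 2 + th); last by field; rewrite gt_eqF.
  have aux (D a : R) : D <= 1 -> a <= th ^+ 2 + th -> a + (1 + th) * D <= D + 3 * th.
    move=> D1 ha; have h1 : th <= 1 by apply: le_trans t1 _; rewrite invf_le1 ?ler1n ?ltr0n.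
    by have := ler_wpM2l (ltW t0) D1; have := ler_wpM2l (ltW t0) h1; lra.
  exact: aux.
move=> ns; have e0 : 0 <= d ^+ i by rewrite exprn_ge0.
(* Dividing by the lower frame bound [1 - th] costs at most another [2 th], whence [5] after [3]. *)
have : nq s <= (1 - th) * (d ^+ i + 5 * th).
  apply: le_trans ns _; move: (d ^+ i) t1' => D D1.
  have t10 : 10 * th <= 1 by rewrite -ler_pdivlMl ?mulr1 ?ltr0n.
  by have := ler_wpM2l (ltW t0) D1; have := ler_wpM2l (ltW t0) t10; have := ltW t0; lra.
move: (d ^+ i) (c i) (s) => D [a e] [f g]; rewrite /nq /= => h4.
have t9 : 0 < 1 - th by rewrite subr_gt0; apply: le_lt_trans t1 _; rewrite invf_lt1 ?ltr1n ?ltr0n.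
rewrite -subr_ge0 -(pmulr_rge0 _ t9).
have := sqr_ge0 ((1 - th) * a - f); have := sqr_ge0 ((1 - th) * e - g).
by nra.
Qed.

Lemma cga_upper : exists2 y, spn p k y &
  norm2sq (u - adjmx X *m y) <= norm2sq u - \sum_(i < k) (d ^+ i - 3 * th).
Proof.
have sp : spn uvec k (comb uvec k (fun i => ((tau i)%:C)%C)) by eexists.
have [y sy Xy] := uvec_spn sp.
exists y => //; rewrite Xy expand lerD2l.
have /andP[_ h] := frameU (fun i => ((tau i)%:C)%C); rewrite lerBlDr; apply: le_trans h _.
rewrite mulr_sumr [leRHS]addrC -sumrB; apply: ler_sum => i _.
set s := ip _ _; have := projU (ltn_ord i); rewrite -/s => he.
have td := tau2 i; have t1' := tau1 i; rewrite nqR td.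
have := abs_re_le (ltW t0) he.
have -> : re ((((tau i)%:C)%C)^* * s) = tau i * re s by case: (s) => a e /=; ring.
have -> : re (s - ((tau i)%:C)%C) = re s - tau i by case: (s) => a e.
move=> h3.
have tau_le : `|tau i| <= 1 by rewrite -(expr_le1 (n := 2))// real_normK ?num_real// td.
have : `|tau i * (re s - tau i)| <= 1 * th by rewrite normrM; apply: ler_pM.
have e0 : 0 <= th * (1 - d ^+ i) by rewrite mulr_ge0 ?subr_ge0// ltW.
by rewrite ler_norml => /andP[h4 _]; have := ltW t0; lra.
Qed.

End Dual.
End InnerProduct.

(** * The iterates as least-squares problems *)

Section Iterates.
Context {R : realType}.
Local Notation C := (R[i]).

Lemma argmin_exists n m (p : nat -> 'cV[C]_n) k (B : 'M[C]_(m, n)) (v : 'cV[C]_m) :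
  exists y, [/\ spn p k y, forall i, (i < k)%N -> ip (B *m p i) (v - B *m y) = 0 &
    forall z, spn p k z -> norm2sq (v - B *m z) = norm2sq (v - B *m y) + norm2sq (B *m (y - z))].
Proof.
pose P := \matrix_(r < n, i < k) p i r 0.
have colP (i : 'I_k) : col i P = p i by apply/matrixP => r j; rewrite ord1 !mxE.
have Pc (a : 'cV[C]_k) : P *m a = \sum_i a i 0 *: p i.
  apply/matrixP => r j; rewrite ord1 mxE summxE; apply: eq_bigr => i _.
  by rewrite !mxE mulrC.
have sP a : spn p k (P *m a).
  by rewrite Pc; apply: spn_sum => i; apply/spnZ/spn_at.
have [a Ha] := proj_exists (B *m P) v; rewrite -mulmxA in Ha.
have G i : (i < k)%N -> ip (B *m p i) (v - B *m (P *m a)) = 0.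
  move=> ik; have := congr1 (fun A : 'cV[C]_k => A (Ordinal ik) 0) Ha; rewrite [in RHS]mxE => <-.
  rewrite -(colP (Ordinal ik)) (_ : B *m col (Ordinal ik) P = col (Ordinal ik) (B *m P)); last by rewrite !colE mulmxA.
  rewrite /ip !mxE; apply: eq_bigr => r _.
  by rewrite !mxE.
exists (P *m a); split=> // z sz.
have orth0 : ip (B *m (P *m a - z)) (v - B *m (P *m a)) = 0.
  have : spn p k (P *m a - z) by rewrite -scaleN1r; apply: spnD => //; exact: spnZ.
  move=> [r ->]; rewrite comb_mul /comb ip_suml big1// => i _.
  by rewrite ipZl G ?mulr0.
have -> : v - B *m z = (v - B *m (P *m a)) + B *m (P *m a - z) by rewrite mulmxBr addrA subrK.
by rewrite norm2sqD ipJ orth0 rmorph0 mulr0 addr0.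
Qed.

(** The vectors [p i] may be dependent and the minimiser not unique, but Pythagoras' identity
    determines its image [B y]. *)
Lemma argmin_galerkin n m (p : nat -> 'cV[C]_n) k (B : 'M[C]_(m, n)) (v : 'cV[C]_m) y :
  spn p k y -> (forall z, spn p k z -> norm2sq (v - B *m y) <= norm2sq (v - B *m z)) ->
  forall i, (i < k)%N -> ip (B *m p i) (v - B *m y) = 0.
Proof.
move=> sy my i ik; have [y0 [s0 g0 n0]] := argmin_exists p k B v.
suff -> : B *m y = B *m y0 by exact: g0.
have := my _ s0; rewrite n0// -[leRHS]addr0 lerD2l => h.
have /norm2sq_eq0 : norm2sq (B *m (y0 - y)) = 0 by apply/eqP; rewrite eq_le h norm2sq_ge0.
by rewrite mulmxBr => /eqP; rewrite subr_eq0 => /eqP ->.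
Qed.

Variables (n m : nat) (X : 'M[C]_(n, m)).
Local Notation W := (X *m adjmx X).

Lemma wnorm2_adj (y : 'cV[C]_n) : wnorm2 W y = norm2sq (adjmx X *m y).
Proof. by rewrite /wnorm2 norm2sq_ip /ip adjM adjK !mulmxA. Qed.

(** [xget] falls back to [0] when no minimiser exists, so existence is what gives the iterate its
    meaning. The energy norm becomes Euclidean after applying [adjmx X]. *)
Lemma cga_iterP (c : 'cV[C]_n) (p : nat -> 'cV[C]_n) k :
  (forall y, krylov W c k y <-> spn p k y) -> let u := adjmx X *m xsol W c in
  spn p k (cga_iter W c k) /\ forall z, spn p k z ->
    norm2sq (u - adjmx X *m cga_iter W c k) <= norm2sq (u - adjmx X *m z).
Proof.
move=> kp u; rewrite /cga_iter; set S := (X in xget _ X).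
have [|h1 h2] := @xgetPex _ 0 S.
  have [y [sy _ ny]] := argmin_exists p k (adjmx X) u; exists y; split; first exact/kp.
  move=> z /kp sz; rewrite !wnorm2_adj !mulmxBr -/u (ny _ sz) lerDl; exact: norm2sq_ge0.
split; first exact/kp.
by move=> z /kp sz; have := h2 z sz; rewrite !wnorm2_adj !mulmxBr.
Qed.

Lemma minres_iterP (c : 'cV[C]_n) (p : nat -> 'cV[C]_n) k :
  (forall y, krylov W c k y <-> spn p k y) ->
  spn p k (minres_iter W c k) /\ forall z, spn p k z ->
    norm2sq (c - W *m minres_iter W c k) <= norm2sq (c - W *m z).
Proof.
move=> kp; rewrite /minres_iter; set S := (X in xget _ X).
have [|h1 h2] := @xgetPex _ 0 S.
  have [y [sy _ ny]] := argmin_exists p k W c; exists y; split; first exact/kp.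
  by move=> z /kp sz; rewrite (ny _ sz) lerDl; exact: norm2sq_ge0.
split; first exact/kp.
by move=> z /kp sz; exact: h2.
Qed.

Variable d : R.
Hypothesis d01 : 0 < d <= 1.

Let sq := Num.sqrt d.
Let sq2 : sq ^+ 2 = d. Proof. by rewrite sqr_sqrtr//; case/andP: d01 => /ltW. Qed.
Let sq0 : sq != 0. Proof. by rewrite gt_eqF// sqrtr_gt0; case/andP: d01. Qed.

Section Left.
Variable b : 'cV[C]_n.
Local Notation p := (ovec sq 1 (1 + d) W b).
Variables (k : nat) (del : R).
Hypothesis del0 : 0 <= del.
Hypothesis Hp : forall i j, (i < k.+1)%N -> (j < k.+1)%N -> nq (ip (p i) (p j) - (i == j)%:R) <= del ^+ 2.

Let kp y : krylov W b k y <-> spn p k y.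
Proof. exact: krylov_spn. Qed.

(** A kernel vector of [L^T], in the bidiagonal factorisation of the limiting Jacobi matrix; hence a
    geometric sequence. *)
Let z i : R := (- sq^-1) ^+ i.

Let z0 : z 0%N = 1. Proof. exact: expr0. Qed.
Let z1 : 1 * z 0%N + sq * z 1%N = 0.
Proof. by rewrite /z expr0 expr1 mulrN mulfV// mulr1 subrr. Qed.
Let zS i : sq * z i + (1 + d) * z i.+1 + sq * z i.+2 = 0.
Proof. by rewrite /z !exprS -sq2; field. Qed.
Let z2 i : z i ^+ 2 = d^-1 ^+ i.
Proof. by rewrite /z exprAC sqrrN (exprVn sq 2) sq2. Qed.

Lemma minres_value : k.+1%:R * del <= 1 ->
  (1 - k.+1%:R * del) / \sum_(i < k.+1) d^-1 ^+ i <= norm2sq (minres_res W b k) <=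
  (1 + k.+1%:R * del) / \sum_(i < k.+1) d^-1 ^+ i.
Proof.
move=> kd; have [sy my] := minres_iterP kp.
have eZ : \sum_(i < k.+1) z i ^+ 2 = \sum_(i < k.+1) d^-1 ^+ i by apply: eq_bigr => i _; exact: z2.
rewrite -eZ; apply/andP; split.
  exact: (minres_lower sq0 z0 z1 zS del0 Hp kd sy).
have [y s1 h1] := minres_upper sq0 z0 z1 zS del0 Hp.
by apply: le_trans h1; exact: my.
Qed.

Variable th : R.
Hypothesis t01 : 0 < th <= 10^-1.

Section Unit.
Hypothesis Wu : W \in unitmx.

Let u := adjmx X *m xsol W b.
Let Xu : X *m u = b.
Proof. by rewrite /u /xsol !mulmxA mulmxV ?mul1mx. Qed.

Lemma cga_res_value : k.+1%:R * del <= th -> (k.+1%:R * del) ^+ 2 <= th ^+ 2 ->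
  k.+1%:R * (\sum_(i < k.+1) d^-1 ^+ i) * (k.+1%:R * del) ^+ 2 <= th ^+ 2 * d^-1 ^+ k ->
  `|d^-1 ^+ k * norm2sq (cga_res W b k) - 1| <= 10 * th.
Proof.
move=> h1 h2 h3; have [sy my] := cga_iterP kp.
have eZ : \sum_(i < k.+1) z i ^+ 2 = \sum_(i < k.+1) d^-1 ^+ i by apply: eq_bigr => i _; exact: z2.
rewrite -z2; apply: (galerkin_res sq0 z0 z1 zS del0 Hp t01 sy); rewrite ?eZ ?z2//.
  move=> i ik; have := argmin_galerkin sy my ik.
  by rewrite -ipM mulmxBr -/u Xu !mulmxA.
by rewrite exprn_gt0// invr_gt0; case/andP: d01.
Qed.

Hypothesis dth : uconst k * del ^+ 2 <= (th / k.+1%:R) ^+ 2.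

Lemma cga_err_value :
  [/\ norm2sq u - \sum_(i < k) (d ^+ i + 5 * th) <= wnorm2 W (cga_err W b k),
      wnorm2 W (cga_err W b k) <= norm2sq u - \sum_(i < k) (d ^+ i - 3 * th) &
      \sum_(i < k) (d ^+ i - 3 * th) <= norm2sq u].
Proof.
have [sy my] := cga_iterP kp; rewrite wnorm2_adj /cga_err mulmxBr -/u.
have [y s1 h1] := cga_upper d01 Hp t01 dth Xu; split.
- exact: (cga_lower d01 Hp t01 dth Xu sy).
- by apply: le_trans h1; exact: my.
- by rewrite -subr_ge0; apply: le_trans h1; exact: norm2sq_ge0.
Qed.

End Unit.
End Left.

Section Right.
Variable b : 'cV[C]_m.
Local Notation p := (ovec sq d (1 + d) (adjmx X *m X) b).
Variables (k : nat) (del : R).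
Hypothesis del0 : 0 <= del.
Hypothesis Hp : forall i j, (i < k.+1)%N -> (j < k.+1)%N -> nq (ip (p i) (p j) - (i == j)%:R) <= del ^+ 2.
Hypothesis Wu : W \in unitmx.

Let z i : R := (- sq) ^+ i.
Let z0 : z 0%N = 1. Proof. exact: expr0. Qed.
Let z1 : d * z 0%N + sq * z 1%N = 0.
Proof. by rewrite /z expr0 expr1 mulrN -expr2 sq2 mulr1 subrr. Qed.
Let zS i : sq * z i + (1 + d) * z i.+1 + sq * z i.+2 = 0.
Proof. by rewrite /z !exprS -sq2; ring. Qed.
Let z2 i : z i ^+ 2 = d ^+ i. Proof. by rewrite /z exprAC sqrrN sq2. Qed.

Lemma mulX_power j : W ^+ j *m X = X *m (adjmx X *m X) ^+ j.
Proof.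
elim: j => [|j IH]; first by rewrite !expr0 mul1mx mulmx1.
by rewrite exprS -mulmxA IH exprS !mulmxA.
Qed.

(** Since [W^j X = X (adjmx X *m X)^j], the Krylov space of the normal equations is the image under
    [X] of a Krylov space on the other side. *)
Let kp y : krylov W (X *m b) k y <-> spn (fun i => X *m p i) k y.
Proof.
have kr w : krylov (adjmx X *m X) b k w <-> spn p k w by exact: krylov_spn.
split.
  move=> [a ->]; have /kr [r Hr] : krylov (adjmx X *m X) b k (\sum_(j < k) a j *: ((adjmx X *m X) ^+ j *m b)) by exists a.
  exists r; rewrite -comb_mul -Hr mulmx_sumr; apply: eq_bigr => j _.
  by rewrite -scalemxAr !mulmxA mulX_power.
move=> [r ->]; have /kr [a Ha] : spn p k (comb p k r) by exists r.
exists a; rewrite -comb_mul Ha mulmx_sumr; apply: eq_bigr => j _.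
by rewrite -scalemxAr !mulmxA mulX_power.
Qed.

Definition rproj : 'cV[C]_m := adjmx X *m xsol W (X *m b).

Let Xu : X *m rproj = X *m b.
Proof. by rewrite /rproj /xsol !mulmxA mulmxV ?mul1mx. Qed.

Let pyth y : norm2sq (b - adjmx X *m y) = norm2sq (rproj - adjmx X *m y) + norm2sq (b - rproj).
Proof.
have -> : b - adjmx X *m y = (rproj - adjmx X *m y) + (b - rproj) by rewrite [RHS]addrC addrA subrK.
rewrite norm2sqD [X in ip X](_ : _ = adjmx X *m (xsol W (X *m b) - y)); last by rewrite mulmxBr.
by rewrite -ipM mulmxBr Xu subrr /ip mulmx0 mxE mulr0 addr0.
Qed.

Lemma norm2sq_rproj : norm2sq b = norm2sq rproj + norm2sq (b - rproj).
Proof. by have := pyth 0; rewrite mulmx0 !subr0. Qed.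

(** [rproj] is the orthogonal projection of [b] onto the range of [adjmx X]. By Pythagoras'
    identity, minimising the energy error amounts to minimising [|b - adjmx X *m y|], which is
    MINRES for [adjmx X *m X] and [b]; the squared distance [v] is the price. *)
Lemma cga_normal_value : k.+1%:R * del <= 1 -> let v := norm2sq (b - rproj) in
  [/\ (1 - k.+1%:R * del) / \sum_(i < k.+1) d ^+ i <= wnorm2 W (cga_err W (X *m b) k) + v,
      wnorm2 W (cga_err W (X *m b) k) + v <= (1 + k.+1%:R * del) / \sum_(i < k.+1) d ^+ i &
      v <= (1 + k.+1%:R * del) / \sum_(i < k.+1) d ^+ i].
Proof.
move=> kd v; have [sy my] := cga_iterP kp; rewrite wnorm2_adj /cga_err mulmxBr -/rproj -pyth.
have eZ : \sum_(i < k.+1) z i ^+ 2 = \sum_(i < k.+1) d ^+ i by apply: eq_bigr => i _; exact: z2.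
have spX y : spn (fun i => X *m p i) k y -> exists2 w, spn p k w & y = X *m w.
  by move=> [r ->]; exists (comb p k r); [exists r|rewrite comb_mul].
have [w sw ew] := spX _ sy.
have [w' sw' h1] := minres_upper sq0 z0 z1 zS del0 Hp.
have sw2 : spn (fun i => X *m p i) k (X *m w').
  by case: sw' => r ->; rewrite comb_mul; exists r.
rewrite -eZ; split.
- rewrite ew mulmxA; exact: (minres_lower sq0 z0 z1 zS del0 Hp kd sw).
- apply: le_trans h1; rewrite -mulmxA (pyth (cga_iter _ _ _)) (pyth (X *m w')) lerD2r; exact: my.
- by apply: le_trans h1; rewrite -mulmxA (pyth (X *m w')) lerDr norm2sq_ge0.
Qed.

End Right.
End Iterates.

(** * Anti-concentration *)

Section BooleanEvents.
Context {R : realType} {n m : nat}.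
Local Notation C := (R[i]).
Local Notation MX := (@MX R n m).
Variable mu : probability MX R.

Definition mev (b : MX -> bool) := measurable [set x : MX | b x].
(** A probability is the expectation of a boolean, so it is a real number and obeys the rules for
    [E]. *)
Definition Pr (b : MX -> bool) : R := E mu (fun x => (b x)%:R).

Lemma mev_fun b : mev b -> measurable_fun setT (fun x => (b x)%:R : R).
Proof.
move=> mb; rewrite (_ : (fun x => _) = (\1_[set x | b x] : MX -> R)); first exact: measurable_indic.
apply/funext => x; rewrite indicE; case bx: (b x); first by rewrite mem_set.
by rewrite memNset//= bx.
Qed.

Lemma LL_mev b : mev b -> LL mu (fun x => (b x)%:R).
Proof.
move=> mb; apply: (@LL_bnd _ _ _ _ 1); first exact: mev_fun.
by move=> x; case: (b x); rewrite ?normr1 ?normr0.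
Qed.

Lemma mev_neg b : mev b -> mev (fun x => ~~ b x).
Proof.
move=> mb; rewrite /mev (_ : [set x | _] = ~` [set x | b x]); first exact: measurableC.
by apply/seteqP; split=> x /=; [move/negP|move/negP].
Qed.

Lemma mev_and a b : mev a -> mev b -> mev (fun x => a x && b x).
Proof.
move=> ma mb; rewrite /mev (_ : [set x | _] = [set x | a x] `&` [set x | b x]); first exact: measurableI.
by apply/seteqP; split=> x /=; [move/andP|move=> h; exact/andP].
Qed.

Lemma mev_cst c : mev (fun=> c).
Proof.
rewrite /mev; case: c; first by rewrite (_ : [set x | _] = setT)//; apply/seteqP; split.
by rewrite (_ : [set x | _] = set0)//; apply/seteqP; split.
Qed.

Lemma mev_or a b : mev a -> mev b -> mev (fun x => a x || b x).
Proof.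
move=> ma mb; rewrite (_ : (fun x => _) = (fun x => ~~ (~~ a x && ~~ b x))).
  by apply: mev_neg; apply: mev_and; exact: mev_neg.
by apply/funext => x; rewrite negb_and !negbK.
Qed.

Lemma mev_has (I : Type) (s : seq I) (b : I -> MX -> bool) : (forall i, mev (b i)) -> mev (fun x => has (fun i => b i x) s).
Proof.
by move=> h; elim: s => [|i s IH] /=; [exact: mev_cst|exact: mev_or].
Qed.

Lemma mev_all (I : Type) (s : seq I) (b : I -> MX -> bool) : (forall i, mev (b i)) -> mev (fun x => all (fun i => b i x) s).
Proof.
by move=> h; elim: s => [|i s IH] /=; [exact: mev_cst|exact: mev_and].
Qed.

Lemma mev_eq (Y : MX -> C) t : CLL mu Y -> mev (fun x => Y x == t).
Proof.
move=> [[mr _] [mi _]].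
rewrite (_ : (fun x => _) = (fun x => (re (Y x) == re t) && (im (Y x) == im t))).
  have h (f : MX -> R) c : measurable_fun setT f -> mev (fun x => f x == c).
    move=> mf; rewrite /mev (_ : [set x | _] = setT `&` f @^-1` [set c]).
      exact: mf.
    by rewrite setTI; apply/seteqP; split=> x /=; [move/eqP|move->].
  by apply: mev_and; exact: h.
by apply/funext => x; case: (Y x) => a b; case: t => c e; rewrite eq_complex.
Qed.

Lemma Pr_ge0 b : 0 <= Pr b. Proof. by apply: E_ge0 => x; case: (b x). Qed.

Lemma Pr_le a b : mev a -> mev b -> (forall x, a x -> b x) -> Pr a <= Pr b.
Proof.
move=> ma mb h; apply: E_le; try exact: LL_mev.
by move=> x; have := h x; case: (a x) => [->|_]; rewrite ?lexx//; case: (b x).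
Qed.

Lemma Pr_le1 b : mev b -> Pr b <= 1.
Proof.
move=> mb; rewrite -[leRHS](E_cst mu 1); apply: E_le; [exact: LL_mev|exact: LL_cst|].
by move=> x; case: (b x).
Qed.

Lemma Pr_or a b : mev a -> mev b -> Pr (fun x => a x || b x) <= Pr a + Pr b.
Proof.
move=> ma mb; rewrite -E_add; try exact: LL_mev; apply: E_le; first by apply: LL_mev; exact: mev_or.
  by apply: LLD; exact: LL_mev.
by move=> x; case: (a x); case: (b x) => /=; lra.
Qed.

Lemma Pr_neg b : mev b -> Pr (fun x => ~~ b x) = 1 - Pr b.
Proof.
move=> mb; rewrite -[in RHS](E_cst mu 1) -E_sub; [|exact: LL_cst|exact: LL_mev].
by apply: E_ext => x; case: (b x); rewrite /= ?subrr ?subr0.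
Qed.

Lemma Pr_has (I : Type) (s : seq I) (b : I -> MX -> bool) p : (forall i, mev (b i)) ->
  (forall i, Pr (b i) <= p) -> Pr (fun x => has (fun i => b i x) s) <= (size s)%:R * p.
Proof.
move=> mb hp; elim: s => [|i s IH] /=.
  by rewrite mul0r /Pr E_cst.
apply: le_trans (Pr_or (mb i) (mev_has s mb)) _.
by rewrite -natr1 mulrDl mul1r addrC; apply: lerD.
Qed.

Lemma Pr_False b : (forall x, ~~ b x) -> Pr b = 0.
Proof. by move=> h; rewrite -(E_cst mu 0); apply: E_ext => x; rewrite (negbTE (h x)). Qed.

Hypothesis ind : indep_entries mu.

Lemma measurable_mix_fix S x : measurable_fun setT (mix S x : MX -> MX).
Proof.
rewrite (_ : mix S x = (fun w : MX * MX => mix S w.1 w.2) \o (fun y => (x, y)))//.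
apply: measurableT_comp; first exact: measurable_mix.
by apply: measurable_fun_pair; [exact: measurable_cst|exact: measurable_id].
Qed.

Lemma mev_mix S b x : mev b -> mev (fun y => b (mix S x y)).
Proof. by move=> mb; have := measurable_mix_fix S x measurableT mb; rewrite setTI. Qed.

(** Conditioning on the entries outside [S]: they are frozen at [x], while those in [S] are drawn
    afresh from [y]. *)
Lemma E_mix S (f : MX -> R) : measurable_fun setT f -> (forall x, 0 <= f x <= 1) ->
  LL mu (fun x => E mu (fun y => f (mix S x y))) /\
  E mu f = E mu (fun x => E mu (fun y => f (mix S x y))).
Proof.
move=> mf f01.
have mE : measurable_fun setT (fun x => (f x)%:E) by exact/measurable_EFinP.
have mg x : measurable_fun setT (fun y => f (mix S x y)).
  by apply: (measurableT_comp mf); exact: measurable_mix_fix.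
have fn x : `|f x| <= 1 by have /andP[a b] := f01 x; rewrite ger0_norm.
have lg x : LL mu (fun y => f (mix S x y)) by exact: LL_bnd (mg x) (fun y => fn _).
have eg x : (\int[mu]_y (f (mix S x y))%:E = (E mu (fun y => f (mix S x y)))%:E)%E.
  by rewrite /E /Rintegral fineK//; apply: integrable_fin_num => //; exact: LL_int.
have e1 : (\int[mu]_x (f x)%:E = \int[mu]_x (E mu (fun y => f (mix S x y)))%:E)%E.
  rewrite (mix_integral2 ind S mE); last by move=> x; rewrite lee_fin; case/andP: (f01 x).
  by apply: eq_integral => x _; rewrite eg.
split; last by rewrite /E /Rintegral e1.
apply: (@LL_bnd _ _ _ _ 1); last first.
  move=> x; apply: le_trans (E_norm (lg x)) _; rewrite -[leRHS](E_cst mu 1).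
  apply: E_le; [|exact: LL_cst|by move=> y].
  by apply: (@LL_bnd _ _ _ _ 1) => [|y]; [exact: measurableT_comp|rewrite normr_id].
have := @measurable_fun_fubini_tonelli_F _ _ _ _ _ mu (fun w : MX * MX => (f (mix S w.1 w.2))%:E).
rewrite /fubini_F => h; apply/measurable_EFinP.
rewrite (_ : EFin \o _ = (fun x => \int[mu]_y (f (mix S x y))%:E)%E); last by apply/funext => x; rewrite /= eg.
apply: h.
  by apply: (measurableT_comp mE); exact: measurable_mix.
by move=> w; rewrite lee_fin; case/andP: (f01 (mix S w.1 w.2)).
Qed.

Lemma Pr_mix S b (f : MX -> R) : mev b -> LL mu f ->
  (forall x, Pr (fun y => b (mix S x y)) <= f x) -> Pr b <= E mu f.
Proof.
move=> mb lf h; have b01 x : 0 <= ((b x)%:R : R) <= 1 by case: (b x); rewrite ?ler01 ?lexx.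
rewrite [leLHS]/Pr; have [l ->] := @E_mix S (fun x => (b x)%:R) (mev_fun mb) b01.
by apply: E_le.
Qed.

Lemma Pr_mix_le S b p : mev b -> (forall x, Pr (fun y => b (mix S x y)) <= p) -> Pr b <= p.
Proof. by move=> mb h; rewrite -(E_cst mu p); apply: (Pr_mix mb (LL_cst _ _) h). Qed.

End BooleanEvents.

Section AntiConcentration.
Context {R : realType} {n m : nat}.
Local Notation C := (R[i]).
Local Notation MX := (@MX R n m).
Variables (kap : nat -> R) (mu : probability MX R).
Hypothesis m0 : (0 < m)%N.
Hypothesis gl : good_law kap mu.

Let ind : indep_entries mu. Proof. by case: gl. Qed.

(** A lower bound for the probability that an entry avoids a prescribed value, uniform in the value
    and the dimensions. The factor [8 kap 2] bounds the fourth moment of an entry minus a constant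
    by the square of its second moment. *)
Definition spread : R := (8 * kap 2)^-1.

Let kap1 : 1 <= kap 2. Proof. by case: gl. Qed.
Let kap0 : 0 < 8 * kap 2. Proof. by rewrite mulr_gt0// (lt_le_trans ltr01). Qed.

Lemma spread_gt0 : 0 < spread. Proof. by rewrite invr_gt0. Qed.
Lemma spread_le1 : spread <= 1.
Proof. by rewrite invf_le1//; have := kap1; lra. Qed.

Let sp1 : 0 <= 1 - spread. Proof. by rewrite subr_ge0 spread_le1. Qed.

Definition co (q : 'I_n * 'I_m) (A : MX) : C := coord q.1 q.2 A.
Definition offp (q : 'I_n * 'I_m) : MX -> MX -> Prop := off q.1 q.2.

Lemma CLL_co q : CLL mu (co q).
Proof. by case: gl => _ _ /(_ q.1 q.2) []. Qed.

(* Paley-Zygmund for the second and fourth moments of [coord i j - t]. *)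
Lemma co_neq q t : Pr mu (fun y => co q y == t) <= 1 - spread.
Proof.
case: gl => _ _ /(_ q.1 q.2) [cc er ei en ep].
have cX := CLL_co q; have cY : CLL mu (fun y => co q y - t) by apply: CLLB => //; exact: CLL_cst.
have mb := mev_eq t cX.
suff : spread <= Pr mu (fun y => co q y != t) by have := Pr_neg mu mb; lra.
set v := m%:R^-1 + nq t; set K := 8 * kap 2.
have mi : 0 < m%:R^-1 :> R by rewrite invr_gt0 ltr0n.
have v0 : 0 < v by rewrite ltr_pwDl//; nneg.
have lX : LL mu (fun y => nq (co q y)) by exact: LL_nq.
have lY : LL mu (fun y => nq (co q y - t)) by exact: LL_nq.
have [lr li] := cX.
have e1 : E mu (fun y => nq (co q y - t)) = v.
  rewrite (_ : (fun y => _) = (fun y => nq (co q y) - (2 * re t * re (co q y) + 2 * im t * im (co q y)) + nq t)).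
    have l2 : LL mu (fun y => 2 * re t * re (co q y) + 2 * im t * im (co q y)).
      by apply: LLD; apply: LLZ.
    rewrite (E_add (LLB lX l2) (LL_cst mu _)) (E_sub lX l2) (E_add (LLZ _ lr) (LLZ _ li)).
    by rewrite (E_scale _ lr) (E_scale _ li) er ei en E_cst !mulr0 addr0 subr0.
  by apply/funext => y; rewrite /nq; case: (co q y) => a b; case: (t) => e f /=; ring.
have e2 : E mu (fun y => nq (co q y - t) ^+ 2) <= K * v ^+ 2.
  apply: (@le_trans _ _ (E mu (fun y => 8 * nq (co q y) ^+ 2 + 8 * nq t ^+ 2))).
    apply: E_le; first exact: LLX.
      by apply: LLD; [apply: LLZ; exact: LLX|exact: LL_cst].
    move=> y; have h : nq (co q y - t) <= 2 * (nq (co q y) + nq t).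
      have := @nqD_weighted R 1 1 (co q y) (- t) ltr01 ltr01.
      by rewrite nqN expr1n !divr1 !mul1r -mulr2n.
    have a0 : 0 <= nq (co q y) by nneg. have b0 : 0 <= nq t by nneg.
    have c0 : 0 <= nq (co q y - t) by nneg.
    move: (nq (co q y - t)) (nq (co q y)) (nq t) h a0 b0 c0 => x y' z h a0 b0 c0.
    apply: (@le_trans _ _ ((2 * (y' + z)) ^+ 2)); first by rewrite ler_sqr ?nnegrE; lra.
    by have := sqr_ge0 (y' - z); lra.
  rewrite E_add; [|by apply: LLZ; exact: LLX|exact: LL_cst].
  rewrite E_cst E_scale; last exact: LLX.
  have h2 := ep 2%N; rewrite -/(co q _) in h2.
  have b0 : 0 <= nq t by nneg.
  apply: (@le_trans _ _ (8 * (kap 2 * m%:R^-1 ^+ 2) + 8 * nq t ^+ 2)); first by rewrite lerD2r ler_wpM2l.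
  rewrite /K /v; move: (m%:R^-1) (nq t) mi b0 => x z x0 z0.
  have zz : 0 <= x * z by rewrite mulr_ge0// ltW.
  have := ler_wpM2r (sqr_ge0 z) kap1; have : 0 <= kap 2 * (x * z) by rewrite mulr_ge0// (le_trans ler01).
  by rewrite mul1r; lra.
have D0 : 0 <= (2 * K * v)^-1.
  by rewrite invr_ge0; apply: mulr_ge0; [apply: mulr_ge0 => //; exact: ltW kap0|exact: ltW].
(* Integrates [y <= y^2 / (2 K v) + (K v / 2) 1_(y <> 0)], an arithmetic-geometric mean inequality
   for [y = |co q - t|^2]; the value [2 K v] leaves exactly [v / 2] for the second term. *)
have h : v <= (2 * K * v)^-1 * (K * v ^+ 2) + (K * v / 2) * Pr mu (fun y => co q y != t).
  rewrite -[leLHS]e1; apply: (@le_trans _ _ (E mu (fun y => (2 * K * v)^-1 * nq (co q y - t) ^+ 2 + (K * v / 2) * (co q y != t)%:R))).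
    apply: E_le => //.
      by apply: LLD; apply: LLZ; [exact: LLX|apply: LL_mev; exact: mev_neg].
    move=> y; case: (eqVneq (co q y) t) => [->|_]; first by rewrite subrr nq0 expr0n !mulr0 addr0.
    rewrite mulr1 -subr_ge0.
    rewrite (_ : _ - _ = (2 * K * v)^-1 * (nq (co q y - t) - K * v) ^+ 2).
      by rewrite mulr_ge0 ?sqr_ge0.
    by field; rewrite !gt_eqF.
  have lm := LL_mev mu (mev_neg mb).
  rewrite (E_add (LLZ _ (LLX 2 lY)) (LLZ _ lm)) (E_scale _ (LLX 2 lY)) (E_scale _ lm).
  by rewrite lerD2r ler_wpM2l.
have e3 : (2 * K * v)^-1 * (K * v ^+ 2) = v / 2 by field; rewrite !gt_eqF.
rewrite e3 in h.
have h' : v / 2 <= v / 2 * (K * Pr mu (fun y => co q y != t)).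
  by rewrite mulrA (mulrAC v) (mulrC v) [leRHS](_ : _ = K * v / 2 * Pr mu (fun y => co q y != t)); [lra|ring].
have v2 : 0 < v / 2 by rewrite divr_gt0.
by move: h'; rewrite -{1}[v / 2]mulr1 ler_pM2l// /spread -/K => h'; rewrite -div1r ler_pdivrMr// mulrC.
Qed.

Section Forced.
Variables (I : eqType) (pos : I -> 'I_n * 'I_m) (La : I -> MX -> C).
Hypothesis pos_inj : injective pos.
Hypothesis cLa : forall a, CLL mu (La a).
Hypothesis bLa : forall a a', blind (offp (pos a')) (fun A => La a A - co (pos a) A).

Lemma mix_off (S : 'I_n -> 'I_m -> bool) q x y : (forall i j, S i j = ((i, j) == q)) -> offp q (mix S x y) x.
Proof.
by move=> h i j; rewrite -surjective_pairing => /negbTE ij; rewrite /coord mxE h ij.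
Qed.

(** Given all other entries, [La a = 0] prescribes the entry at [pos a], and this entry occurs in
    none of the other equations. Each equation therefore costs an independent factor. *)
Lemma forced s : uniq s -> Pr mu (fun A => all (fun a => La a A == 0) s) <= (1 - spread) ^+ size s.
Proof.
have ms a : mev (fun A => La a A == 0) := mev_eq 0 (cLa a).
elim: s => [|a s IH] /=; first by move=> _; rewrite /Pr E_cst.
move=> /andP[as_ us].
pose f A := (1 - spread) * (all (fun a => La a A == 0) s)%:R : R.
have lf : LL mu f by apply: LLZ; apply: LL_mev; exact: mev_all.
pose S i j := (i, j) == pos a.
have mb : mev (fun A => (La a A == 0) && all (fun a => La a A == 0) s) by apply: mev_and => //; exact: mev_all.
apply: le_trans (Pr_mix ind (S := S) mb lf _) _; last first.
  rewrite /f E_scale; last by apply: LL_mev; exact: mev_all.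
  by rewrite exprS ler_wpM2l// IH.
move=> x.
have o y : offp (pos a) (mix S x y) x by exact: mix_off.
have cs y : co (pos a) (mix S x y) = co (pos a) y by rewrite /co /coord mxE /S -surjective_pairing eqxx.
have e1 y : La a (mix S x y) = co (pos a) y + (La a x - co (pos a) x).
  by rewrite -(@bLa a a _ _ (o y)) cs addrCA subrr addr0.
have e2 a' y : a' \in s -> La a' (mix S x y) = La a' x.
  move=> a's; have aa : a' != a by apply: contraNneq as_ => <-.
  have := @bLa a' a _ _ (o y).
  have -> : co (pos a') (mix S x y) = co (pos a') x.
    rewrite /co; apply: (o y); rewrite -!surjective_pairing.
    by rewrite (inj_eq pos_inj).
  by move/addIr.
have e3 y : all (fun a => La a (mix S x y) == 0) s = all (fun a => La a x == 0) s.
  by apply: eq_in_all => a' a's; rewrite e2.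
rewrite /f; case: (all (fun a => La a x == 0) s) e3 => e3; last first.
  by rewrite mulr0 Pr_False// => y; rewrite e3 andbF.
rewrite mulr1; apply: le_trans (co_neq (pos a) (- (La a x - co (pos a) x))).
have h y : (La a (mix S x y) == 0) && all (fun a => La a (mix S x y) == 0) s = (co (pos a) y == - (La a x - co (pos a) x)).
  by rewrite e3 andbT e1 addr_eq0.
by rewrite /Pr; under [X in E _ X]eq_fun => y do rewrite h.
Qed.

End Forced.

Definition vecp q (pos : 'I_q -> 'I_n * 'I_m) (A : MX) : 'rV[C]_q := \row_t co (pos t) A.

(** An inequality of Odlyzko type: each of the linear equations of [V] prescribes one entry. The
    equations are first brought to a form where every pivot entry occurs in only one of them. *)
Lemma subspace_bound p q (pos : 'I_q -> 'I_n * 'I_m) (V : 'M[C]_(p, q)) (b : MX -> bool) :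
  injective pos -> mev b -> (forall y, b y -> (vecp pos y <= V)%MS) ->
  Pr mu b <= (1 - spread) ^+ (q - \rank V).
Proof.
move=> pi mb bV; set Kc := cokermx V.
pose f := maxrankfun Kc; pose B := rowsub f Kc.
have fB : row_free B := maxrowsub_free _.
have rK : \rank Kc = (q - \rank V)%N by rewrite mxrank_coker.
(* The pivot rows [f a] of the equation matrix become the identity after this change of basis of the
   equations. *)
pose Q := Kc *m pinvmx B.
have Qf a' a : Q (f a') a = (a' == a)%:R.
  have : (B *m pinvmx B) a' a = (1%:M : 'M[C]_(\rank Kc)) a' a by rewrite mulmxVp.
  rewrite [in RHS]mxE => <-; rewrite !mxE; apply: eq_bigr => t _; by rewrite /B !mxE.
pose La a A := (vecp pos A *m Q) 0 a.
have LaE a A : La a A = \sum_t co (pos t) A * Q t a.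
  by rewrite /La mxE; apply: eq_bigr => t _; rewrite mxE.
have cLa a : CLL mu (La a).
  apply: (@CLL_eq _ _ _ _ (fun A => \sum_t co (pos t) A * Q t a)); first by move=> A; rewrite LaE.
  by apply: CLL_sum => t _; apply: CLLM; [exact: CLL_co|exact: CLL_cst].
have bLa a a' : blind (offp (pos (f a'))) (fun A => La a A - co (pos (f a)) A).
  move=> A A' o; rewrite !LaE (bigD1 (f a'))//= [in RHS](bigD1 (f a'))//= !Qf.
  have eo t : t != f a' -> co (pos t) A = co (pos t) A'.
    by move=> tf; apply: o; rewrite -!surjective_pairing (inj_eq pi).
  rewrite (eq_bigr (fun t => co (pos t) A' * Q t a)) => [|t tf]; last by rewrite eo.
  case: (eqVneq a' a) => [->|aa]; first by rewrite !mulr1 [X in X - _ = _]addrC [X in _ = X - _]addrC !addrK.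
  rewrite !mulr0 !add0r; congr (_ - _); apply: eo.
  by rewrite (inj_eq (@maxrankfun_inj _ _ _ Kc)) eq_sym.
have pi' : injective (fun a => pos (f a)) by move=> a a' /pi; exact: maxrankfun_inj.
have mall : mev (fun A => all (fun a => La a A == 0) (enum 'I_(\rank Kc))).
  by apply: mev_all => a; exact: mev_eq.
apply: le_trans (Pr_le mu mb mall _) _.
  move=> y /bV; rewrite submxE => /eqP e; apply/allP => a _.
  by rewrite /La /Q mulmxA e mul0mx mxE.
apply: le_trans (forced pi' cLa bLa (enum_uniq _)) _.
by rewrite size_enum_ord rK.
Qed.

End AntiConcentration.

(** * Invertibility *)

Section LazyWalk.
Context {R : realType}.
Variable c : R.
Hypothesis c01 : 0 < c <= 1.

Let c0 : 0 < c. Proof. by case/andP: c01. Qed.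
Let c1 : c <= 1. Proof. by case/andP: c01. Qed.

(* Survival probability after [L] steps of the lazy walk killed at [0]. *)
Fixpoint surv L s : R :=
  if L is L'.+1 then
    if s is s'.+1 then (1 - c) * surv L' s + c / 2 * (surv L' s.+1 + surv L' s') else 0
  else (0 < s)%N%:R.

Lemma surv0 L : surv L 0 = 0. Proof. by case: L. Qed.

Lemma surv_ge0 L s : 0 <= surv L s.
Proof.
elim: L s => [|L IH] s; first exact: ler0n.
case: s => [|s] //=.
by rewrite addr_ge0// mulr_ge0 ?subr_ge0 ?addr_ge0 ?IH// divr_ge0// ltW.
Qed.

(** Concavity in the starting point is preserved by the step of the walk; it yields monotonicity in
    [L] and drives the induction in [littlewood_offord]. *)
Lemma surv_concave L s : surv L s.+2 + surv L s <= 2 * surv L s.+1.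
Proof.
elim: L s => [|L IH] s; first by case: s => [|s] /=; lra.
have h := ltW c0; have h' := c1.
case: s => [|s] /=.
  have i0 := IH 0%N; have i1 := IH 1%N; rewrite surv0 addr0 in i0; rewrite surv0 !addr0.
  have : 0 <= (1 - c) * (2 * surv L 1 - surv L 2) by rewrite mulr_ge0 ?subr_ge0.
  have : 0 <= c / 2 * (2 * surv L 2 - (surv L 3 + surv L 1)) by rewrite mulr_ge0 ?subr_ge0 ?divr_ge0.
  lra.
have i0 := IH s; have i1 := IH s.+1; have i2 := IH s.+2.
have : 0 <= (1 - c) * (2 * surv L s.+2 - (surv L s.+3 + surv L s.+1)) by rewrite mulr_ge0 ?subr_ge0.
have : 0 <= c / 2 * (2 * surv L s.+3 - (surv L s.+4 + surv L s.+2)) by rewrite mulr_ge0 ?subr_ge0 ?divr_ge0.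
have : 0 <= c / 2 * (2 * surv L s.+1 - (surv L s.+2 + surv L s)) by rewrite mulr_ge0 ?subr_ge0 ?divr_ge0.
lra.
Qed.

Lemma surv_decS L s : surv L.+1 s <= surv L s.
Proof.
case: s => [|s]; first by rewrite !surv0.
rewrite /= -subr_ge0 (_ : _ - _ = c / 2 * (2 * surv L s.+1 - (surv L s.+2 + surv L s))); last by field.
by rewrite mulr_ge0 ?subr_ge0 ?surv_concave// divr_ge0// ltW.
Qed.

Lemma surv_dec L L' s : (L <= L')%N -> surv L' s <= surv L s.
Proof. by move=> /subnK <-; elim: (L' - L)%N => [//|k IH]; apply: le_trans IH; exact: surv_decS. Qed.

(** The monotone limit is harmonic for the walk and vanishes at [0], so it is linear in the starting
    point; being at most [1], it is zero. *)
Lemma surv_cvg0 : surv^~ 1%N @ \oo --> 0.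
Proof.
have cv s : cvgn (surv^~ s).
  apply: nonincreasing_is_cvgn; first by move=> i j ij; exact: surv_dec.
  by exists 0 => _ [L _ <-]; exact: surv_ge0.
pose l s := limn (surv^~ s).
have ls s : surv^~ s @ \oo --> l s by exact: cv.
have l0 : l 0%N = 0.
  by apply/cvg_lim => //; rewrite (_ : surv^~ 0%N = fun=> 0); [exact: cvg_cst|apply/funext => L; exact: surv0].
have step s : l s.+2 + l s = 2 * l s.+1.
  have h : l s.+1 = (1 - c) * l s.+1 + c / 2 * (l s.+2 + l s).
    have h1 : (fun L => surv L.+1 s.+1) @ \oo --> l s.+1 by rewrite (cvg_shiftS (surv^~ s.+1)); exact: ls.
    apply: (cvg_unique _ h1); rewrite //=.
    by apply: cvgD; [apply: cvgMr|apply: cvgMr; apply: cvgD]; exact: ls.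
  have : c / 2 * (l s.+2 + l s - 2 * l s.+1) = 0 by move: h; lra.
  by move/eqP; rewrite mulf_eq0 (gt_eqF (divr_gt0 c0 _))//= subr_eq0 => /eqP.
have lin s : l s = s%:R * l 1%N /\ l s.+1 = s.+1%:R * l 1%N.
  elim: s => [|s [IH0 IH1]]; first by rewrite l0 mul0r mul1r.
  split=> //; have := step s; rewrite IH0 IH1 -(natr1 s.+1) -(natr1 s); lra.
have lge0 : 0 <= l 1%N by apply: limr_ge => //; apply: nearW => L; exact: surv_ge0.
have lle s : l s <= 1.
  apply: limr_le => //; apply: nearW => L; apply: le_trans (surv_dec s (leq0n L)) _ => /=.
  by case: (0 < s)%N.
suff -> : 0 = l 1%N by exact: ls.
apply/esym/eqP; rewrite eq_le lge0 andbT leNgt; apply/negP => l1.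
have := lle (Num.bound (l 1%N)^-1).
have [-> _] := lin (Num.bound (l 1%N)^-1).
have := archi_boundP (x := (l 1%N)^-1); rewrite invr_ge0 => /(_ (ltW l1)).
by rewrite -(ltr_pM2r l1) mulVf ?gt_eqF// ltNge => /negP.
Qed.

End LazyWalk.

(** * Littlewood-Offord bound and linear dependence of random rows *)

Section Dependence.
Context {R : realType} {n m : nat}.
Local Notation C := (R[i]).
Local Notation MX := (@MX R n m).
Variables (kap : nat -> R) (mu : probability MX R).
Hypothesis m0 : (0 < m)%N.
Hypothesis gl : good_law kap mu.

Let ind : indep_entries mu. Proof. by case: gl. Qed.
Let c := spread kap.
Let c0 : 0 < c. Proof. exact: spread_gt0 gl. Qed.
Let c1 : c <= 1. Proof. exact: spread_le1 gl. Qed.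
Let c01 : 0 < c <= 1. Proof. by rewrite c0 c1. Qed.

Local Notation co := (@co R n m).

Lemma mev_in (Y : MX -> C) (B : seq C) : CLL mu Y -> mev (fun x => Y x \in B).
Proof.
move=> cY; rewrite (_ : (fun x => _) = (fun x => has (fun z => Y x == z) B)).
  by apply: (mev_has B (b := fun z x => Y x == z)) => w; exact: (mev_eq w cY).
by apply/funext => A; apply/idP/hasP => [h|[w wB /eqP ->]//]; exists (Y A).
Qed.

(** A nonempty finite set is not invariant under a nonzero translation: compare the sums of its
    elements. *)
Lemma mem_shift_exists (B : seq C) u v : uniq B -> B != [::] -> u != v ->
  exists2 z, z \in [seq x - u | x <- B] & z \notin [seq x - v | x <- B].
Proof.
move=> uB B0 uv; apply/hasP; apply: contraT; rewrite -all_predC => /allP h.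
have injs w : injective (fun x : C => x - w) by move=> x y /addIr.
have sub : {subset [seq x - u | x <- B] <= [seq x - v | x <- B]}.
  by move=> z zB; have := h z zB; rewrite /= negbK.
have u1 : uniq [seq x - u | x <- B] by rewrite map_inj_uniq.
have u2 : uniq [seq x - v | x <- B] by rewrite map_inj_uniq.
have [|_ e] := uniq_min_size u1 sub; first by rewrite !size_map.
have : \sum_(x <- [seq x - u | x <- B]) x = \sum_(x <- [seq x - v | x <- B]) x.
  by apply: perm_big; exact: uniq_perm.
rewrite !big_map !big_split /= => /addrI /eqP.
rewrite !big_const_seq !count_predT -!Monoid.iteropE /= -!/(GRing.natmul _ _).
case: (B) B0 => // b B' _ /=.
rewrite -subr_eq0 -mulrnBl mulrn_eq0 /= opprK addrC subr_eq0 => /eqP uv'.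
by rewrite uv' eqxx in uv.
Qed.

(** Induction on the entries for all finite [B], after Kleitman. Exposing one entry shifts the
    target. For two distinct shifts, moving one element from one target to the other leaves the sum
    of the two probabilities unchanged and makes the sizes [s' + 2] and [s']. Concavity of [surv]
    turns this into a gain, realised whenever two independent copies of the entry differ. *)
Lemma littlewood_offord (I : eqType) (pos : I -> 'I_n * 'I_m) (a : I -> C) (g : MX -> C) (s : seq I) (B : seq C) :
  injective pos -> CLL mu g -> (forall t, t \in s -> blind (offp (pos t)) g) ->
  (forall t, t \in s -> a t != 0) -> uniq s -> uniq B ->
  Pr mu (fun A => (\sum_(t <- s) a t * co (pos t) A + g A) \in B) <= surv c (size s) (size B).
Proof.
move=> pi cg; elim: s B => [|t s IH] B bg a0 us uB.
  case: B uB => [|z B] uB /=.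
    by rewrite Pr_False.
  apply: Pr_le1; apply: mev_in; apply: CLL_eq cg => A; by rewrite big_nil add0r.
have ts : t \notin s by case/andP: us.
have us' : uniq s by case/andP: us.
have bg' t' : t' \in s -> blind (offp (pos t')) g by move=> h; apply: bg; rewrite inE h orbT.
have a0' t' : t' \in s -> a t' != 0 by move=> h; apply: a0; rewrite inE h orbT.
pose F A := \sum_(t' <- s) a t' * co (pos t') A + g A.
have cF : CLL mu F.
  by apply: CLLD => //; apply: CLL_sum => i _; apply: CLLM; [exact: CLL_cst|exact: CLL_co gl _].
have mF (B' : seq C) : mev (fun A => F A \in B') by exact: mev_in.
case: (eqVneq B [::]) => [->|B0]; first by rewrite Pr_False// surv0.
have [s' es] : exists s', size B = s'.+1 by case: (B) B0 => // z B' _; exists (size B').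
pose psi u := Pr mu (fun A => F A \in [seq x - u | x <- B]).
have injs w : injective (fun x : C => x - w) by move=> x y /addIr.
have psi_le u : psi u <= surv c (size s) s'.+1.
  by rewrite /psi -es -(size_map (fun x => x - u)); apply: IH => //; rewrite map_inj_uniq.
have psi2 u v : u != v -> psi u + psi v <= surv c (size s) s'.+2 + surv c (size s) s'.
  move=> uv; have [z z1 z2] := mem_shift_exists uB B0 uv.
  have h1 : Pr mu (fun A => F A \in rem z [seq x - u | x <- B]) <= surv c (size s) s'.
    have <- : size (rem z [seq x - u | x <- B]) = s' by rewrite size_rem// size_map es.
    by apply: IH => //; apply: rem_uniq; rewrite map_inj_uniq.
  have h2 : Pr mu (fun A => F A \in z :: [seq x - v | x <- B]) <= surv c (size s) s'.+2.
    have <- : size (z :: [seq x - v | x <- B]) = s'.+2 by rewrite /= size_map es.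
    by apply: IH => //=; rewrite z2 map_inj_uniq.
  apply: le_trans (lerD h2 h1); rewrite /psi /Pr -!E_add; try (by apply: LL_mev; exact: mF).
  rewrite le_eqVlt; apply/orP; left; apply/eqP; apply: E_ext => A.
  rewrite mem_rem_uniq ?map_inj_uniq// !inE.
  by case: (eqVneq (F A) z) => [->|_] /=; rewrite ?z1 ?(negbTE z2)/= ?addr0 ?add0r// addrC.
pose S i j := (i, j) != pos t.
pose b A := (\sum_(t' <- t :: s) a t' * co (pos t') A + g A) \in B.
have mb : mev b.
  have cb : CLL mu (fun A => \sum_(t' <- t :: s) a t' * co (pos t') A + g A).
    by apply: CLLD => //; apply: CLL_sum => i _; apply: CLLM; [exact: CLL_cst|exact: CLL_co gl _].
  exact: mev_in.
have phi x : Pr mu (fun y => b (mix S x y)) = psi (a t * co (pos t) x).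
  rewrite /psi /Pr; apply: E_ext => y; congr ((_ : bool)%:R).
  have o : offp (pos t) (mix S x y) y.
    move=> i j; rewrite -surjective_pairing => ij; by rewrite /coord mxE /S ij.
  have e1 : co (pos t) (mix S x y) = co (pos t) x.
    by rewrite /co /coord mxE /S -surjective_pairing eqxx.
  have e2 t' : t' \in s -> co (pos t') (mix S x y) = co (pos t') y.
    move=> h; apply: o; rewrite -!surjective_pairing (inj_eq pi).
    by apply: contraNneq ts => <-.
  have e3 : g (mix S x y) = g y by apply: (bg t (mem_head _ _)).
  rewrite /b big_cons e1 e3 (eq_big_seq (fun t' => a t' * co (pos t') y)) => [|t' h]; last by rewrite e2.
  rewrite -addrA -/(F y); apply/idP/mapP => [h|[w wB ->]].
    by exists (a t * co (pos t) x + F y) => //; rewrite addrAC subrr add0r.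
  by rewrite addrC subrK.
have b01 x : 0 <= ((b x)%:R : R) <= 1 by case: (b x); rewrite ?ler01 ?lexx.
have [lb eb] := E_mix ind S (mev_fun mb) b01.
have eb' : Pr mu b = E mu (fun x => psi (a t * co (pos t) x)).
  by rewrite /Pr eb; apply: E_ext => x; rewrite -phi.
have lpsi : LL mu (fun x => psi (a t * co (pos t) x)).
  by apply: LL_eq lb => x; rewrite -phi.
set h0 := surv c (size s) s'.+1; set D := 2 * h0 - (surv c (size s) s'.+2 + surv c (size s) s').
have D0 : 0 <= D by rewrite subr_ge0 surv_concave.
(* One copy of the entry is fixed at [x] and the other integrated. Integrating over [x] as well
   gives [2 Pr b <= 2 h0 - D c], which is the recursion of [surv]. *)
have key x : psi (a t * co (pos t) x) <= 2 * h0 - D * c - Pr mu b.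
  rewrite eb' lerBrDr addrC.
  have -> : E mu (fun x' => psi (a t * co (pos t) x')) + psi (a t * co (pos t) x) =
     E mu (fun x' => psi (a t * co (pos t) x') + psi (a t * co (pos t) x)).
    by rewrite E_add ?E_cst//; exact: LL_cst.
  have mn : mev (fun x' => co (pos t) x' != co (pos t) x).
    by apply: mev_neg; apply: mev_eq; exact: CLL_co gl _.
  apply: (@le_trans _ _ (E mu (fun x' => 2 * h0 - D * (co (pos t) x' != co (pos t) x)%:R))).
    apply: E_le; first by apply: LLD => //; exact: LL_cst.
      by apply: LLB; [exact: LL_cst|apply: LLZ; exact: LL_mev].
    move=> x'; case: (eqVneq (co (pos t) x') (co (pos t) x)) => [->|ne] /=.
      by rewrite mulr0 subr0 mulr_natl mulr2n lerD.
    rewrite mulr1 /D subKr; apply: psi2.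
    by rewrite (inj_eq (mulfI (a0 _ (mem_head _ _)))).
  rewrite E_sub; [|exact: LL_cst|by apply: LLZ; exact: LL_mev].
  rewrite E_cst E_scale; last exact: LL_mev.
  rewrite lerD2l lerN2 ler_wpM2l//.
  have := Pr_neg mu (mev_eq (co (pos t) x) (CLL_co gl (pos t))); rewrite /Pr => ->.
  by have := co_neq m0 gl (pos t) (co (pos t) x); rewrite -/c /Pr; lra.
have : Pr mu b <= 2 * h0 - D * c - Pr mu b.
  rewrite {1}eb' -(E_cst mu (2 * h0 - D * c - Pr mu b)); apply: E_le => //; exact: LL_cst.
by rewrite es /= -/h0 /D; lra.
Qed.

Section Rows.
Variables (q : nat) (pos : nat -> 'I_q -> 'I_n * 'I_m).

(** [pos] abstracts from what a line is: full rows in [rowpos], columns truncated to their first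
    rows in [colpos]. The dependence bound serves both. *)
Definition linemx p (A : MX) : 'M[C]_(p, q) := \matrix_(i < p, t < q) co (pos i t) A.

(** Expresses the rank condition by a polynomial in the entries and their conjugates, from which
    measurability follows. *)
Lemma row_free_gram p (B : 'M[C]_(p, q)) : row_free B = (\det (B *m adjmx B) != 0).
Proof.
rewrite -unitfE -[_ \is a _]/(B *m adjmx B \in unitmx); apply/idP/idP => h.
  rewrite -row_free_unit -kermx_eq0; apply/eqP/row_matrixP => i; rewrite row0.
  set v := row i _; have v0 : v *m (B *m adjmx B) = 0 by rewrite -row_mul mulmx_ker row0.
  have : norm2sq (adjmx (v *m B)) = 0.
    by rewrite norm2sq_ip /ip adjK adjM -mulmxA [B *m _]mulmxA mulmxA v0 mul0mx mxE.
  move/norm2sq_eq0 => e; have : v *m B = 0 by rewrite -[v *m B]adjK e; apply/matrixP => a b; rewrite !mxE rmorph0.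
  by move/eqP; rewrite mulmx_free_eq0// => /eqP.
have : \rank (B *m adjmx B) = p by apply/eqP; rewrite -/(row_free _) row_free_unit.
by rewrite /row_free => e; rewrite eqn_leq rank_leq_row /= -[leqLHS]e mxrankM_maxl.
Qed.

Lemma mev_free p : mev (fun A => row_free (linemx p A)).
Proof.
rewrite (_ : (fun A => _) = (fun A => ~~ (\det (linemx p A *m adjmx (linemx p A)) == 0))); last first.
  by apply/funext => A; rewrite row_free_gram.
have cP (T : Type) (s : seq T) (F : T -> MX -> C) : (forall i, CLL mu (F i)) -> CLL mu (fun A => \prod_(i <- s) F i A).
  move=> h; elim: s => [|i s IH].
    by apply: (@CLL_eq _ _ _ _ (fun=> 1)); [move=> A; rewrite big_nil|exact: CLL_cst].
  by apply: (@CLL_eq _ _ _ _ (fun A => F i A * \prod_(j <- s) F j A)); [move=> A; rewrite big_cons|exact: CLLM].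
have cl : mCLL mu (fun A => linemx p A).
  move=> i t; apply: CLL_eq (CLL_co gl (pos i t)) => A; by rewrite mxE.
have cg := mCLL_mul cl (mCLL_adj cl).
apply: mev_neg; apply: (mev_eq 0 (mu := mu)).
rewrite /determinant; apply: CLL_sum => sg _; apply: CLLM; first exact: CLL_cst.
exact: cP.
Qed.

Lemma span_last p (B : 'M[C]_(p.+1, q)) (B0 : 'M[C]_(p, q)) :
  (forall i t, B (widen_ord (leqnSn p) i) t = B0 i t) -> row_free B0 -> ~~ row_free B ->
  (row ord_max B <= B0)%MS.
Proof.
move=> BB f0; rewrite -kermx_eq0 => /rowV0Pn[w /sub_kermxP wB w0].
pose w' : 'rV[C]_p := \row_i w 0 (widen_ord (leqnSn p) i).
have e : w' *m B0 + w 0 ord_max *: row ord_max B = 0.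
  rewrite -wB; apply/rowP => t; rewrite !mxE big_ord_recr /=; congr (_ + _).
  by apply: eq_bigr => i _; rewrite BB mxE.
case: (eqVneq (w 0 ord_max) 0) => [wl|wl].
  move: e; rewrite wl scale0r addr0 => /eqP; rewrite mulmx_free_eq0// => /eqP w'0.
  case/negP: w0; apply/eqP/rowP => i; rewrite [RHS]mxE.
  case: (unliftP ord_max i) => [j ->|-> //].
  have := congr1 (fun u : 'rV_p => u 0 j) w'0; rewrite !mxE => <-.
  by congr (w _ _); apply/val_inj; rewrite /= /bump leqNgt ltn_ord.
have -> : row ord_max B = (- (w 0 ord_max)^-1 *: w') *m B0.
  rewrite -scalemxAl; move/eqP: e; rewrite addr_eq0 => /eqP ->.
  by rewrite scalerN scaleNr opprK scalerA mulVf// scale1r.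
exact: submxMl.
Qed.

Variable N : nat.
Hypothesis pos_inj : forall i i' t t', (i < N)%N -> (i' < N)%N -> pos i t = pos i' t' -> i = i' /\ t = t'.

Definition lineS p (i : 'I_n) (j : 'I_m) := [exists t, (i, j) == pos p t].

Lemma line_mix p x y : (p < N)%N -> linemx p (mix (lineS p) x y) = linemx p x.
Proof.
move=> pN; apply/matrixP => i t; rewrite !mxE /co /coord mxE /lineS.
case: existsP => // -[t' /eqP]; rewrite -surjective_pairing => /pos_inj [||e _] //.
  exact: ltn_trans pN.
by have := ltn_ord i; rewrite e ltnn.
Qed.

Lemma line_mix_last p x y t : co (pos p t) (mix (lineS p) x y) = co (pos p t) y.
Proof.
rewrite /co /coord mxE /lineS; case: existsP => // -[].
by exists t; rewrite -surjective_pairing.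
Qed.

Let pinj p : (p < N)%N -> injective (pos p). Proof. by move=> pN t t' /pos_inj[]. Qed.

Lemma line_step p x y : (p < N)%N -> row_free (linemx p x) -> ~~ row_free (linemx p.+1 (mix (lineS p) x y)) ->
  (vecp (pos p) y <= linemx p x)%MS.
Proof.
move=> pN fx /(span_last _ fx) h.
have -> : vecp (pos p) y = row ord_max (linemx p.+1 (mix (lineS p) x y)).
  by apply/rowP => t; rewrite !mxE line_mix_last.
by apply: h => i t; rewrite -(line_mix x y pN) !mxE.
Qed.

Lemma dependent_bound p : (p <= q)%N -> (p <= N)%N ->
  Pr mu (fun A => ~~ row_free (linemx p A)) <= \sum_(i < p) (1 - c) ^+ (q - i).
Proof.
elim: p => [|p IH] pq pN.
  by rewrite big_ord0 Pr_False// => A; rewrite negbK /row_free -leqn0 rank_leq_row.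
have mf p' := mev_free p'.
apply: (@le_trans _ _ (Pr mu (fun A => ~~ row_free (linemx p A) || (row_free (linemx p A) && ~~ row_free (linemx p.+1 A))))).
  apply: Pr_le; first exact: mev_neg.
    by apply: mev_or; [exact: mev_neg|apply: mev_and => //; exact: mev_neg].
  by move=> A ->; case: (row_free _).
have m2 : mev (fun A => row_free (linemx p A) && ~~ row_free (linemx p.+1 A)).
  by apply: mev_and => //; exact: mev_neg.
apply: le_trans (Pr_or mu (mev_neg (mf p)) m2) _.
rewrite big_ord_recr /=; apply: lerD; first by apply: IH; exact: ltnW.
apply: (Pr_mix_le ind (S := lineS p)) => // x.
case fx : (row_free (linemx p x)); last first.
  by rewrite Pr_False ?exprn_ge0 ?subr_ge0// => y; rewrite line_mix// fx.
apply: le_trans; first apply: (subspace_bound m0 gl (pinj pN) (V := linemx p x)).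
- exact: (mev_mix _ _ m2).
- by move=> y /andP[_]; exact: line_step pN fx.
rewrite -/c; apply: ler_wiXn2l; rewrite ?subr_ge0//; first by rewrite lerBlDr lerDl ltW.
by rewrite leq_sub2l// rank_leq_row.
Qed.

End Rows.

Hypothesis n0 : (0 < n)%N.
Hypothesis nm : (n <= m)%N.

Let i0 : 'I_n := Ordinal n0.
Let j0 : 'I_m := Ordinal m0.

Definition rowpos i (t : 'I_m) : 'I_n * 'I_m := (insubd i0 i, t).

Let rowpos_inj i i' t t' : (i < n)%N -> (i' < n)%N -> rowpos i t = rowpos i' t' -> i = i' /\ t = t'.
Proof. by move=> h h' [e ->]; split=> //; have := congr1 val e; rewrite !insubdK. Qed.

Lemma linemx_row k A (kn : (k <= n)%N) i t : linemx rowpos k A i t = (A : 'M[C]_(n, m)) (widen_ord kn i) t.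
Proof.
rewrite mxE /co /coord /=; congr (_ _ t); apply/val_inj; rewrite insubdK//=.
exact: leq_trans (ltn_ord i) kn.
Qed.

Section Sparse.
Variables (q L : nat).
Hypothesis qn : (q <= n)%N.
Hypothesis Lq : (L <= q)%N.

Definition colpos (J : seq 'I_m) a (t : 'I_q) : 'I_n * 'I_m := (widen_ord qn t, nth j0 J a).

(** At most [L] columns are dependent already within the first [q] rows. Outside this event, any
    nonzero kernel vector of rows containing these has more than [L] nonzero coordinates. *)
Definition sparse (A : MX) := has (fun p => has (fun J : p.-tuple 'I_m =>
  uniq J && ~~ row_free (linemx (colpos J) p A)) (enum {: p.-tuple 'I_m})) (iota 0 L.+1).

Lemma mev_sparse : mev sparse.
Proof.
apply: (mev_has _ (b := fun p A => has (fun J : p.-tuple 'I_m =>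
  uniq J && ~~ row_free (linemx (colpos J) p A)) (enum {: p.-tuple 'I_m}))) => p.
apply: (mev_has _ (b := fun (J : p.-tuple 'I_m) A => uniq J && ~~ row_free (linemx (colpos J) p A))) => J.
apply: mev_and; first exact: mev_cst.
by apply: mev_neg; exact: mev_free.
Qed.

Lemma sparse_bound : Pr mu sparse <= L.+1%:R * (m%:R ^+ L * (L%:R * (1 - c) ^+ (q - L))).
Proof.
have c1' : 0 <= 1 - c by rewrite subr_ge0.
set be := _ * (1 - c) ^+ _; have be0 : 0 <= be by rewrite mulr_ge0 ?exprn_ge0.
have bd p (J : p.-tuple 'I_m) : (p <= L)%N ->
    Pr mu (fun A => uniq J && ~~ row_free (linemx (colpos J) p A)) <= be.
  move=> pL; case uJ : (uniq J); last by rewrite Pr_False.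
  have inj i i' t t' : (i < p)%N -> (i' < p)%N -> colpos J i t = colpos J i' t' -> i = i' /\ t = t'.
    move=> h h' [/val_inj-> /eqP]; rewrite nth_uniq ?size_tuple// => /eqP ->; split=> //.
  apply: le_trans (dependent_bound inj (leq_trans pL Lq) (leqnn p)) _.
  apply: (@le_trans _ _ (\sum_(i < p) (1 - c) ^+ (q - L))).
    apply: ler_sum => i _; apply: ler_wiXn2l => //; first by rewrite lerBlDr lerDl ltW.
    by rewrite leq_sub2l// ltnW// (leq_trans (ltn_ord i)).
  rewrite sumr_const card_ord -[_ *+ p]mulr_natl ler_wpM2r ?exprn_ge0//.
  by rewrite ler_nat.
have m1 : 1 <= m%:R :> R by rewrite ler1n.
pose b p A := (p <= L)%N && has (fun J : p.-tuple 'I_m =>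
  uniq J && ~~ row_free (linemx (colpos J) p A)) (enum {: p.-tuple 'I_m}).
have mb p : mev (b p).
  apply: mev_and; first exact: mev_cst.
  apply: (mev_has _ (b := fun (J : p.-tuple 'I_m) A => uniq J && ~~ row_free (linemx (colpos J) p A))) => J.
  by apply: mev_and; [exact: mev_cst|apply: mev_neg; exact: mev_free].
apply: (@le_trans _ _ (Pr mu (fun A => has (fun p => b p A) (iota 0 L.+1)))).
  apply: Pr_le; [exact: mev_sparse|exact: mev_has|].
  move=> A /hasP[p pI h]; apply/hasP; exists p => //; rewrite /b h andbT.
  by move: pI; rewrite mem_iota add0n ltnS.
rewrite -[X in X%:R](size_iota 0 L.+1); apply: Pr_has => // p.
rewrite /b; case pL : (p <= L)%N; last by rewrite Pr_False ?mulr_ge0 ?exprn_ge0.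
apply: (@le_trans _ _ ((size (enum {: p.-tuple 'I_m}))%:R * be)).
  apply: Pr_has => [J|J]; last exact: bd.
  by apply: mev_and; [exact: mev_cst|apply: mev_neg; exact: mev_free].
rewrite -cardE card_tuple card_ord natrX ler_wpM2r//.
exact: ler_weXn2l.
Qed.

Definition supp (u : 'cV[C]_m) : seq 'I_m := [seq j <- enum 'I_m | u j 0 != 0].

Lemma kernel_support k (x : MX) (u : 'cV[C]_m) : (q <= k)%N -> (k <= n)%N -> ~~ sparse x ->
  linemx rowpos k x *m u = 0 -> u != 0 -> (L < size (supp u))%N.
Proof.
move=> qk kn; set J := supp u => sx xu u0; rewrite ltnNge; apply/negP => JL.
case/negP: sx; apply/hasP; exists (size J); first by rewrite mem_iota add0n ltnS.
apply/hasP; exists (in_tuple J); first by rewrite mem_enum.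
rewrite /= [uniq _]filter_uniq ?enum_uniq//=.
rewrite -kermx_eq0; apply/rowV0Pn; exists (\row_(a < size J) u (nth j0 J a) 0).
  apply/sub_kermxP/rowP => t; rewrite !mxE.
  have tk : (t < k)%N := leq_trans (ltn_ord t) qk.
  have e0 : \sum_j (x : 'M[C]_(n, m)) (widen_ord qn t) j * u j 0 = 0.
    have := congr1 (fun w : 'cV_k => w (Ordinal tk) 0) xu; rewrite !mxE => e; rewrite -[RHS]e.
    apply: eq_bigr => j _; rewrite (linemx_row _ kn); congr ((x : 'M[C]_(n, m)) _ _ * _).
    exact/val_inj.
  rewrite -[RHS]e0 [RHS](bigID (fun j => u j 0 != 0)) /= [X in _ = _ + X]big1 ?addr0; last first.
    by move=> j /negPn/eqP ->; rewrite mulr0.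
  transitivity (\sum_(j <- J) (x : 'M[C]_(n, m)) (widen_ord qn t) j * u j 0).
    rewrite (big_nth j0) big_mkord; apply: eq_bigr => a _.
    by rewrite !mxE /co /coord /= mulrC.
  by rewrite /J big_filter big_enum_cond; apply: eq_bigl => j.
apply: contraNneq u0 => e; apply/eqP/colP => j; rewrite mxE.
apply: contraTeq isT => uj.
have jJ : j \in J by rewrite mem_filter uj mem_enum.
have := congr1 (fun w : 'rV_(size J) => w 0 (Ordinal (etrans (index_mem j J) jJ))) e.
by rewrite !mxE /= nth_index// => /eqP; rewrite (negbTE uj).
Qed.

(** Fewer than [m] rows leave a nonzero kernel vector [u]. A new row in the span of the earlier ones
    is orthogonal to [u], a relation with more than [L] nonzero coefficients, to which
    [littlewood_offord] applies with target [[:: 0]]. *)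
Lemma last_step k : (q <= k)%N -> (k < n)%N ->
  Pr mu (fun A => row_free (linemx rowpos k A) && ~~ row_free (linemx rowpos k.+1 A)) <=
  Pr mu sparse + surv c L 1.
Proof.
move=> qk kn; have mf p := mev_free rowpos p.
have m2 : mev (fun A => row_free (linemx rowpos k A) && ~~ row_free (linemx rowpos k.+1 A)).
  by apply: mev_and => //; exact: mev_neg.
have m3 := mev_and (mev_neg mev_sparse) m2.
apply: (@le_trans _ _ (Pr mu (fun A => sparse A || (~~ sparse A && (row_free (linemx rowpos k A) && ~~ row_free (linemx rowpos k.+1 A)))))).
  apply: Pr_le => //; first by apply: mev_or => //; exact: mev_sparse.
  by move=> A ->; case: (sparse A).
apply: le_trans (Pr_or mu mev_sparse m3) _; rewrite lerD2l.
apply: (Pr_mix_le ind (S := lineS rowpos k)) => // x.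
have smix y : sparse (mix (lineS rowpos k) x y) = sparse x.
  apply: eq_in_has => p _; apply: eq_in_has => J _; congr (_ && ~~ row_free _).
  apply/matrixP => i t; rewrite !mxE /co /coord mxE /lineS.
  case: existsP => // -[t' /eqP[e _]].
  have := congr1 val e; rewrite /= insubdK// => tk.
  by have := leq_trans (ltn_ord t) qk; rewrite tk ltnn.
case fx : (~~ sparse x && row_free (linemx rowpos k x)); last first.
  rewrite Pr_False ?surv_ge0// => y; rewrite smix (line_mix rowpos_inj)//.
  by rewrite andbA fx.
move/andP: fx => [sx fx].
have [u xu u0] : exists2 u : 'cV[C]_m, linemx rowpos k x *m u = 0 & u != 0.
  have : cokermx (linemx rowpos k x) != 0.
    rewrite -mxrank_eq0 mxrank_coker -lt0n subn_gt0.
    by apply: leq_ltn_trans (rank_leq_row _) _; exact: leq_trans kn nm.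
  move=> h; have [j hj] : exists j, col j (cokermx (linemx rowpos k x)) != 0.
    apply/existsP; apply: contraR h; rewrite negb_exists => /forallP h.
    by apply/eqP/matrixP => a b; have /negPn/eqP/colP/(_ a) := h b; rewrite !mxE.
  by exists (col j (cokermx (linemx rowpos k x))) => //; rewrite colE mulmxA mulmx_coker mul0mx.
set J := supp u.
have JL := kernel_support qk (ltnW kn) sx xu u0.
apply: le_trans (surv_dec c01 1 (ltnW JL)).
have bo t : blind (@offp R n m (rowpos k t)) (fun=> 0 : C) by [].
have := @littlewood_offord _ (rowpos k) (fun j => u j 0) (fun=> 0) J [:: 0] _ (CLL_cst _ _) (fun t _ => bo t) _ _ isT.
move=> h; apply: le_trans (h _ _ _); last 1 first.
- by rewrite filter_uniq ?enum_uniq.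
- apply: Pr_le; first exact: (mev_mix _ _ m3).
    apply: mev_in; apply: CLLD; last exact: CLL_cst.
    by apply: CLL_sum => j _; apply: CLLM; [exact: CLL_cst|exact: CLL_co gl _].
  move=> y /andP[_ /andP[_ /(line_step rowpos_inj kn fx) /submxP[D eD]]].
  rewrite inE addr0 /J big_filter big_enum_cond /=.
  have e : (vecp (rowpos k) y *m u) 0 0 = 0 by rewrite eD -mulmxA xu mulmx0 mxE.
  apply/eqP; rewrite -[RHS]e mxE [RHS](bigID (fun j => u j 0 != 0)) /= [X in _ = _ + X]big1 ?addr0; last first.
    by move=> j /negPn/eqP ->; rewrite mulr0.
  by apply: eq_bigr => j _; rewrite mxE mulrC.
- by move=> t t' [].
- by move=> t; rewrite mem_filter => /andP[].
Qed.

Lemma singular_steps k : (q <= k)%N -> (k <= n)%N ->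
  Pr mu (fun A => ~~ row_free (linemx rowpos k A)) <=
  Pr mu (fun A => ~~ row_free (linemx rowpos q A)) + (k - q)%:R * (Pr mu sparse + surv c L 1).
Proof.
have mf p := mev_free rowpos p.
move=> /subnK <-; elim: (k - q)%N => [|j IH] kn.
  by rewrite add0n subnn mul0r addr0.
have m2 : mev (fun A => row_free (linemx rowpos (j + q) A) && ~~ row_free (linemx rowpos (j + q).+1 A)).
  by apply: mev_and => //; exact: mev_neg.
apply: (@le_trans _ _ (Pr mu (fun A => ~~ row_free (linemx rowpos (j + q) A) ||
   (row_free (linemx rowpos (j + q) A) && ~~ row_free (linemx rowpos (j + q).+1 A))))).
  apply: Pr_le; first exact: mev_neg.
    by apply: mev_or => //; exact: mev_neg.
  by move=> A; rewrite addSn => ->; case: (row_free _).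
apply: le_trans (Pr_or mu (mev_neg (mf _)) m2) _.
have h := last_step (leq_addl j q) kn; have := IH (ltnW kn).
rewrite addSn subSn ?leq_addl// !addnK -natr1 mulrDl mul1r => h'.
by rewrite addrA; apply: lerD.
Qed.

End Sparse.

Lemma geom_tail p : (p <= m)%N -> c * \sum_(i < p) (1 - c) ^+ (m - i) <= (1 - c) ^+ (m - p).
Proof.
have c1' : 0 <= 1 - c by rewrite subr_ge0.
elim: p => [|p IH] pm; first by rewrite big_ord0 mulr0 exprn_ge0.
rewrite big_ord_recr /= mulrDr; apply: le_trans (lerD (IH (ltnW pm)) (lexx _)) _.
rewrite -subnSK//.
rewrite exprS; set y := _ ^+ _; have y0 : 0 <= y by rewrite exprn_ge0.
have := mulr_ge0 (sqr_ge0 c) y0; lra.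
Qed.

(** Up to [m - l0] rows the codimension is at least [l0] and the bounds of [subspace_bound] form a
    geometric sum. The codimension bound is too weak for the at most [l0] rows beyond, which are
    charged to [last_step]. *)
Lemma singular_le l0 L : (L + l0 <= m)%N ->
  Pr mu (fun A => \det ((A : 'M[C]_(n, m)) *m adjmx (A : 'M[C]_(n, m))) == 0) <=
  (1 - c) ^+ l0 / c + l0%:R * (L.+1%:R * (m%:R ^+ L * (L%:R * (1 - c) ^+ (m - l0 - L))) + surv c L 1).
Proof.
move=> Ll; have c1' : 0 <= 1 - c by rewrite subr_ge0.
have cc1 : 1 - c <= 1 by rewrite lerBlDr lerDl ltW.
have -> : Pr mu (fun A => \det ((A : 'M[C]_(n, m)) *m adjmx (A : 'M[C]_(n, m))) == 0) =
   Pr mu (fun A => ~~ row_free (linemx rowpos n A)).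
  rewrite /Pr; apply: E_ext => A; rewrite row_free_gram negbK.
  rewrite (_ : linemx rowpos n A = (A : 'M[C]_(n, m)))//.
  by apply/matrixP => i t; rewrite (linemx_row _ (leqnn n)); congr ((A : 'M[C]_(n, m)) _ _); exact/val_inj.
have first_rows p : (p <= n)%N -> (p <= m - l0)%N ->
    Pr mu (fun A => ~~ row_free (linemx rowpos p A)) <= (1 - c) ^+ l0 / c.
  move=> pn pm; have pm' : (p <= m)%N := leq_trans pn nm.
  apply: le_trans (dependent_bound rowpos_inj pm' pn) _.
  rewrite ler_pdivlMr// mulrC; apply: le_trans (geom_tail pm') _.
  by apply: ler_wiXn2l => //; rewrite leq_subRL// addnC -leq_subRL ?(leq_trans (leq_addl _ _) Ll).
have T0 : 0 <= L.+1%:R * (m%:R ^+ L * (L%:R * (1 - c) ^+ (m - l0 - L))) + surv c L 1.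
  by rewrite addr_ge0 ?surv_ge0// !mulr_ge0 ?exprn_ge0.
case: (leqP n (m - l0)) => nl.
  by apply: le_trans (first_rows _ (leqnn n) nl) _; rewrite lerDl mulr_ge0.
have Lq : (L <= m - l0)%N by rewrite leq_subRL ?(leq_trans (leq_addl _ _) Ll)// addnC.
apply: le_trans (singular_steps L (ltnW nl) (ltnW nl) (leqnn n)) _.
apply: lerD; first exact: first_rows (ltnW nl) (leqnn _).
apply: ler_pM => //; first by rewrite addr_ge0 ?surv_ge0// Pr_ge0.
  by rewrite ler_nat leq_subLR subnK ?(leq_trans (leq_addl _ _) Ll).
by rewrite lerD2r; exact: sparse_bound.
Qed.

End Dependence.

Section Asymptotics.
Context {R : realType}.
Local Notation C := (R[i]).

Lemma geom_le (r e : R) : 0 <= r < 1 -> 0 < e -> exists N, forall k, (N <= k)%N -> r ^+ k <= e.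
Proof.
move=> /andP[r0 r1] e0.
have : (fun k => r ^+ k) @ \oo --> 0 by apply: cvg_expr; rewrite ger0_norm.
move/cvgrPdist_le => /(_ _ e0) [N _ HN]; exists N => k Nk.
by have := HN k Nk; rewrite /= sub0r normrN ger0_norm ?exprn_ge0.
Qed.

Lemma poly_geom_bounded L (r : R) : 0 < r < 1 -> exists B, forall k, k%:R ^+ L * r ^+ k <= B.
Proof.
elim: L r => [|L IH] r /andP[r0 r1].
  by exists 1 => k; rewrite expr0 mul1r exprn_ile1 ?ltW.
have s0 : 0 < Num.sqrt r by rewrite sqrtr_gt0.
have s1 : Num.sqrt r < 1 by rewrite -[ltRHS]sqrtr1 ltr_sqrt.
have s2 : Num.sqrt r ^+ 2 = r by rewrite sqr_sqrtr// ltW.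
have [|B HB] := IH (Num.sqrt r); first by rewrite s0.
set s := Num.sqrt r in s0 s1 s2 HB.
have h0 : 0 < s^-1 - 1 by rewrite subr_gt0 invf_gt1.
have bern k : k%:R * s ^+ k <= (s^-1 - 1)^-1.
  have : 1 + k%:R * (s^-1 - 1) <= s^-1 ^+ k.
    elim: k => [|k IHk]; first by rewrite mul0r addr0 expr0.
    rewrite exprS -natr1; apply: (@le_trans _ _ (s^-1 * (1 + k%:R * (s^-1 - 1)))); last first.
      by rewrite ler_wpM2l// invr_ge0 ltW.
    have : 0 <= k%:R * (s^-1 - 1) ^+ 2 by rewrite mulr_ge0// sqr_ge0.
    by move: (s^-1) => y; lra.
  rewrite exprVn => h.
  rewrite -[leRHS]mul1r ler_pdivlMr// mulrAC -ler_pdivlMr ?exprn_gt0// mul1r.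
  by apply: le_trans h; rewrite lerDr.
have B0 : 0 <= B by apply: le_trans (HB 0%N); rewrite mulr_ge0 ?exprn_ge0// ltW.
exists ((s^-1 - 1)^-1 * B) => k.
rewrite [leLHS](_ : _ = (k%:R * s ^+ k) * (k%:R ^+ L * s ^+ k)).
  by apply: ler_pM => //; rewrite mulr_ge0 ?exprn_ge0// ltW.
by rewrite -s2 -exprM mulnC exprM exprS expr2; ring.
Qed.

Lemma poly_geom_le L (r e : R) : 0 < r < 1 -> 0 < e -> exists N, forall k, (N <= k)%N -> k%:R ^+ L * r ^+ k <= e.
Proof.
move=> /andP[r0 r1] e0.
have s0 : 0 < Num.sqrt r by rewrite sqrtr_gt0.
have s1 : Num.sqrt r < 1 by rewrite -[ltRHS]sqrtr1 ltr_sqrt.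
have s2 : Num.sqrt r ^+ 2 = r by rewrite sqr_sqrtr// ltW.
have [|B HB] := @poly_geom_bounded L (Num.sqrt r); first by rewrite s0.
have B0 : 0 <= B by apply: le_trans (HB 0%N); rewrite mulr_ge0 ?exprn_ge0// ltW.
have B1 : 0 < B + 1 by lra.
have [||N HN] := @geom_le (Num.sqrt r) (e / (B + 1)); first by rewrite ltW.
  by rewrite divr_gt0.
exists N => k Nk.
rewrite [leLHS](_ : _ = Num.sqrt r ^+ k * (k%:R ^+ L * Num.sqrt r ^+ k)).
  apply: (@le_trans _ _ (e / (B + 1) * B)).
    by apply: ler_pM (HN k Nk) (HB k); rewrite ?mulr_ge0 ?exprn_ge0// ltW.
  by rewrite mulrAC ler_pdivrMr// ler_wpM2l ?(ltW e0)// lerDl.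
by rewrite -{1}s2 -exprM mulnC exprM expr2; ring.
Qed.

Lemma singular_limit (kap : nat -> R) (del : R) : 0 < del ->
  exists N, forall n m (mu : probability (@MX R n m) R), (N <= m)%N -> (0 < m)%N -> (n <= m)%N ->
  good_law kap mu ->
  Pr mu (fun A => \det ((A : 'M[C]_(n, m)) *m adjmx (A : 'M[C]_(n, m))) == 0) <= del.
Proof.
move=> del0; case: (lerP 1 (kap 2)) => k1; last first.
  by exists 0%N => n m mu _ _ _ [_ /(_ 2%N)]; rewrite leNgt k1.
set c := spread kap.
have c0 : 0 < c by rewrite invr_gt0 mulr_gt0// (lt_le_trans ltr01).
have c1 : c < 1 by rewrite invf_lt1 ?mulr_gt0 ?(lt_le_trans ltr01)//; lra.
have r01 : 0 < 1 - c < 1 by rewrite subr_gt0 c1 ltrBlDr ltrDl.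
have r01' : 0 <= 1 - c < 1 by case/andP: r01 => /ltW -> ->.
have d3 : 0 < del / 3 by rewrite divr_gt0.
(* The order of choice matters: [l0] for the geometric sum, then [L] so that [surv] beats [l0], then
   [m] so that the exponential beats the union bound over sets of columns. *)
have [|l0 H0] := geom_le r01' (e := del / 3 * c); first by rewrite mulr_gt0.
have {}H0 := H0 l0 (leqnn _).
have c01 : 0 < c <= 1 by rewrite c0 ltW.
have l1 : 0 < l0.+1%:R :> R by rewrite ltr0n.
have [L HL] : exists L, l0%:R * surv c L 1 <= del / 3.
  have := surv_cvg0 c01 => /cvgrPdist_le /(_ (del / 3 / l0.+1%:R)) [|L _ HL]; first by rewrite divr_gt0.
  exists L; have := HL L (leqnn L); rewrite /= sub0r normrN ger0_norm ?surv_ge0// ler_pdivlMr// mulrC.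
  by apply: le_trans; rewrite ler_wpM2r ?surv_ge0// ler_nat.
pose G := l0%:R * L.+1%:R * L%:R * (1 - c) ^- (l0 + L) : R.
have G0 : 0 <= G.
  by rewrite mulr_ge0 ?invr_ge0 ?exprn_ge0 ?mulr_ge0//; case/andP: r01'.
have G1 : 0 < G + 1 by lra.
have [|N HN] := poly_geom_le L r01 (e := del / 3 / (G + 1)); first by rewrite divr_gt0.
exists (maxn N (L + l0)) => n m mu; rewrite geq_max => /andP[Nm Lm] m0 nm gl.
case: (posnP n) => [n0|n0].
  rewrite Pr_False ?ltW// => A; subst n.
  by rewrite det_mx00 oner_eq0.
apply: le_trans (singular_le m0 gl n0 nm Lm) _; rewrite -/c mulrDr.
have -> : del = del / 3 + (del / 3 + del / 3) by field.
apply: lerD; first by rewrite ler_pdivrMr.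
apply: lerD => //.
have -> : (1 - c) ^+ (m - l0 - L) = (1 - c) ^+ m * (1 - c) ^- (l0 + L).
  have r0 : 1 - c != 0 by rewrite gt_eqF//; case/andP: r01.
  rewrite -subnDA -[in X in _ = X * _](subnK (_ : (l0 + L <= m)%N)); last by rewrite addnC.
  by rewrite exprD mulfK// expf_neq0.
rewrite [leLHS](_ : _ = G * (m%:R ^+ L * (1 - c) ^+ m)); last by rewrite /G; ring.
apply: le_trans (_ : G * (del / 3 / (G + 1)) <= _); first by rewrite ler_wpM2l// HN.
by rewrite mulrCA ler_piMr ?(ltW d3)// ler_pdivrMr// mul1r lerDl.
Qed.

End Asymptotics.

(** * Resolvents *)

Section Resolvent.
Context {R : realType}.
Local Notation C := (R[i]).

Lemma conjR (x : R) : ((x%:C)%C : C)^* = (x%:C)%C.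
Proof. exact: conjc_real. Qed.

Section Def.
Variables (p q : nat) (eta : R) (B : 'M[C]_(p, q)).
Hypothesis eta0 : 0 < eta.

Definition gmx : 'M[C]_p := B *m adjmx B + (eta%:C)%C%:M.
Definition resv : 'M[C]_p := invmx gmx.

Lemma gmx_herm : adjmx gmx = gmx.
Proof.
rewrite /gmx adjD adjM adjK; congr (_ + _).
apply/matrixP => i j; rewrite adjE !mxE eq_sym.
by case: (i == j); rewrite ?mulr1n ?mulr0n ?rmorph0 ?conjR.
Qed.

Lemma ip_gmx (z : 'cV[C]_p) : ip z (gmx *m z) = ((norm2sq (adjmx B *m z) + eta * norm2sq z)%:C)%C.
Proof.
by rewrite /gmx mulmxDl ipDr mul_scalar_mx ipZr -mulmxA ipM !ip_norm2sq rmorphD rmorphM.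
Qed.

Lemma gmx_unit : gmx \in unitmx.
Proof.
rewrite -row_free_unit -kermx_eq0; apply/eqP/row_matrixP => i; rewrite row0.
set v := row i _; have v0 : v *m gmx = 0 by rewrite -row_mul mulmx_ker row0.
have : ip (adjmx v) (gmx *m adjmx v) = 0 by rewrite /ip adjK mulmxA v0 mul0mx mxE.
rewrite ip_gmx => /eqP; rewrite -(rmorph0 (real_complex R)) (inj_eq (@complexI R)).
rewrite paddr_eq0 ?norm2sq_ge0//; last by rewrite mulr_ge0 ?norm2sq_ge0// ltW.
move=> /andP[_]; rewrite mulf_eq0 gt_eqF//= => /eqP/norm2sq_eq0 e.
by rewrite -[v]adjK e; apply/matrixP => a b; rewrite !mxE rmorph0.
Qed.

Lemma resvK : gmx *m resv = 1%:M. Proof. exact: mulmxV gmx_unit. Qed.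
Lemma resvKl : resv *m gmx = 1%:M. Proof. exact: mulVmx gmx_unit. Qed.

Lemma resv_herm : adjmx resv = resv.
Proof.
have : adjmx resv *m gmx = 1%:M by rewrite -[in X in _ *m X]gmx_herm -adjM resvK adj1.
by move=> h; rewrite -[LHS]mulmx1 -resvK mulmxA h mul1mx.
Qed.

Lemma ip_resv (b : 'cV[C]_p) : let y := resv *m b in
  ip b (resv *m b) = ((norm2sq (adjmx B *m y) + eta * norm2sq y)%:C)%C.
Proof.
move=> y; rewrite -ip_gmx /y mulmxA resvK mul1mx ipM resv_herm.
by [].
Qed.

Lemma re_ip_resv_ge0 (b : 'cV[C]_p) : 0 <= re (ip b (resv *m b)).
Proof. by rewrite ip_resv /= addr_ge0 ?mulr_ge0 ?norm2sq_ge0// ltW. Qed.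

Lemma gmx_ge0 (z : 'cV[C]_p) : 0 <= re (ip z (gmx *m z)).
Proof. by rewrite ip_gmx /= addr_ge0 ?mulr_ge0 ?norm2sq_ge0// ltW. Qed.

(** The resolvent form is the maximum of the left-hand side over [y], attained at [y = resv *m b];
    the gap is the form of [gmx] at the difference. *)
Lemma resv_variational (b y : 'cV[C]_p) :
  2 * re (ip y b) - re (ip y (gmx *m y)) <= re (ip b (resv *m b)).
Proof.
have := gmx_ge0 (y - resv *m b); set w := resv *m b.
have ew : ip w (gmx *m y) = ip b y by rewrite ipM gmx_herm mulmxA resvK mul1mx.
have ewb : ip w b = (ip b w)^* := ipJ _ _.
rewrite mulmxBr [gmx *m w]mulmxA resvK mul1mx.
have -> : ip (y - w) (gmx *m y - b) = ip y (gmx *m y) - ip y b - (ip b y - (ip b w)^*).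
  by rewrite -[- w]scaleN1r ipDl ipZl !ipDr !ipNr ew ewb rmorphN rmorph1; ring.
rewrite [ip b y]ipJ; case: (ip y (gmx *m y)) => a a'; case: (ip y b) => e e'; case: (ip b w) => f f' /=; lra.
Qed.

(* Cauchy-Schwarz for the scalar product of [gmx], tested on the columns of [resv]. *)
Lemma norm2sq_le_trace (z : 'cV[C]_p) : norm2sq z <= re (\tr resv) * re (ip z (gmx *m z)).
Proof.
rewrite norm2sqE /mxtrace re_sum mulr_suml; apply: ler_sum => i _.
set e : 'cV[C]_p := delta_mx i 0; set N := re (ip z (gmx *m z)).
have ezi : ip e z = z i 0 by rewrite /ip dot_delta.
set t := re (resv i i).
have ee : ip e (resv *m e) = (t%:C)%C.
  have := ip_resv e; rewrite /= => h; rewrite /t.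
  have -> : resv i i = ip e (resv *m e) by rewrite /ip dot_delta mulmx_delta_at.
  by rewrite h.
have t0 : 0 <= t by have := re_ip_resv_ge0 e; rewrite ee.
have N0 : 0 <= N by exact: gmx_ge0.
have key (s : C) : 0 <= N - 2 * re (s^* * z i 0) + nq s * t.
  have := gmx_ge0 (z - s *: (resv *m e)).
  have -> : gmx *m (z - s *: (resv *m e)) = gmx *m z - s *: e.
    by rewrite mulmxBr -scalemxAr mulmxA resvK mul1mx.
  rewrite -scaleNr ipDl !ipDr !ipZl -scaleNr !ipZr.
  have -> : ip (resv *m e) (gmx *m z) = z i 0.
    by rewrite ipM gmx_herm mulmxA resvK mul1mx ezi.
  have -> : ip z e = (z i 0)^* by rewrite ipJ ezi.
  have -> : ip (resv *m e) e = (t%:C)%C by rewrite ipJ ee conjR.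
  rewrite /N; case: (ip z (gmx *m z)) => a a'; case: (z i 0) => f f'; case: s => g g'.
  by rewrite /nq /=; lra.
case: (eqVneq t 0) => [t00|tn].
  case: (eqVneq (z i 0) 0) => [->|zn].
    by rewrite t00 mul0r /nq !expr2 !mulr0 addr0.
  have zq : nq (z i 0) != 0 by rewrite nq_eq0.
  have := key ((((N + 1) / nq (z i 0))%:C)%C * z i 0).
  have -> : re (((((N + 1) / nq (z i 0))%:C)%C * z i 0)^* * z i 0) = N + 1.
    move: zq; case: (z i 0) => a a'; rewrite /nq /= => zq; field; exact: zq.
  rewrite t00 !mulr0 addr0 => h; exfalso.
  by move: h; rewrite /=; move: N0; clear; lra.
have tp : 0 < t by rewrite lt_neqAle eq_sym tn.
have := key (((t^-1)%:C)%C * z i 0).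
rewrite nqM nqR.
have -> : re ((((t^-1)%:C)%C * z i 0)^* * z i 0) = t^-1 * nq (z i 0).
  by case: (z i 0) => a a'; rewrite /nq /=; ring.
rewrite -(pmulr_rge0 _ tp) (_ : t * _ = t * N - nq (z i 0)) ?subr_ge0//.
by field.
Qed.

Lemma norm2sq_resv_le (b : 'cV[C]_p) : norm2sq (resv *m b) <= norm2sq b / eta ^+ 2.
Proof.
have := ip_resv b; rewrite /=; set y := resv *m b => e.
have h : 0 <= norm2sq (((eta%:C)%C) *: y - b) by exact: norm2sq_ge0.
rewrite norm2sqB ipZl conjR [ip y b]ipJ e in h.
have ey : norm2sq ((eta%:C)%C *: y) = eta ^+ 2 * norm2sq y.
  by rewrite !norm2sqE mulr_sumr; apply: eq_bigr => i _; rewrite mxE nqM nqR.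
rewrite ey in h.
rewrite ler_pdivlMr ?exprn_gt0// mulrC.
have : 0 <= eta * norm2sq (adjmx B *m y) by rewrite mulr_ge0 ?norm2sq_ge0// ltW.
by move: h; rewrite /=; lra.
Qed.

Lemma resv_entry i j : nq (resv i j) <= eta^-1 ^+ 2.
Proof.
have := norm2sq_resv_le (delta_mx j 0); rewrite norm2sq_delta mul1r exprVn; apply: le_trans.
by rewrite -(mulmx_delta_at resv); exact: nq_le_norm.
Qed.

End Def.

Lemma resv_push p q eta (B : 'M[C]_(p, q)) : 0 < eta ->
  resv eta (adjmx B) *m adjmx B = adjmx B *m resv eta B.
Proof.
move=> e0; have h : gmx eta (adjmx B) *m adjmx B = adjmx B *m gmx eta B.
  by rewrite /gmx adjK mulmxDl mulmxDr mulmxA mul_scalar_mx mul_mx_scalar.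
rewrite -[LHS]mulmx1 -(resvK B e0) mulmxA -[_ *m adjmx B *m _]mulmxA -h.
by rewrite mulmxA resvKl// mul1mx.
Qed.

Lemma resv_compl p q eta (B : 'M[C]_(p, q)) : 0 < eta ->
  B *m adjmx B *m resv eta B = 1%:M - (eta%:C)%C *: resv eta B.
Proof.
move=> e0; apply/eqP; rewrite eq_sym subr_eq -(resvK B e0) {1}/gmx mulmxDl mul_scalar_mx.
by [].
Qed.

Section Leave.
Variables (n m : nat) (eta : R) (A : 'M[C]_(n, m)) (i : 'I_n).
Hypothesis eta0 : 0 < eta.

Definition zrow : 'M[C]_(n, m) := \matrix_(i', j) if i' == i then 0 else A i' j.

Local Notation r := (row i A).
Local Notation S := (resv eta (adjmx A)).
Local Notation S0 := (resv eta (adjmx zrow)).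

(** A regularised orthogonal projection onto the kernel of [B]. *)
Definition qmx (B : 'M[C]_(n, m)) : 'M[C]_m := (eta%:C)%C *: resv eta (adjmx B).

Definition rform (x : 'cV[C]_m) : C := (r *m x) 0 0.
Definition rres : C := rform (S *m adjmx r).
Definition invD : C := ((eta^-1)%:C)%C * (1 - rres).
(** The Schur complement whose inverse is the diagonal entry [i] of the resolvent: a quadratic form
    in row [i] with a matrix that does not see this row. *)
Definition dval : C := (eta%:C)%C + rform (qmx zrow *m adjmx r).

Let etaC : (eta%:C)%C != 0 :> C.
Proof. by rewrite -(rmorph0 (real_complex R)) (inj_eq (@complexI R)) gt_eqF. Qed.

Lemma gram_zrow : adjmx A *m A = adjmx zrow *m zrow + adjmx r *m r.
Proof.
apply/matrixP => a b; rewrite !mxE (bigD1 i)//= [in RHS](bigD1 i)//= big_ord1 !mxE eqxx mulr0 add0r addrC.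
by congr (_ + _); apply: eq_bigr => k ki; rewrite !mxE (negbTE ki).
Qed.

Lemma gmx_zrow : gmx eta (adjmx A) = gmx eta (adjmx zrow) + adjmx r *m r.
Proof. by rewrite /gmx !adjK gram_zrow addrAC. Qed.

Lemma rank1_update (x : 'cV[C]_m) : r *m (S0 *m x) = r *m (S *m x) + rres *: (r *m (S0 *m x)).
Proof.
have h : S0 = S + S *m (adjmx r *m r) *m S0.
  rewrite -{1}[S0]mul1mx -(resvKl (adjmx A) eta0) gmx_zrow mulmxDr mulmxDl -[S *m gmx _ _ *m S0]mulmxA.
  by rewrite resvK// mulmx1.
rewrite {1}h mulmxDl mulmxDr; congr (_ + _).
rewrite (_ : r *m _ = r *m (S *m adjmx r) *m (r *m (S0 *m x))); last by rewrite !mulmxA.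
rewrite (_ : r *m (S *m adjmx r) = rres%:M) ?mul_scalar_mx//.
by apply/matrixP => a b; rewrite !ord1 [RHS]mxE eqxx mulr1n.
Qed.

Lemma rform_update x : rform (S *m x) = (1 - rres) * rform (S0 *m x).
Proof.
have e : rform (S0 *m x) = rform (S *m x) + rres * rform (S0 *m x).
  rewrite {1}/rform rank1_update [LHS]mxE; congr (_ + _).
  by rewrite [LHS]mxE.
by rewrite mulrBl mul1r {1}e addrK.
Qed.

Lemma rform_qmx x : rform (S *m x) = invD * rform (qmx zrow *m x).
Proof.
rewrite rform_update /invD /qmx /rform -scalemxAl -scalemxAr scaled_at.
by rewrite fmorphV /=; field.
Qed.

Lemma dval_invD : dval * invD = 1.
Proof.
have := rform_qmx (adjmx r); rewrite -/rres => e.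
rewrite /dval mulrDl [rform _ * _]mulrC -e /invD.
by rewrite mulrA -rmorphM mulfV ?gt_eqF// rmorph1 mul1r subrK.
Qed.

Lemma rform_ip x : rform x = ip (adjmx r) x. Proof. by rewrite /ip adjK. Qed.

Lemma ip_qmx (B : 'M[C]_(n, m)) b : ip b (qmx B *m b) = ((re (ip b (qmx B *m b)))%:C)%C /\ 0 <= re (ip b (qmx B *m b)) <= norm2sq b.
Proof.
rewrite /qmx -scalemxAl ipZr; have := ip_resv (adjmx B) eta0 b; rewrite /= adjK.
set y := resv _ _ *m b => e.
rewrite e -rmorphM /=; split=> //.
have p1 : 0 <= eta * norm2sq (B *m y) by rewrite mulr_ge0 ?norm2sq_ge0// ltW.
have p2 := norm2sq_ge0 y; have p3 : 0 <= eta ^+ 2 * norm2sq y by rewrite mulr_ge0// sqr_ge0.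
apply/andP; split; first by rewrite mulrDr addr_ge0// mulrA -expr2.
have : 0 <= norm2sq ((eta%:C)%C *: y - b) by exact: norm2sq_ge0.
rewrite norm2sqB ipZl conjR [ip y b]ipJ e.
have -> : norm2sq ((eta%:C)%C *: y) = eta ^+ 2 * norm2sq y.
  by rewrite !norm2sqE mulr_sumr; apply: eq_bigr => j _; rewrite mxE nqM nqR.
by rewrite /=; lra.
Qed.

Lemma norm2sq_qmx (B : 'M[C]_(n, m)) b : norm2sq (qmx B *m b) <= norm2sq b.
Proof.
rewrite /qmx -scalemxAl.
have -> : norm2sq ((eta%:C)%C *: (resv eta (adjmx B) *m b)) = eta ^+ 2 * norm2sq (resv eta (adjmx B) *m b).
  by rewrite !norm2sqE mulr_sumr; apply: eq_bigr => j _; rewrite mxE nqM nqR.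
by rewrite mulrC -ler_pdivlMr ?exprn_gt0//; exact: norm2sq_resv_le.
Qed.

Lemma dval_real : dval = ((re dval)%:C)%C /\ eta <= re dval.
Proof.
rewrite /dval rform_ip; have [e /andP[h _]] := ip_qmx zrow (adjmx r); rewrite e -rmorphD /=.
by split=> //; rewrite lerDl.
Qed.

Lemma invD_real : invD = ((re dval)^-1%:C)%C.
Proof.
have [e h] := dval_real; have d0 : re dval != 0 by rewrite gt_eqF// (lt_le_trans eta0).
apply: (@mulfI _ dval); first by rewrite e -(rmorph0 (real_complex R)) (inj_eq (@complexI R)).
by rewrite dval_invD e -rmorphM mulfV.
Qed.

Lemma qmx_mono b : re (ip b (qmx zrow *m b)) = re (ip b (qmx A *m b)) + (re dval)^-1 * nq (rform (qmx zrow *m b)).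
Proof.
have h : S0 = S + S *m (adjmx r *m r) *m S0.
  rewrite -{1}[S0]mul1mx -(resvKl (adjmx A) eta0) gmx_zrow mulmxDr mulmxDl -[S *m gmx _ _ *m S0]mulmxA.
  by rewrite resvK// mulmx1.
have hq : qmx zrow *m b = qmx A *m b + (rform (qmx zrow *m b)) *: (S *m adjmx r).
  rewrite {1}/qmx {1}h scalerDr mulmxDl; congr (_ + _).
  rewrite -scalemxAl -!mulmxA -[S *m _]/(S *m _).
  have -> : r *m (S0 *m b) = ((eta^-1)%:C)%C *: (rform (qmx zrow *m b))%:M.
    apply/matrixP => a c; rewrite !ord1 /qmx -scalemxAl /rform -scalemxAr !mxE eqxx mulr1n.
    by rewrite mulrA -rmorphM mulVf ?gt_eqF// rmorph1 mul1r.
  rewrite -!scalemxAr scalerA -rmorphM mulfV ?gt_eqF// rmorph1 scale1r mul_mx_scalar.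
  by rewrite -scalemxAr.
rewrite [X in re (ip b X) = _]hq ipDr reD; congr (_ + _); rewrite ipZr.
have -> : ip b (S *m adjmx r) = (rform (S *m b))^*.
  by rewrite rform_ip -ipJ ipM resv_herm.
rewrite rform_qmx invD_real.
by case: (rform _) => a a'; rewrite /nq /=; ring.
Qed.

(** Schur's formula. Apart from the scalar [dval], row [i] enters only linearly, through a vector
    independent of it, so the second term is centered. *)
Lemma resv_row (b : 'cV[C]_n) : (resv eta A *m b) i 0 =
  ((re dval)^-1%:C)%C * (b i 0 - rform (adjmx zrow *m (resv eta zrow *m b))).
Proof.
set y := resv eta A *m b.
have Gy : gmx eta A *m y = b by rewrite /y mulmxA resvK// mul1mx.
have e1 : rform (adjmx A *m y) + (eta%:C)%C * y i 0 = b i 0.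
  have := congr1 (fun v : 'cV_n => v i 0) Gy; rewrite /= /gmx mulmxDl mul_scalar_mx mxE -mulmxA => <-.
  by rewrite /rform -row_mul [row _ _ _ _]mxE [(_ *: y) _ _]mxE.
have e2 : adjmx A *m b = adjmx zrow *m b + b i 0 *: adjmx r.
  apply/matrixP => a c; rewrite !ord1 !mxE (bigD1 i)//= [in RHS](bigD1 i)//= !mxE eqxx rmorph0 mul0r add0r addrC mulrC.
  by congr (_ + _); apply: eq_bigr => k ki; rewrite !mxE (negbTE ki).
have e3 : rform (adjmx A *m y) = rform (S *m (adjmx A *m b)).
  by rewrite /y !mulmxA resv_push.
rewrite e3 rform_update e2 mulmxDr -scalemxAr in e1.
set t := rform (adjmx zrow *m _).
have e4 : rform (S0 *m (adjmx zrow *m b)) = t by rewrite /t !mulmxA resv_push.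
have e5 : rform (S0 *m (adjmx zrow *m b) + b i 0 *: (S0 *m adjmx r)) = t + b i 0 * rform (S0 *m adjmx r).
  by rewrite {1}/rform mulmxDr mxE -/(rform _) e4 -scalemxAr mxE.
rewrite e5 in e1.
have e6 : rres = (1 - rres) * rform (S0 *m adjmx r) by exact: rform_update.
rewrite -invD_real /invD; apply: (mulfI etaC).
rewrite mulrA mulrA -rmorphM mulfV ?gt_eqF// rmorph1 mul1r.
have -> : (eta%:C)%C * y i 0 = b i 0 - (1 - rres) * (t + b i 0 * rform (S0 *m adjmx r)) by apply/eqP; rewrite eq_sym subr_eq addrC e1.
by rewrite mulrDr [(1 - rres) * (b i 0 * _)]mulrCA -e6; ring.
Qed.

(** The resolvent vector of the punctured problem vanishes at [i], where it therefore does not see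
    the missing row; it is a test vector for [resv_variational]. *)
Lemma punct_mono (b : 'cV[C]_n) :
  re (ip (puncture i b) (resv eta zrow *m puncture i b)) <= re (ip b (resv eta A *m b)).
Proof.
set b' := puncture i b; set y := resv eta zrow *m b'.
have Gy : gmx eta zrow *m y = b' by rewrite /y mulmxA resvK// mul1mx.
have yi : y i 0 = 0.
  have := congr1 (fun v : 'cV_n => v i 0) Gy; rewrite /gmx mulmxDl mul_scalar_mx mxE -mulmxA.
  rewrite puncture_v [X in X + _](_ : _ = 0); last first.
    by rewrite mxE big1// => a _; rewrite mxE eqxx mul0r.
  by rewrite add0r mxE => /eqP; rewrite mulf_eq0 (negbTE etaC) => /eqP.
have e1 : ip y b = ip y b'.
  rewrite /ip !dot_sum; apply: eq_bigr => a _; case: (eqVneq a i) => [->|ai].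
    by rewrite yi rmorph0 !mul0r.
  by rewrite /b' [puncture _ _ _ _]mxE (negbTE ai).
have e2 : adjmx A *m y = adjmx zrow *m y.
  move: yi; clear; move: y => y yi.
  apply/matrixP => a c; rewrite !ord1 mxE [RHS]mxE; apply: eq_bigr => k _; rewrite !adjE mxE.
  by case: (eqVneq k i) => [->|//]; rewrite yi !mulr0.
have := resv_variational A eta0 b y; apply: le_trans.
rewrite ip_gmx e2 -ip_gmx Gy e1.
have -> : ip b' y = (ip y b')^* by exact: ipJ.
by rewrite reJ; lra.
Qed.

End Leave.

Lemma trace_qmx n m eta (B : 'M[C]_(n, m)) : 0 < eta ->
  \tr (qmx eta B) = m%:R - n%:R + (eta%:C)%C * \tr (resv eta B).
Proof.
move=> e0; have := resv_compl (adjmx B) e0; rewrite adjK => h.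
have -> : qmx eta B = 1%:M - adjmx B *m B *m resv eta (adjmx B) by rewrite h opprB addrC subrK.
have e : \tr (adjmx B *m B *m resv eta (adjmx B)) = \tr (B *m adjmx B *m resv eta B).
  by rewrite mxtrace_mulC mulmxA resv_push// mxtrace_mulC mulmxA.
by rewrite raddfB /= mxtrace1 e resv_compl// raddfB /= mxtrace1 mxtraceZ opprB addrA addrAC.
Qed.

Lemma re_trace_resv_ge0 p q eta (B : 'M[C]_(p, q)) : 0 < eta -> 0 <= re (\tr (resv eta B)).
Proof.
move=> e0; rewrite /mxtrace re_sum sumr_ge0// => i _.
have -> : resv eta B i i = ip (delta_mx i 0) (resv eta B *m delta_mx i 0) by rewrite /ip dot_delta mulmx_delta_at.
exact: re_ip_resv_ge0.
Qed.

End Resolvent.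

(** * Resolvent estimates in mean *)

Section ResolventLaw.
Context {R : realType}.
Local Notation C := (R[i]).
Local Notation MX n m := (@MX R n m).

Section Measurability.
Context {d : measure_display} {T : measurableType d}.
Variable mu : probability T R.

Lemma measurable_inv_pos (f : T -> R) : measurable_fun setT f -> (forall x, 0 < f x) ->
  measurable_fun setT (fun x => (f x)^-1).
Proof.
move=> mf f0; rewrite (_ : (fun x => _) = (fun x => f x `^ (-1))).
  by apply: (@measurableT_comp _ _ _ _ _ _ (fun y : R => y `^ (-1)) _ f); first exact: measurable_powR.
by apply/funext => x; rewrite powR_inv1// ltW.
Qed.

Lemma LL_inv (c : R) (f : T -> R) : 0 < c -> LL mu f -> (forall x, c <= f x) -> LL mu (fun x => (f x)^-1).
Proof.
move=> c0 [mf _] cf; have f0 x : 0 < f x by exact: lt_le_trans (cf x).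
apply: (@LL_bnd _ _ _ mu c^-1); first exact: measurable_inv_pos.
move=> x; rewrite ger0_norm ?invr_ge0; last exact: ltW.
by rewrite lef_pV2// posrE.
Qed.

Lemma CLL_det p (F : T -> 'M[C]_p) : mCLL mu F -> CLL mu (fun x => \det (F x)).
Proof.
move=> cF; rewrite /determinant; apply: CLL_sum => sg _; apply: CLLM; first exact: CLL_cst.
elim: (index_enum _) => [|i s IH].
  by apply: (@CLL_eq _ _ _ _ (fun=> 1)); [move=> x; rewrite big_nil|exact: CLL_cst].
apply: CLL_eq (CLLM (cF i _) IH) => x; by rewrite big_cons.
Qed.

Lemma mCLL_add p q (F G : T -> 'M[C]_(p, q)) : mCLL mu F -> mCLL mu G -> mCLL mu (fun x => F x + G x).
Proof.
move=> cF cG i j; apply: (@CLL_eq _ _ _ mu (fun x => F x i j + G x i j)); first by move=> x; rewrite mxE.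
exact: CLLD.
Qed.

Lemma mCLL_adjugate p (F : T -> 'M[C]_p) : mCLL mu F -> mCLL mu (fun x => \adj (F x)).
Proof.
move=> cF i j; apply: (@CLL_eq _ _ _ mu (fun x => cofactor (F x) j i)); first by move=> x; rewrite mxE.
apply: CLLM; first exact: CLL_cst.
apply: CLL_det => a b; apply: CLL_eq (cF _ _) => x; rewrite !mxE; reflexivity.
Qed.

(** Measurability comes from Cramer's formula, integrability from the deterministic bound [eta^-1]
    on the entries. *)
Lemma mCLL_resv p q eta (F : T -> 'M[C]_(p, q)) : 0 < eta -> mCLL mu F -> mCLL mu (fun x => resv eta (F x)).
Proof.
move=> e0 cF; have cG : mCLL mu (fun x => gmx eta (F x)).
  by apply: mCLL_add; [apply: mCLL_mul => //; exact: mCLL_adj|exact: mCLL_cst].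
move=> i j; pose Z x := (\det (gmx eta (F x)))^* * (\adj (gmx eta (F x))) i j.
have cZ : CLL mu Z by apply: CLLM; [apply: CLLJ; exact: CLL_det|exact: mCLL_adjugate].
have n0 x : 0 < nq (\det (gmx eta (F x))).
  rewrite lt_neqAle eq_sym nq_eq0 nq_ge0 andbT -unitfE.
  by have := gmx_unit (F x) e0; rewrite unitmxE.
have [mN _] := LL_nq (CLL_det cG).
have e x : resv eta (F x) i j = (((nq (\det (gmx eta (F x))))^-1)%:C)%C * Z x.
  rewrite /resv /invmx gmx_unit// mxE /Z mulrA; congr (_ * _).
  move: (n0 x); case: (\det _) => a a' h; apply/eqP; rewrite eq_complex /=.
  by apply/andP; split; apply/eqP; rewrite /nq /=; ring.
have mI := measurable_inv_pos mN n0; case: cZ => [[mr _] [mi _]].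
split.
  apply: (@LL_bnd _ _ _ mu (1 + eta^-1 ^+ 2)).
    rewrite (_ : (fun x => _) = (fun x => (nq (\det (gmx eta (F x))))^-1 * re (Z x))); first exact: measurable_funM.
    by apply/funext => x; rewrite e; case: (Z x) => a a' /=; rewrite mul0r subr0.
  move=> x; have h := resv_entry (F x) e0 i j; have h2 := sqr_ge0 (im (resv eta (F x) i j)).
  rewrite ler_norml; move: h h2; rewrite /nq; set a := re _; set b := eta^-1 ^+ 2 => h h2.
  have p1 := sqr_ge0 (a + 1); have p2 := sqr_ge0 (a - 1); have p3 := sqr_ge0 a; nra.
apply: (@LL_bnd _ _ _ mu (1 + eta^-1 ^+ 2)).
  rewrite (_ : (fun x => _) = (fun x => (nq (\det (gmx eta (F x))))^-1 * im (Z x))); first exact: measurable_funM.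
  by apply/funext => x; rewrite e; case: (Z x) => a a' /=; rewrite mul0r addr0.
move=> x; have h := resv_entry (F x) e0 i j; have h2 := sqr_ge0 (re (resv eta (F x) i j)).
rewrite ler_norml; move: h h2; rewrite /nq; set a := im _; set b := eta^-1 ^+ 2 => h h2.
have p1 := sqr_ge0 (a + 1); have p2 := sqr_ge0 (a - 1); have p3 := sqr_ge0 a; nra.
Qed.

Lemma CLL_ip p (F G : T -> 'cV[C]_p) : mCLL mu F -> mCLL mu G -> CLL mu (fun x => ip (F x) (G x)).
Proof. by move=> cF cG; rewrite /ip; apply: mCLL_mul => //; exact: mCLL_adj. Qed.

End Measurability.

Lemma rformE n m (A : 'M[C]_(n, m)) i x : rform A i x = \sum_j A i j * x j 0.
Proof. by rewrite /rform mxE; apply: eq_bigr => j _; rewrite mxE. Qed.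

Section Row.
Variables (n m : nat) (kap : nat -> R) (mu : probability (MX n m) R) (i : 'I_n).
Hypothesis m0 : (0 < m)%N.
Hypothesis gl : good_law kap mu.

Lemma mCLL_id : mCLL mu (fun A : MX n m => (A : 'M[C]_(n, m))).
Proof. by move=> a b; case: gl => _ _ /(_ a b) []. Qed.

Lemma mCLL_zrow : mCLL mu (fun A : MX n m => zrow (A : 'M[C]_(n, m)) i).
Proof.
move=> a b; apply: (@CLL_eq _ _ _ mu (fun A : MX n m => if a == i then 0 else (A : 'M[C]_(n, m)) a b)).
  by move=> A; rewrite mxE.
by case: (a == i); [exact: CLL_cst|exact: mCLL_id].
Qed.

Lemma zrow_blind j : blind (off i j) (fun A : MX n m => zrow (A : 'M[C]_(n, m)) i).
Proof.
move=> A A' o; apply/matrixP => a b; rewrite !mxE; case: eqVneq => // ai.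
by apply: (o a b); rewrite xpair_eqE (negbTE ai).
Qed.

Lemma CLL_rform (u : MX n m -> 'cV[C]_m) : mCLL mu u -> CLL mu (fun A => rform (A : 'M[C]_(n, m)) i (u A)).
Proof.
move=> cu; apply: (@CLL_eq _ _ _ mu (fun A : MX n m => \sum_j (A : 'M[C]_(n, m)) i j * u A j 0)).
  by move=> A; rewrite rformE.
by apply: CLL_sum => j _; apply: CLLM => //; exact: mCLL_id.
Qed.

(* The entries of a row are uncorrelated and independent of [u] and [v]. *)
Lemma row_isotropy (u v : MX n m -> 'cV[C]_m) : mCLL mu u -> mCLL mu v ->
  (forall j, blind (off i j) u) -> (forall j, blind (off i j) v) ->
  E mu (fun A => re ((rform (A : 'M[C]_(n, m)) i (u A))^* * rform (A : 'M[C]_(n, m)) i (v A))) =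
  m%:R^-1 * E mu (fun A => re (ip (u A) (v A))).
Proof.
move=> cu cv bu bv.
pose co j (A : MX n m) : C := coord i j A.
have cco j : CLL mu (co j) by exact: mCLL_id.
pose F j k (A : MX n m) := re ((co j A * u A j 0)^* * (co k A * v A k 0)).
have LF j k : LL mu (F j k).
  by have [] : CLL mu (fun A => (co j A * u A j 0)^* * (co k A * v A k 0)) by apply: CLLM; [apply: CLLJ|]; apply: CLLM.
rewrite (E_ext mu (g := fun A => \sum_j \sum_k F j k A)); last first.
  move=> A; rewrite !rformE rmorph_sum /= mulr_suml re_sum; apply: eq_bigr => j _.
  by rewrite mulr_sumr re_sum.
rewrite E_sum; last by move=> j _; exact: LL_sum.
rewrite (E_ext mu (f := fun A => re (ip (u A) (v A))) (g := fun A => \sum_j re ((u A j 0)^* * v A j 0))); last first.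
  by move=> A; rewrite /ip dot_sum re_sum.
have Luv j : LL mu (fun A => re ((u A j 0)^* * v A j 0)).
  by have [] : CLL mu (fun A => (u A j 0)^* * v A j 0) by apply: CLLM; [apply: CLLJ|].
rewrite E_sum// mulr_sumr; apply: eq_bigr => j _.
rewrite E_sum// (bigD1 j)//= [X in _ + X]big1 ?addr0 => [|k kj].
  have [_ _ <-//] := entry_coord i j m0 gl; last by move=> A A' o; rewrite (bu j A A' o) (bv j A A' o).
  apply: E_ext => A; rewrite /F /co /coord.
  case: ((A : 'M[C]_(n, m)) i j) => a a'; case: (u A j 0) => e e'; case: (v A j 0) => f f'.
  by rewrite /nq /=; ring.
have [hc _ _] := entry_coord i k m0 gl.
rewrite (E_ext mu (g := fun A => re ((co j A * u A j 0)^* * v A k 0 * co k A))); last first.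
  by move=> A; rewrite /F [co k A * _]mulrC mulrA.
apply: (cent_cross hc); first by apply: CLLM => //; apply: CLLJ; exact: CLLM.
move=> A A' o; rewrite (bu k A A' o) (bv k A A' o) /co (o i j)//.
by rewrite xpair_eqE eqxx /= eq_sym.
Qed.

Lemma rform_Ob (u : MX n m -> 'cV[C]_m) : mCLL mu u -> (forall j, blind (off i j) u) ->
  (forall A, norm2sq (u A) <= 1) ->
  Ob mu (fun p => `|rosenthal_const kap p| * 1) (scl m * 1) (fun A => rform (A : 'M[C]_(n, m)) i (u A)).
Proof.
move=> cu bu u1.
apply: (@Ob_eq _ _ _ _ _ _ (fun A : MX n m => \sum_j coord i j A * u A j 0)).
  by move=> A; rewrite rformE.
apply: (@lin_Ob _ _ _ mu _ (fun j => off i j) (fun j => coord i j) (fun j A => u A j 0) kap (scl m) (fun=> 1) 1) => //.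
- exact: scl_gt0.
- by move=> j; have [] := entry_coord i j m0 gl.
- by move=> j k jk A A' o; apply: (o i j); rewrite xpair_eqE eqxx /= neq_ltn jk.
- by move=> j k _ A A' o; rewrite (bu k A A' o).
move=> p; rewrite expr1n mulr1 -[leRHS](E_cst mu 1).
apply: E_le; [|exact: LL_cst|].
  by apply: LLX; apply: LL_sum => j _; exact: LL_nq.
by move=> A; rewrite -norm2sqE exprn_ile1// norm2sq_ge0.
Qed.

End Row.

(** [q] is bounded below by a constant but [D] only by the tiny [e]. If [D < q / 2], the deviation
    exceeds [g / 2], so the factor [e^-2] can be paid for by any even power of the deviation. The
    tenth power matches [e = reta]: [s^-8 * s^10 = s^2]. *)
Lemma inv_diff_bound (D q g e : R) : 0 < g -> g <= q -> 0 < e -> e <= D ->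
  (D^-1 - q^-1) ^+ 2 <= (2 * g^-1 ^+ 2) ^+ 2 * (D - q) ^+ 2 + e^-1 ^+ 2 * ((2 * g^-1) ^+ 2 * (D - q) ^+ 2) ^+ 5.
Proof.
move=> g0 gq e0 eD; have q0 : 0 < q by exact: lt_le_trans gq.
have D0 : 0 < D by exact: lt_le_trans eD.
have G0 : 0 <= g^-1 by rewrite invr_ge0 ltW.
have e1 : 0 <= e^-1 by rewrite invr_ge0 ltW.
set x := D - q; have x20 := sqr_ge0 x.
have eu : D^-1 - q^-1 = - (x * (D * q)^-1) by rewrite /x; field; rewrite !gt_eqF.
have [h|h] := lerP (q / 2) D.
  apply: ler_wpDr; first by nneg.
  rewrite eu sqrrN exprMn mulrC ler_wpM2r// lerXn2r ?nnegrE//.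
  - by rewrite invr_ge0 mulr_ge0 ?(ltW D0) ?(ltW q0).
  - by nneg.
  rewrite -(ler_pM2l (mulr_gt0 D0 q0)) mulfV ?gt_eqF ?mulr_gt0//.
  have h1 : g / 2 * g <= D * q.
    apply: ler_pM => //; rewrite ?divr_ge0 ?(ltW g0)//.
    by apply: le_trans h; rewrite ler_pM2r.
  have : g / 2 * g * (2 * g^-1 ^+ 2) <= D * q * (2 * g^-1 ^+ 2) by rewrite ler_wpM2r//; nneg.
  by rewrite (_ : g / 2 * g * (2 * g^-1 ^+ 2) = 1)//; field; rewrite gt_eqF.
apply: ler_wpDl; first by nneg.
apply: (@le_trans _ _ (e^-1 ^+ 2)).
  have u0 : 0 <= D^-1 - q^-1.
    rewrite subr_ge0 lef_pV2 ?posrE//; move: h q0; lra.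
  rewrite lerXn2r ?nnegrE//.
  apply: (@le_trans _ _ D^-1); first by rewrite gerBl invr_ge0 ltW.
  by rewrite lef_pV2.
rewrite ler_peMr//; first by nneg.
rewrite -exprMn exprn_ege1// (_ : (2 * g^-1 * x) ^+ 2 = ((q - D) / (g / 2)) ^+ 2).
  by rewrite exprn_ege1// ler_pdivlMr ?divr_gt0// mul1r; move: h gq; lra.
by rewrite /x; field; rewrite gt_eqF.
Qed.

Section Bounds.
Variables (n m : nat) (kap : nat -> R) (mu : probability (MX n m) R) (g0 : R).
Hypothesis m0 : (0 < m)%N.
Hypothesis nm : (n <= m)%N.
Hypothesis gl : good_law kap mu.
Hypothesis g00 : 0 < g0.
Let g : R := 1 - n%:R / m%:R.
Hypothesis gg : g0 <= g.
Let M (A : MX n m) : 'M[C]_(n, m) := A.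
Let s : R := scl m.
Let s0 : 0 < s. Proof. exact: scl_gt0. Qed.
Let s2 : s ^+ 2 = m%:R^-1. Proof. exact: scl2. Qed.
Let ns2 : n%:R * s ^+ 2 <= 1.
Proof. by rewrite s2 ler_pdivrMr ?ltr0n// mul1r ler_nat. Qed.
Let gp : 0 < g. Proof. exact: lt_le_trans gg. Qed.

(** Equal to [m^-2]: small enough for [eta] times the trace of the resolvent to vanish, yet only
    polynomially small, so that [eta^-2] is compensated by a moment of [dval] of fixed order. *)
Definition reta : R := scl m ^+ 4.
Local Notation eta := reta.
Lemma reta_gt0 : 0 < eta. Proof. by rewrite exprn_gt0. Qed.
Let e0 := reta_gt0.

Definition Q0 i (A : MX n m) : 'M[C]_m := qmx eta (zrow (M A) i).
Definition Dv i (A : MX n m) : R := re (dval eta (M A) i).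
(** The conditional mean of [Dv i] given the other rows. *)
Definition qv i (A : MX n m) : R := eta + m%:R^-1 * re (\tr (Q0 i A)).
Definition uv i (A : MX n m) : R := (Dv i A)^-1 - (qv i A)^-1.

Lemma mCLL_qmx (F : MX n m -> 'M[C]_(n, m)) : mCLL mu F -> mCLL mu (fun A => qmx eta (F A)).
Proof.
move=> cF a b; apply: (@CLL_eq _ _ _ mu (fun A => (eta%:C)%C * resv eta (adjmx (F A)) a b)).
  by move=> A; rewrite /qmx scaled_at.
by apply: CLLM; [exact: CLL_cst|apply: mCLL_resv => //; exact: mCLL_adj].
Qed.

Lemma mCLL_Q0 i : mCLL mu (Q0 i).
Proof. by apply: mCLL_qmx; exact: mCLL_zrow gl. Qed.

Lemma Q0_blind i j : blind (off i j) (Q0 i).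
Proof. by move=> A A' o; rewrite /Q0 /M (zrow_blind o). Qed.

Let reNat k : re (k%:R : C) = k%:R.
Proof. by rewrite -(rmorph_nat (real_complex R)). Qed.

Let reZ (x : R) (z : C) : re ((x%:C)%C * z) = x * re z.
Proof. by case: z => a a' /=; rewrite mul0r subr0. Qed.

(** Dimension count: the regularised kernel projection of an [n] by [m] matrix has trace at least
    [m - n]. This deterministic bound is what [d < 1] provides. *)
Lemma qv_ge i A : g <= qv i A.
Proof.
rewrite /qv trace_qmx// reD reD reN !reNat reZ.
have h : 0 <= eta * re (\tr (resv eta (zrow (M A) i))) by rewrite mulr_ge0 ?re_trace_resv_ge0// ltW.
apply: ler_wpDl; first exact: ltW.
rewrite /g [m%:R^-1 * _]mulrC ler_pdivlMr ?ltr0n// mulrBl mul1r divfK ?lerDl//.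
by rewrite pnatr_eq0 -lt0n.
Qed.

Lemma qv_blind i j : blind (off i j) (qv i).
Proof. by move=> A A' o; rewrite /qv (Q0_blind o). Qed.

Lemma LL_qv i : LL mu (qv i).
Proof.
apply: LLD; first exact: LL_cst.
apply: LLZ; have [] // : CLL mu (fun A => \tr (Q0 i A)).
by rewrite /mxtrace; apply: CLL_sum => j _; exact: mCLL_Q0.
Qed.

Lemma LL_qinv i : LL mu (fun A => (qv i A)^-1).
Proof. by apply: (LL_inv gp) => // *; [exact: LL_qv|exact: qv_ge]. Qed.

Lemma qinv_le i A : 0 <= (qv i A)^-1 <= g^-1.
Proof.
have q0 : 0 < qv i A by exact: lt_le_trans (qv_ge i A).
by rewrite invr_ge0 ltW//= lef_pV2 ?qv_ge.
Qed.

Lemma Dv_ge i A : eta <= Dv i A.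
Proof. by have [] := dval_real (M A) i e0. Qed.

Lemma CLL_dval i : CLL mu (fun A => dval eta (M A) i).
Proof.
apply: CLLD; first exact: CLL_cst.
have c : mCLL mu (fun A => Q0 i A *m adjmx (row i (M A))).
  apply: mCLL_mul; first exact: mCLL_Q0.
  by apply: mCLL_adj => a b; apply: CLL_eq (mCLL_id gl i b) => A; rewrite mxE.
exact: (CLL_rform _ gl c).
Qed.

Lemma LL_Dinv i : LL mu (fun A => (Dv i A)^-1).
Proof. by apply: (LL_inv e0) => // *; [have [] := CLL_dval i|exact: Dv_ge]. Qed.

Lemma LL_uv i : LL mu (uv i).
Proof. by apply: LLB; [exact: LL_Dinv|exact: LL_qinv]. Qed.

Lemma dval_concentration i : Ob mu (quad_const kap (fun=> 1)) (scl m * 1)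
  (fun A => dval eta (M A) i - (((eta%:C)%C) + ((m%:R^-1)%:C)%C * \tr (Q0 i A))).
Proof.
pose h (j : 'I_m) (A : MX n m) : C := (coord i j A)^*.
pose B (j k : 'I_m) (A : MX n m) := Q0 i A j k.
have colB k A : \sum_j nq (B j k A) <= 1.
  have := norm2sq_qmx e0 (zrow (M A) i) (delta_mx k 0).
  by rewrite norm2sq_delta norm2sqE; under eq_bigr do rewrite mulmx_delta_at.
apply: (@Ob_eq _ _ _ _ _ _ (fun A : MX n m => \sum_j \sum_k (h j A)^* * B j k A * h k A
   - \sum_j ((m%:R^-1)%:C)%C * B j j A)).
  move=> A; rewrite /dval opprD addrACA subrr add0r; congr (_ - _); last by rewrite -mulr_sumr.
  rewrite rformE; apply: eq_bigr => j _; rewrite mxE mulr_sumr; apply: eq_bigr => k _.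
  by rewrite /h conjCK adjE [row _ _ _ _]mxE mulrA.
apply: (@quad_Ob _ _ _ mu kap (fun=> 1) _ (fun j => off i j) h (scl m) (fun j => m%:R^-1) B 1 s0 ltr01).
- by rewrite -/s s2 mulfV ?pnatr_eq0 -?lt0n// ler1n.
- by move=> j; apply: entry_conj; exact: entry_coord.
- move=> j k jk A A' o; rewrite /h (o i j)//.
  by rewrite xpair_eqE eqxx.
- by move=> j k l A A' o; rewrite /B (Q0_blind o).
- by move=> j k; exact: mCLL_Q0.
- move=> k p; rewrite expr1n mulr1 -[leRHS](E_cst mu 1); apply: E_le; [|exact: LL_cst|].
    by apply: LLX; apply: LL_sum => j _; apply: LL_nq; exact: mCLL_Q0.
  by move=> A; rewrite exprn_ile1//; nneg.
move=> k p; rewrite expr1n mulr1 -[leRHS](E_cst mu 1); apply: E_le; [|exact: LL_cst|].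
  by apply: LLX; apply: LL_sum => j _; apply: LL_nq; exact: mCLL_Q0.
move=> A; rewrite exprn_ile1//; first by nneg.
apply: le_trans (colB k A); apply: ler_sum => j _.
have qh : adjmx (Q0 i A) = Q0 i A by rewrite /Q0 /qmx adjZ conjR resv_herm.
by rewrite /B -{1}qh adjE nqJ.
Qed.

Let kq p := `|quad_const kap (fun=> 1) p|.
Definition u_const := (2 * g0^-1 ^+ 2) ^+ 2 * kq 1 + (2 * g0^-1) ^+ 10 * kq 5.

Lemma u_const_ge0 : 0 <= u_const.
Proof. by have h := invr_ge0 g0; rewrite /u_const /kq addr_ge0// mulr_ge0// exprn_ge0// mulr_ge0// ?exprn_ge0// h ltW. Qed.

Lemma uv_bound i : E mu (fun A => uv i A ^+ 2) <= u_const * s ^+ 2.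
Proof.
have := Ob_K (fun p => ler_norm (quad_const kap (fun=> 1) p)) (dval_concentration i).
rewrite -/kq => -[_ cX hX]; set X := fun A => _ in cX hX.
have Xb A : (Dv i A - qv i A) ^+ 2 <= nq (X A).
  have -> : Dv i A - qv i A = re (X A).
    have aux (z w t : C) : re (z - (w + t)) = re z - (re w + re t) by rewrite reD reN reD.
    by rewrite /X aux reZ.
  by rewrite /nq lerDl sqr_ge0.
have LX := LL_nq cX.
apply: (@le_trans _ _ (E mu (fun A => (2 * g0^-1 ^+ 2) ^+ 2 * nq (X A) +
   eta^-1 ^+ 2 * (2 * g0^-1) ^+ 10 * nq (X A) ^+ 5))).
  apply: E_le; [by apply: LLX; exact: LL_uv| |].
    by apply: LLD; apply: LLZ => //; exact: LLX.
  move=> A; have gq : g0 <= qv i A by exact: le_trans gg (qv_ge i A).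
  have := inv_diff_bound g00 gq e0 (Dv_ge i A); rewrite -/(uv i A) => /le_trans; apply.
  have G0 : 0 <= g0^-1 by rewrite invr_ge0 ltW.
  have e1 : 0 <= eta^-1 by rewrite invr_ge0 ltW.
  rewrite -mulrA; apply: lerD; first by rewrite ler_wpM2l//; nneg.
  rewrite ler_wpM2l//; first by nneg.
  rewrite exprMn -exprM; rewrite ler_wpM2l//; first by nneg.
  by rewrite lerXn2r ?nnegrE ?sqr_ge0 ?nq_ge0.
rewrite (E_add (LLZ _ LX) (LLZ _ (LLX 5 LX))) !E_scale//; last exact: LLX.
have h1 := hX 1%N; have h5 := hX 5%N.
rewrite mulr1 -/s in h1 h5.
rewrite /u_const [leRHS]mulrDl; apply: lerD.
  by rewrite -[leRHS]mulrA ler_wpM2l ?sqr_ge0//; exact: h1.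
apply: (@le_trans _ _ (eta^-1 ^+ 2 * (2 * g0^-1) ^+ 10 * (kq 5 * s ^+ (2 * 5)))).
  rewrite ler_wpM2l// mulr_ge0 ?sqr_ge0// exprn_ge0// mulr_ge0// invr_ge0 ltW//.
have -> : eta^-1 ^+ 2 * (2 / g0) ^+ 10 * (kq 5 * s ^+ (2 * 5)) =
    (2 / g0) ^+ 10 * kq 5 * s ^+ 2 * (eta^-1 ^+ 2 * s ^+ 8).
  by rewrite (_ : (2 * 5 = 2 + 8)%N)// exprD; ring.
by rewrite /eta -/s -[8%N]/(4 * 2)%N exprM exprVn mulVf ?mulr1// !expf_neq0// gt_eqF.
Qed.

Lemma rform_centered i (Z : MX n m -> C) (u : MX n m -> 'cV[C]_m) : CLL mu Z -> mCLL mu u ->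
  (forall j, blind (off i j) Z) -> (forall j, blind (off i j) u) ->
  E mu (fun A => re (Z A * rform (M A) i (u A))) = 0.
Proof.
move=> cZ cu bZ bu.
have cco j : CLL mu (coord i j) by exact: mCLL_id gl i j.
have cc j : CLL mu (fun A => Z A * u A j 0 * coord i j A) by apply: CLLM => //; exact: CLLM.
rewrite (E_ext mu (g := fun A => \sum_j re (Z A * u A j 0 * coord i j A))); last first.
  move=> A; rewrite rformE mulr_sumr re_sum; apply: eq_bigr => j _.
  by rewrite [in LHS]mulrCA [in LHS]mulrC.
rewrite E_sum => [|j _]; last by have [] := cc j.
rewrite big1// => j _; have [hc _ _] := entry_coord i j m0 gl.
apply: (cent_cross hc); first exact: CLLM.
by move=> A A' o; rewrite (bZ j A A' o) (bu j A A' o).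
Qed.

Lemma uv_norm_bound i : E mu (fun A => `|uv i A|) <= s / 2 * (1 + u_const).
Proof.
have Lu := LL_uv i; have Lu2 := LLX 2 Lu.
apply: (@le_trans _ _ (E mu (fun A => s / 2 + (2 * s)^-1 * uv i A ^+ 2))).
  apply: E_le; [exact: LL_norm| |].
    by apply: LLD; [exact: LL_cst|exact: LLZ].
  move=> A; rewrite -[uv i A ^+ 2]real_normK ?num_real//; set x := `|_|.
  rewrite -subr_ge0 (_ : _ - x = (2 * s)^-1 * (x - s) ^+ 2); last by field; rewrite gt_eqF.
  by rewrite mulr_ge0 ?sqr_ge0// invr_ge0 mulr_ge0// ltW.
rewrite (E_add (LL_cst _ _) (LLZ _ Lu2)) E_cst E_scale//.
have : (2 * s)^-1 * E mu (fun A => uv i A ^+ 2) <= (2 * s)^-1 * (u_const * s ^+ 2).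
  by rewrite ler_wpM2l ?uv_bound// invr_ge0 mulr_ge0// ltW.
rewrite (_ : (2 * s)^-1 * (u_const * s ^+ 2) = s / 2 * u_const); last by field; rewrite gt_eqF.
by lra.
Qed.

Definition fR (b : 'cV[C]_n) (A : MX n m) : R := re (ip b (resv eta (M A) *m b)).
Definition fQ (b : 'cV[C]_m) (A : MX n m) : R := re (ip b (qmx eta (M A) *m b)).

Let cM : mCLL mu M. Proof. by move=> a c; case: gl => _ _ /(_ a c) []. Qed.

Lemma LL_fR b : LL mu (fR b).
Proof.
have [] // : CLL mu (fun A => ip b (resv eta (M A) *m b)).
by apply: CLL_ip; [exact: mCLL_cst|apply: mCLL_mul; [exact: mCLL_resv|exact: mCLL_cst]].
Qed.

Lemma LL_fQ b : LL mu (fQ b).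
Proof.
have [] // : CLL mu (fun A => ip b (qmx eta (M A) *m b)).
by apply: CLL_ip; [exact: mCLL_cst|apply: mCLL_mul; [exact: mCLL_qmx|exact: mCLL_cst]].
Qed.

Lemma fR_ge0 b A : 0 <= fR b A. Proof. exact: re_ip_resv_ge0. Qed.

Lemma fQ_bnd b A : 0 <= fQ b A <= norm2sq b.
Proof. by have [] := ip_qmx e0 (M A) b. Qed.

Let tv i (b : 'cV[C]_n) (A : MX n m) := adjmx (zrow (M A) i) *m (resv eta (zrow (M A) i) *m b).

Lemma tv_le i b A : norm2sq (tv i b A) <= fR b A.
Proof.
apply: le_trans (punct_mono (M A) i e0 b).
rewrite ip_resv//= (_ : tv i b A = adjmx (zrow (M A) i) *m (resv eta (zrow (M A) i) *m puncture i b)).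
  by rewrite lerDl mulr_ge0 ?norm2sq_ge0// ltW.
rewrite /tv !mulmxA -!resv_push// -!mulmxA; congr (_ *m _).
apply/matrixP => a c; rewrite !ord1 mxE [RHS]mxE; apply: eq_bigr => k _; rewrite !adjE !mxE.
by case: eqVneq => // _; rewrite rmorph0 !mul0r.
Qed.

Lemma tv_blind i b j : blind (off i j) (tv i b).
Proof. by move=> A A' o; rewrite /tv /M (zrow_blind o). Qed.

Lemma mCLL_tv i b : mCLL mu (tv i b).
Proof.
have cz : mCLL mu (fun A => zrow (M A) i) by exact: mCLL_zrow gl.
apply: mCLL_mul; first exact: mCLL_adj.
by apply: mCLL_mul; [exact: mCLL_resv|exact: mCLL_cst].
Qed.

(** A self-consistent inequality. Sum [resv_row] over [i], with [Dv] replaced by [qv], whose inverse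
    is at most [g^-1]. The linear term is centered, and its product with the error [uv] is bounded
    through [tv_le] by a small multiple of the mean of [fR] itself. *)
Lemma fR_bound b : norm2sq b = 1 ->
  E mu (fR b) <= g^-1 + s / 2 * (1 + (2 * u_const + E mu (fR b))).
Proof.
move=> b1; pose Z i (A : MX n m) : C := (((qv i A)^-1)%:C)%C * (b i 0)^*.
pose rf i A := rform (M A) i (tv i b A).
have cZ i : CLL mu (Z i) by apply: CLLM; [apply: CLLR; exact: LL_qinv|exact: CLL_cst].
have crf i : CLL mu (rf i) by apply: (CLL_rform i gl (mCLL_tv i b)).
have LZ i : LL mu (fun A => re (Z i A * rf i A)) by have [] := CLLM (cZ i) (crf i).
(* A pointwise majorant of the contribution of row [i]: the product of [uv] with the linear form is
   split with weights [s^-1] and [s], because [uv] has mean square of order [s^2]. *)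
pose G i A := nq (b i 0) * (g^-1 + `|uv i A| + (2 * s)^-1 * uv i A ^+ 2) + s / 2 * nq (rf i A) - re (Z i A * rf i A).
have L1 i : LL mu (fun A => g^-1 + `|uv i A| + (2 * s)^-1 * uv i A ^+ 2).
  apply: LLD; last by apply: LLZ; apply: LLX; exact: LL_uv.
  by apply: LLD; [exact: LL_cst|apply: LL_norm; exact: LL_uv].
have L2 i : LL mu (fun A => s / 2 * nq (rf i A)) by apply: LLZ; exact: LL_nq.
have L12 i : LL mu (fun A => nq (b i 0) * (g^-1 + `|uv i A| + (2 * s)^-1 * uv i A ^+ 2) + s / 2 * nq (rf i A)).
  by apply: LLD => //; exact: LLZ.
have LG i : LL mu (G i) by exact: LLB.
have EG i : E mu (G i) <= nq (b i 0) * (g^-1 + s / 2 * (1 + 2 * u_const)) + s / 2 * m%:R^-1 * E mu (fR b).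
  rewrite /G (E_sub (L12 i) (LZ i)) (E_add (LLZ _ (L1 i)) (L2 i)) rform_centered ?subr0; first last.
  - by move=> j A A' o; rewrite (tv_blind b o).
  - by move=> j A A' o; rewrite /Z (qv_blind o).
  - exact: mCLL_tv.
  - exact: cZ.
  rewrite (E_scale _ (L1 i)) (E_scale _ (LL_nq (crf i))); apply: lerD.
    rewrite ler_wpM2l ?nq_ge0//.
    have Lu := LL_uv i; have Lu2 := LLX 2 Lu.
    rewrite (E_add (LLD (LL_cst _ _) (LL_norm Lu)) (LLZ _ Lu2)) (E_add (LL_cst _ _) (LL_norm Lu)) E_cst E_scale//.
    have h1 := uv_norm_bound i.
    have : (2 * s)^-1 * E mu (fun A => uv i A ^+ 2) <= (2 * s)^-1 * (u_const * s ^+ 2).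
      by rewrite ler_wpM2l ?uv_bound// invr_ge0 mulr_ge0// ltW.
    rewrite (_ : (2 * s)^-1 * (u_const * s ^+ 2) = s / 2 * u_const); last by field; rewrite gt_eqF.
    by move: h1; lra.
  rewrite -[leRHS]mulrA ler_wpM2l ?divr_ge0 ?(ltW s0)//.
  rewrite (E_ext mu (g := fun A => re ((rf i A)^* * rf i A))); last first.
    by move=> A; case: (rf i A) => a a'; rewrite /nq /=; ring.
  rewrite (row_isotropy m0 gl (mCLL_tv i b) (mCLL_tv i b)).
  - rewrite ler_wpM2l ?invr_ge0//; apply: E_le; [|exact: LL_fR|].
      by have [] := CLL_ip (mCLL_tv i b) (mCLL_tv i b).
    by move=> A; rewrite ip_norm2sq /= tv_le.
  - by move=> j; exact: tv_blind.
  - by move=> j; exact: tv_blind.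
apply: (@le_trans _ _ (E mu (fun A => \sum_i G i A))).
  apply: E_le; [exact: LL_fR|by apply: LL_sum|].
  move=> A; rewrite /fR /ip dot_sum re_sum; apply: ler_sum => i _.
  rewrite resv_row// -/(Dv i A) -/(tv i b A) -/(rf i A).
  have -> : (Dv i A)^-1 = (qv i A)^-1 + uv i A by rewrite /uv addrC subrK.
  have /andP[q0 q1] := qinv_le i A.
  rewrite /G /Z; set q := (qv i A)^-1 in q0 q1 *; set u := uv i A.
  have hu := ler_norm u; have au2 : `|u| ^+ 2 = u ^+ 2 by rewrite real_normK ?num_real.
  case: (b i 0) => a a'; case: (rf i A) => f f'; rewrite /nq /=.
  have y : - (u * (a * f + a' * f')) <= (2 * s)^-1 * u ^+ 2 * (a ^+ 2 + a' ^+ 2) + s / 2 * (f ^+ 2 + f' ^+ 2).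
    rewrite -subr_ge0 (_ : _ - _ = (2 * s)^-1 * ((u * a + s * f) ^+ 2 + (u * a' + s * f') ^+ 2)); last by field; rewrite gt_eqF.
    by rewrite mulr_ge0 ?addr_ge0 ?sqr_ge0// invr_ge0 mulr_ge0// ltW.
  have n0 : 0 <= a ^+ 2 + a' ^+ 2 by rewrite addr_ge0 ?sqr_ge0.
  have k1 : (a ^+ 2 + a' ^+ 2) * (q + u) <= (a ^+ 2 + a' ^+ 2) * (g^-1 + `|u|) by rewrite ler_wpM2l// lerD.
  by move: y k1; lra.
rewrite E_sum//; apply: le_trans (ler_sum _ (fun i _ => EG i)) _.
rewrite big_split /= -mulr_suml -norm2sqE b1 mul1r sumr_const card_ord -[_ *+ n]mulr_natl.
have h : n%:R * (s / 2 * m%:R^-1 * E mu (fR b)) <= s / 2 * E mu (fR b).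
  rewrite (_ : n%:R * _ = n%:R * s ^+ 2 * (s / 2 * E mu (fR b))); last by rewrite s2; ring.
  by rewrite ler_piMl// mulr_ge0 ?divr_ge0 ?(ltW s0)// E_ge0// => A; exact: fR_ge0.
by move: h; lra.
Qed.

Definition rform_const p := `|rosenthal_const kap p| * 1.

(** [1 - fQ b] is a sum over rows of [conj (r_i b) * (r_i S b)], and [r_i S b] equals
    [r_i Q0 b / Dv]. With [Dv] replaced by [qv >= g], row isotropy gives [(n / m) g^-1 = g^-1 - 1]
    times the mean of [fQ]; solving the inequality yields [fQ >= g] in mean, up to errors. *)
Lemma fQ_bound b : norm2sq b = 1 ->
  1 - E mu (fQ b) <= (g^-1 - 1) * (E mu (fQ b) + s ^+ 2 * (g0^-1 * rform_const 1 + u_const + rform_const 2))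
   + s * (u_const + (rform_const 2 + rform_const 2)).
Proof.
move=> b1.
pose rf i (A : MX n m) := rform (M A) i b.
pose rq i A := rform (M A) i (Q0 i A *m b).
have cqb i : mCLL mu (fun A => Q0 i A *m b) by apply: mCLL_mul; [exact: mCLL_Q0|exact: mCLL_cst].
have bqb i j : blind (off i j) (fun A => Q0 i A *m b) by move=> A A' o; rewrite (Q0_blind o).
have crf i : CLL mu (rf i) by apply: (CLL_rform i gl); exact: mCLL_cst.
have crq i : CLL mu (rq i) by exact: (CLL_rform i gl (cqb i)).
have Orf i : Ob mu rform_const (s * 1) (rf i).
  by apply: (rform_Ob m0 gl (u := fun=> b)) => // [|A]; [exact: mCLL_cst|rewrite b1].
have Orq i : Ob mu rform_const (s * 1) (rq i).
  by apply: (rform_Ob m0 gl (u := fun A => Q0 i A *m b)) => // A; rewrite -b1; exact: norm2sq_qmx.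
rewrite mulr1 in Orf; rewrite mulr1 in Orq.
pose G i A := re ((rf i A)^* * rform (M A) i ((((qv i A)^-1)%:C)%C *: (Q0 i A *m b))) +
   ((2 * s)^-1 * nq (rf i A * rq i A) + s / 2 * uv i A ^+ 2).
pose v i A := (((qv i A)^-1)%:C)%C *: (Q0 i A *m b).
have cv i : mCLL mu (v i).
  move=> a c; apply: (@CLL_eq _ _ _ mu (fun A => (((qv i A)^-1)%:C)%C * (Q0 i A *m b) a c)).
    by move=> A; rewrite /v [RHS]mxE.
  by apply: CLLM; [apply: CLLR; exact: LL_qinv|exact: cqb].
have bv i j : blind (off i j) (v i) by move=> A A' o; rewrite /v (qv_blind o) (Q0_blind o).
have crv i : CLL mu (fun A => rform (M A) i (v i A)) by exact: (CLL_rform i gl (cv i)).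
have L1 i : LL mu (fun A => re ((rf i A)^* * rform (M A) i (v i A))) by have [] := CLLM (CLLJ (crf i)) (crv i).
have L2 i : LL mu (fun A => nq (rf i A * rq i A)) by apply: LL_nq; exact: CLLM.
have L3 i : LL mu (fun A => uv i A ^+ 2) by apply: LLX; exact: LL_uv.
have L23 i : LL mu (fun A => (2 * s)^-1 * nq (rf i A * rq i A) + s / 2 * uv i A ^+ 2).
  by apply: LLD; exact: LLZ.
have LG i : LL mu (G i) by exact: LLD.
have Q0b i : E mu (fun A => re (ip b (Q0 i A *m b))) <= E mu (fQ b) + s ^+ 2 * (g0^-1 * rform_const 1 + u_const + rform_const 2).
  have [_ _ h1] := Orq i.
  have Lq := LL_nq (crq i); have Lq2 := LLX 2 Lq.
  have T1 : LL mu (fun A => g0^-1 * nq (rq i A)) by exact: LLZ.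
  have T2 : LL mu (fun A => uv i A ^+ 2 + nq (rq i A) ^+ 2) by exact: LLD.
  apply: (@le_trans _ _ (E mu (fun A => fQ b A + (g0^-1 * nq (rq i A) + (uv i A ^+ 2 + nq (rq i A) ^+ 2))))).
    apply: E_le; [by have [] := CLL_ip (mCLL_cst mu b) (cqb i)|by apply: LLD; [exact: LL_fQ|exact: LLD]|].
    move=> A; rewrite /Q0 qmx_mono// -/(fQ b A) lerD2l -/(Dv i A) -/(Q0 i A) -/(rq i A).
    have -> : (Dv i A)^-1 = (qv i A)^-1 + uv i A by rewrite /uv addrC subrK.
    rewrite mulrDl; apply: lerD; last exact: mul_sqr_le.
    rewrite ler_wpM2r ?nq_ge0//; have /andP[_ /le_trans -> //] := qinv_le i A.
    by rewrite lef_pV2.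
  rewrite (E_add (LL_fQ b) (LLD T1 T2)) (E_add T1 T2) (E_add (L3 i) Lq2) (E_scale _ Lq) lerD2l.
  have a1 : g0^-1 * E mu (fun A => nq (rq i A)) <= g0^-1 * (rform_const 1 * s ^+ 2).
    by rewrite ler_wpM2l ?invr_ge0 ?(ltW g00)//; exact: (h1 1%N).
  have a2 := uv_bound i; have a3 := h1 2%N.
  have a4 : rform_const 2 * s ^+ (2 * 2) <= rform_const 2 * s ^+ 2.
    rewrite ler_wpM2l//; first by rewrite /rform_const mulr1.
    by rewrite (_ : (2 * 2 = 2 + 2)%N)// exprD ler_piMr ?sqr_ge0// s2 invf_le1 ?ler1n ?ltr0n.
  by move: a1 a2 a3 a4; lra.
have EG i : E mu (G i) <= m%:R^-1 * (g^-1 * (E mu (fQ b) + s ^+ 2 * (g0^-1 * rform_const 1 + u_const + rform_const 2)))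
    + s / 2 * (s ^+ 2 * (u_const + (rform_const 2 + rform_const 2))).
  rewrite /G (E_add (L1 i) (L23 i)) (E_add (LLZ _ (L2 i)) (LLZ _ (L3 i))) (E_scale _ (L2 i)) (E_scale _ (L3 i)).
  rewrite (row_isotropy m0 gl (mCLL_cst mu b) (cv i))//; apply: lerD.
    rewrite ler_wpM2l ?invr_ge0//; apply: (@le_trans _ _ (g^-1 * E mu (fun A => re (ip b (Q0 i A *m b))))); last first.
      by rewrite ler_wpM2l ?Q0b// invr_ge0 ltW.
    have Lb : LL mu (fun A => re (ip b (Q0 i A *m b))) by have [] := CLL_ip (mCLL_cst mu b) (cqb i).
    rewrite -E_scale//; apply: E_le; [by have [] := CLL_ip (mCLL_cst mu b) (cv i)|exact: LLZ|].
    move=> A; rewrite ipZr reZ ler_wpM2r//; last by have /andP[] := qinv_le i A.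
    by have [_ /andP[]] := ip_qmx e0 (zrow (M A) i) b.
  have [_ _ /(_ 1%N) h2] := ObM (Orf i) (Orq i).
  have h3 : (2 * s)^-1 * E mu (fun A => nq (rf i A * rq i A)) <= (2 * s)^-1 * ((rform_const (1 * 2)%N + rform_const (1 * 2)%N) * (s * s) ^+ (2 * 1)).
    apply: ler_wpM2l; first by rewrite invr_ge0 mulr_ge0// ltW.
    exact: h2.
  have h4 : s / 2 * E mu (fun A => uv i A ^+ 2) <= s / 2 * (u_const * s ^+ 2).
    by rewrite ler_wpM2l ?uv_bound// divr_ge0// ltW.
  rewrite [X in _ <= X](_ : _ = s / 2 * (s ^+ 2 * (rform_const (1 * 2)%N + rform_const (1 * 2)%N))) in h3; last first.
    by field; rewrite gt_eqF.
  by move: h3 h4; rewrite mul1n; lra.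
have step : 1 - E mu (fQ b) <= E mu (fun A => \sum_i G i A).
  rewrite -{1}(E_cst mu 1) -(E_sub (LL_cst _ _) (LL_fQ b)); apply: E_le; [|by apply: LL_sum|].
    by apply: LLB; [exact: LL_cst|exact: LL_fQ].
  move=> A; rewrite /fQ.
  have -> : qmx eta (M A) *m b = b - adjmx (M A) *m (M A *m (resv eta (adjmx (M A)) *m b)).
    have := resv_compl (adjmx (M A)) e0; rewrite adjK => h.
    by rewrite !mulmxA h mulmxBl mul1mx opprB addrC subrK.
  rewrite ipDr ipNr ip_norm2sq b1 ipM adjK reD reN opprD addrA [re _]/= subrr add0r opprK.
  rewrite /ip dot_sum re_sum; apply: ler_sum => i _.
  have eA x : (M A *m x) i 0 = rform (M A) i x by rewrite /rform -row_mul [RHS]mxE.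
  rewrite !eA rform_qmx// invD_real// -/(Dv i A) -/(Q0 i A) -/(rf i A) -/(rq i A).
  have -> : (Dv i A)^-1 = (qv i A)^-1 + uv i A by rewrite /uv addrC subrK.
  rewrite /G.
  have -> : rform (M A) i ((((qv i A)^-1)%:C)%C *: (Q0 i A *m b)) = (((qv i A)^-1)%:C)%C * rq i A.
    by rewrite /rq /rform -scalemxAr scaled_at.
  rewrite nqM; set q := (qv i A)^-1; set u := uv i A.
  case: (rf i A) => a a'; case: (rq i A) => f f'; rewrite /nq /=.
  have y : u * (a * f + a' * f') <= (2 * s)^-1 * ((a ^+ 2 + a' ^+ 2) * (f ^+ 2 + f' ^+ 2)) + s / 2 * u ^+ 2.
    rewrite -subr_ge0 (_ : _ - _ = (2 * s)^-1 * ((a * f + a' * f' - s * u) ^+ 2 + (a * f' - a' * f) ^+ 2)); last by field; rewrite gt_eqF.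
    by rewrite mulr_ge0 ?addr_ge0 ?sqr_ge0// invr_ge0 mulr_ge0// ltW.
  by move: y; lra.
apply: le_trans step _; rewrite E_sum//; apply: le_trans (ler_sum _ (fun i _ => EG i)) _.
rewrite sumr_const card_ord -[_ *+ n]mulr_natl mulrDr; apply: lerD.
  rewrite !mulrA (_ : n%:R * m%:R^-1 * g^-1 = g^-1 - 1)//.
  have -> : n%:R * m%:R^-1 = 1 - g by rewrite /g opprB addrCA subrr addr0.
  by rewrite mulrBl mul1r mulfV// gt_eqF.
have rc p : 0 <= rform_const p by rewrite /rform_const mulr1.
have uc := u_const_ge0.
rewrite (_ : n%:R * _ = n%:R * s ^+ 2 * (s / 2 * (u_const + (rform_const 2 + rform_const 2)))); last by ring.
have c0 : 0 <= u_const + (rform_const 2 + rform_const 2) by have h := rc 2%N; rewrite addr_ge0// addr_ge0.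
apply: (@le_trans _ _ (s / 2 * (u_const + (rform_const 2 + rform_const 2)))).
  by rewrite ler_piMl// mulr_ge0// divr_ge0// ltW.
rewrite ler_wpM2r// ler_pdivrMr//; have := s0; lra.
Qed.

Lemma fR_limit b : norm2sq b = 1 ->
  E mu (fR b) <= g^-1 + s * (1 + 2 * u_const + g0^-1).
Proof.
move=> b1; have h := fR_bound b1; have A0 : 0 <= E mu (fR b) by apply: E_ge0 => A; exact: fR_ge0.
have gi : g^-1 <= g0^-1 by rewrite lef_pV2.
have s1 : s <= 1 by exact: scl_le1.
have := u_const_ge0; have := s0; move: h A0 gi s1; set a := E mu _; set c := u_const.
move=> h A0 gi s1 sp cp.
have h2 : a <= 2 * g0^-1 + 1 + 2 * c.
  have : s / 2 * (1 + (2 * c + a)) <= 1 / 2 * (1 + (2 * c + a)) by rewrite ler_wpM2r// ?ler_pM2r// !addr_ge0// mulr_ge0.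
  by move: h gi; lra.
apply: le_trans h _; rewrite lerD2l -mulrA ler_wpM2l ?(ltW s0)//.
by move: h2 cp; lra.
Qed.

Lemma fQ_limit b : norm2sq b = 1 ->
  g - s * (g0^-1 * rform_const 1 + rform_const 2 * 3 + 2 * u_const) <= E mu (fQ b).
Proof.
move=> b1; have := fQ_bound b1; set B := E mu _; set K1 := _ + u_const + _; set K2 := _ + (_ + _) => h.
have rc p : 0 <= rform_const p by rewrite /rform_const mulr1.
have s1 : s <= 1 by exact: scl_le1.
have g1 : g <= 1 by rewrite gerBl divr_ge0.
have sp := s0; have uc := u_const_ge0; have gp' := gp.
have k1 : 0 <= K1 by rewrite addr_ge0// addr_ge0// mulr_ge0// invr_ge0 ltW.
have k2 : 0 <= K2 by have h2 := rc 2%N; rewrite addr_ge0// addr_ge0.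
have : g * (1 - B) <= g * ((g^-1 - 1) * (B + s ^+ 2 * K1) + s * K2) by rewrite ler_wpM2l// ltW.
rewrite (_ : g * ((g^-1 - 1) * _ + _) = (1 - g) * (B + s ^+ 2 * K1) + g * (s * K2)) => [h3|]; last first.
  by field; rewrite gt_eqF.
have h4 : (1 - g) * (s ^+ 2 * K1) <= s * K1.
  apply: (@le_trans _ _ (1 * (s ^+ 2 * K1))).
    by rewrite ler_wpM2r ?gerBl ?(ltW gp')// mulr_ge0 ?sqr_ge0.
  by rewrite mul1r ler_wpM2r// expr2 ler_piMl// ltW.
have h5 : g * (s * K2) <= s * K2 by rewrite ler_piMl// mulr_ge0// ltW.
by move: h3 h4 h5; rewrite /K1 /K2; lra.
Qed.

Lemma trace_resv_limit : E mu (fun A => eta * re (\tr (resv eta (M A)))) <=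
  s * (g0^-1 + (1 + 2 * u_const + g0^-1)).
Proof.
have c : mCLL mu (fun A => resv eta (M A)) by exact: mCLL_resv.
have L i : LL mu (fR (delta_mx i 0)) by exact: LL_fR.
rewrite (E_ext mu (g := fun A => eta * \sum_i fR (delta_mx i 0) A)); last first.
  move=> A; congr (_ * _); rewrite /mxtrace re_sum; apply: eq_bigr => i _.
  by rewrite /fR /ip dot_delta mulmx_delta_at.
rewrite (E_scale _ (LL_sum _ _)) ?(E_sum _ _)// .
have s1 : s <= 1 by exact: scl_le1.
have gi : g^-1 <= g0^-1 by rewrite lef_pV2.
have uc := u_const_ge0; have g0i : 0 <= g0^-1 by rewrite invr_ge0 ltW.
have c0 : 0 <= 1 + 2 * u_const + g0^-1 by rewrite !addr_ge0// mulr_ge0.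
apply: (@le_trans _ _ (eta * \sum_(i < n) (g0^-1 + (1 + 2 * u_const + g0^-1)))).
  rewrite ler_wpM2l ?(ltW e0)//; apply: ler_sum => i _; apply: le_trans (fR_limit (norm2sq_delta _)) _.
  by apply: lerD => //; rewrite ler_piMl.
rewrite sumr_const card_ord -[_ *+ n]mulr_natl mulrA; apply: ler_wpM2r; first exact: addr_ge0.
rewrite /eta -/s (_ : s ^+ 4 * n%:R = n%:R * s ^+ 2 * (s * s)); last by ring.
apply: (@le_trans _ _ (1 * (s * s))); first by rewrite ler_wpM2r// mulr_ge0// ltW.
by rewrite mul1r ler_piMl// ltW.
Qed.
End Bounds.

Lemma scl_small (del : R) : 0 < del -> exists N, forall m, (N <= m)%N -> (0 < m)%N -> scl m <= del.
Proof.
move=> del0; exists (Num.bound (del^-1 ^+ 2)) => m Nm m0.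
have h : del^-1 ^+ 2 <= m%:R.
  rewrite ltW// (lt_le_trans (archi_boundP _)) ?sqr_ge0// ler_nat; exact: Nm.
rewrite -(@ler_pXn2r _ 2)// ?nnegrE ?(ltW del0) ?(ltW (scl_gt0 m0))// scl2.
by rewrite -[leRHS]invrK lef_pV2 ?posrE ?ltr0n ?invr_gt0 ?exprn_gt0// -exprVn.
Qed.

End ResolventLaw.

(** * Limits with high probability *)

Section HighProbability.
Context {R : realType}.
Local Notation C := (R[i]).
Local Notation MX n m := (@MX R n m).

(** Test [resv_variational] with [y = W^-1 x]. The excess [eta |y|^2] is controlled by
    [norm2sq_le_trace] in terms of the form of [gmx] at [y], which contains it again; the trace
    condition with [1/2] allows it to be absorbed. *)
Lemma resv_compare n m eta (X : 'M[C]_(n, m)) (x : 'cV[C]_n) : 0 < eta ->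
  X *m adjmx X \in unitmx -> eta * re (\tr (resv eta X)) <= 2^-1 ->
  (1 - 2 * (eta * re (\tr (resv eta X)))) * norm2sq (adjmx X *m xsol (X *m adjmx X) x) <=
  re (ip x (resv eta X *m x)).
Proof.
move=> e0 Wu d2; set y := xsol _ x; set dl := eta * _ in d2 *.
have Wy : X *m (adjmx X *m y) = x by rewrite /y /xsol !mulmxA mulmxV// mul1mx.
have exy : ip y x = ((norm2sq (adjmx X *m y))%:C)%C by rewrite -{1}Wy ipM ip_norm2sq.
have h1 := resv_variational X e0 x y; have h2 := norm2sq_le_trace X e0 y.
rewrite ip_gmx /= exy /= in h1 h2.
have {}h2 : eta * norm2sq y <= dl * (norm2sq (adjmx X *m y) + eta * norm2sq y).
  by rewrite /dl -mulrA ler_wpM2l// ltW.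
apply: le_trans h1; move: h2; have := norm2sq_ge0 (adjmx X *m y); have : 0 <= eta * norm2sq y.
  by rewrite mulr_ge0 ?norm2sq_ge0// ltW.
move: (norm2sq (adjmx X *m y)) (eta * norm2sq y) => a c c0 a0 h2.
have : (2^-1 - dl) * c >= 0 by rewrite mulr_ge0// subr_ge0.
by move: h2; lra.
Qed.

Section Markov.
Variables (n m : nat) (mu : probability (MX n m) R).

Lemma mev_gt (f : MX n m -> R) c : LL mu f -> mev (fun A => c < f A).
Proof.
case=> mf _; rewrite /mev; have := mf measurableT `]c, +oo[%classic (measurable_itv _).
rewrite setTI; congr measurable; apply/seteqP; split => A /=; by rewrite in_itv /= andbT.
Qed.

Lemma markov_Pr (f : MX n m -> R) c : 0 < c -> LL mu f -> (forall A, 0 <= f A) ->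
  Pr mu (fun A => c < f A) <= E mu f / c.
Proof.
move=> c0 Lf f0; rewrite ler_pdivlMr// mulrC -E_scale; last exact: LL_mev (mev_gt _ Lf).
apply: E_le => //; first by apply: LLZ; exact: LL_mev (mev_gt _ Lf).
by move=> A; case: ltP => [/ltW h|_]; rewrite ?mulr1 ?mulr0.
Qed.

End Markov.

Variables (kap : nat -> R) (d : R).
Hypothesis d01 : 0 < d <= 1.
Let d0 : 0 < d. Proof. by case/andP: d01. Qed.
Let d1 : d <= 1. Proof. by case/andP: d01. Qed.
Let d01' : 0 <= d <= 1. Proof. by rewrite d1 ltW. Qed.

Section Def.
Variable T : nat -> nat -> Type.

(* The tolerance [eps d n m] controls both [1 / m] and [|n / m - d|]. *)
Definition whp (P : forall n m, T n m -> MX n m -> Prop) :=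
  forall del, 0 < del -> exists2 ep, 0 < ep & forall n m (mu : probability (MX n m) R) (t : T n m),
  (0 < m)%N -> (n <= m)%N -> good_law kap mu -> eps d n m <= ep ->
  exists b, [/\ mev b, Pr mu b <= del & forall A, ~~ b A -> P n m t A].

Lemma whp_true (P : forall n m, T n m -> MX n m -> Prop) :
  (forall n m t A, P n m t A) -> whp P.
Proof.
move=> h del del0; exists 1 => // n m mu t _ _ _ _; exists (fun=> false).
by split=> //; [exact: mev_cst|rewrite Pr_False ?ltW].
Qed.

Lemma whp_and (P Q S : forall n m, T n m -> MX n m -> Prop) : whp P -> whp Q ->
  (forall n m t A, P n m t A -> Q n m t A -> S n m t A) -> whp S.
Proof.
move=> hP hQ PQS del del0; have del2 : 0 < del / 2 by rewrite divr_gt0.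
have [e1 e10 H1] := hP _ del2; have [e2 e20 H2] := hQ _ del2.
exists (Num.min e1 e2); first by rewrite lt_min e10.
move=> n m mu t m0 nm gl; rewrite le_min => /andP[h1 h2].
have [b1 [m1 p1 g1]] := H1 n m mu t m0 nm gl h1; have [b2 [m2 p2 g2]] := H2 n m mu t m0 nm gl h2.
exists (fun A => b1 A || b2 A); split; first exact: mev_or.
  by apply: le_trans (Pr_or mu m1 m2) _; rewrite [leRHS]splitr lerD.
by move=> A; rewrite negb_or => /andP[/g1 ? /g2 ?]; exact: PQS.
Qed.

Lemma whp_imp (P S : forall n m, T n m -> MX n m -> Prop) : whp P ->
  (forall n m t A, P n m t A -> S n m t A) -> whp S.
Proof. by move=> hP PS; apply: (whp_and hP hP) => n m t A p _; exact: PS. Qed.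

Lemma whp_pos (P : forall n m, T n m -> MX n m -> Prop) :
  whp (fun n m t A => (0 < m)%N -> P n m t A) -> whp P.
Proof.
move=> h del del0; have [ep ep0 H] := h del del0; exists ep => // n m mu t m0 nm gl he.
by have [b [mb pb gb]] := H n m mu t m0 nm gl he; exists b; split=> // A /gb; apply.
Qed.

Lemma whp_all (I : eqType) (s : seq I) (P : I -> forall n m, T n m -> MX n m -> Prop) :
  (forall i, whp (P i)) -> whp (fun n m t A => forall i, i \in s -> P i n m t A).
Proof.
move=> h; elim: s => [|i s IH]; first by apply: whp_true.
apply: (whp_and (h i) IH) => n m t A p q j; rewrite inE => /orP[/eqP -> //|]; exact: q.
Qed.

Definition elim0 (e : nat -> nat -> R) := forall del, 0 < del -> exists2 ep, 0 < ep &
  forall n m, (0 < m)%N -> eps d n m <= ep -> e n m <= del.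

Lemma whp_markov (f : forall n m, T n m -> MX n m -> R) (e : nat -> nat -> R) c : 0 < c -> elim0 e ->
  (exists2 ep, 0 < ep & forall n m (mu : probability (MX n m) R) t, (0 < m)%N -> (n <= m)%N -> good_law kap mu ->
    eps d n m <= ep -> [/\ LL mu (f n m t), forall A, 0 <= f n m t A & E mu (f n m t) <= e n m]) ->
  whp (fun n m t A => f n m t A <= c).
Proof.
move=> c0 he [e1 e10 h] del del0; have [e2 e20 H] := he (del * c) (mulr_gt0 del0 c0).
exists (Num.min e1 e2); first by rewrite lt_min e10.
move=> n m mu t m0 nm gl; rewrite le_min => /andP[h1 h2].
have [Lf f0 Ef] := h n m mu t m0 nm gl h1.
exists (fun A => c < f n m t A); split; first exact: (mev_gt c Lf).
  by apply: le_trans (markov_Pr c0 Lf f0) _; rewrite ler_pdivrMr// (le_trans Ef)// H.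
by move=> A; rewrite -leNgt.
Qed.

(* A variable that is asymptotically at least [c] while its mean is asymptotically at most [c]. *)
Lemma whp_mean (Z : forall n m, T n m -> MX n m -> R) (c th : R) : 0 <= c -> 0 < th ->
  (forall del, 0 < del -> exists2 ep, 0 < ep & forall n m (mu : probability (MX n m) R) t, (0 < m)%N -> (n <= m)%N ->
    good_law kap mu -> eps d n m <= ep -> [/\ LL mu (Z n m t), forall A, 0 <= Z n m t A & E mu (Z n m t) <= c + del]) ->
  (forall del, 0 < del -> whp (fun n m t A => c - del <= Z n m t A)) ->
  whp (fun n m t A => Z n m t A <= c + th).
Proof.
move=> c0 th0 hE hZ del del0.
have td : 0 < th * del by rewrite mulr_gt0.
have x0 : 0 < th * del / 4 by rewrite divr_gt0.
have [e1 e10 H1] := hE _ x0.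
have p0 : 0 < th * del / (2 * (c + 1)) by rewrite divr_gt0// mulr_gt0// ltr_wpDl.
have [e2 e20 H2] := hZ _ x0 _ p0.
exists (Num.min e1 e2); first by rewrite lt_min e10.
move=> n m mu t m0 nm gl; rewrite le_min => /andP[h1 h2].
have [LZ Z0 EZ] := H1 n m mu t m0 nm gl h1; have [b [mb pb gb]] := H2 n m mu t m0 nm gl h2.
have Lb := LL_mev mu mb; have mg := mev_gt (c + th) LZ.
exists (fun A => c + th < Z n m t A); split=> //; last by move=> A; rewrite -leNgt.
rewrite -(ler_pM2l th0) -E_scale; last exact: LL_mev.
apply: (@le_trans _ _ (E mu (fun A => Z n m t A + (th * del / 4 - c + c * (b A)%:R)))).
  apply: E_le; [by apply: LLZ; exact: LL_mev| |].
    by apply: LLD => //; apply: LLD; [exact: LL_cst|exact: LLZ].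
  move=> A; have zA := Z0 A; case: (boolP (b A)) => [_|/gb h]; case: ltP => h3; rewrite ?mulr1 ?mulr0; lra.
rewrite (E_add LZ (LLD (LL_cst _ _) (LLZ c Lb))) (E_add (LL_cst _ _) (LLZ c Lb)) E_cst E_scale//.
have : c * E mu (fun A => (b A)%:R) <= (c + 1) * (th * del / (2 * (c + 1))).
  apply: ler_pM => //; [by apply: E_ge0 => A; case: (b A)|by rewrite lerDl].
rewrite (_ : (c + 1) * _ = th * del / 2); last by field; rewrite gt_eqF// ltr_wpDl.
by move: EZ; lra.
Qed.

End Def.

Definition ulT n (m : nat) := {b : 'cV[C]_n | norm2sq b = 1}.
Definition urT (n : nat) m := {b : 'cV[C]_m | norm2sq b = 1}.

Lemma elim0_eps (c : R) : elim0 (fun n m => c * eps d n m).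
Proof.
move=> del del0; exists (del / (`|c| + 1)); first by rewrite divr_gt0// ltr_wpDl.
move=> n m m0; rewrite ler_pdivlMr ?ltr_wpDl// mulrDr mulr1 => h.
apply: le_trans h; have e := eps_gt0 d n m0.
have : c * eps d n m <= `|c| * eps d n m by rewrite ler_wpM2r ?ler_norm// ltW.
by move: e; lra.
Qed.

Let whp2 T k (P : nat -> nat -> forall n m, T n m -> MX n m -> Prop) : (forall i j, whp (P i j)) ->
  whp (fun n m t A => forall i j, (i < k)%N -> (j < k)%N -> P i j n m t A).
Proof.
move=> h; apply: (whp_imp (@whp_all T _ (iota 0 k) _ (fun i => @whp_all T _ (iota 0 k) _ (h i)))).
by move=> n m t A H i j ik jk; apply: H; rewrite mem_iota.
Qed.

Lemma whp_lgram k del : 0 < del -> whp (T := ulT) (fun n m t A => forall i j, (i < k)%N -> (j < k)%N ->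
  nq (ip (lbasis d (sval t) i A) (lbasis d (sval t) j A) - (i == j)%:R) <= del ^+ 2).
Proof.
move=> del0; apply: whp2 => i j; have [Cst H] := lgram_limit kap d01 i j.
apply: (whp_markov (exprn_gt0 2 del0) (elim0_eps Cst)); exists 1 => // n m mu [b b1] m0 nm gl _.
by have [h1 h2] := H n m mu b m0 nm gl b1; split.
Qed.

Lemma whp_rgram k del : 0 < del -> whp (T := urT) (fun n m t A => forall i j, (i < k)%N -> (j < k)%N ->
  nq (ip (rbasis d (sval t) i A) (rbasis d (sval t) j A) - (i == j)%:R) <= del ^+ 2).
Proof.
move=> del0; apply: whp2 => i j; have [Cst H] := rgram_limit kap d01 i j.
apply: (whp_markov (exprn_gt0 2 del0) (elim0_eps Cst)); exists 1 => // n m mu [b b1] m0 nm gl _.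
by have [h1 h2] := H n m mu b m0 nm gl b1; split.
Qed.

Lemma eps_large N : exists2 ep, 0 < ep & forall n m, (0 < m)%N -> eps d n m <= ep -> (N <= m)%N.
Proof.
exists (N.+1%:R^-1); first by rewrite invr_gt0.
move=> n m m0 h; have s1 : scl m <= N.+1%:R^-1 := le_trans (scl_eps d n m) h.
have : m%:R^-1 <= N.+1%:R^-1 :> R.
  rewrite -scl2 expr2; apply: le_trans s1; rewrite ler_piMl ?scl_le1// ltW ?scl_gt0//.
by rewrite lef_pV2 ?posrE ?ltr0n// ler_nat => /ltnW.
Qed.

Lemma whp_unit T : whp (T := T) (fun n m _ A => (A : 'M[C]_(n, m)) *m adjmx (A : 'M[C]_(n, m)) \in unitmx).
Proof.
move=> del del0; have [N HN] := singular_limit kap del0; have [ep ep0 h] := eps_large N.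
exists ep => // n m mu t m0 nm gl he.
exists (fun A => \det ((A : 'M[C]_(n, m)) *m adjmx (A : 'M[C]_(n, m))) == 0); split.
- apply: (mev_eq 0 (mu := mu)); apply: CLL_det; apply: mCLL_mul => //; last apply: mCLL_adj.
    by move=> a c; case: gl => _ _ /(_ a c) [].
  by move=> a c; case: gl => _ _ /(_ a c) [].
- by apply: HN => //; exact: h he.
by move=> A; rewrite unitmxE unitfE.
Qed.

Lemma small_tol (c e : R) : 0 < e -> exists2 x0, 0 < x0 & forall x, 0 <= x -> x <= x0 -> c * x <= e /\ c * x ^+ 2 <= e.
Proof.
move=> e0; exists (Num.min 1 (e / (`|c| + 1))); first by rewrite lt_min ltr01 divr_gt0// ltr_wpDl.
move=> x x0; rewrite le_min => /andP[x1 xe].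
have h : `|c| * x <= e.
  by move: xe; rewrite ler_pdivlMr ?ltr_wpDl//; move: x0; lra.
have c1 : c <= `|c| := ler_norm c.
split; first by apply: le_trans h; rewrite ler_wpM2r.
apply: le_trans h; apply: (@le_trans _ _ (`|c| * x ^+ 2)); first by rewrite ler_wpM2r// sqr_ge0.
by rewrite ler_wpM2l// expr2 ler_piMl.
Qed.

Lemma geom_sum k : (\sum_(i < k) d ^+ i) * (1 - d) = 1 - d ^+ k.
Proof. by rewrite -[RHS]opprB subrX1 mulrC -mulNr opprB. Qed.

(** The Krylov bound [1 / S], with [S] the sum of [k + 1] powers of [d], is at most
    [1 - d + 1 / (k + 1)], because [S >= (k + 1) d^(k + 1)]. This form treats [d = 1] along with
    [d < 1]. *)
Lemma whp_proj_up th : 0 < th -> whp (T := urT) (fun n m t A =>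
  norm2sq (sval t - rproj (A : 'M[C]_(n, m)) (sval t)) <= 1 - d + th).
Proof.
move=> th0; pose k := Num.bound (4 / th).
have hk : k.+1%:R^-1 <= th / 4.
  rewrite -[th / 4]invrK invfM invrK lef_pV2 ?posrE ?ltr0n ?mulr_gt0 ?invr_gt0// mulrC.
  by apply: ltW; apply: lt_le_trans (archi_boundP _) _; rewrite ?divr_ge0 ?(ltW th0)// ler_nat.
have t4 : 0 < Num.min 1 (th / 4) by rewrite lt_min ltr01 divr_gt0.
have [x0 x00 hx] := small_tol k.+1%:R t4.
apply: (whp_and (whp_rgram k.+1 x00) (@whp_unit urT)) => n m [b b1] A /= gr Wu.
have [] := hx x0 (ltW x00) (lexx _); rewrite le_min => /andP[k1 k4] _.
have [_ _ vle] := cga_normal_value d01 (ltW x00) gr Wu k1.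
apply: le_trans vle _; set S := \sum_(i < k.+1) d ^+ i.
have S1 : 1 <= S by rewrite /S big_ord_recl expr0 lerDl sumr_ge0// => i _; rewrite exprn_ge0 ?(ltW d0).
have Sp : 0 < S := lt_le_trans ltr01 S1.
have Sg : k.+1%:R * d ^+ k.+1 <= S.
  rewrite (_ : k.+1%:R * _ = \sum_(i < k.+1) d ^+ k.+1); last by rewrite sumr_const card_ord mulr_natl.
  apply: ler_sum => i _.
  by rewrite ler_wiXn2l ?(ltW d0)// ltnW.
have Sd : S * (1 - d) = 1 - d ^+ k.+1 by exact: geom_sum.
have Si : S^-1 <= 1 - d + k.+1%:R^-1.
  rewrite -[S^-1]mul1r ler_pdivrMr// mulrDl mulrC Sd -subr_ge0.
  rewrite (_ : _ - 1 = k.+1%:R^-1 * (S - k.+1%:R * d ^+ k.+1)); last first.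
    by rewrite [RHS]mulrBr mulKf ?pnatr_eq0//; ring.
  by rewrite mulr_ge0 ?subr_ge0// invr_ge0.
have Si1 : S^-1 <= 1 by rewrite invf_le1.
have kx : 0 <= k.+1%:R * x0 by rewrite mulr_ge0// ltW.
have : k.+1%:R * x0 * S^-1 <= k.+1%:R * x0 by rewrite ler_piMr.
rewrite [X in _ -> X <= _](_ : _ = S^-1 + k.+1%:R * x0 * S^-1); last by rewrite mulrDl mul1r.
move: k4 hk Si; move: (k.+1%:R * x0 * S^-1) (k.+1%:R * x0) (k.+1%:R^-1) (S^-1) => p1 p2 p3 p4; move: th0; lra.
Qed.

Lemma whp_E0_low th : d < 1 -> 0 < th -> whp (T := ulT) (fun n m t A =>
  (1 - d)^-1 - th <= norm2sq (adjmx (A : 'M[C]_(n, m)) *m xsol ((A : 'M[C]_(n, m)) *m adjmx (A : 'M[C]_(n, m))) (sval t))).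
Proof.
move=> dl1 th0; have g0 : 0 < 1 - d by rewrite subr_gt0.
have [|k hk] := @geom_le R d (th / 2 * (1 - d)) _ (mulr_gt0 (divr_gt0 th0 (ltr0Sn _ 1)) g0); first by rewrite ltW.
have {hk} := hk k (leqnn k) => hk.
pose u := Num.min 10^-1 (th / (6 * k.+1%:R)).
have u0 : 0 < u by rewrite lt_min invr_gt0 ltr0n divr_gt0// mulr_gt0// ltr0n.
have u10 : 0 < u <= 10^-1 by rewrite u0 ge_min lexx.
have ku : k%:R * (3 * u) <= th / 2.
  have : u <= th / (6 * k.+1%:R) by rewrite ge_min lexx orbT.
  rewrite ler_pdivlMr ?mulr_gt0 ?ltr0n// -[k.+1%:R]natr1 => h.
  by move: h u0; lra.
have e0 : 0 < (u / k.+1%:R) ^+ 2 by rewrite exprn_gt0// divr_gt0// ltr0n.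
have [x0 x00 hx] := small_tol (uconst k) e0.
apply: (whp_and (whp_lgram k.+1 x00) (@whp_unit ulT)) => n m [b b1] A /= gr Wu.
have [_ hx2] := hx x0 (ltW x00) (lexx _).
have [_ _] := cga_err_value d01 gr u10 Wu hx2.
apply: le_trans; rewrite sumrB sumr_const card_ord -[_ *+ k]mulr_natl.
have Sd : \sum_(i < k) d ^+ i = (1 - d ^+ k) / (1 - d).
  by rewrite -geom_sum mulfK// gt_eqF.
rewrite Sd mulrBl mul1r; have : d ^+ k / (1 - d) <= th / 2 by rewrite ler_pdivrMr.
by move: ku; lra.
Qed.

Section Subcritical.
Hypothesis dl1 : d < 1.
Let g0 : 0 < 1 - d. Proof. by rewrite subr_gt0. Qed.
Let h0 : 0 < (1 - d) / 2. Proof. by rewrite divr_gt0. Qed.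

Lemma gap n m : eps d n m <= (1 - d) / 2 -> [/\ (1 - d) / 2 <= 1 - n%:R / m%:R,
  (1 - n%:R / m%:R)^-1 <= (1 - d)^-1 + (((1 - d) / 2) * (1 - d))^-1 * eps d n m &
  1 - d - eps d n m <= 1 - n%:R / m%:R].
Proof.
rewrite /eps; have s0 : 0 <= scl m :> R by exact: sqrtr_ge0.
have := ler_norm (n%:R / m%:R - d); set x := n%:R / m%:R; set a := `|_| => xa h.
have hx : (1 - d) / 2 <= 1 - x by move: g0; lra.
have x0 : 0 < 1 - x by exact: lt_le_trans hx.
split=> //; last by lra.
have -> : (1 - x)^-1 = (1 - d)^-1 + ((1 - x) * (1 - d))^-1 * (x - d).
  by field; rewrite !gt_eqF.
rewrite lerD2l; apply: (@le_trans _ _ (((1 - x) * (1 - d))^-1 * (scl m + a))).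
  by rewrite ler_wpM2l ?invr_ge0 ?mulr_ge0 ?(ltW x0) ?(ltW g0)//; lra.
rewrite ler_wpM2r//; first by rewrite addr_ge0// normr_ge0.
by rewrite lef_pV2 ?posrE ?mulr_gt0// ler_wpM2r// ltW.
Qed.

Lemma whp_trace T del : 0 < del -> whp (T := T) (fun n m _ A =>
  (reta m : R) * re (\tr (resv ((reta m : R)) (A : 'M[C]_(n, m)))) <= del).
Proof.
move=> del0; set c := ((1 - d) / 2)^-1 + (1 + 2 * u_const kap ((1 - d) / 2) + ((1 - d) / 2)^-1).
apply: (whp_markov (e := fun n m => `|c| * eps d n m) del0 (elim0_eps _)).
exists ((1 - d) / 2) => // n m mu t m0 nm gl /gap[gg _ _].
have e0 := (reta_gt0 (R := R) m0); have cM : mCLL mu (fun A : MX n m => (A : 'M[C]_(n, m))).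
  by move=> a b; case: gl => _ _ /(_ a b) [].
split.
- apply: LLZ; have [] // : CLL mu (fun A : MX n m => \tr (resv ((reta m : R)) (A : 'M[C]_(n, m)))).
  by rewrite /mxtrace; apply: CLL_sum => j _; exact: mCLL_resv.
- by move=> A; rewrite mulr_ge0 ?re_trace_resv_ge0// ltW.
have := trace_resv_limit m0 nm gl h0 gg; rewrite -/c => /le_trans; apply.
apply: (@le_trans _ _ (scl m * `|c|)).
  by rewrite ler_wpM2l ?ler_norm// ltW ?scl_gt0.
by rewrite mulrC ler_wpM2l// scl_eps.
Qed.

Lemma whp_compare T (x : forall n m, T n m -> MX n m -> 'cV[C]_n) tau : 0 < tau -> tau <= 2^-1 ->
  whp (T := T) (fun n m t A => let X : 'M[C]_(n, m) := A in
   (1 - 2 * tau) * norm2sq (adjmx X *m xsol (X *m adjmx X) (x n m t A)) <=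
     re (ip (x n m t A) (resv ((reta m : R)) X *m x n m t A))).
Proof.
move=> t0 t2; apply: whp_pos; apply: (whp_and (@whp_unit T) (@whp_trace T tau t0)) => n m t A /= Wu tr m0.
have e0 := reta_gt0 (R := R) m0; apply: le_trans (resv_compare _ e0 Wu (le_trans tr t2)).
by rewrite ler_wpM2r ?norm2sq_ge0//; move: tr; lra.
Qed.

(** The comparison with the resolvent is used twice: to transport the Krylov lower bound to [fR], so
    that [whp_mean] applies to the latter, and to return from the upper bound on [fR] to the
    norm. *)
Lemma whp_E0_up th : 0 < th -> whp (T := ulT) (fun n m t A => let X : 'M[C]_(n, m) := A in
  norm2sq (adjmx X *m xsol (X *m adjmx X) (sval t)) <= (1 - d)^-1 + th).
Proof.
move=> th0; have c0 : 0 < (1 - d)^-1 by rewrite invr_gt0.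
have cmp tau (t0 : 0 < tau) (t2 : tau <= 2^-1) := @whp_compare ulT (fun n m t A => sval t) tau t0 t2.
have up : whp (T := ulT) (fun n m t A => fR (sval t) A <= (1 - d)^-1 + th / 2).
  apply: whp_mean; [exact: ltW|by rewrite divr_gt0| |].
    move=> del del0; set c := (((1 - d) / 2) * (1 - d))^-1 + `|1 + 2 * u_const kap ((1 - d) / 2) + ((1 - d) / 2)^-1|.
    have [e1 e10 H] := elim0_eps c del0.
    exists (Num.min ((1 - d) / 2) e1); first by rewrite lt_min h0.
    move=> n m mu [b b1] m0 nm gl; rewrite le_min => /andP[/gap[gg gi _] he]; split.
    - exact: (LL_fR m0 gl).
    - by move=> A; exact: (fR_ge0 m0).
    apply: le_trans (fR_limit m0 nm gl h0 gg b1) _.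
    have h1 := H n m m0 he; have h2 := scl_eps d n m; have h3 := scl_gt0 (R := R) m0.
    have h4 := ler_norm (1 + 2 * u_const kap ((1 - d) / 2) + ((1 - d) / 2)^-1).
    have h5 : scl m * (1 + 2 * u_const kap ((1 - d) / 2) + ((1 - d) / 2)^-1) <=
        `|1 + 2 * u_const kap ((1 - d) / 2) + ((1 - d) / 2)^-1| * eps d n m.
      by rewrite mulrC; apply: (@le_trans _ _ (`|1 + 2 * u_const kap ((1 - d) / 2) + ((1 - d) / 2)^-1| * scl m)); rewrite ?ler_wpM2r ?ler_wpM2l// ltW.
    by move: h1; rewrite /c mulrDl; move: gi h5; lra.
  move=> del del0; pose tau := Num.min 2^-1 (del * (1 - d) / 4).
  have t0 : 0 < tau by rewrite lt_min invr_gt0 ltr0n divr_gt0// mulr_gt0.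
  have t2 : tau <= 2^-1 by rewrite ge_min lexx.
  have tc : tau * (1 - d)^-1 <= del / 4.
    by rewrite ler_pdivrMr// mulrAC ge_min lexx orbT.
  have d2 : 0 < del / 2 by rewrite divr_gt0.
  apply: (whp_and (cmp tau t0 t2) (whp_E0_low dl1 d2)) => n m t A /= hc hl; rewrite /fR.
  apply: le_trans hc; have t12 : 0 <= 1 - 2 * tau by lra.
  have := ler_wpM2l t12 hl; have : 0 <= tau * del by rewrite mulr_ge0// ltW.
  by move: tc; lra.
have x0 : 0 < (1 - d)^-1 + th by rewrite addr_gt0.
pose tau := th / (4 * ((1 - d)^-1 + th)).
have t0 : 0 < tau by rewrite divr_gt0// mulr_gt0.
have te : tau * ((1 - d)^-1 + th) = th / 4 by rewrite /tau; move: ((1 - d)^-1 + th) x0 => x x0; field; rewrite gt_eqF.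
have t4 : tau <= 4^-1.
  by rewrite ler_pdivrMr ?mulr_gt0// mulrA mulVf ?mul1r ?lerDr ?(ltW c0)// pnatr_eq0.
have t2 : tau <= 2^-1 by lra.
apply: (whp_and (cmp tau t0 t2) up) => n m t A /= hc hu.
rewrite -(@ler_pM2l _ (1 - 2 * tau)); last by lra.
by apply: le_trans hc _; apply: le_trans hu _; move: te; lra.
Qed.

(** The regularised form of the squared length of the projection of [b] onto the range of [adjmx X],
    which allows [whp_compare] to be used with [x = X b]. *)
Lemma fQ_proj n m (X : MX n m) (b : 'cV[C]_m) : (0 < m)%N ->
  re (ip ((X : 'M[C]_(n, m)) *m b) (resv ((reta m : R)) (X : 'M[C]_(n, m)) *m ((X : 'M[C]_(n, m)) *m b))) = norm2sq b - fQ b X.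
Proof.
move=> m0; have e0 := (reta_gt0 (R := R) m0); rewrite /fQ.
have := resv_compl (adjmx (X : 'M[C]_(n, m))) e0; rewrite adjK => h.
have p := resv_push (adjmx (X : 'M[C]_(n, m))) e0; rewrite adjK in p.
have -> : qmx ((reta m : R)) (X : 'M[C]_(n, m)) *m b = b - adjmx (X : 'M[C]_(n, m)) *m ((X : 'M[C]_(n, m)) *m (resv ((reta m : R)) (adjmx (X : 'M[C]_(n, m))) *m b)).
  by rewrite !mulmxA h mulmxBl mul1mx opprB addrC subrK.
rewrite ipDr ipNr ip_norm2sq [ip b (adjmx _ *m _)]ipM adjK reD reN opprD addrA [re _]/= subrr add0r opprK.
by rewrite [X in _ = re (ip _ X)]mulmxA -p -mulmxA.
Qed.

Lemma whp_proj_low th : 0 < th -> whp (T := urT) (fun n m t A =>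
  1 - d - th <= norm2sq (sval t - rproj (A : 'M[C]_(n, m)) (sval t))).
Proof.
move=> th0.
have cmp tau (t0 : 0 < tau) (t2 : tau <= 2^-1) : whp (T := urT) (fun n m t A =>
    (1 - 2 * tau) * (1 - norm2sq (sval t - rproj (A : 'M[C]_(n, m)) (sval t))) <= 1 - fQ (sval t) A).
  apply: whp_pos; apply: (whp_and (@whp_compare urT (fun n m t A => (A : 'M[C]_(n, m)) *m sval t) tau t0 t2) (@whp_unit urT)).
  move=> n m [b b1] A /= hc Wu m0; rewrite fQ_proj// b1 in hc.
  by rewrite -[X in _ * (X - _)]b1 (norm2sq_rproj b Wu) addrK.
have up : whp (T := urT) (fun n m t A => 1 - fQ (sval t) A <= d + th / 2).
  apply: whp_mean; [exact: ltW|by rewrite divr_gt0| |].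
    move=> del del0; set c := ((1 - d) / 2)^-1 * (rform_const kap 1) + (rform_const kap 2) * 3 + 2 * u_const kap ((1 - d) / 2).
    have [e1 e10 H] := elim0_eps (1 + `|c|) del0.
    exists (Num.min ((1 - d) / 2) e1); first by rewrite lt_min h0.
    move=> n m mu [b b1] m0 nm gl; rewrite le_min => /andP[/gap[gg _ gi] he].
    have LQ : LL mu (fQ b) by exact: LL_fQ m0 gl b.
    split; first by apply: LLB => //; exact: LL_cst.
      by move=> A; have /andP[_] := fQ_bnd m0 b A; rewrite b1 subr_ge0.
    rewrite (E_sub (LL_cst _ _) LQ) E_cst /=.
    have := fQ_limit m0 nm gl h0 gg b1; rewrite -/c => h1.
    have h2 := H n m m0 he; have h3 := scl_eps d n m; have h4 := scl_gt0 (R := R) m0.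
    have h5 : scl m * c <= `|c| * eps d n m.
      by rewrite mulrC; apply: (@le_trans _ _ (`|c| * scl m)); rewrite ?ler_wpM2r ?ler_wpM2l ?ler_norm// ltW.
    by move: h2; rewrite mulrDl mul1r; move: h1 gi h5; lra.
  move=> del del0; pose tau := Num.min 2^-1 (del / 4).
  have t0 : 0 < tau by rewrite lt_min invr_gt0 ltr0n divr_gt0.
  have t2 : tau <= 2^-1 by rewrite ge_min lexx.
  have tc : tau <= del / 4 by rewrite ge_min lexx orbT.
  have d2 : 0 < del / 2 by rewrite divr_gt0.
  apply: (whp_and (cmp tau t0 t2) (whp_proj_up d2)) => n m t A /= hc hl.
  apply: le_trans hc; have t12 : 0 <= 1 - 2 * tau by lra.
  have h1 : d - del / 2 <= 1 - norm2sq (sval t - rproj (A : 'M[C]_(n, m)) (sval t)) by lra.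
  have := ler_wpM2l t12 h1; have : 0 <= tau * del by rewrite mulr_ge0// ltW.
  have : tau * d <= tau by rewrite ler_piMr// ltW.
  by move: tc; lra.
pose tau := Num.min 4^-1 (th / 8).
have t0 : 0 < tau by rewrite lt_min invr_gt0 ltr0n divr_gt0.
have t4 : tau <= 4^-1 by rewrite ge_min lexx.
have tc : tau <= th / 8 by rewrite ge_min lexx orbT.
have t2 : tau <= 2^-1 by lra.
apply: (whp_and (cmp tau t0 t2) up) => n m t A /= hc hu.
have v0 := norm2sq_ge0 (sval t - rproj (A : 'M[C]_(n, m)) (sval t)).
move: (norm2sq _) v0 hc hu => v v0 hc hu.
have h : (1 - v) - 2 * tau <= d + th / 2.
  apply: le_trans (le_trans hc hu).
  have : 0 <= tau * v by rewrite mulr_ge0// ltW.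
  by lra.
by lra.
Qed.

Lemma whp_cga_err k th : 0 < th -> whp (T := ulT) (fun n m t A => let X : 'M[C]_(n, m) := A in
  `|wnorm2 (X *m adjmx X) (cga_err (X *m adjmx X) (sval t) k) - d ^+ k / (1 - d)| <= th).
Proof.
move=> th0; pose u := Num.min 10^-1 (th / (10 * k.+1%:R)).
have u0 : 0 < u by rewrite lt_min invr_gt0 ltr0n divr_gt0// mulr_gt0// ltr0n.
have u10 : 0 < u <= 10^-1 by rewrite u0 ge_min lexx.
have ku : k%:R * (5 * u) <= th / 2.
  have : u <= th / (10 * k.+1%:R) by rewrite ge_min lexx orbT.
  rewrite ler_pdivlMr ?mulr_gt0 ?ltr0n// -[k.+1%:R]natr1 => h.
  by move: h u0; lra.
have e0 : 0 < (u / k.+1%:R) ^+ 2 by rewrite exprn_gt0// divr_gt0// ltr0n.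
have [x0 x00 hx] := small_tol (uconst k) e0.
have th2 : 0 < th / 2 by rewrite divr_gt0.
have both : whp (T := ulT) (fun n m t A => let X : 'M[C]_(n, m) := A in
   `|norm2sq (adjmx X *m xsol (X *m adjmx X) (sval t)) - (1 - d)^-1| <= th / 2).
  apply: (whp_and (whp_E0_low dl1 th2) (whp_E0_up th2)) => n m t A /= h1 h2.
  by rewrite ler_norml; apply/andP; split; [move: h1|move: h2]; lra.
apply: (whp_and (whp_and (P := _) (whp_lgram k.+1 x00) (@whp_unit ulT) (fun n m t A p q => conj p q)) both).
move=> n m [b b1] A /= [gr Wu]; rewrite ler_norml => /andP[l1 l2].
have [_ hx2] := hx x0 (ltW x00) (lexx _).
have [] := cga_err_value d01 gr u10 Wu hx2.
rewrite big_split sumrB /= !sumr_const card_ord -[(5 * u) *+ k]mulr_natl -[(3 * u) *+ k]mulr_natl.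
have -> : \sum_(i < k) d ^+ i = (1 - d)^-1 - d ^+ k / (1 - d).
  by rewrite -[X in X - _]mul1r -mulrBl -geom_sum mulfK// gt_eqF.
have k3 : k%:R * (3 * u) <= k%:R * (5 * u) by rewrite ler_wpM2l// ler_wpM2r ?ler_nat// ltW.
move=> h1 h2 _; rewrite ler_norml; apply/andP; split; [move: h1 ku l1|move: h2 ku k3 l2]; lra.
Qed.

End Subcritical.

Lemma whp_proj th : 0 < th -> whp (T := urT) (fun n m t A =>
  `|norm2sq (sval t - rproj (A : 'M[C]_(n, m)) (sval t)) - (1 - d)| <= th).
Proof.
move=> th0; have low : whp (T := urT) (fun n m t A => 1 - d - th <= norm2sq (sval t - rproj (A : 'M[C]_(n, m)) (sval t))).
  have [dl1|] := ltP d 1; first exact: whp_proj_low.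
  (* At [d = 1] the lower bound is the positivity of a squared norm. *)
  move=> d1'; apply: whp_true => n m t A; apply: le_trans (norm2sq_ge0 _); lra.
apply: (whp_and low (whp_proj_up th0)) => n m t A h1 h2.
by rewrite ler_norml; apply/andP; split; [move: h1|move: h2]; lra.
Qed.

Lemma whp_minres k th : 0 < th -> whp (T := ulT) (fun n m t A => let X : 'M[C]_(n, m) := A in
  `|norm2sq (minres_res (X *m adjmx X) (sval t) k) - (\sum_(i < k.+1) d^-1 ^+ i)^-1| <= th).
Proof.
move=> th0; have t1 : 0 < Num.min 1 th by rewrite lt_min ltr01.
have [x0 x00 hx] := small_tol k.+1%:R t1.
apply: (whp_imp (whp_lgram k.+1 x00)) => n m [b b1] A /= gr.
have [] := hx x0 (ltW x00) (lexx _); rewrite le_min => /andP[k1 k4] _.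
have /andP[] := minres_value d01 (ltW x00) gr k1.
set S := \sum_(i < k.+1) _; have S1 : 1 <= S.
  by rewrite /S big_ord_recl expr0 lerDl sumr_ge0// => i _; rewrite exprn_ge0// invr_ge0 ltW.
have S0 : 0 <= S^-1 <= 1 by rewrite invr_ge0 (le_trans ler01 S1)/= invf_le1// (lt_le_trans ltr01).
have /andP[S00 S01] := S0; have kx : 0 <= k.+1%:R * x0 by rewrite mulr_ge0// ltW.
have : k.+1%:R * x0 * S^-1 <= k.+1%:R * x0 by rewrite ler_piMr.
rewrite mulrBl mulrDl mul1r; move: (k.+1%:R * x0 / S) k4 => y k4 h h1 h2.
by rewrite ler_norml; apply/andP; split; [move: h1|move: h2]; lra.
Qed.

Lemma whp_normal k th : 0 < th -> whp (T := urT) (fun n m t A => let X : 'M[C]_(n, m) := A in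
  `|wnorm2 (X *m adjmx X) (cga_err (X *m adjmx X) (X *m sval t) k) - ((\sum_(i < k.+1) d ^+ i)^-1 - (1 - d))| <= th).
Proof.
move=> th0; have th2 : 0 < th / 2 by rewrite divr_gt0.
have t1 : 0 < Num.min 1 (th / 2) by rewrite lt_min ltr01.
have [x0 x00 hx] := small_tol k.+1%:R t1.
apply: (whp_and (whp_and (P := _) (whp_rgram k.+1 x00) (@whp_unit urT) (fun n m t A p q => conj p q)) (whp_proj th2)).
move=> n m [b b1] A /= [gr Wu]; rewrite ler_norml => /andP[l1 l2].
have [] := hx x0 (ltW x00) (lexx _); rewrite le_min => /andP[k1 k4] _.
have [] := cga_normal_value d01 (ltW x00) gr Wu k1.
set S := \sum_(i < k.+1) _; have S1 : 1 <= S.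
  by rewrite /S big_ord_recl expr0 lerDl sumr_ge0// => i _; rewrite exprn_ge0// ltW.
have S0 : 0 <= S^-1 <= 1 by rewrite invr_ge0 (le_trans ler01 S1)/= invf_le1// (lt_le_trans ltr01).
have /andP[S00 S01] := S0; have kx : 0 <= k.+1%:R * x0 by rewrite mulr_ge0// ltW.
have : k.+1%:R * x0 * S^-1 <= k.+1%:R * x0 by rewrite ler_piMr.
rewrite mulrBl mulrDl mul1r; move: (k.+1%:R * x0 / S) k4 => y k4 h h1 h2 _.
by rewrite ler_norml; apply/andP; split; [move: h1 l2|move: h2 l1]; lra.
Qed.

Lemma whp_cga_res k th : 0 < th -> whp (T := ulT) (fun n m t A => let X : 'M[C]_(n, m) := A in
  `|norm2sq (cga_res (X *m adjmx X) (sval t) k) - d ^+ k| <= th).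
Proof.
move=> th0; pose u := Num.min 10^-1 (th / 10).
have u0 : 0 < u by rewrite lt_min invr_gt0 ltr0n divr_gt0.
have u10 : 0 < u <= 10^-1 by rewrite u0 ge_min lexx.
have ut : 10 * u <= th.
  by have : u <= th / 10 by [rewrite ge_min lexx orbT]; rewrite ler_pdivlMr// mulrC.
clearbody u; have dk : 0 < d^-1 ^+ k by rewrite exprn_gt0// invr_gt0.
pose e := Num.min u (Num.min (u ^+ 2) (u ^+ 2 * d^-1 ^+ k)).
have e0 : 0 < e by rewrite /e !lt_min u0 (mulr_gt0 _ dk) exprn_gt0.
pose Sg := \sum_(i < k.+1) d^-1 ^+ i.
have [x1 x10 hx1] := small_tol k.+1%:R e0.
have [x2 x20 hx2] := small_tol (k.+1%:R ^+ 2) e0.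
have [x3 x30 hx3] := small_tol (k.+1%:R * Sg * k.+1%:R ^+ 2) e0.
pose x0 := Num.min x1 (Num.min x2 x3).
have x00 : 0 < x0 by rewrite !lt_min x10 x20.
apply: (whp_and (whp_lgram k.+1 x00) (@whp_unit ulT)) => n m [b b1] A /= gr Wu.
have ex : e <= u by rewrite ge_min lexx.
have ex2 : e <= u ^+ 2 by rewrite !ge_min lexx orbT.
have ex3 : e <= u ^+ 2 * d^-1 ^+ k by rewrite !ge_min lexx !orbT.
have l1 : x0 <= x1 by rewrite ge_min lexx.
have l2 : x0 <= x2 by rewrite !ge_min lexx orbT.
have l3 : x0 <= x3 by rewrite !ge_min lexx !orbT.
have [a1 _] := hx1 x0 (ltW x00) l1; have [_ a2] := hx2 x0 (ltW x00) l2; have [_ a3] := hx3 x0 (ltW x00) l3.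
have := cga_res_value d01 (ltW x00) gr u10 Wu (le_trans a1 ex).
rewrite exprMn => /(_ (le_trans a2 ex2)); rewrite mulrA => /(_ (le_trans a3 ex3)).
set r := norm2sq _ => h.
have -> : r - d ^+ k = d ^+ k * (d^-1 ^+ k * r - 1).
  by rewrite mulrBr mulr1 mulrA -exprMn mulfV ?gt_eqF// expr1n mul1r.
rewrite normrM ger0_norm ?exprn_ge0 ?(ltW d0)//; apply: le_trans ut; apply: le_trans h.
by rewrite ler_piMl// exprn_ile1// ltW.
Qed.

End HighProbability.

(** * Convergence in distribution *)

Section Sandwich.
Context {R : realType} {d : measure_display} {T : measurableType d}.

(* The iterates are defined by choice, so that their measurability is unknown:
   their integrals are compared through the suprema defining them. *)
Lemma ge0_integral_mono (mu : {measure set T -> \bar R}) (f g : T -> \bar R) :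
  (forall x, 0 <= f x)%E -> (forall x, f x <= g x)%E -> (\int[mu]_x f x <= \int[mu]_x g x)%E.
Proof.
move=> f0 fg; have g0 x : (0 <= g x)%E by exact: le_trans (fg x).
rewrite !ge0_integralTE//; apply: ereal_sup_le => _ [h hf <-]; exists h => // x.
exact: le_trans (hf x) (fg x).
Qed.

Lemma integral_mono (mu : {measure set T -> \bar R}) (f g : T -> \bar R) :
  (forall x, f x <= g x)%E -> (\int[mu]_x f x <= \int[mu]_x g x)%E.
Proof.
move=> fg; rewrite integralE [leRHS]integralE; apply: leeB; apply: ge0_integral_mono => x //.
  by rewrite !funeposE ge_max !le_max (fg x) lexx orbT.
by rewrite !funenegE ge_max !le_max leeN2 (fg x) lexx orbT.
Qed.

Variable P : probability T R.

Lemma E_integral (f : T -> R) : LL P f -> (\int[P]_x (f x)%:E = (E P f)%:E)%E.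
Proof. by move=> Lf; rewrite /E /Rintegral fineK//; apply: integrable_fin_num => //; exact: LL_int Lf. Qed.

Lemma E_sandwich (g L U : T -> R) : LL P L -> LL P U -> (forall x, L x <= g x <= U x) ->
  ('E_P[g] \is a fin_num)%E /\ E P L <= fine ('E_P[g])%E <= E P U.
Proof.
move=> lL lU h; rewrite unlock.
have h1 : ((E P L)%:E <= \int[P]_x (g x)%:E)%E.
  by rewrite -E_integral//; apply: integral_mono => x; rewrite lee_fin; case/andP: (h x).
have h2 : (\int[P]_x (g x)%:E <= (E P U)%:E)%E.
  by rewrite -E_integral//; apply: integral_mono => x; rewrite lee_fin; case/andP: (h x).
have fn : (\int[P]_x (g x)%:E)%E \is a fin_num.
  by rewrite fin_numE; apply/andP; split; apply/eqP => e; move: h1 h2; rewrite e.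
split; first exact: fn.
by apply/andP; split; rewrite -lee_fin (fineK fn).
Qed.

End Sandwich.

Section Criterion.
Context {R : realType} {dT : measure_display}.
Variables (T : nat -> measurableType dT) (P : forall M, probability (T M) R).

(** Convergence in probability to a constant, where the bad event is replaced by a measurable
    majorant [be] of its indicator since [Z] may fail to be measurable. Continuity of [f] at the
    limit point handles the good event and boundedness the rest. *)
Lemma fdd_criterion (Z : forall M, T M -> nat -> R) (z : nat -> R) (I : pred nat) :
  (forall k th del, I k -> 0 < th -> 0 < del -> \forall M \near \oo, exists be : T M -> R,
    [/\ LL (P M) be, forall w, 0 <= be w, E (P M) be <= del &
        forall w, `|Z M w k - z k| <= th \/ 1 <= be w]) ->
  fdd_cvg P Z z I.
Proof.
move=> H S IS f fc [K fK].
have {}H th del : 0 < th -> 0 < del -> \forall M \near \oo, exists be : T M -> R,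
    [/\ LL (P M) be, forall w, 0 <= be w, E (P M) be <= del &
        forall w, (forall k, k \in S -> `|Z M w k - z k| <= th) \/ 1 <= be w].
  move=> th0; elim: S IS del {f fc fK} => [|k S IH] /= IS del del0.
    apply: nearW => M; exists (fun=> 0); split => //; first exact: LL_cst.
      by rewrite E_cst ltW.
    by move=> w; left.
  have del2 : 0 < del / 2 by rewrite divr_gt0.
  case/andP: IS => Ik IS; have H1 := H k th _ Ik th0 del2; have H2 := IH IS _ del2.
  near=> M.
  have [b1 [L1 p1 e1 g1]] : exists be : T M -> R, [/\ LL (P M) be, forall w, 0 <= be w, E (P M) be <= del / 2 &
        forall w, `|Z M w k - z k| <= th \/ 1 <= be w] by near: M.
  have [b2 [L2 p2 e2 g2]] : exists be : T M -> R, [/\ LL (P M) be, forall w, 0 <= be w, E (P M) be <= del / 2 &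
        forall w, (forall k, k \in S -> `|Z M w k - z k| <= th) \/ 1 <= be w] by near: M.
  exists (fun w => b1 w + b2 w); split.
  - exact: LLD.
  - by move=> w; rewrite addr_ge0.
  - by rewrite (E_add L1 L2) [leRHS]splitr lerD.
  move=> w; case: (g1 w) => [h1|h1]; last by right; rewrite (le_trans h1)// lerDl.
  case: (g2 w) => [h2|h2]; last by right; rewrite (le_trans h2)// lerDr.
  by left=> k'; rewrite inE => /orP[/eqP ->//|]; exact: h2.
set z0 := \row_(j < size S) z (nth 0%N S j); set c := f z0.
have K0 : 0 <= K by exact: le_trans (normr_ge0 _) (fK z0).
have key e : 0 < e -> \forall M \near \oo,
   ('E_(P M)[fun w => f (\row_(j < size S) Z M w (nth 0%N S j))])%E \is a fin_num /\
   `|c - fine ('E_(P M)[fun w => f (\row_(j < size S) Z M w (nth 0%N S j))])%E| <= e.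
  move=> e0; have e2 : 0 < e / 2 by rewrite divr_gt0.
  have /cvgrPdist_le/(_ _ e2)/nbhs_ballP[del /= del0 hb] := fc z0.
  (* Half the radius, because balls are open and the deviations are bounded by a non-strict
     inequality. *)
  have d2 : 0 < del / 2 by rewrite divr_gt0.
  have p0 : 0 < e / (4 * (K + 1)) by rewrite divr_gt0// mulr_gt0// ltr_wpDl.
  have HM := H _ _ d2 p0; near=> M.
  have [be [Lb b0 Eb gb]] : exists be : T M -> R, [/\ LL (P M) be, forall w, 0 <= be w, E (P M) be <= e / (4 * (K + 1)) &
        forall w, (forall k, k \in S -> `|Z M w k - z k| <= del / 2) \/ 1 <= be w] by near: M.
  set g := fun w => _.
  have gw w : `|c - g w| <= e / 2 + 2 * K * be w.
    case: (gb w) => [h|h].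
      apply: ler_wpDr; first by rewrite mulr_ge0// mulr_ge0.
      apply: hb; split=> // i j; rewrite ord1 !mxE /ball /= distrC.
      by apply: le_lt_trans (h _ (mem_nth _ _)) _ => //; rewrite ltr_pdivrMr// ltr_pMr// ltr1n.
    apply: (@le_trans _ _ (2 * K)).
      rewrite mulr_natl mulr2n; apply: le_trans (ler_normB _ _) _; apply: lerD; exact: fK.
    by apply: ler_wpDl; [exact: ltW|rewrite ler_peMr// mulr_ge0].
  have LKb : LL (P M) (fun w => 2 * K * be w) by exact: LLZ.
  have LU : LL (P M) (fun w => e / 2 + 2 * K * be w) by apply: LLD => //; exact: LL_cst.
  have gLU w : c - (e / 2 + 2 * K * be w) <= g w <= c + (e / 2 + 2 * K * be w).
    have := gw w; rewrite ler_norml => /andP[a1 a2].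
    by apply/andP; split; [move: a2|move: a1]; lra.
  have [fn /andP[h1 h2]] := E_sandwich (LLB (LL_cst (P M) c) LU) (LLD (LL_cst (P M) c) LU) gLU.
  have hh : E (P M) (fun w => e / 2 + 2 * K * be w) <= e.
    rewrite (E_add (LL_cst _ _) LKb) E_cst E_scale//.
    have : 2 * K * E (P M) be <= 2 * (K + 1) * (e / (4 * (K + 1))).
      by apply: ler_pM => //; [rewrite mulr_ge0|exact: E_ge0|rewrite ler_pM2l// lerDl].
    rewrite (_ : 2 * (K + 1) * _ = e / 2); last by field; rewrite gt_eqF// ltr_wpDl.
    by lra.
  split=> //; rewrite (E_sub (LL_cst _ _) LU) E_cst in h1; rewrite (E_add (LL_cst _ _) LU) E_cst in h2.
  by rewrite ler_norml; apply/andP; split; [move: h2 hh|move: h1 hh]; lra.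
apply/fine_cvgP; split.
  by apply: filterS (key 1 ltr01) => M [].
by apply/cvgrPdist_le => e /key; apply: filterS => M [].
Unshelve. all: by end_near.
Qed.

End Criterion.

(** * From the given random variables to laws of matrices *)

Section PushForward.
Context {R : realType} {dT : measure_display} {T : measurableType dT}.
Local Notation C := (R[i]).
Local Notation MX n m := (@MX R n m).
Variables (P : probability T R) (n m : nat) (X : T -> 'M[C]_(n, m)).
Hypothesis mre : forall i j, measurable_fun setT (fun w => re (X w i j)).
Hypothesis mim : forall i j, measurable_fun setT (fun w => im (X w i j)).

Let mX : measurable_fun setT (X : T -> MX n m).
Proof. exact: measurable_to_MX. Qed.

Definition toMX : {mfun T >-> MX n m} := HB.pack (X : T -> MX n m) (isMeasurableFun.Build _ _ _ _ _ mX).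

Definition law : probability (MX n m) R := distribution P toMX.

Lemma integ_law (f : MX n m -> R) : measurable_fun setT f ->
  integ P (fun w => f (X w)) -> integ law f.
Proof. by move=> mf h; apply: (@integrable_pushforward _ _ _ _ _ _ mX) => //; exact/measurable_EFinP. Qed.

Lemma LL_law (f : MX n m -> R) : measurable_fun setT f -> LL P (fun w => f (X w)) -> LL law f.
Proof.
move=> mf [_ h]; split=> // p; apply: integ_law (h p).
by apply: measurable_funX; exact: measurableT_comp.
Qed.

Lemma law_integ (f : MX n m -> R) : integ law f -> integ P (fun w => f (X w)).
Proof.
move=> h; have mf : measurable_fun setT (EFin \o f) by have /integrableP[] := h.
apply/integrableP; split; first exact: (measurableT_comp mf mX).
have /integrableP[_] := h; apply: le_lt_trans.
rewrite /law ge0_integral_distribution//; exact: measurableT_comp.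
Qed.

Lemma law_LL (f : MX n m -> R) : LL law f -> LL P (fun w => f (X w)).
Proof.
move=> [mf h]; split; first exact: (measurableT_comp mf mX).
by move=> p; exact: (law_integ (h p)).
Qed.

Lemma E_law (f : MX n m -> R) : LL law f -> E law f = E P (fun w => f (X w)).
Proof.
move=> Lf; rewrite /E /Rintegral /law integral_distribution//.
  by apply/measurable_EFinP; case: Lf.
exact: LL_int (law_LL Lf).
Qed.

Hypothesis ind : entries_indep P X.

Lemma indep_law : indep_entries law.
Proof.
move=> A mA; have := ind mA.
rewrite (_ : \bigcap_(ij in _) _ = X @^-1` rect A).
  move=> e; apply: (etrans e); apply: eq_bigr => i _; apply: eq_bigr => j _; congr (P _).
  by apply/seteqP; split => w /=; [move/set_mem|move/mem_set].
apply/seteqP; split => w /= h.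
  by move=> i j; apply: set_mem; exact: (h (i, j) Logic.I).
by move=> [i j] _; apply: mem_set; exact: h.
Qed.

Variables (beta : nat) (Cm : nat -> R).
Hypothesis m0 : (0 < m)%N.
Hypothesis b12 : beta = 1%N \/ beta = 2%N.
Hypothesis mom : forall i j (l p : nat), (l + p <= 2)%N ->
     ('E_P[fun w => (re (X w i j) ^+ l * im (X w i j) ^+ p)%R])%E = (gauss_mom R beta m l p)%:E.
Hypothesis bnd : forall i j (p : nat),
     ('E_P[fun w => ((Num.sqrt m%:R * cabs (X w i j)) ^+ p)%R] <= (Cm p)%:E)%E.

(** The order doubles since [nq] is a squared modulus; the summand [1] provides the lower bound that
    [good_law] asks for. *)
Definition mom_bound p : R := 1 + `|Cm (2 * p)|.

Let mn0 : (0 : R) < m%:R. Proof. by rewrite ltr0n. Qed.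

Lemma cabs_pow (z : C) p : (Num.sqrt m%:R * cabs z) ^+ (2 * p) = m%:R ^+ p * nq z ^+ p.
Proof. by rewrite exprM [(Num.sqrt _ * _) ^+ 2]exprMn sqr_sqrtr ?ler0n// /cabs sqr_sqrtr ?exprMn//; exact: nq_ge0. Qed.

Let mnq i j : measurable_fun setT (fun w => nq (X w i j)).
Proof. by apply: measurable_funD; apply: measurable_funX. Qed.

Let nqI i j p : (\int[P]_w (nq (X w i j) ^+ p)%:E <= (mom_bound p * m%:R^-1 ^+ p)%:E)%E.
Proof.
have := bnd i j (2 * p); rewrite unlock.
under eq_integral do rewrite cabs_pow EFinM.
rewrite ge0_integralZl//; last 2 first.
- by apply/measurable_EFinP; exact: measurable_funX.
- by move=> w _; rewrite lee_fin exprn_ge0 ?nq_ge0.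
have I0 : (0 <= \int[P]_w (nq (X w i j) ^+ p)%:E)%E by apply: integral_ge0 => w _; rewrite lee_fin exprn_ge0 ?nq_ge0.
move=> h; rewrite -(@lee_pmul2l _ (m%:R ^+ p)%:E)// ?lte_fin ?exprn_gt0//.
apply: (le_trans h); rewrite -EFinM lee_fin mulrCA -exprMn mulfV ?gt_eqF// expr1n mulr1.
by rewrite /mom_bound (le_trans (ler_norm _))// lerDr.
Qed.

Let nq_integ i j p : integ P (fun w => nq (X w i j) ^+ p).
Proof.
apply/integrableP; split; first by apply/measurable_EFinP; exact: measurable_funX.
rewrite (eq_integral (fun w => (nq (X w i j) ^+ p)%:E)); last by move=> w _ /=; rewrite ger0_norm ?exprn_ge0 ?nq_ge0.
by apply: le_lt_trans (nqI i j p) _; rewrite ltry.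
Qed.

Let part_LL i j (h : C -> R) : measurable_fun setT (fun w => h (X w i j)) -> (forall z, h z ^+ 2 <= nq z) ->
  LL P (fun w => h (X w i j)).
Proof.
move=> mh hq; split=> // p; apply: (@integ_le _ _ _ _ _ (fun w => 1 + nq (X w i j) ^+ p)).
- by apply: measurable_funX; exact: measurableT_comp.
- move=> w; rewrite ger0_norm ?exprn_ge0//.
  have a0 : 0 <= `|h (X w i j)| ^+ p by rewrite exprn_ge0.
  have : (`|h (X w i j)| ^+ p) ^+ 2 <= nq (X w i j) ^+ p.
    rewrite exprAC; apply: lerXn2r; rewrite ?nnegrE ?sqr_ge0 ?nq_ge0//.
    by rewrite real_normK ?num_real.
  move: (`|_| ^+ p) (nq _ ^+ p) a0 => a c a0; have h3 := sqr_ge0 (a - 1); move: a0 h3; nra.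
by apply: integD; [exact: integ_cst|exact: nq_integ].
Qed.

Lemma CLL_entry i j : CLL P (fun w => X w i j).
Proof.
split; apply: part_LL => // z; rewrite /nq; first by rewrite lerDl sqr_ge0.
by rewrite lerDr sqr_ge0.
Qed.

Let E_mom i j l p : (l + p <= 2)%N ->
  E P (fun w => re (X w i j) ^+ l * im (X w i j) ^+ p) = gauss_mom R beta m l p.
Proof. by move=> lp; rewrite /E /Rintegral; have := mom i j lp; rewrite unlock => ->. Qed.

Lemma good_law_law : good_law mom_bound law.
Proof.
split; first exact: indep_law.
  by move=> p; rewrite /mom_bound lerDl.
move=> i j; have [Lr Li] := CLL_entry i j.
have LR : LL law (fun A => re (coord i j A)) by apply: LL_law => //; exact: measurable_re_coord.
have LI : LL law (fun A => im (coord i j A)) by apply: LL_law => //; exact: measurable_im_coord.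
have cc : CLL law (coord i j) by split.
split => //.
- have e := E_mom i j (l := 1) (p := 0) isT; rewrite E_law//; apply: etrans e; apply: E_ext => w.
  by rewrite expr0 mulr1.
- have e := E_mom i j (l := 0) (p := 1) isT; rewrite E_law//; apply: etrans e; apply: E_ext => w.
  by rewrite expr0 mul1r.
- rewrite E_law; last exact: LL_nq.
  rewrite /nq (E_add (LLX 2 Lr) (LLX 2 Li)).
  have e2 := E_mom i j (l := 2) (p := 0) isT; have e3 := E_mom i j (l := 0) (p := 2) isT.
  rewrite (E_ext P (g := fun w => re (X w i j) ^+ 2)) in e2; last by move=> w; rewrite expr0 mulr1.
  rewrite (E_ext P (g := fun w => im (X w i j) ^+ 2)) in e3; last by move=> w; rewrite expr0 mul1r.
  rewrite e2 e3 /gauss_mom; case: b12 => -> /=; first by rewrite mul1n addr0.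
  by rewrite natrM; field; rewrite gt_eqF.
move=> p; rewrite E_law; last by apply: LLX; exact: LL_nq.
by rewrite -lee_fin -E_integral ?nqI//; apply: LLX; apply: LL_nq; exact: CLL_entry.
Qed.

End PushForward.

Section Transfer.
Context {R : realType} {dT : measure_display}.
Local Notation C := (R[i]).
Variables (d : R) (Nf : nat -> nat) (T : nat -> measurableType dT).
Variables (P : forall M, probability (T M) R) (X : forall M, T M -> 'M[C]_(Nf M, M)) (kap : nat -> R).
Hypothesis Nle : forall M, (Nf M <= M)%N.
Hypothesis Nd : ((Nf M)%:R / M%:R : R) @[M --> \oo] --> d.
Hypothesis mre : forall M i j, measurable_fun setT (fun w : T M => re (X w i j)).
Hypothesis mim : forall M i j, measurable_fun setT (fun w : T M => im (X w i j)).
Hypothesis gl : forall M, (0 < M)%N -> good_law kap (law (P M) (@mre M) (@mim M)).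

Lemma near_eps ep : 0 < ep -> \forall M \near \oo, (0 < M)%N /\ eps d (Nf M) M <= ep.
Proof.
move=> ep0; have e2 : 0 < ep / 2 by rewrite divr_gt0.
have [N HN] := scl_small e2.
have /cvgrPdist_le/(_ _ e2) h := Nd.
near=> M; have M0 : (0 < M)%N by near: M; exact: nbhs_infty_gt.
split=> //; rewrite /eps [leRHS]splitr; apply: lerD.
  by apply: HN => //; near: M; exact: nbhs_infty_ge.
by rewrite distrC; near: M.
Unshelve. all: by end_near.
Qed.

Lemma fdd_of_whp (U : nat -> nat -> Type) (Q : forall n m, U n m -> 'M[C]_(n, m) -> nat -> R)
    (t : forall M, (0 < M)%N -> U (Nf M) M) (Z : forall M, T M -> nat -> R) (z : nat -> R) (I : pred nat) :
  (forall M (M0 : (0 < M)%N) w k, Z M w k = Q _ _ (t M M0) (X w) k) ->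
  (forall k th, I k -> 0 < th -> whp kap d (T := U) (fun n m u A => `|Q n m u A k - z k| <= th)) ->
  fdd_cvg P Z z I.
Proof.
move=> HZ H; apply: fdd_criterion => k th del Ik th0 del0.
have [ep ep0 {}H] := H k th Ik th0 del del0.
apply: filterS (near_eps ep0) => M [M0 he].
have [b [mb pb gb]] := H _ _ _ (t M M0) M0 (Nle M) (gl M0) he.
have Lb := LL_mev (law (P M) (@mre M) (@mim M)) mb.
exists (fun w => (b (X w))%:R); split.
- exact: (law_LL Lb).
- by move=> w; rewrite ler0n.
- by rewrite -(E_law Lb).
move=> w; case: (boolP (b (X w))) => [_|/gb h]; first by right.
by left; rewrite (HZ M M0).
Qed.

End Transfer.

(** The geometric sum is the form in which the limit arises from the minimisation; it is continuous
    at [d = 1], where the quotient is not defined by its formula. *)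
Lemma inv_geom_limit (R : realType) (d : R) k : 0 < d ->
  (\sum_(i < k.+1) d^-1 ^+ i)^-1 = if d == 1 then k.+1%:R^-1 else d ^+ k * (1 - d) / (1 - d ^+ k.+1).
Proof.
move=> d0; case: eqVneq => [->|d1].
  by under eq_bigr do rewrite invr1 expr1n; rewrite sumr_const card_ord.
have dn : d != 0 by rewrite gt_eqF.
have x1 : d^-1 - 1 != 0 by rewrite subr_eq0 invr_eq1.
have h : \sum_(i < k.+1) d^-1 ^+ i = (d^-1 ^+ k.+1 - 1) / (d^-1 - 1) by rewrite subrX1 mulrC mulKf.
have D1 : 1 - d ^+ k.+1 != 0.
  rewrite subr_eq0 eq_sym; apply: contra d1 => /eqP e.
  by rewrite -(pexpr_eq1 (ltn0Sn k) (ltW d0)) e.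
have g1 : 1 - d != 0 by rewrite subr_eq0 eq_sym.
have Dk : d ^+ k != 0 by rewrite expf_neq0.
rewrite h exprVn exprS; rewrite exprS in D1; move: (d ^+ k) Dk D1 => D Dk D1.
have -> : (d * D)^-1 - 1 = (1 - d * D) / (d * D) by field; rewrite dn Dk.
have -> : d^-1 - 1 = (1 - d) / d by field; exact: dn.
by field; rewrite dn Dk g1 D1.
Qed.

Lemma geom_limit (R : realType) (d : R) k : 0 < d ->
  (\sum_(i < k.+1) d ^+ i)^-1 - (1 - d) = if d == 1 then k.+1%:R^-1 else d ^+ k.+1 * (1 - d) / (1 - d ^+ k.+1).
Proof.
move=> d0; case: eqVneq => [->|d1].
  by under eq_bigr do rewrite expr1n; rewrite sumr_const card_ord subrr subr0.
have D1 : 1 - d ^+ k.+1 != 0.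
  rewrite subr_eq0 eq_sym; apply: contra d1 => /eqP e.
  by rewrite -(pexpr_eq1 (ltn0Sn k) (ltW d0)) e.
have g1 : 1 - d != 0 by rewrite subr_eq0 eq_sym.
rewrite -[\sum_(i < _) _](mulfK g1) geom_sum; move: (d ^+ k.+1) D1 => D D1.
by field; rewrite g1 D1.
Qed.

Theorem theorem1p4 (R : realType) (beta : nat) (d : R) (Nf : nat -> nat)
  (dT : measure_display) (T : nat -> measurableType dT)
  (P : forall M, probability (T M) R)
  (X : forall M, T M -> 'M[R[i]]_(Nf M, M)) (C : nat -> R) :
  (beta = 1%N \/ beta = 2%N) ->
  0 < d <= 1 ->
  (forall M, (Nf M <= M)%N) ->
  ((Nf M)%:R / M%:R : R) @[M --> \oo] --> d ->
  (* entries are random variables *)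
  (forall M i j, measurable_fun setT (fun w => complex.Re (X M w i j))) ->
  (forall M i j, measurable_fun setT (fun w => complex.Im (X M w i j))) ->
  (* beta = 1 : real entries *)
  (beta = 1%N -> forall M w i j, complex.Im (X M w i j) = 0) ->
  (* independent entries *)
  (forall M, (0 < M)%N -> entries_indep (P M) (X M)) ->
  (* moment matching with N_beta(0, 1/M) up to order 2 *)
  (forall M, (0 < M)%N -> forall i j (l p : nat), (l + p <= 2)%N ->
     ('E_(P M)[fun w => (complex.Re (X M w i j) ^+ l * complex.Im (X M w i j) ^+ p)%R])%E
       = (gauss_mom R beta M l p)%:E) ->
  (* uniform moment bounds *)
  (forall M, (0 < M)%N -> forall i j (p : nat),
     ('E_(P M)[fun w => ((Num.sqrt M%:R * cabs (X M w i j)) ^+ p)%R] <= (C p)%:E)%E) ->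
  let W M w := X M w *m adjmx (X M w) in
  (* (a) CGA on W x = b, b unit of length N *)
  (forall b : forall M, 'cV[R[i]]_(Nf M),
     (forall M, (0 < M)%N -> norm2sq (b M) = 1) ->
     (beta = 1%N -> forall M i, complex.Im (b M i 0) = 0) ->
     (d != 1 -> fdd_cvg P (fun M w k => wnorm2 (W M w) (cga_err (W M w) (b M) k))
                  (fun k => d ^+ k / (1 - d)) predT) /\
     fdd_cvg P (fun M w k => norm2sq (cga_res (W M w) (b M) k))
                  (fun k => d ^+ k) (fun k => (0 < k)%N)) /\
  (* (b) MINRES on W x = b *)
  (forall b : forall M, 'cV[R[i]]_(Nf M),
     (forall M, (0 < M)%N -> norm2sq (b M) = 1) ->
     (beta = 1%N -> forall M i, complex.Im (b M i 0) = 0) ->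
     fdd_cvg P (fun M w k => norm2sq (minres_res (W M w) (b M) k))
       (fun k => if d == 1 then (k.+1%:R)^-1 else d ^+ k * (1 - d) / (1 - d ^+ k.+1))
       (fun k => (0 < k)%N)) /\
  (* (c) CGA on the normal equations W x = X b, b unit of length M *)
  (forall b : forall M, 'cV[R[i]]_M,
     (forall M, (0 < M)%N -> norm2sq (b M) = 1) ->
     (beta = 1%N -> forall M i, complex.Im (b M i 0) = 0) ->
     fdd_cvg P (fun M w k => wnorm2 (W M w) (cga_err (W M w) (X M w *m b M) k))
       (fun k => if d == 1 then (k.+1%:R)^-1 else d ^+ k.+1 * (1 - d) / (1 - d ^+ k.+1))
       predT).
Proof.
move=> b12 d01 Nle Nd mre mim _ ind mom bnd W.
have /andP[d0 d1] := d01.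
have gl M : (0 < M)%N -> good_law (mom_bound C) (law (P M) (mre M) (mim M)).
  by move=> M0; apply: (good_law_law _ _ (ind M M0) M0 b12 (mom M M0) (bnd M M0)).
(* The normalisation of [b M] is available for [0 < M] only, so the unit vector is packed together
   with that proof. *)
pose tl (b : forall M, 'cV[R[i]]_(Nf M)) (hb : forall M, (0 < M)%N -> norm2sq (b M) = 1) M (M0 : (0 < M)%N) : @ulT R (Nf M) M :=
  exist _ (b M) (hb M M0).
pose tr (b : forall M, 'cV[R[i]]_M) (hb : forall M, (0 < M)%N -> norm2sq (b M) = 1) M (M0 : (0 < M)%N) : @urT R (Nf M) M :=
  exist _ (b M) (hb M M0).
split; [|split] => b hb _; first split.
- move=> dn1; have dl1 : d < 1 by rewrite lt_neqAle dn1.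
  apply: (@fdd_of_whp R dT d Nf T P X (mom_bound C) Nle Nd mre mim gl (@ulT R)
    (fun n m u A k => wnorm2 (A *m adjmx A) (cga_err (A *m adjmx A) (sval u) k)) (tl b hb)) => //.
  by move=> k th _ th0; exact: whp_cga_err.
- apply: (@fdd_of_whp R dT d Nf T P X (mom_bound C) Nle Nd mre mim gl (@ulT R)
    (fun n m u A k => norm2sq (cga_res (A *m adjmx A) (sval u) k)) (tl b hb)) => //.
  by move=> k th _ th0; exact: whp_cga_res.
- apply: (@fdd_of_whp R dT d Nf T P X (mom_bound C) Nle Nd mre mim gl (@ulT R)
    (fun n m u A k => norm2sq (minres_res (A *m adjmx A) (sval u) k)) (tl b hb)) => //.
  by move=> k th _ th0; rewrite -inv_geom_limit//; exact: whp_minres.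
apply: (@fdd_of_whp R dT d Nf T P X (mom_bound C) Nle Nd mre mim gl (@urT R)
  (fun n m u A k => wnorm2 (A *m adjmx A) (cga_err (A *m adjmx A) (A *m sval u) k)) (tr b hb)) => //.
by move=> k th _ th0; rewrite -geom_limit//; exact: whp_normal.
Qed.
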